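(* Every $2$-connected cubic graph $G$ with $\mathrm{df}(G)=3$ and $\pi(G)=5$ is either isomorphic to the Petersen graph $Pg$ or arises from the Petersen graph with a fixed $6$-cycle $C$ by combining the following two operations: (O1) insertion of connected $3$-edge-colourable edge-deleted cubic graphs into any number of edges from $E(Pg)-E(C)$; (O2) correct substitution of any number of vertices from $V(Pg)-V(C)$ with connected vertex-deleted $3$-edge-colourable quasi-bipartite cubic graphs. Conversely, every cubic graph constructed from the Petersen graph with a fixed $6$-cycle $C$ by means of operations (O1) and (O2) has $\mathrm{df}=3$ and perfect matching index $5$, and $C$ is a hexagonal core of the resulting graph.
   Context: Graphs are finite; loops and multiple edges are allowed. A $3$-array of a bridgeless cubic graph $H$ is a set of three perfect matchings; an edge is uncovered if in none of them and simply covered if in exactly one. The colouring defect $\mathrm{df}(H)$ is the minimum number of uncovered edges over all $3$-arrays; a $3$-array attaining it is optimal; its core is the subgraph formed by all edges not simply covered. If $\mathrm{df}(H)=3$ the core of every optimal $3$-array is an induced $6$-cycle, called a hexagonal core. The perfect matching index $\pi(G)$ is the smallest number of perfect matchings whose union is $E(G)$. For $2$-connected cubic graphs $H,K$: a $2$-sum $H\oplus_2 K$ with distinguished edges $e\in E(H)$, $f\in E(K)$ deletes $e,f$ and joins the $2$-valent vertices of $H-e$ to those of $K-f$ by two new independent edges; a $3$-sum $H\oplus_3 K$ with distinguished vertices $u,v$ deletes $u,v$ and joins the three dangling edge-ends formerly at $u$ bijectively to those formerly at $v$. Inserting the edge-deleted graph $K-f$ into an edge $e$ of $H$ means forming $H\oplus_2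 K$ with distinguished edges $e,f$ ($K$ $2$-connected cubic). Substituting a vertex $u$ of $H$ with $K-v$ means forming $H\oplus_3 K$ with distinguished vertices $u,v$ ($K$ $2$-connected cubic). A $2$-connected cubic graph $K$ is quasi-bipartite if it has an independent vertex set $U$ with $|U|\ge 2$ such that contracting each component of $K-U$ to a vertex gives a bipartite cubic graph (possibly with multiple edges) with partite sets $U$ and the contracted vertices; $U$ is a bipartising set. A substitution of $u$ with $K-v$, $K$ quasi-bipartite, is correct if $K$ has a bipartising set $U$ such that $\{v\}$ is a component of $K-U$. In the operations, the edges and vertices of $Pg$ outside $C$ are kept (with their identity) in the intermediate graphs, so that subsequent operations may be applied to them. *)

(* Defs.v *)
From HB Require Import structures.
From mathcomp Require Import all_boot.
Set Implicit Arguments. Unset Strict Implicit. Unset Printing Implicit Defensive.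

(* A finite multigraph: vertex type, edge type, and the (unordered) pair of
   end-vertices of each edge, stored as an ordered pair. A loop has both ends equal. *)
Record mgraph : Type := MGraph {
  gV : finType;
  gE : finType;
  gends : gE -> (gV * gV)%type }.
Arguments gends {m} _.

Notation dart G := (gE G * bool)%type.
Definition dend (G : mgraph) (d : dart G) : gV G :=
  if d.2 then (gends d.1).1 else (gends d.1).2.
Definition dother (G : mgraph) (d : dart G) : gV G := dend (G := G) (d.1, ~~ d.2).

Definition ueq (T : eqType) (p q : (T * T)%type) : bool :=
  (p == q) || (p == (q.2, q.1)).

(* degree (a loop counts twice) *)
Definition deg (G : mgraph) (v : gV G) : nat := #|[set d : dart G | dend d == v]|.
Definition cubic (G : mgraph) : Prop := forall v : gV G, deg v = 3.

Definition adj_av (G : mgraph) (X : {set gE G}) : rel (gV G) :=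
  fun x y => [exists e : gE G, (e \notin X) && ueq (gends e) (x, y)].
Definition connected (G : mgraph) : Prop :=
  forall x y : gV G, connect (adj_av set0) x y.
Definition bridgeless (G : mgraph) : Prop :=
  forall (e : gE G) (x y : gV G), connect (adj_av [set e]) x y.
(* 2-connected (for cubic graphs, equivalently: connected and bridgeless) *)
Definition twoconn (G : mgraph) : Prop := connected G /\ bridgeless G.

(* perfect matchings: every vertex is incident with exactly one dart of M
   (so loops can never belong to a perfect matching) *)
Definition perfect_matching (G : mgraph) (M : {set gE G}) : Prop :=
  forall v : gV G, #|[set d : dart G | (dend d == v) && (d.1 \in M)]| = 1.

Definition colourable3 (G : mgraph) : Prop :=
  exists c : gE G -> 'I_3, forall (v : gV G) (i : 'I_3),
    #|[set d : dart G | (dend d == v) && (c d.1 == i)]| <= 1.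

Definition array3 (G : mgraph) := ({set gE G} * {set gE G} * {set gE G})%type.
Definition is_array3 (G : mgraph) (A : array3 G) : Prop :=
  [/\ perfect_matching A.1.1, perfect_matching A.1.2 & perfect_matching A.2].
Definition cover_count (G : mgraph) (A : array3 G) (e : gE G) : nat :=
  (e \in A.1.1) + (e \in A.1.2) + (e \in A.2).
Definition uncovered (G : mgraph) (A : array3 G) : {set gE G} :=
  [set e | cover_count A e == 0].
Definition df_eq (G : mgraph) (k : nat) : Prop :=
  (exists A : array3 G, is_array3 A /\ #|uncovered A| = k) /\
  (forall A : array3 G, is_array3 A -> k <= #|uncovered A|).
Definition optimal (G : mgraph) (A : array3 G) : Prop :=
  is_array3 A /\ forall B : array3 G, is_array3 B -> #|uncovered A| <= #|uncovered B|.
Definition core (G : mgraph) (A : array3 G) : {set gE G} :=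
  [set e | cover_count A e != 1].

Definition pmi_eq (G : mgraph) (k : nat) : Prop :=
  (exists Ms : 'I_k -> {set gE G},
      (forall i, perfect_matching (Ms i)) /\ (forall e, exists i, e \in Ms i)) /\
  (forall (m : nat) (Ms : 'I_m -> {set gE G}),
      (forall i, perfect_matching (Ms i)) -> (forall e, exists i, e \in Ms i) -> k <= m).

Definition iso (G H : mgraph) : Prop :=
  exists (fV : gV G -> gV H) (fE : gE G -> gE H),
    [/\ bijective fV, bijective fE &
        forall e, ueq (gends (fE e)) (fV (gends e).1, fV (gends e).2)].

Definition is_6cycle (G : mgraph) (cv : 'I_6 -> gV G) (ce : 'I_6 -> gE G) : Prop :=
  [/\ injective cv, injective ce &
      forall i : 'I_6, ueq (gends (ce i)) (cv i, cv (inord ((i + 1) %% 6)))].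

(* The Petersen graph: outer 5-cycle, spokes, inner pentagram *)
Definition pg_ends (e : ('I_3 * 'I_5)%type) : (('I_5 + 'I_5) * ('I_5 + 'I_5))%type :=
  let i := e.2 in
  match nat_of_ord e.1 with
  | 0 => (inl i, inl (inord ((i + 1) %% 5)))
  | 1 => (inl i, inr i)
  | _ => (inr i, inr (inord ((i + 2) %% 5)))
  end.
Definition Pg : mgraph := @MGraph ('I_5 + 'I_5)%type ('I_3 * 'I_5)%type pg_ends.

(* H (+)_2 K with distinguished edges e, f: delete e, f, and join the ends of e
   to the ends of f by two independent new edges; b chooses which matching. *)
Definition ts2_E (H K : mgraph) (e : gE H) (f : gE K) : Type :=
  (({x : gE H | x != e} + {y : gE K | y != f}) + bool)%type.
Definition ts2_ends (H K : mgraph) (e : gE H) (f : gE K) (b : bool)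
  (x : (({x : gE H | x != e} + {y : gE K | y != f}) + bool)%type)
  : ((gV H + gV K) * (gV H + gV K))%type :=
  match x with
  | inl (inl x) => (inl (gends (val x)).1, inl (gends (val x)).2)
  | inl (inr y) => (inr (gends (val y)).1, inr (gends (val y)).2)
  | inr true => (inl (gends e).1, inr (if b then (gends f).1 else (gends f).2))
  | inr false => (inl (gends e).2, inr (if b then (gends f).2 else (gends f).1))
  end.
Definition twosum (H K : mgraph) (e : gE H) (f : gE K) (b : bool) : mgraph :=
  @MGraph (gV H + gV K)%type
          (({x : gE H | x != e} + {y : gE K | y != f}) + bool)%type
          (ts2_ends b).

Notation ndarts G x := {d : dart G | (dend d == x) && (dother d != x)}.

Lemma andb_l (a b : bool) : a && b -> a. Proof. by case/andP. Qed.
Lemma andb_r (a b : bool) : a && b -> b. Proof. by case/andP. Qed.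

(* H (+)_3 K with distinguished vertices u, v: delete u, v and join the dangling
   edge-ends formerly at u bijectively (via sigma) to those formerly at v. *)
Definition ts3_ends (H K : mgraph) (u : gV H) (v : gV K)
  (sigma : ndarts H u -> ndarts K v)
  (x : (({e : gE H | ((gends e).1 != u) && ((gends e).2 != u)}
        + {e : gE K | ((gends e).1 != v) && ((gends e).2 != v)}) + ndarts H u)%type)
  : (({x : gV H | x != u} + {y : gV K | y != v}) *
     ({x : gV H | x != u} + {y : gV K | y != v}))%type :=
  match x with
  | inl (inl e) =>
      (inl (exist _ (gends (sval e)).1 (andb_l (proj2_sig e))),
       inl (exist _ (gends (sval e)).2 (andb_r (proj2_sig e))))
  | inl (inr e) =>
      (inr (exist _ (gends (sval e)).1 (andb_l (proj2_sig e))),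
       inr (exist _ (gends (sval e)).2 (andb_r (proj2_sig e))))
  | inr d =>
      (inl (exist _ (dother (sval d)) (andb_r (proj2_sig d))),
       inr (exist _ (dother (sval (sigma d))) (andb_r (proj2_sig (sigma d)))))
  end.
Definition threesum (H K : mgraph) (u : gV H) (v : gV K)
  (sigma : ndarts H u -> ndarts K v) : mgraph :=
  @MGraph ({x : gV H | x != u} + {y : gV K | y != v})%type
          (({e : gE H | ((gends e).1 != u) && ((gends e).2 != u)}
            + {e : gE K | ((gends e).1 != v) && ((gends e).2 != v)}) + ndarts H u)%type
          (ts3_ends sigma).

Definition adj_out (K : mgraph) (U : {set gV K}) : rel (gV K) :=
  fun x y => [&& x \notin U, y \notin U &
                 [exists e : gE K, ueq (gends e) (x, y)]].
(* the component of K - U containing x (for x outside U) *)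
Definition comp_out (K : mgraph) (U : {set gV K}) (x : gV K) : {set gV K} :=
  [set y | connect (adj_out U) x y].
(* U is a bipartising set: U independent, |U| >= 2, and contracting each
   component of K - U to a vertex (deleting the edges inside it) yields a cubic
   graph, bipartite with partite sets U and the contracted vertices. *)
Definition bipartising (K : mgraph) (U : {set gV K}) : Prop :=
  [/\ 2 <= #|U|,
      (forall e : gE K, ~~ (((gends e).1 \in U) && ((gends e).2 \in U))),
      (* degree 3 of u in U in the contracted graph *)
      (forall u, u \in U ->
         #|[set e : gE K | (((gends e).1 == u) && ((gends e).2 \notin U))
                          || (((gends e).2 == u) && ((gends e).1 \notin U))]| = 3) &
      (* degree 3 of each contracted component *)
      (forall x, x \notin U ->
         #|[set e : gE K | (((gends e).1 \in U) && ((gends e).2 \in comp_out U x))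
                          || (((gends e).2 \in U) && ((gends e).1 \in comp_out U x))]| = 3)].
Definition quasi_bipartite (K : mgraph) : Prop :=
  twoconn K /\ cubic K /\ exists U : {set gV K}, bipartising U.
Definition correct_sub (K : mgraph) (v : gV K) : Prop :=
  exists U : {set gV K}, bipartising U /\ v \notin U /\ comp_out U v = [set v].

(* The state records the current graph together with the current identity of
   each vertex / edge of Pg (None once a vertex has been substituted or an edge
   has received an insertion). *)
Definition ins_tv (G K : mgraph) (e0 : gE G) (f : gE K) (b : bool)
  (tv : gV Pg -> option (gV G)) : gV Pg -> option (gV (twosum e0 f b)) :=
  fun x => omap inl (tv x).
Definition ins_te (G K : mgraph) (e0 : gE G) (f : gE K) (b : bool) (e : gE Pg)
  (te : gE Pg -> option (gE G)) : gE Pg -> option (gE (twosum e0 f b)) :=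
  fun x => if x == e then None
           else obind (fun y => omap (fun z => inl (inl z))
                                     (insub y : option {x : gE G | x != e0})) (te x).
Definition sub_tv (G K : mgraph) (u0 : gV G) (v : gV K)
  (sigma : ndarts G u0 -> ndarts K v) (u : gV Pg)
  (tv : gV Pg -> option (gV G)) : gV Pg -> option (gV (threesum sigma)) :=
  fun x => if x == u then None
           else obind (fun y => omap inl (insub y : option {x : gV G | x != u0})) (tv x).
Definition sub_edge (G K : mgraph) (u0 : gV G) (v : gV K)
  (sigma : ndarts G u0 -> ndarts K v) (y : gE G) : option (gE (threesum sigma)) :=
  match (insub y : option {e : gE G | ((gends e).1 != u0) && ((gends e).2 != u0)}) with
  | Some z => Some (inl (inl z))
  | None =>
    match (insub (y, true) : option (ndarts G u0)) with
    | Some d => Some (inr d)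
    | None => omap inr (insub (y, false) : option (ndarts G u0))
    end
  end.
Definition sub_te (G K : mgraph) (u0 : gV G) (v : gV K)
  (sigma : ndarts G u0 -> ndarts K v)
  (te : gE Pg -> option (gE G)) : gE Pg -> option (gE (threesum sigma)) :=
  fun x => obind (sub_edge sigma) (te x).

Inductive built (cv : 'I_6 -> gV Pg) (ce : 'I_6 -> gE Pg) :
  forall G : mgraph, (gV Pg -> option (gV G)) -> (gE Pg -> option (gE G)) -> Prop :=
| built_Pg : @built cv ce Pg (@Some _) (@Some _)
| built_O1 (G : mgraph) tv te (e : gE Pg) (e0 : gE G) (K : mgraph) (f : gE K) (b : bool) :
    @built cv ce G tv te -> te e = Some e0 -> (forall i, ce i != e) ->
    twoconn K -> cubic K -> connected K -> colourable3 K ->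
    @built cv ce (twosum e0 f b) (ins_tv e0 f b tv) (ins_te e0 f b e te)
| built_O2 (G : mgraph) tv te (u : gV Pg) (u0 : gV G) (K : mgraph) (v : gV K)
    (sigma : ndarts G u0 -> ndarts K v) :
    @built cv ce G tv te -> tv u = Some u0 -> (forall i, cv i != u) ->
    twoconn K -> cubic K -> connected K -> colourable3 K -> quasi_bipartite K ->
    correct_sub v -> bijective sigma ->
    @built cv ce (threesum sigma) (sub_tv sigma u tv) (sub_te sigma te).

(* Main.v *)
Require Import Defs.
From HB Require Import structures.
From mathcomp Require Import all_boot.
From mathcomp Require Import zify.
Set Implicit Arguments. Unset Strict Implicit. Unset Printing Implicit Defensive.

(* Converse: a perfect matching of a 2-sum or of a correct 3-sum restricts to one of the
   Petersen side (by parity, respectively by counting along the bipartising set), and a family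
   of perfect matchings extends through a 3-edge-colouring of the inserted graph. So the bounds
   on uncovered edges and on coverings follow from those for the Petersen graph, whose six
   perfect matchings pairwise share exactly one edge.

   Forward: a 3-array with three uncovered edges has a hexagonal core. A perfect matching
   of the complement of the hexagon would extend by the uncovered edges to a fourth perfect
   matching, and the four would cover the graph; so there is a Tutte-Berge barrier. Since the
   graph is not 3-edge-colourable, an alternating-path argument splits the barrier into
   three pieces with cuts of size 3, attached to opposite vertices of the hexagon, and a
   quasi-bipartite remainder: a Petersen graph whose vertices off the hexagon are blown up.
   If a piece had a matching missing exactly its three attaching vertices, four perfect
   matchings would cover the graph; hence each piece is a single vertex, or is
   quasi-bipartite because of a second barrier, or consists of an edge with an insertion. *)

(** * Matchings and the Tutte-Berge formula *)

(** Non-colourability and the matching index enter at different points. At the vertices off the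
    hexagon every edge lies in exactly one matching of the array, so the array is a proper
    3-edge-colouring there. This colouring gives the edges of every 3-cut three distinct colours,
    drives the alternating paths, and finally colours the inserted and substituted graphs. The
    matching index serves only to exclude coverings by four perfect matchings: once for the
    complement of the hexagon, once for each piece. Both exclusions feed one barrier lemma. At most
    six edges leave the removed set, parity raises the deficiency to two, and odd cuts of a
    bridgeless graph have at least three edges. Hence 3(|S|+2) <= 3|S|+6 is tight, and the structure
    is read off from the equality. In the rebuilding, the surviving vertices and edges of the
    Petersen graph must keep their identity through all sums. So the induction runs over the set of
    skeleton vertices already expanded and compares the graph with each intermediate graph through
    contraction maps. *)

Lemma even_card_involution (T : finType) (A : {set T}) (f : T -> T) :
  (forall x, x \in A -> f x \in A) -> (forall x, x \in A -> f (f x) = x) ->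
  (forall x, x \in A -> f x != x) -> ~~ odd #|A|.
Proof.
move: {2}#|A|.+1 (ltnSn #|A|) => n; elim: n A => // n IH A ltA fA fK fN.
case: (set_0Vmem A) => [->|[x xA]]; first by rewrite cards0.
have fxA : f x \in A :\ x by rewrite !inE fN // fA.
rewrite (cardsD1 x) xA (cardsD1 (f x)) fxA /= negbK.
apply: IH.
- by move: ltA; rewrite (cardsD1 x) xA (cardsD1 (f x)) fxA /=; lia.
- move=> y; rewrite !inE => /and3P[y1 y2 yA]; rewrite fA // andbT.
  apply/andP; split; last by apply: contra y1 => /eqP h; rewrite -h fK.
  by apply: contra y2 => /eqP h; rewrite -(fK _ yA) h fK.
- by move=> y; rewrite !inE => /and3P[_ _ /fK].
- by move=> y; rewrite !inE => /and3P[_ _ /fN].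
Qed.

Section TutteBerge.
Variables (V : finType) (e : rel V).
Hypothesis e_sym : symmetric e.
Implicit Types (Y : {set V}) (x y z : V) (m : V -> V).

(** A matching is an involution of the whole vertex type whose fixed points are the unmatched
    vertices, so exchanging edges is a pointwise redefinition. Vertices outside [Y] are fixed
    automatically. *)
Definition ematching (Y : {set V}) (m : V -> V) :=
  forall x, m (m x) = x /\ (m x != x -> [&& x \in Y, m x \in Y & e x (m x)]).
Definition missed (Y : {set V}) (m : V -> V) := [set x in Y | m x == x].
Definition maxmatching Y m :=
  ematching Y m /\ forall m', ematching Y m' -> #|missed Y m| <= #|missed Y m'|.

Definition within (Y : {set V}) : rel V := [rel x y | [&& x \in Y, y \in Y & e x y]].
Definition component (Y : {set V}) (x : V) := [set y | connect (within Y) x y].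

Lemma within_sym Y : symmetric (within Y).
Proof. by move=> x y; rewrite /within /= (e_sym x) andbCA. Qed.

Lemma component_sub Y x : x \in Y -> component Y x \subset Y.
Proof.
move=> xY; apply/subsetP=> y; rewrite inE => /connectP[p pth ->] {y}.
elim: p x xY pth => //= y p IH x _ /andP[/and3P[_ yY _]]; exact: IH.
Qed.

Lemma component_refl Y x : x \in component Y x.
Proof. by rewrite inE connect0. Qed.

Lemma component_csym Y : connect_sym (within Y).
Proof. exact: sym_connect_sym (@within_sym Y). Qed.

Lemma component_eq Y x y : y \in component Y x -> component Y y = component Y x.
Proof.
rewrite inE => xy; apply/setP=> z; rewrite !inE.
by apply/esym/same_connect => //; apply: component_csym.
Qed.

Lemma component_step Y x y z :
  y \in component Y x -> y \in Y -> z \in Y -> e y z -> z \in component Y x.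
Proof.
by rewrite !inE => h yY zY yz; apply: connect_trans h (connect1 _); rewrite /within /= yY zY.
Qed.

Lemma ematching_inj Y m : ematching Y m -> injective m.
Proof. by move=> h; apply: can_inj (m) _ => x; case: (h x). Qed.

(** The involution [m] pairs off the matched vertices of [Y]. *)
Lemma missed_parity Y m : ematching Y m -> odd #|missed Y m| = odd #|Y|.
Proof.
move=> mm; rewrite -(cardsID (missed Y m) Y) oddD.
have -> : Y :&: missed Y m = missed Y m by apply/setIidPr/subsetP=> x; rewrite inE => /andP[].
suff /negbTE-> : ~~ odd #|Y :\: missed Y m| by rewrite addbF.
apply: (@even_card_involution _ _ m) => x; case: (mm x) => mK h; rewrite !inE.
- rewrite mK => /andP[h1 xY]; rewrite xY /= in h1.
  by case/and3P: (h h1) => _ -> _; rewrite /= eq_sym h1.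
- by [].
- by case/andP=> h1 xY; rewrite xY in h1.
Qed.

Lemma id_ematching Y : ematching Y id.
Proof. by move=> x; rewrite eqxx. Qed.

(** Passing to finite functions allows minimising over all matchings and deciding whether some
    maximum matching misses a given vertex. *)
Definition ematchingb Y (m : {ffun V -> V}) :=
  [forall x, (m (m x) == x) && ((m x != x) ==> [&& x \in Y, m x \in Y & e x (m x)])].

Lemma ematchingP Y (m : {ffun V -> V}) : reflect (ematching Y m) (ematchingb Y m).
Proof.
apply: (iffP forallP) => h x; first by have /andP[/eqP-> /implyP] := h x.
by have [h1 h2] := h x; rewrite h1 eqxx; apply/implyP.
Qed.

Lemma ematching_ffun Y m : ematching Y m -> ematchingb Y (finfun m).
Proof. by move=> mm; apply/ematchingP => x; rewrite !ffunE; apply: mm. Qed.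

Lemma missed_ffun Y m : missed Y (finfun m) = missed Y m.
Proof. by apply/setP=> x; rewrite !inE ffunE. Qed.

Lemma ex_maxmatching Y : exists m, maxmatching Y m.
Proof.
have P0 : ematchingb Y (finfun (@id V)) by apply/ematching_ffun/id_ematching.
case: (@arg_minnP _ _ (ematchingb Y) (fun m : {ffun V -> V} => #|missed Y m|) P0).
move=> m /ematchingP mm minm; exists m; split=> // m' mm'.
by rewrite -(missed_ffun Y m'); apply: minm; apply: ematching_ffun.
Qed.

Lemma maxmatching_card Y m m' :
  maxmatching Y m -> maxmatching Y m' -> #|missed Y m| = #|missed Y m'|.
Proof. by case=> a b [c d]; apply/eqP; rewrite eqn_leq b // d. Qed.

Lemma maxmatching_edge Y m x y : maxmatching Y m -> x \in Y -> y \in Y -> x != y ->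
  e x y -> m x = x -> m y = y -> False.
Proof.
move=> [mm minm] xY yY xy exy mx my.
pose m' z := if z == x then y else if z == y then x else m z.
have mm' : ematching Y m'.
  have mi := ematching_inj mm.
  move=> z; rewrite /m'; case: (eqVneq z x) => [->|zx].
    by rewrite eqxx; case: eqVneq => [h|_]; [rewrite h eqxx in xy|rewrite xY yY exy].
  case: (eqVneq z y) => [->|zy]; first by rewrite eqxx xY yY e_sym exy.
  rewrite -{1}mx (inj_eq mi) (negbTE zx) -{1}my (inj_eq mi) (negbTE zy); exact: mm.
have := minm _ mm'; rewrite leqNgt => /negP; apply.
apply: proper_card; apply/properP; split.
  apply/subsetP=> z; rewrite !inE /m'; case: (eqVneq z x) => [->|zx].
    by rewrite eq_sym (negbTE xy) andbF.
  by case: (eqVneq z y) => [->|_] //; rewrite (negbTE xy) andbF.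
by exists x; rewrite !inE ?xY ?mx ?eqxx //= /m' eqxx eq_sym.
Qed.

(** Sets of equal size have differences of equal size: two elements in one difference give two in
    the other, and at most one of these is [x]. *)
Lemma missed_disjoint_card Y m m' x : #|missed Y m| = #|missed Y m'| ->
  1 < #|missed Y m :\: missed Y m'| ->
  exists2 z, z != x & (z \in missed Y m') && (z \notin missed Y m).
Proof.
move=> eqc lt1.
have e1 := cardsID (missed Y m') (missed Y m); have e2 := cardsID (missed Y m) (missed Y m').
have : 1 < #|missed Y m' :\: missed Y m| by move: e2; rewrite setIC; lia.
rewrite (cardsD1 x) => h.
have : 0 < #|(missed Y m' :\: missed Y m) :\ x| by move: h; case: (_ \in _); lia.
by case/card_gt0P=> z; rewrite in_setD1 in_setD => /and3P[zx a b]; exists z; rewrite // a b.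
Qed.

(* Gallai's exchange argument: "no maximum matching misses both" is transitive
   as soon as the middle vertex is missed by some maximum matching. *)
Lemma gallai_trans Y u v w m : u \in Y -> v \in Y -> w \in Y -> u != v ->
  (forall m, maxmatching Y m -> m u = u -> m w = w -> u = w) ->
  (forall m, maxmatching Y m -> m w = w -> m v = v -> w = v) ->
  maxmatching Y m -> m u = u -> m v = v ->
  (exists n, maxmatching Y n /\ n w = w) -> False.
Proof.
move=> uY vY wY uv huw hwv mx mu mv [n0 [mxn0 n0w]].
have mw : m w != w.
  by apply/negP=> /eqP mw; rewrite (huw _ mx mu mw) (hwv _ mx mw mv) eqxx in uv.
have [mm minm] := mx.
(* [agree n] collects the matched vertices on which [n] follows [m]. It can be enlarged for every
   maximum matching [n] missing [w], although its size never exceeds [#|V|]; the lower bound [k]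
   grows along the induction. *)
pose agree n := [set x in Y | (m x != x) && (m x == n x)].
have step k : forall n, maxmatching Y n -> n w = w -> k <= #|agree n| -> False; last first.
  exact: (step 0 _ mxn0 n0w).
have [r] := ubnP (#|V|.+1 - k); elim: r k => // r IH k ltk n mxn nw lek.
have lekV : k <= #|V| by apply: leq_trans lek (max_card _).
have ltk' : #|V|.+1 - k.+1 < r by clear -ltk lekV; lia.
have [nm minn] := mxn.
have nu : n u != u.
  apply/negP=> /eqP nu; have h := huw _ mxn nu nw.
  by rewrite -h mu eqxx in mw.
have nv : n v != v.
  apply/negP=> /eqP nv; have h := hwv _ mxn nw nv.
  by rewrite h mv eqxx in mw.
have c2 : 1 < #|missed Y m :\: missed Y n|.
  apply: leq_trans (subset_leq_card (_ : [set u; v] \subset _)); first by rewrite cards2 uv.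
  by apply/subsetP=> z; rewrite !inE => /orP[] /eqP->; rewrite ?uY ?vY ?mu ?mv ?eqxx ?nu ?nv.
have [x xw /andP[]] := missed_disjoint_card w (maxmatching_card mx mxn) c2.
rewrite !inE => /andP[xY /eqP nx]; rewrite xY /= => mx1.
have [mmx] := mm x => /(_ mx1) /and3P[_ yY exy].
set y := m x in mmx mx1 yY exy.
have ny : n y != y.
  apply/negP=> /eqP ny; apply: (maxmatching_edge mxn xY yY _ exy nx ny).
  by rewrite eq_sym.
have [nnz] := nm y => /(_ ny) /and3P[_ zY eyz].
set z := n y in nnz ny zY eyz.
have zx : z != x by apply/negP=> /eqP h; rewrite h nx in nnz; rewrite -nnz eqxx in mx1.
have ni := ematching_inj nm.
(* Exchange on the path x-y-z, where [n] misses [x], the edge xy belongs to [m] and yz to [n]: the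
   new matching uses xy and misses [z] instead of [x]. It still misses [w] and now agrees with [m]
   at [x]. No agreement is lost, since [m] and [n] differ at [y] and at [z]. *)
pose n' t := if t == x then y else if t == y then x else if t == z then z else n t.
have nm' : ematching Y n'.
  move=> t; rewrite /n'; case: (eqVneq t x) => [->|tx].
    by rewrite (negbTE mx1) eqxx xY yY exy.
  case: (eqVneq t y) => [->|ty]; first by rewrite eqxx yY xY e_sym exy.
  case: (eqVneq t z) => [->|tz].
    by rewrite (negbTE zx) (negbTE ny) !eqxx.
  have n1 : n t == x = false by apply/negbTE; rewrite -{1}nx (inj_eq ni).
  have n2 : n t == y = false by apply/negbTE; rewrite -nnz (inj_eq ni).
  have n3 : n t == z = false by apply/negbTE; rewrite (inj_eq ni).
  by rewrite n1 n2 n3; apply: nm.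
have cn' : #|missed Y n'| = #|missed Y n|.
  rewrite (cardsD1 z (missed Y n')) (cardsD1 x (missed Y n)).
  rewrite !inE zY xY nx eqxx /n' (negbTE zx) (negbTE ny) eqxx /= eqxx /=; congr (_ + _).
  congr #|pred_of_set _|; apply/setP=> t; rewrite !inE.
  case: (eqVneq t x) => [->|tx]; first by rewrite (negbTE mx1) !andbF.
  case: (eqVneq t y) => [->|ty]; first by rewrite (eq_sym x) (negbTE mx1) (negbTE ny) !andbF.
  case: (eqVneq t z) => [->|tz] //=.
  by rewrite nnz eq_sym (negbTE ny) andbF.
have mxn' : maxmatching Y n' by split=> // m' /minn; rewrite cn'.
apply: (IH k.+1 ltk' n' mxn').
  rewrite /n' (eq_sym w) (negbTE xw); case: (eqVneq w y) => [h|_]; last by case: eqVneq => [->|].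
  by rewrite /z -h nw eqxx in ny.
apply: leq_ltn_trans lek _; apply: proper_card; apply/properP; split.
  apply/subsetP=> t; rewrite !inE => /and3P[tY t1 /eqP t2]; rewrite tY t1 /=.
  rewrite /n'; case: (eqVneq t x) => [->|tx] //.
  case: (eqVneq t y) => [h|ty]; first by rewrite h mmx.
  case: (eqVneq t z) => [h|tz]; last by rewrite t2.
  by move: t2; rewrite h nnz => /(congr1 m); rewrite (proj1 (mm z)) mmx => h'; rewrite h' eqxx in zx.
exists x; first by rewrite !inE xY mx1 /n' eqxx eqxx.
by rewrite !inE xY mx1 nx /= (negbTE mx1).
Qed.

Definition odd_components Y := [set C in [set component Y y | y in Y] | odd #|C|].

(** [m] preserves the component and has [y] as its only fixed point there. *)
Lemma component_fixed_odd Y m y : ematching Y m -> y \in Y -> m y = y ->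
  (forall z, z \in component Y y -> m z = z -> z = y) -> odd #|component Y y|.
Proof.
move=> mm yY my uniq.
rewrite (cardsD1 y) component_refl /=.
apply: (@even_card_involution _ _ m) => x; rewrite in_setD1 => /andP[xy xC].
- have mxn : m x != x by apply: contra xy => /eqP/(uniq _ xC) ->.
  have [mK /(_ mxn) /and3P[xY mxY exm]] := mm x.
  rewrite in_setD1 (component_step xC xY mxY exm) andbT.
  by apply: contra xy => /eqP h; rewrite -mK h my.
- by case: (mm x).
- by apply: contra xy => /eqP/(uniq _ xC) ->.
Qed.

(** Gallai's proof. A vertex missed by no maximum matching is deleted and put into [S]. If there is
    none, a maximum matching misses at most one vertex of each component, so its missed vertices lie
    in distinct odd components and [S] is empty. *)
Theorem tutte_berge Y : exists (S : {set V}) (m : V -> V),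
  [/\ S \subset Y, maxmatching Y m & #|missed Y m| + #|S| <= #|odd_components (Y :\: S)|].
Proof.
have [n] := ubnP #|Y|; elim: n Y => // n IH Y ltY.
have [m mx] := ex_maxmatching Y.
pose inD v := [exists n : {ffun V -> V},
  [&& ematchingb Y n, #|missed Y n| == #|missed Y m| & n v == v]].
have inDP v : reflect (exists n, maxmatching Y n /\ n v = v) (inD v).
  apply: (iffP existsP) => [[n0 /and3P[/ematchingP h1 /eqP h2 /eqP h3]]|[n0 [[h1 h2] h3]]].
    by exists n0; split=> //; split=> // m'; rewrite h2; apply: (proj2 mx).
  exists (finfun n0); rewrite ematching_ffun // missed_ffun ffunE h3 eqxx andbT /=.
  by apply/eqP/(@maxmatching_card Y).
case: (boolP [exists v in Y, ~~ inD v]) => [/exists_inP[v vY /inDP nD]|].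
  have lt' : #|Y :\ v| < n by move: ltY; rewrite (cardsD1 v Y) vY; lia.
  have [S [m0 [SY [mm0 min0] le]]] := IH _ lt'.
  have m0v : m0 v = v.
    apply/eqP; apply/negPn/negP => h; have [_ /(_ h)] := mm0 v.
    by rewrite !inE eqxx.
  have mY : ematching Y m0.
    move=> x; have [h1 h2] := mm0 x; split=> // /h2; rewrite !inE.
    by case/and3P=> /andP[_ ->] /andP[_ ->] ->.
  have c1 : #|missed Y m0| = #|missed (Y :\ v) m0|.+1.
    rewrite (cardsD1 v) !inE vY m0v eqxx add1n; congr _.+1.
    by congr #|pred_of_set _|; apply/setP=> x; rewrite !inE ?andbA.
  have lt : #|missed Y m| < #|missed Y m0|.
    rewrite ltnNge; apply/negP => le'; apply: nD; exists m0; split=> //; split=> // m' mm'.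
    by apply: leq_trans le' _; apply: (proj2 mx).
  (* Equal parity turns the strict inequality into a gap of two: one unit accounts for [v] being
     missed by [m0], the other for [v] joining [S]. *)
  have par : odd #|missed Y m| = odd #|missed Y m0|.
    by rewrite !missed_parity //; apply: (proj1 mx).
  exists (v |: S), m; split=> //.
    by apply/subsetP=> x; rewrite !inE => /orP[/eqP->//|/(subsetP SY)]; rewrite !inE => /andP[].
  have vS : v \notin S by apply/negP=> /(subsetP SY); rewrite !inE eqxx.
  rewrite cardsU1 vS; have -> : Y :\: (v |: S) = Y :\ v :\: S.
    by apply/setP=> x; rewrite !inE negb_or; case: (x == v); case: (x \in S).
  by move: le lt par; rewrite c1 /=; lia.
rewrite negb_exists => /forallP allD.
have {}allD v : v \in Y -> exists n, maxmatching Y n /\ n v = v.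
  by move=> vY; apply/inDP; have := allD v; rewrite vY negbK.
exists set0, m; split=> //; first exact: sub0set.
rewrite cards0 addn0 setD0.
(* Induction along a path from [u]: the new vertex [w] and its predecessor are never missed
   together, because of the edge between them, and Gallai's exchange carries the claim from the
   predecessor to [w]. *)
have sim u v n0 : u \in Y -> v \in component Y u -> maxmatching Y n0 -> n0 u = u ->
    n0 v = v -> u = v.
  move=> uY; rewrite inE => /connectP[p]; elim/last_ind: p v n0 => [|p w IHp] v n0.
    by move=> _ ->.
  rewrite rcons_path last_rcons => /andP[pth /and3P[lY wY exy]] -> mx0 h1 h2.
  apply/eqP/negPn/negP => uw.
  apply: (gallai_trans (u := u) (v := w) (w := last u p) uY wY lY uw _ _ mx0 h1 h2 (allD _ lY)).
    by move=> n1 mx1 a1 a2; apply: (IHp _ n1).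
  move=> n1 mx1 a1 a2; apply/eqP/negPn/negP => lw.
  exact: (maxmatching_edge mx1 lY wY lw exy a1 a2).
rewrite -(card_in_imset (f := fun y => component Y y) (D := mem (missed Y m))).
  apply/subset_leq_card/subsetP=> C /imsetP[y]; rewrite inE => /andP[yY /eqP my] ->.
  rewrite inE imset_f //=; apply: (component_fixed_odd (proj1 mx) yY my) => z zC mz.
  by apply/esym/(sim _ _ m).
move=> y z; rewrite !inE => /andP[yY /eqP my] /andP[zY /eqP mz] eqC.
by apply: (sim _ _ m) => //; rewrite eqC component_refl.
Qed.
End TutteBerge.

(** * Darts and edge cuts *)

Section Darts.
Variable G : mgraph.
Implicit Types (d : dart G) (x y : gV G) (X Y Z S : {set gV G}) (g : gE G) (M : {set gE G}).

Definition flip d : dart G := (d.1, ~~ d.2).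
Lemma flipK : involutive flip. Proof. by case=> g b; rewrite /flip /= negbK. Qed.
Lemma flip_neq d : flip d != d.
Proof. by case: d => g []; apply/eqP => -[]. Qed.
Lemma dend_flip d : dend (flip d) = dother d. Proof. by []. Qed.
Lemma dother_flip d : dother (flip d) = dend d.
Proof. by rewrite -{2}(flipK d). Qed.
Lemma flip_inj : injective flip. Proof. exact: can_inj flipK. Qed.
Lemma dart_eq_edge d d' : d.1 = d'.1 -> d' = d \/ d' = flip d.
Proof.
by case: d d' => g b [g' b'] /= ->; case: b b' => [] []; [left|right|right|left].
Qed.

(** Each cut edge contributes only its dart pointing out of [X], so [#|bd X|] is the number of edges
    of the cut. *)
Definition bd X : {set dart G} := [set d | (dend d \in X) && (dother d \notin X)].

Lemma in_bd X d : (d \in bd X) = (dend d \in X) && (dother d \notin X).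
Proof. by rewrite in_set. Qed.

Definition eadj : rel (gV G) := fun x y => [exists g, ueq (gends g) (x, y)].

Lemma ueq_dartP g x y :
  reflect (exists b, dend (G := G) (g, b) = x /\ dother (G := G) (g, b) = y) (ueq (gends g) (x, y)).
Proof.
rewrite /ueq /=; apply: (iffP orP) => [[/eqP h|/eqP h]|[[] [<- <-]]].
- by exists true; rewrite /dother /dend /= h.
- by exists false; rewrite /dother /dend /= h.
- by left; rewrite /dother /dend /=; case: (gends g).
- by right; rewrite /dother /dend /=; case: (gends g).
Qed.

Lemma eadjP x y : reflect (exists d, dend d = x /\ dother d = y) (eadj x y).
Proof.
apply: (iffP existsP) => [[g /ueq_dartP[b h]]|[[g b] h]]; first by exists (g, b).
by exists g; apply/ueq_dartP; exists b.
Qed.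

Lemma eadj_sym : symmetric eadj.
Proof.
move=> x y; apply/eadjP/eadjP => -[d [h1 h2]]; exists (flip d);
by rewrite dend_flip dother_flip.
Qed.

Lemma adj_avP (A : {set gE G}) x y :
  reflect (exists d, [/\ dend d = x, dother d = y & d.1 \notin A]) (adj_av A x y).
Proof.
apply: (iffP existsP) => [[g /andP[gA /ueq_dartP[b [h1 h2]]]]|[[g b] [h1 h2 gA]]].
  by exists (g, b).
by exists g; rewrite gA; apply/ueq_dartP; exists b.
Qed.

Lemma connect_leaves (A : {set gE G}) X x y : connect (adj_av A) x y -> x \in X ->
  y \notin X -> exists2 d, d \in bd X & d.1 \notin A.
Proof.
move=> /connectP[p pth ->] {y}; elim: p x pth => [|z p IH] x /=; first by move=> _ ->.
case/andP=> /adj_avP[d [dx dz dA]] pth xX lX.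
case: (boolP (z \in X)) => [zX|zX]; first exact: (IH z).
by exists d => //; rewrite inE dx xX dz.
Qed.

Lemma bd_connected X x y : connected G -> x \in X -> y \notin X -> bd X != set0.
Proof.
move=> cG xX yX; have [d dX _] := connect_leaves (cG x y) xX yX.
by apply/set0Pn; exists d.
Qed.

Lemma bd_neq1 X : bridgeless G -> #|bd X| != 1.
Proof.
move=> bG; apply/negP => /cards1P[d hd].
have : d \in bd X by rewrite hd set11.
rewrite inE => /andP[h1 h2].
have [d' ] := connect_leaves (bG d.1 _ _) h1 h2.
by rewrite hd inE => /eqP->; rewrite set11.
Qed.

Lemma card_darts_sum X (P : pred (dart G)) :
  #|[set d | (dend d \in X) && P d]| = \sum_(x in X) #|[set d | (dend d == x) && P d]|.
Proof.
rewrite -sum1_card (partition_big (fun d : dart G => dend d) (mem X)) /=; last first.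
  by move=> d; rewrite inE => /andP[].
apply: eq_bigr => x xX; rewrite -sum1_card; apply: eq_bigl => d; rewrite !inE.
by case: eqVneq => [->|]; rewrite ?xX ?andbT ?andbF.
Qed.

Lemma card_darts_cubic X : cubic G -> #|[set d | dend d \in X]| = 3 * #|X|.
Proof.
move=> cG; rewrite (_ : [set d | _] = [set d | (dend d \in X) && predT d]); last first.
  by apply/setP=> d; rewrite !inE andbT.
rewrite card_darts_sum (eq_bigr (fun=> 3)) ?sum_nat_const 1?mulnC // => x _.
by rewrite -(cG x) /deg; apply: eq_card => d; rewrite !inE andbT.
Qed.

(** Reversal pairs off the darts with both ends in [X]. With a matching or a colour class for [P]
    this is the parity lemma for cuts. *)
Lemma odd_darts_bd X (P : pred (gE G)) :
  odd #|[set d | (dend d \in X) && P d.1]| = odd #|[set d in bd X | P d.1]|.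
Proof.
set A := [set d | _ & _]; rewrite -(cardsID (bd X) A) oddD.
have -> : A :&: bd X = [set d in bd X | P d.1].
  by apply/setP=> d; rewrite !inE; case: (_ \in X) => //=; rewrite andbC.
suff /negbTE-> : ~~ odd #|A :\: bd X| by rewrite addbF.
apply: (@even_card_involution _ _ flip) => d; rewrite ?inE.
- rewrite dother_flip dend_flip /=.
  by case: (dend d \in X); case: (dother d \in X).
- by rewrite flipK.
- by rewrite flip_neq.
Qed.

Lemma odd_bd X : cubic G -> odd #|bd X| = odd #|X|.
Proof.
move=> cG; have := odd_darts_bd X predT.
have -> : [set d in bd X | predT d.1] = bd X by apply/setP=> d; rewrite !inE andbT.
move=> <-; have -> : [set d | (dend d \in X) && predT d.1] = [set d | dend d \in X].
  by apply/setP=> d; rewrite !inE andbT.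
by rewrite card_darts_cubic // oddM.
Qed.

(** A loop takes two of the three darts at its vertex. At most one dart is left for the cut around
    the vertex, whose size is odd; that dart would be a bridge. *)
Lemma no_loop d : cubic G -> bridgeless G -> dend d != dother d.
Proof.
move=> cG bG; apply/negP => /eqP h.
have /negP := bd_neq1 [set dend d] bG; apply; rewrite eqn_leq.
have /odd_gt0 -> : odd #|bd [set dend d]| by rewrite odd_bd // cards1.
rewrite andbT; have c3 := cG (dend d).
have : #|bd [set dend d]| <= #|[set d' : dart G | dend d' == dend d] :\ d :\ flip d|.
  apply/subset_leq_card/subsetP=> d'; rewrite !inE => /andP[h1 h2]; rewrite h1 andbT.
  apply/andP; split; apply: contra h2 => /eqP->; rewrite ?dother_flip ?h //.
move: c3; rewrite /deg (cardsD1 d) (cardsD1 (flip d)) !inE eqxx flip_neq dend_flip h eqxx /=.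
by rewrite !add1n => -[->].
Qed.

(** The second clause applies to both darts of an edge, so both ends of every edge of [M] lie in
    [Y]. *)
Definition pm_on Y M :=
  (forall x, x \in Y -> #|[set d | (dend d == x) && (d.1 \in M)]| = 1) /\
  (forall d, d.1 \in M -> dend d \in Y).

Lemma pm_on_ematching Y m : ematching eadj Y m -> missed Y m = set0 -> exists M, pm_on Y M.
Proof.
move=> mm m0.
have mx x : x \in Y -> m x != x.
  move=> xY; apply/negP=> h; suff : x \in missed Y m by rewrite m0 inE.
  by rewrite inE xY.
pose pk x y := [pick g | ueq (gends g) (x, y)].
(* Among parallel edges both ends must select the same one, so the choice has to be symmetric. *)
have pkC x y : pk x y = pk y x.
  by apply: eq_pick => g; apply/ueq_dartP/ueq_dartP => -[b [h1 h2]]; exists (~~ b);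
     rewrite -/(flip (g, b)) ?dend_flip ?dother_flip.
pose M := [set g | [&& (gends g).1 \in Y, m (gends g).1 == (gends g).2 &
                      pk (gends g).1 (gends g).2 == Some g]].
have MP d : d.1 \in M -> [/\ dend d \in Y, m (dend d) = dother d & pk (dend d) (dother d) = Some d.1].
  rewrite inE; case: d => g [] /and3P[]; rewrite /dother /dend /= => h1 /eqP h2 /eqP h3.
    by rewrite h1 h2.
  have [mK /(_ (mx _ h1)) /and3P[_ h4 _]] := mm (gends g).1.
  by rewrite pkC -h2 h4 mK h2 h3.
exists M; split; last by move=> d /MP[].
move=> x xY; have [mK /(_ (mx _ xY)) /and3P[_ mY exm]] := mm x.
have [g hg] : exists g, pk x (m x) = Some g.
  rewrite /pk; case: pickP => [g _|h]; first by exists g.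
  by case/existsP: exm => g; rewrite h.
have := hg; rewrite {1}/pk; case: pickP => // g' /ueq_dartP[b [h1 h2]] [eg]; subst g'.
apply/eqP/cards1P; exists (g, b); apply/setP=> d; rewrite in_set1 in_set.
apply/andP/eqP => [[/eqP dx /MP[d1 d2 d3]]|->].
  have eg : (g, b).1 = d.1 by move: d3; rewrite -d2 dx hg => -[].
  case: (dart_eq_edge eg) => // h; move: dx; rewrite h dend_flip h2 => h'.
  by have := mx _ xY; rewrite h' eqxx.
rewrite h1 eqxx; split=> //; rewrite /M inE.
case: b h1 h2; rewrite /dother /dend /= => h1 h2.
  by rewrite h1 xY -h2 eqxx h2 hg /=.
by rewrite h1 h2 mY mK eqxx pkC hg eqxx.
Qed.

(** By parity a maximum matching misses at least two vertices, so there are at least [#|S| + 2] odd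
    components, each with a cut of at least three edges. These edges end in [S] or [Z], which offer
    at most [3 * #|S| + 6]. Equality throughout makes [S] independent, all cuts of size three and
    the cut of [Z] of size six. *)
Lemma barrier Z : twoconn G -> cubic G -> Z != set0 -> ~~ odd #|~: Z| -> #|bd Z| <= 6 ->
  (forall M, ~ pm_on (~: Z) M) ->
  exists S, [/\ S \subset ~: Z, forall d, dend d \in S -> dother d \in ~: Z :\: S,
    forall y, y \in ~: Z :\: S -> #|bd (component eadj (~: Z :\: S) y)| = 3 & #|bd Z| = 6].
Proof.
move=> [cnG brG] cG Z0 evenZ bd6 noM.
have [S [m [SZ [mm mx] le]]] := tutte_berge eadj_sym (~: Z).
set T := ~: Z :\: S in le *; set OC := odd_components eadj T in le.
have cT := component_eq eadj_sym (Y := T).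
have miss2 : 1 < #|missed (~: Z) m|.
  have := missed_parity mm; rewrite (negbTE evenZ).
  case E: #|missed (~: Z) m| => [|[|n]] //= _.
  have [M /noM []] : exists M, pm_on (~: Z) M by apply/(pm_on_ematching mm)/eqP; rewrite -cards_eq0 E.
pose C d := component eadj T (dend d).
pose B := [set d | [&& C d \in OC, dend d \in T & dother d \notin C d]].
have BE d : (d \in B) = [&& C d \in OC, dend d \in T & dother d \notin C d] by rewrite in_set.
have bdC y d : y \in T -> d \in bd (component eadj T y) -> C d = component eadj T y /\ dend d \in T.
  move=> yT; rewrite in_bd => /andP[h _]; split; first exact: cT.
  exact: (subsetP (component_sub _ yT) _ h).
have OCbd K : K \in OC -> exists2 y, y \in T & K = component eadj T y.
  by rewrite inE => /andP[/imsetP].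
have cB : #|B| = \sum_(K in OC) #|bd K|.
  rewrite -sum1_card (partition_big C (mem OC)) /=; last by move=> d; rewrite BE => /and3P[].
  apply: eq_bigr => K KO; rewrite -sum1_card; apply: eq_bigl => d.
  have [y yT eK] := OCbd _ KO.
  apply/andP/idP => [[h /eqP h2]|h].
    by move: h; rewrite BE in_bd h2 => /and3P[_ _ ->]; rewrite -h2 component_refl.
  have := h; rewrite {1}eK => /(bdC _ _ yT) [e1 e2].
  by move: h; rewrite BE in_bd e1 -eK e2 KO eqxx => /andP[_ ->].
have bd3 K : K \in OC -> 2 < #|bd K|.
  move=> KO; have : odd #|bd K| by rewrite odd_bd //; move: KO; rewrite inE => /andP[].
  by have := bd_neq1 K brG; case: #|bd K| => [|[|[|n]]].
have lower : 3 * #|OC| <= #|B|.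
  by rewrite cB mulnC -sum_nat_const; apply: leq_sum => K /bd3.
pose D0 := [set d | dend d \in S] :|: bd Z.
have sub : flip @: B \subset D0.
  apply/subsetP=> d' /imsetP[d]; rewrite BE => /and3P[h1 h2 h3] ->.
  rewrite in_setU in_set in_bd dend_flip dother_flip; move: (h2); rewrite in_setD in_setC => /andP[d1 d2].
  rewrite d2 andbT; case: (boolP (dother d \in S)) => //= oS.
  apply: contraR h3 => oZ.
  apply: (component_step (component_refl _ _ _) h2); first by rewrite !inE oS oZ.
  by apply/eadjP; exists d.
have upper : #|D0| <= 3 * #|S| + #|bd Z|.
  by rewrite /D0 cardsU card_darts_cubic // leq_subr.
have cflip : #|flip @: B| = #|B| by apply/card_imset/flip_inj.
have subc := subset_leq_card sub.
have eqq : #|OC| = #|S| + 2 /\ #|B| = 3 * #|OC| /\ #|bd Z| = 6 by clear -le miss2 lower upper cflip subc bd6; lia.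
have [q1 [q2 q3]] := eqq.
have eqD : flip @: B = D0.
  apply/eqP; rewrite eqEcard sub; clear -q1 q2 q3 upper cflip; lia.
have inB d : d \in D0 -> flip d \in B.
  by rewrite -eqD => /imsetP[d' d'B ->]; rewrite flipK.
exists S; split=> //.
  move=> d dS; have : flip d \in B by apply: inB; rewrite in_setU in_set dS.
  by rewrite BE dend_flip => /and3P[].
move=> y yT; set K := component eadj T y.
(* By equality every edge leaving [S] or [Z] enters an odd component. Every component has a nonempty
   cut by connectivity, so there are no even ones. *)
have Kbd d : d \in bd K -> K \in OC.
  move=> dK; have [e1 e2] := bdC _ _ yT dK.
  have : flip (flip d) \in B.
    apply: inB; rewrite in_setU in_set in_bd dother_flip dend_flip; move: dK; rewrite in_bd.
    case/andP=> dK oK; case: (boolP (dother d \in S)) => //= oS.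
    move: (e2); rewrite in_setD in_setC => /andP[_ ->]; rewrite andbT.
    apply: contraR oK => oZ; apply: (component_step _ e2 _ (z := dother d)).
    - by [].
    - by rewrite !inE oS oZ.
    - by apply/eadjP; exists d.
  by rewrite flipK BE e1 => /andP[].
have [z zZ] := set0Pn _ Z0.
have : bd K != set0.
  apply: (bd_connected (x := y) (y := z) cnG); first exact: component_refl.
  by apply/negP => /(subsetP (component_sub _ yT)); rewrite !inE zZ andbF.
case/set0Pn=> d /Kbd KO; apply/eqP; rewrite eqn_leq bd3 // andbT.
have q4 := cardsD1 K OC; rewrite KO in q4.
have q5 : 3 * #|OC :\ K| <= \sum_(i in OC | i != K) #|bd i|.
  rewrite mulnC -sum_nat_const; apply: leq_trans (_ : \sum_(i in OC | i != K) 3 <= _).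
    by apply: eq_leq; apply: eq_bigl => i; rewrite !inE andbC.
  by apply: leq_sum => i /andP[/bd3].
move: q2; rewrite cB (bigD1 K KO) => q2.
have aux (a b s t : nat) : a = 1 + b -> 3 * b <= t -> s + t = 3 * a -> s <= 3 by lia.
exact: aux q4 q5 q2.
Qed.
End Darts.

(** * Alternating paths along a barrier *)

Notation o6 k := (@Ordinal 6 k isT).
Notation o3 k := (@Ordinal 3 k isT).

Section TwoInvolutions.
Variables (E : finType) (A : {set E}) (a b : E -> E).
Hypotheses (aA : forall x, x \in A -> a x \in A) (bA : forall x, x \in A -> b x \in A).
Hypotheses (aK : forall x, x \in A -> a (a x) = x) (bK : forall x, x \in A -> b (b x) = x).
Hypotheses (aN : forall x, x \in A -> a x != x) (bN : forall x, x \in A -> b x != x).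

(* [a] and [b] generate a dihedral group without reflections having a fixed point,
   so [x] and [a x] lie in different orbits of the rotation. *)
Lemma involutions_2colouring :
  exists f : E -> bool, forall x, x \in A -> f (a x) != f x /\ f (b x) != f x.
Proof.
pose a' x := if x \in A then a x else x; pose b' x := if x \in A then b x else x.
have a'K : involutive a'.
  move=> x; rewrite /a'; case: (boolP (x \in A)) => xA; last by rewrite (negbTE xA).
  by rewrite aA // aK.
have b'K : involutive b'.
  move=> x; rewrite /b'; case: (boolP (x \in A)) => xA; last by rewrite (negbTE xA).
  by rewrite bA // bK.
pose r x := a' (b' x).
have rI : injective r by move=> x y /(can_inj a'K)/(can_inj b'K).
have rA x : x \in A -> r x \in A by move=> xA; rewrite /r /b' xA /a' bA // aA // bA.
have itA m x : x \in A -> iter m r x \in A by move=> xA; elim: m => //= m; apply: rA.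
have ar m x : a' (iter m r x) = iter m (fun y => b' (a' y)) (a' x).
  by elim: m x => //= m IH x; rewrite -IH /r a'K a'K.
have back m k x : iter m (fun y => b' (a' y)) (iter (m + k) r x) = iter k r x.
  by elim: m => // m IH; rewrite iterSr addSn iterS /r a'K b'K.
have csym := fconnect_sym rI.
(* Suppose [a x] is the [k]-th iterate of the rotation at [x], and let [y] be the iterate at half of
   [k]. If [k] is even then [y] is fixed by [a]; if [k] is odd then [a y = a (b y)], so [y] is fixed
   by [b]. *)
have noloop x : x \in A -> froot r (a' x) != froot r x.
  move=> xA; rewrite eq_sym root_connect //.
  apply/negP => /iter_findex; set k := findex _ _ _ => h.
  have ek := odd_double_half k.
  have h2 : a' (iter k./2 r x) = iter (odd k + k./2) r x.
    rewrite ar -h -[X in iter X r x]ek -addnn addnA (addnC (odd k + k./2)).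
    by rewrite back.
  case: (odd k) h2 => /=.
    move=> /(can_inj a'K) /eqP; rewrite eq_sym; apply/negP.
    by rewrite /b' itA //; apply: bN; apply: itA.
  by move/eqP; apply/negP; rewrite /a' itA //; apply: aN; apply: itA.
(* Any strict order on orbits serves: [x] and [a x] lie in different orbits, and [b x] lies in the
   orbit of [a x]. The colour tells whether the orbit of [x] is the smaller of the two. *)
pose rk x := enum_rank (froot r x).
have rkN x : x \in A -> (rk (a' x) : nat) != rk x.
  by move=> xA; rewrite val_eqE (inj_eq enum_rank_inj); apply: noloop.
have rkr x y : fconnect r x y -> rk x = rk y.
  by move=> h; congr enum_rank; apply/eqP; rewrite root_connect.
exists (fun x => rk x < rk (a' x)) => x xA.
have e1 : a x = a' x by rewrite /a' xA.
have e2 : b x = b' x by rewrite /b' xA.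
have rb : rk (b' x) = rk (a' x).
  apply: rkr; rewrite -[b' x]a'K -/(r x) csym.
  have -> : a' x = r (a' (r x)) by rewrite /r a'K b'K.
  by rewrite csym; apply: fconnect1.
have rr : rk (r x) = rk x by apply/esym/rkr/fconnect1.
rewrite e1 e2 a'K -/(r x) rb rr; have := rkN _ xA.
by case: ltngtP.
Qed.
End TwoInvolutions.

Lemma pair_involution (E : finType) (K : eqType) (A : {set E}) (f : E -> K) :
  (forall x, x \in A -> #|[set y in A | f y == f x]| = 2) ->
  exists o : E -> E, forall x, x \in A ->
    [/\ o x \in A, o x != x, o (o x) = x, f (o x) = f x &
      forall y, y \in A -> f y = f x -> y = x \/ y = o x].
Proof.
move=> h2; pose o x := odflt x [pick y in A | (f y == f x) && (y != x)].
have oP x : x \in A -> [/\ o x \in A, o x != x, f (o x) = f x &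
      forall y, y \in A -> f y = f x -> y = x \/ y = o x].
  move=> xA; have c1 : #|[set y in A | f y == f x] :\ x| = 1.
    by have := h2 _ xA; rewrite (cardsD1 x) !inE xA eqxx /= => -[].
  have /cards1P[z hz] : #|[set y in A | f y == f x] :\ x| == 1 by rewrite c1.
  have memz y : ((y != x) && ((y \in A) && (f y == f x))) = (y == z).
    by have := in_set1 y z; rewrite -hz !inE.
  have oz : o x = z.
    rewrite /o; case: pickP => [y /and3P[h3 h4 h5] | /(_ z)].
      by apply/eqP; rewrite -memz h3 h4 h5.
    by have := memz z; rewrite eqxx => /and3P[-> -> ->].
  have := memz z; rewrite eqxx oz => /and3P[zx zA /eqP fz]; split=> // y yA fy.
  by case: (eqVneq y x) => [|yx]; [left | right; apply/eqP; rewrite -memz yx yA fy /=].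
exists o => x xA; have [h1 h3 h4 h5] := oP _ xA; split=> //.
have [g1 g2 g3 g4] := oP _ h1.
case: (h5 (o (o x)) g1); rewrite ?g3 ?h4 // => e1; by rewrite e1 eqxx in g2.
Qed.

Section Incidence.
Variables (E T L : finType) (t : E -> T) (s : E -> L + 'I_6) (d : 'I_6 -> E).

(** The structure models the graph after contracting the components of a barrier: [E] are the edges,
    [T] the contracted components, [L] the barrier vertices. The six edges [d i] run to the hexagon
    and are pendant, so no properness is asked at their far ends. *)
Definition proper3 (c : E -> 'I_3) :=
  [/\ forall e e', t e = t e' -> c e = c e' -> e = e',
      forall e e', s e = s e' -> c e = c e' -> e = e' &
      (forall x k, exists2 e, t e = x & c e = k) /\
      (forall l k, exists2 e, s e = inl l & c e = k)].

(** All neighbours of [QL] lie in [QT], so [outQ] is the full edge cut of the two sets together. *)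
Definition closedQ (QT : {set T}) (QL : {set L}) :=
  forall e l, s e = inl l -> l \in QL -> t e \in QT.
Definition outQ (QT : {set T}) (QL : {set L}) :=
  [set e | (t e \in QT) && (if s e is inl l then l \notin QL else true)].

Variable c : E -> 'I_3.
Hypothesis pc : proper3 c.
Hypothesis sd : forall e i, s e = inr i <-> e = d i.

Lemma card_tfibre x : #|[set e | t e == x]| = 3.
Proof.
case: pc => ht _ [ex _].
rewrite -(card_in_imset (f := c)).
  rewrite -[RHS](card_ord 3); apply: eq_card => k; rewrite inE; apply/imsetP.
  by have [e e1 e2] := ex x k; exists e; rewrite // inE e1.
by move=> e e'; rewrite !inE => /eqP h /eqP h'; apply: ht; rewrite h.
Qed.

Lemma card_sfibre l : #|[set e | s e == inl l]| = 3.
Proof.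
case: pc => _ hs [_ ex].
rewrite -(card_in_imset (f := c)).
  rewrite -[RHS](card_ord 3); apply: eq_card => k; rewrite inE; apply/imsetP.
  by have [e e1 e2] := ex l k; exists e; rewrite // inE e1.
by move=> e e'; rewrite !inE => /eqP h /eqP h'; apply: hs; rewrite h.
Qed.

Lemma card_tset (QT : {set T}) : #|[set e | t e \in QT]| = 3 * #|QT|.
Proof.
rewrite -sum1_card (partition_big t (mem QT)) /=; last by move=> e; rewrite inE.
rewrite (eq_bigr (fun=> 3)) ?sum_nat_const 1?mulnC // => x xQ.
apply: etrans (card_tfibre x); rewrite -sum1_card; apply: eq_bigl => e; rewrite !inE.
by case: eqP => [->|]; rewrite ?xQ ?andbF.
Qed.

Lemma card_sset (QL : {set L}) : #|[set e | if s e is inl l then l \in QL else false]| = 3 * #|QL|.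
Proof.
pose s' e := if s e is inl l then Some l else None.
rewrite -sum1_card (partition_big s' (mem [set Some l | l in QL])) /=; last first.
  by move=> e; rewrite inE /s'; case: (s e) => // l lQ; apply: imset_f.
rewrite big_imset /=; last by move=> l l' _ _ [].
rewrite (eq_bigr (fun=> 3)) ?sum_nat_const 1?mulnC // => l lQ.
apply: etrans (card_sfibre l); rewrite -sum1_card; apply: eq_bigl => e; rewrite !inE /s'.
case: (s e) => [l'|i] //=.
by rewrite (inj_eq Some_inj) [in RHS]eqE /=; case: eqP => [->|]; rewrite ?lQ ?andbF.
Qed.

(** Three edges start at each node of [QT], and those not leaving are exactly the three at each node
    of [QL]. *)
Lemma card_outQ QT QL : closedQ QT QL -> #|outQ QT QL| + 3 * #|QL| = 3 * #|QT|.
Proof.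
move=> cl; rewrite -card_tset -card_sset.
set A := [set e | if s e is inl l then l \in QL else false].
rewrite -[RHS](cardsID A) addnC; congr (_ + _); congr #|pred_of_set _|; apply/setP=> e; rewrite !inE.
  case E1: (s e) => [l|i]; last by rewrite andbF.
  by case: (boolP (l \in QL)) => [lQ|]; rewrite ?andbF // (cl _ _ E1 lQ).
by rewrite andbC; case: (s e).
Qed.

Hypothesis c01 : c (d (o6 0)) = c (d (o6 1)).
Hypothesis c0N : forall i : 'I_6, 1 < i -> c (d i) != c (d (o6 0)).

Let k0 := c (d (o6 0)).
Let t0 := t (d (o6 0)).
Let t1 := t (d (o6 1)).
Let t3 := t (d (o6 3)).

Lemma d_inj : injective d.
Proof.
move=> i j h; have h1 : s (d i) = inr i by apply/sd.
by have : s (d j) = inr j by [apply/sd]; rewrite -h h1 => -[].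
Qed.

(** A matching covering all of [L] and all of [T] except the node [w], with nothing omitted for
    [None]; pendant edges may be used. *)
Definition transversal (N : {set E}) (w : option T) :=
  [/\ forall e e', e \in N -> e' \in N -> t e = t e' -> e = e',
      forall e e', e \in N -> e' \in N -> s e = s e' -> e = e',
      forall x, Some x <> w -> exists2 e, e \in N & t e = x,
      forall e, e \in N -> Some (t e) <> w &
      forall l, exists2 e, e \in N & s e = inl l].

(** Give [N] one colour. What is left has two edges at every node and decomposes into even cycles
    and paths between pendant ends, which are coloured alternately with the other two colours. *)
Lemma transversal_recolour N : transversal N None ->
  (forall i : 'I_6, (d i \in N) = (i == o6 0) || (i == o6 3)) ->
  exists2 c', proper3 c' & [/\ c' (d (o6 0)) = c' (d (o6 3)),
     forall i : 'I_6, i != o6 0 -> i != o6 3 -> c' (d i) != c' (d (o6 0)),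
     c' (d (o6 1)) != c' (d (o6 5)) & c' (d (o6 2)) != c' (d (o6 4))].
Proof.
move=> [Nt Ns ext _ exs] dN.
pose A := ~: N.
have two (K : eqType) (f : E -> K) x e0 : #|[set y | f y == x]| = 3 -> e0 \in N -> f e0 = x ->
    (forall e, e \in N -> f e = x -> e = e0) -> #|[set y in A | f y == x]| = 2.
  move=> c3 e0N fe0 uq; have := cardsID N [set y | f y == x].
  rewrite c3 (_ : _ :&: N = [set e0]) ?cards1; last first.
    apply/setP=> y; rewrite !inE; apply/andP/eqP => [[/eqP h1 h2]|->]; first exact: uq.
    by rewrite fe0 eqxx.
  rewrite add1n => -[<-]; congr #|pred_of_set _|; apply/setP=> y.
  by rewrite !inE.
have At x : x \in A -> #|[set y in A | t y == t x]| = 2.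
  move=> _; have [] := ext (t x); first by [].
  move=> e0 e0N te0; apply: (two _ t _ e0) => //; first exact: card_tfibre.
  by move=> e eN te; apply: Nt => //; rewrite te.
(* The four remaining pendant ends are glued in pairs, 1 with 5 and 2 with 4, so that every end has
   exactly two edges. The alternating colouring then separates these pairs, as the conclusion
   demands. *)
pose mg (i : 'I_6) : nat := if (i == o6 1) || (i == o6 5) then 1 else 2.
pose s' e : L + nat := match s e with inl l => inl l | inr i => inr (mg i) end.
have As x : x \in A -> #|[set y in A | s' y == s' x]| = 2.
  rewrite inE => xN; case E1: (s x) => [l|i].
    have [e0 e0N se0] := exs l.
    have -> : [set y in A | s' y == s' x] = [set y in A | s y == inl l].
      by apply/setP=> y; rewrite !inE /s' E1; case: (s y) => [l'|j]; rewrite // ?andbF.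
    apply: (two _ s _ e0) => //; first exact: card_sfibre.
    by move=> e eN te; apply: Ns => //; rewrite te.
  have xi : x = d i by apply/sd.
  have dA j : (d j \in A) = [&& j != o6 0 & j != o6 3] by rewrite inE dN negb_or.
  have sE y : (y \in A) && (s' y == s' x) = [exists j : 'I_6, [&& y == d j, j != o6 0, j != o6 3 & mg j == mg i]].
    apply/andP/existsP => [[yA]|[j /and4P[/eqP-> h1 h2 h3]]].
      rewrite /s' E1; case E2: (s y) => [//|j] /eqP[h].
      have yj : y = d j by apply/sd.
      by exists j; move: yA; rewrite yj dA eqxx h => /andP[-> ->] /=.
    by rewrite dA h1 h2 /s' E1 (proj2 (sd (d j) j)) // (eqP h3).
  have -> : [set y in A | s' y == s' x] = if mg i == 1 then [set d (o6 1); d (o6 5)] else [set d (o6 2); d (o6 4)].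
    apply/setP=> y; rewrite inE sE; apply/existsP/idP => [[j /and4P[/eqP-> h1 h2 /eqP <-]]|].
      case: j h1 h2 => [[|[|[|[|[|[|n]]]]]] ltn] // _ _; rewrite /mg /=;
      by rewrite !inE !(inj_eq d_inj) -!val_eqE.
    have [mi|mi] : mg i = 1 \/ mg i = 2 by rewrite /mg; case: ifP; [left | right].
      by rewrite mi !inE => /orP[] /eqP ->; [exists (o6 1) | exists (o6 5)]; rewrite eqxx.
    by rewrite mi !inE => /orP[] /eqP ->; [exists (o6 2) | exists (o6 4)]; rewrite eqxx.
  by case: ifP => _; rewrite cards2 (inj_eq d_inj).
have [b bP] := pair_involution At; have [a aP] := pair_involution As.
have [f fP] : exists f : E -> bool, forall x, x \in A -> f (a x) != f x /\ f (b x) != f x.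
  apply: involutions_2colouring => x xA; first [by case: (aP _ xA) | by case: (bP _ xA)].
pose c' e := if e \in N then o3 0 else if f e then o3 1 else o3 2.
have c'N e e' : e \notin N -> e' \notin N -> f e' != f e -> c' e <> c' e'.
  by rewrite /c' => /negbTE-> /negbTE->; case: (f e); case: (f e').
have c't e e' : t e = t e' -> c' e = c' e' -> e = e'.
  move=> h1 h2; case: (boolP (e \in N)) => eN; case: (boolP (e' \in N)) => eN'.
  - exact: Nt.
  - by move: h2; rewrite /c' eN (negbTE eN'); case: (f e').
  - by move: h2; rewrite /c' eN' (negbTE eN); case: (f e).
  have eA : e \in A by rewrite inE.
  have eA' : e' \in A by rewrite inE.
  have [_ _ _ _ /(_ e' eA' (esym h1)) [//|h]] := bP _ eA.
  case: (c'N e e' eN eN') => //; rewrite h; by case: (fP _ eA).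
have c's' e e' : e \in A -> e' \in A -> s' e = s' e' -> c' e = c' e' -> e = e'.
  move=> eA eA' h1 h2.
  have [_ _ _ _ /(_ e' eA' (esym h1)) [//|h]] := aP _ eA.
  move: (eA) (eA'); rewrite !inE => eN eN'.
  case: (c'N e e' eN eN') => //; rewrite h; by case: (fP _ eA).
have c's e e' : s e = s e' -> c' e = c' e' -> e = e'.
  move=> h1 h2; case: (boolP (e \in N)) => eN; case: (boolP (e' \in N)) => eN'.
  - exact: Ns.
  - by move: h2; rewrite /c' eN (negbTE eN'); case: (f e').
  - by move: h2; rewrite /c' eN' (negbTE eN); case: (f e).
  by apply: c's'; rewrite ?inE // /s' h1.
have onto (F : {set E}) k : #|F| = 3 -> {in F &, injective c'} -> exists2 e, e \in F & c' e = k.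
  move=> F3 inj; have : k \in c' @: F.
    have -> : c' @: F = setT by apply/eqP; rewrite eqEcard subsetT card_in_imset // F3 cardsT card_ord.
    by rewrite inE.
  by case/imsetP=> e; exists e.
exists c'; first split=> //; first split.
- move=> x k; have [||e] := onto [set e | t e == x] k; first exact: card_tfibre.
    by move=> e e'; rewrite !inE => /eqP h /eqP h'; apply: c't; rewrite h.
  by rewrite inE => /eqP; exists e.
- move=> l k; have [||e] := onto [set e | s e == inl l] k; first exact: card_sfibre.
    by move=> e e'; rewrite !inE => /eqP h /eqP h'; apply: c's; rewrite h.
  by rewrite inE => /eqP; exists e.
have c'd i j : i != j -> i != o6 0 -> i != o6 3 -> j != o6 0 -> j != o6 3 -> mg i = mg j -> c' (d i) != c' (d j).
  move=> ij i0 i3 j0 j3 m; apply/eqP => /(c's' _ _); rewrite !inE !dN !negb_or i0 i3 j0 j3.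
  rewrite /s' !(proj2 (sd _ _) erefl) m => /(_ isT isT erefl) /d_inj h.
  by rewrite h eqxx in ij.
split; [|move=> i i0 i3| |]; last 2 first.
- exact: c'd.
- exact: c'd.
- by rewrite /c' !dN.
by rewrite /c' !dN /= (negbTE i0) (negbTE i3) /=; case: (f _).
Qed.

Let n1 x := odflt (d (o6 0)) [pick e | (t e == x) && (c e == k0)].
Lemma n1P x : t (n1 x) = x /\ c (n1 x) = k0.
Proof.
rewrite /n1; case: pickP => [e /andP[/eqP-> /eqP->] //|h].
by case: pc => _ _ [/(_ x k0)[e e1 e2] _]; have := h e; rewrite e1 e2 !eqxx.
Qed.
Lemma n1_uniq e : c e = k0 -> n1 (t e) = e.
Proof. by case: pc => ht _ _ ce; have [h1 h2] := n1P (t e); apply: ht; rewrite ?h1 ?h2. Qed.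
Lemma n1_inl x : x != t0 -> x != t1 -> exists l, s (n1 x) = inl l.
Proof.
move=> x0 x1; have [h1 h2] := n1P x; case E1: (s (n1 x)) => [l|i]; first by exists l.
have ed : n1 x = d i by apply/sd.
have : i <= 1 by rewrite leqNgt; apply/negP => /c0N; rewrite -ed h2 eqxx.
case: i ed {E1} => [[|[|i]] lti] // ed _.
  by move: x0; rewrite -h1 ed /t0 (bool_irrelevance lti isT) eqxx.
by move: x1; rewrite -h1 ed /t1 (bool_irrelevance lti isT) eqxx.
Qed.
Lemma n1_t0 : n1 t0 = d (o6 0). Proof. exact: n1_uniq. Qed.
Lemma n1_t1 : n1 t1 = d (o6 1). Proof. by apply: n1_uniq; rewrite -c01. Qed.

(** One alternating step: along an edge of another colour from [x] to a node of [L], then along the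
    [k0]-edge of that node to [y]. *)
Let step : rel T := fun x y =>
  [exists e, [&& t e == x, c e != k0, s e == s (n1 y) & if s e is inl _ then true else false]].

(** The class of colour [k0] without [d (o6 1)] misses only [t1]. Each step moves the gap forward:
    it adds the first edge of the step and removes the [k0]-edge at the next node. The last clause
    records that [k0]-edges at unvisited nodes are still present, which is where uniqueness of the
    path is used. *)
Lemma alternating_path p : path step t1 p -> uniq (t1 :: p) ->
  exists N, [/\ transversal N (Some (last t1 p)),
    forall i : 'I_6, (d i \in N) = (i == o6 0) &
    forall x, x \notin t1 :: p -> n1 x \in N].
Proof.
have [ht hs [ext exs]] := pc.
elim/last_ind: p => [_ _|p y IH].
  exists [set e | (c e == k0) && (e != d (o6 1))]; split; first split.
  - by move=> e e'; rewrite !inE => /andP[/eqP h _] /andP[/eqP h' _] /ht; apply; rewrite h.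
  - by move=> e e'; rewrite !inE => /andP[/eqP h _] /andP[/eqP h' _] /hs; apply; rewrite h.
  - move=> x xw; have [h1 h2] := n1P x; exists (n1 x) => //; rewrite inE h2 eqxx /=.
    by apply/eqP => h; case: xw; rewrite -h1 h.
  - move=> e; rewrite inE => /andP[/eqP h1 h2] [h3]; move: h2; apply/negP; rewrite negbK.
    by rewrite -(n1_uniq h1) h3 n1_t1.
  - move=> l; have [e e1 e2] := exs l k0; exists e => //; rewrite inE e2 eqxx /=.
    by apply/eqP => /(proj2 (sd _ _)); rewrite e1.
  - move=> i; rewrite inE (inj_eq d_inj); case: (eqVneq i (o6 0)) => [->|i0]; first by rewrite eqxx.
    case: (eqVneq i (o6 1)) => [->|i1]; first by rewrite andbF.
    apply/negbTE; rewrite andbT; apply: c0N.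
    by case: i i0 i1 => [[|[|i]] lti].
  - move=> x; rewrite mem_seq1 => x1; have [h1 h2] := n1P x; rewrite inE h2 eqxx.
    by apply: contra x1 => /eqP h; rewrite -h1 h eqxx.
rewrite rcons_path -rcons_cons rcons_uniq last_rcons => /andP[pth st] /andP[yp up].
have [N [[Nt Ns Nex Nw Nl] Nd Nn]] := IH pth up.
set w := last t1 p in st Nex Nw.
have /existsP[e /and4P[/eqP te /eqP ce /eqP se]] := st.
case E1: (s e) => [l|//] _.
have eN : e \notin N by apply/negP => /Nw; rewrite te.
have nN := Nn _ yp; have [tn cn] := n1P y.
have neq : n1 y != e by apply: contraNneq eN => <-.
have wy : y <> w by move=> h; move: yp; rewrite h mem_last.
have mem z : z \in e |: (N :\ n1 y) -> z = e \/ [/\ z \in N, z != n1 y & z != e].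
  rewrite !inE => /orP[/eqP|/andP[h1 h2]]; [by left | right; split=> //].
  by apply: contraNneq eN => <-.
exists (e |: (N :\ n1 y)); split; first split.
- move=> z z' /mem[->|[h1 h2 h3]] /mem[->|[h4 h5 h6]] // tt; last exact: Nt.
    by case: (Nw _ h4); rewrite -tt te.
  by case: (Nw _ h1); rewrite tt te.
- move=> z z' /mem[->|[h1 h2 h3]] /mem[->|[h4 h5 h6]] // tt; last exact: Ns.
    by move: h5; rewrite (Ns z' (n1 y)) ?eqxx // -tt.
  by move: h2; rewrite (Ns z (n1 y)) ?eqxx // tt.
- move=> x xy; case: (eqVneq x w) => [->|xw]; first by exists e; rewrite ?inE ?eqxx.
  have [|z zN tz] := Nex x; first by case=> /eqP; apply/negP.
  exists z => //; rewrite !inE zN andbT; apply/orP; right.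
  by apply/eqP => h; case: xy; rewrite -tz h tn.
- move=> z /mem[->|[h1 h2 h3]]; first by rewrite te => -[h]; case: wy.
  by move=> [h]; move: h2; rewrite (Nt z (n1 y)) ?eqxx // tn.
- move=> l'; have [z zN sz] := Nl l'; case: (eqVneq z (n1 y)) => [h|zn].
    by exists e; [rewrite !inE eqxx | rewrite se -h].
  by exists z => //; rewrite !inE zn zN orbT.
- move=> i; rewrite !inE -Nd; have si : s (d i) = inr i by apply/sd.
  have /negbTE-> : d i != e by apply/eqP => h; move: E1; rewrite -h si.
  by have /negbTE-> : d i != n1 y by apply/eqP => h; move: E1; rewrite se -h si.
move=> x; rewrite mem_rcons inE negb_or => /andP[xy xp]; rewrite !inE (Nn _ xp) andbT.
by apply/orP; right; apply/eqP => h; move: xy; rewrite -tn -h (proj1 (n1P x)) eqxx.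
Qed.

(** If the gap can be moved from [t1] to [t3], the pendant edge at [t3] fills it and gives a
    transversal containing exactly the pendant edges 0 and 3. Otherwise the nodes that cannot be
    reached form the required cut. *)
Theorem recolour_or_cut :
  (exists2 c', proper3 c' & [/\ c' (d (o6 0)) = c' (d (o6 3)),
     forall i : 'I_6, i != o6 0 -> i != o6 3 -> c' (d i) != c' (d (o6 0)),
     c' (d (o6 1)) != c' (d (o6 5)) & c' (d (o6 2)) != c' (d (o6 4))]) \/
  exists QT QL, [/\ closedQ QT QL, t0 \in QT, t3 \in QT & #|outQ QT QL| = 3].
Proof.
have [ht hs [ext exs]] := pc.
case: (boolP (connect step t1 t3)) => [/connectP[p0 pth0 lst0]|nc].
  left; move: lst0; case/shortenP: pth0 => p pth up _ lst0.
  have [N [[Nt Ns Nex Nw Nl] Nd Nn]] := alternating_path pth up.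
  have t3l : t3 = last t1 p by rewrite lst0.
  have dN : d (o6 3) \notin N by rewrite Nd.
  apply: (transversal_recolour (N := d (o6 3) |: N)); last by move=> i; rewrite !inE Nd (inj_eq d_inj) orbC.
  have sN z : z \in N -> s z <> s (d (o6 3)).
    rewrite (proj2 (sd (d (o6 3)) (o6 3))) // => zN /sd h; by rewrite -h zN in dN.
  split=> //.
  - move=> z z'; rewrite !inE => /orP[/eqP->|h1] /orP[/eqP->|h2] // tt; last exact: Nt.
      by case: (Nw _ h2); rewrite -tt -t3l.
    by case: (Nw _ h1); rewrite tt -t3l.
  - move=> z z'; rewrite !inE => /orP[/eqP->|h1] /orP[/eqP->|h2] // tt; last exact: Ns.
      by case: (sN _ h2).
    by case: (sN _ h1).
  - move=> x _; case: (eqVneq x t3) => [->|x3]; first by exists (d (o6 3)); rewrite // !inE eqxx.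
    have [|z zN tz] := Nex x; first by rewrite -t3l => -[/eqP]; apply/negP.
    by exists z; rewrite // !inE zN orbT.
  - by move=> l; have [z zN sz] := Nl l; exists z; rewrite // !inE zN orbT.
(* [RL] is the set of all [L]-neighbours of [R], reached by [k0]-edges from the nodes of [R] other
   than [t1]; hence it is smaller by one. As [T] exceeds [L] by two, the complements again differ by
   one, and the cut has size three. The node [t0] is not reached because its [k0]-edge is
   pendant. *)
right; pose R := [set x | connect step t1 x].
pose RL := [set l | [exists x in R, (x != t1) && (s (n1 x) == inl l)]].
have t1R : t1 \in R by rewrite inE connect0.
have t01 : t0 != t1.
  by apply/eqP => h; have := n1_t0; rewrite h n1_t1 => /d_inj.
have t0R : t0 \notin R.
  rewrite inE; apply/negP => /connectP[p]; elim/last_ind: p => [_ /= h|p y _].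
    by rewrite h eqxx in t01.
  rewrite rcons_path last_rcons => /andP[_ st] h; move: st; rewrite -h.
  case/existsP=> e /and4P[_ _ /eqP -> ]; rewrite n1_t0 (proj2 (sd (d (o6 0)) (o6 0))) //.
have cl e l : s e = inl l -> t e \in R -> l \in RL.
  move=> se teR; rewrite inE; apply/existsP.
  have n1l z : s z = inl l -> t z == t1 -> c z = k0 -> False.
    move=> sz /eqP tz cz; have := n1_uniq cz; rewrite tz n1_t1 => h.
    by move: sz; rewrite -h (proj2 (sd (d (o6 1)) (o6 1))).
  case: (eqVneq (c e) k0) => ce.
    exists (t e); rewrite teR (n1_uniq ce) se eqxx andbT.
    by apply/negP => h; apply: (n1l e).
  have [z sz cz] := exs l k0; exists (t z); rewrite (n1_uniq cz) sz eqxx andbT.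
  apply/andP; split; last by apply/negP => h; apply: (n1l z).
  rewrite inE; move: teR; rewrite inE => teR; apply: connect_trans teR (connect1 _).
  by apply/existsP; exists e; rewrite eqxx ce (n1_uniq cz) se sz eqxx.
have clQ : closedQ (~: R) (~: RL).
  by move=> e l se; rewrite !in_setC; apply: contra => /(cl _ _ se).
exists (~: R), (~: RL); split=> //; rewrite ?inE //; first by rewrite inE in t0R.
have cRL : #|RL| = #|R :\ t1|.
  have [l0 l0P|noL] := pickP L; last first.
    rewrite !eq_card0 // => x; last by have := noL x.
    rewrite !inE; apply/negP=> /andP[x1 xR].
    have [|l] := n1_inl (x := x) _ x1; last by have := noL l.
    by apply: contraNneq t0R => <-; rewrite inE.
  pose f x := if s (n1 x) is inl l then l else l0.
  have fP x : x \in R :\ t1 -> s (n1 x) = inl (f x).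
    rewrite in_setD1 => /andP[x1 xR]; have [|l e1] := n1_inl (x := x) _ x1.
      by apply: contraNneq t0R => <-.
    by rewrite /f e1.
  rewrite -(card_in_imset (f := f) (D := mem (R :\ t1))).
    apply: eq_card => l; rewrite inE; apply/existsP/imsetP.
      case=> x /and3P[xR x1 /eqP sx]; exists x; first by rewrite in_setD1 x1.
      by rewrite /f sx.
    case=> x xR e1; exists x; have fx := fP _ xR; move: fx xR; rewrite -e1 in_setD1 => -> /andP[-> ->].
    by rewrite eqxx.
  move=> x y xR yR e1; have := fP _ xR; rewrite e1 -(fP _ yR) => h.
  have [h1 h2] := n1P x; have [h3 h4] := n1P y.
  by rewrite -h1 -h3; congr t; apply: hs => //; rewrite h2 h4.
have cTL : #|T| = #|L| + 2.
  have cl0 : closedQ setT setT by move=> *; rewrite inE.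
  have := card_outQ cl0; rewrite (_ : outQ _ _ = d @: setT).
    by rewrite card_imset ?cardsT ?card_ord; [lia | exact: d_inj].
  apply/setP=> e; rewrite !inE; apply/idP/imsetP => [|[i _ ->]].
    by case E1: (s e) => [l|i]; rewrite ?inE // => _; exists i => //; apply/sd.
  by rewrite (proj2 (sd (d i) i)).
have := card_outQ clQ.
have := cardsC R; have := cardsC RL; have := cardsD1 t1 R; rewrite t1R -cRL cTL.
have aux (r rl rc rlc l o : nat) : r = true + rl -> rl + rlc = l -> r + rc = l + 2 ->
  o + 3 * rlc = 3 * rc -> o = 3 by lia.
exact: aux.
Qed.
End Incidence.

(** * The hexagonal core *)

Definition nx (i : 'I_6) : 'I_6 := inord ((i + 1) %% 6).
Definition pv (i : 'I_6) : 'I_6 := inord ((i + 5) %% 6).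
Lemma val_nx i : nx i = (i + 1) %% 6 :> nat. Proof. by rewrite inordK // ltn_mod. Qed.
Lemma val_pv i : pv i = (i + 5) %% 6 :> nat. Proof. by rewrite inordK // ltn_mod. Qed.
Lemma nxK : cancel nx pv.
Proof. by move=> i; apply: val_inj; rewrite /= val_pv val_nx; case: i => [[|[|[|[|[|[|i]]]]]] lti]. Qed.
Lemma pvK : cancel pv nx.
Proof. by move=> i; apply: val_inj; rewrite /= val_nx val_pv; case: i => [[|[|[|[|[|[|i]]]]]] lti]. Qed.

Lemma six_ind (P : 'I_6 -> Prop) :
  P (o6 0) -> P (o6 1) -> P (o6 2) -> P (o6 3) -> P (o6 4) -> P (o6 5) -> forall i, P i.
Proof.
move=> p0 p1 p2 p3 p4 p5 [[|[|[|[|[|[|i]]]]]] lti] //;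
by rewrite (bool_irrelevance lti isT).
Qed.
Lemma nx0 : nx (o6 0) = o6 1. Proof. by apply: val_inj; rewrite /= val_nx. Qed.
Lemma nx1 : nx (o6 1) = o6 2. Proof. by apply: val_inj; rewrite /= val_nx. Qed.
Lemma nx2 : nx (o6 2) = o6 3. Proof. by apply: val_inj; rewrite /= val_nx. Qed.
Lemma nx3 : nx (o6 3) = o6 4. Proof. by apply: val_inj; rewrite /= val_nx. Qed.
Lemma nx4 : nx (o6 4) = o6 5. Proof. by apply: val_inj; rewrite /= val_nx. Qed.
Lemma nx5 : nx (o6 5) = o6 0. Proof. by apply: val_inj; rewrite /= val_nx. Qed.
Definition nxE := (nx0, nx1, nx2, nx3, nx4, nx5).

Fixpoint words n : seq (seq nat) :=
  if n is n'.+1 then [seq x :: w | x <- [:: 0; 1; 2], w <- words n'] else [:: [::]].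
Definition hexok (a h : seq nat) : bool :=
  all (fun i => let j := (i + 1) %% 6 in
    [&& nth 0 h i != nth 0 h j, nth 0 a i != nth 0 h i & nth 0 a j != nth 0 h i]) (iota 0 6).
Definition word_of (a : 'I_6 -> 'I_3) : seq nat :=
  [:: val (a (o6 0)); val (a (o6 1)); val (a (o6 2)); val (a (o6 3)); val (a (o6 4)); val (a (o6 5))].
(** [a i] is the colour of the edge attached to the hexagon at vertex [i], and [h i] the colour to
    be given to the hexagon edge from [i] to [nx i]. *)
Definition hexext (a : 'I_6 -> 'I_3) := exists h : 'I_6 -> 'I_3,
  forall i, [/\ h i != h (nx i), a i != h i & a (nx i) != h i].

Lemma word_of_words a : word_of a \in words 6.
Proof.
have w3 (x : 'I_3) (w : seq nat) n : w \in words n -> (x : nat) :: w \in words n.+1.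
  move=> wn; have x3 : (x : nat) \in [:: 0; 1; 2] by case: x => [[|[|[|x]]] ltx].
  by apply/allpairsPdep; exists (x : nat), w.
by rewrite /word_of; do 6 apply: (w3 _ _ _).
Qed.

(** Each of the [3 ^ 6] boundary words is tested against all colourings of the hexagon by
    computation. *)
Lemma hexext_words (P : seq nat -> bool) a :
  all (fun w => if P w then has (hexok w) (words 6) else true) (words 6) ->
  P (word_of a) -> hexext a.
Proof.
move=> /allP /(_ _ (word_of_words a)) + Pa; rewrite Pa => /hasP[w ww ok].
have w3 n v k : v \in words n -> nth 0 v k < 3.
  elim: n v k => [|n IH] v k; first by rewrite inE => /eqP->; case: k.
  case/allpairsPdep=> x [u [x3 un ->]]; case: k => [|k] /=; last exact: IH.
  by move: x3; rewrite !inE => /or3P[] /eqP->.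
exists (fun i => Ordinal (w3 _ _ i ww)) => i; rewrite -!val_eqE /= val_nx.
have na (j : 'I_6) : nth 0 (word_of a) j = a j.
  by move: j; apply: six_ind.
have /allP /(_ i) := ok; rewrite mem_iota /= => /(_ (ltn_ord i)) /and3P[h1 h2 h3].
rewrite h1 -!na h2 /= val_nx; split=> //.
Qed.

(** This is the boundary left by a 3-array with three uncovered edges. In a graph without a
    3-edge-colouring, the three equal pairs must thus have three different colours. *)
Lemma hexext_two_equal (a : 'I_6 -> 'I_3) :
  a (o6 0) = a (o6 1) -> a (o6 2) = a (o6 3) -> a (o6 4) = a (o6 5) ->
  ~~ [&& a (o6 0) != a (o6 2), a (o6 0) != a (o6 4) & a (o6 2) != a (o6 4)] -> hexext a.
Proof.
move=> e1 e2 e3 h.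
apply: (@hexext_words (fun w => if w is [:: x; x'; y; y'; z; z'] then
  [&& x == x', y == y', z == z' & ~~ [&& x != y, x != z & y != z]] else false)).
  by vm_compute.
by rewrite /= !val_eqE e1 e2 e3 !eqxx /= -e1 -e2 -e3.
Qed.

(** This is the boundary obtained after recolouring along an alternating path. *)
Lemma hexext_opposite (a : 'I_6 -> 'I_3) :
  a (o6 0) = a (o6 3) -> (forall i, i != o6 0 -> i != o6 3 -> a i != a (o6 0)) ->
  a (o6 1) != a (o6 5) -> a (o6 2) != a (o6 4) -> hexext a.
Proof.
move=> e1 e2 e3 e4.
apply: (@hexext_words (fun w => if w is [:: x0; x1; x2; x3; x4; x5] then
  [&& x0 == x3, x1 != x0, x2 != x0, x4 != x0, x5 != x0, x1 != x5 & x2 != x4] else false)).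
  by vm_compute.
by rewrite /= !val_eqE e3 e4 -e1 eqxx !e2.
Qed.

Section Hexagon.
Variable G : mgraph.
Implicit Types (e : gE G) (v : gV G) (x : dart G).

(** The third dart [hd i] may still belong to a chord. That the hexagon is induced is not recorded
    here; it comes from the count in the barrier lemma. *)
Record hexframe (hv : 'I_6 -> gV G) (he : 'I_6 -> gE G) (hd : 'I_6 -> dart G) : Prop := HexFrame {
  hv_inj : injective hv;
  he_inj : injective he;
  he_ends : forall i, exists b, dend (G := G) (he i, b) = hv i /\ dother (G := G) (he i, b) = hv (nx i);
  hd_end : forall i, dend (hd i) = hv i;
  hd_he : forall i j, (hd i).1 != he j;
  hd_all : forall x i, dend x = hv i -> [\/ x = hd i, x.1 = he i | x.1 = he (pv i)] }.

Definition proper_off (hv : 'I_6 -> gV G) (c : gE G -> 'I_3) :=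
  forall x x', dend x = dend x' -> (forall i, dend x != hv i) -> c x.1 = c x'.1 -> x = x'.

Lemma colour_hexagon hv he hd c : cubic G -> bridgeless G -> hexframe hv he hd -> proper_off hv c ->
  hexext (fun i => c (hd i).1) -> colourable3 G.
Proof.
move=> cG bG [hvI heI hen hde hdh hda] pc [h hP].
pose c' e := if [pick i | he i == e] is Some i then h i else c e.
have c'h i : c' (he i) = h i.
  rewrite /c'; case: pickP => [j /eqP/heI-> //|/(_ i)]; by rewrite eqxx.
have c'n e : (forall i, e != he i) -> c' e = c e.
  by move=> ne; rewrite /c'; case: pickP => // j /eqP h'; have := ne j; rewrite h' eqxx.
exists c' => v i.
suff inj x x' : dend x = v -> dend x' = v -> c' x.1 = c' x'.1 -> x = x'.
  rewrite leqNgt; apply/negP => /card_gt1P[x [x' []]]; rewrite !inE.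
  move=> /andP[/eqP h1 /eqP h2] /andP[/eqP h3 /eqP h4]; apply/negP; rewrite negbK.
  by apply/eqP/inj => //; rewrite h2 h4.
move=> vx vx'.
case: (pickP (fun i => v == hv i)) => [j /eqP vj|nv]; last first.
  have nhe y : dend y = v -> forall k, y.1 != he k.
    move=> yv k; apply/eqP => ek; have [b [h1 h2]] := hen k.
    have eq1 : (he k, b).1 = y.1 by rewrite ek.
    case: (dart_eq_edge eq1) => e2; first by move: (nv k); rewrite -yv e2 h1 eqxx.
    by move: (nv (nx k)); rewrite -yv e2 dend_flip h2 eqxx.
  rewrite !c'n; [|exact: nhe..]; apply: pc; rewrite ?vx ?vx' // => k.
  by have := nv k => /negbT.
have same y y' : dend y = v -> dend y' = v -> y.1 = y'.1 -> y = y'.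
  move=> yv yv' /dart_eq_edge[-> //|e2]; have := no_loop y cG bG.
  by rewrite yv -dend_flip -e2 yv' eqxx.
have [P1 P2 P3] := hP j; have [Q1 Q2 Q3] := hP (pv j); rewrite pvK in Q1 Q3.
have ch : c' (hd j).1 = c (hd j).1 by apply: c'n => k; apply: hdh.
have co y : dend y = v -> [\/ y = hd j, y.1 = he j | y.1 = he (pv j)].
  by move=> yv; apply: hda; rewrite yv.
case: (co _ vx) => e1; case: (co _ vx') => e2; rewrite ?e1 ?e2 ?c'h ?ch // => /eqP;
  rewrite ?(negbTE P2) ?(negbTE Q1) ?(negbTE Q3) 1?eq_sym ?(negbTE P2) ?(negbTE Q1) ?(negbTE Q3) // => _;
  apply: same => //; by rewrite e1 e2.
Qed.

End Hexagon.

(** The two involutions generate alternating cycles of even length. Length two is excluded since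
    they never agree, so six points cannot split as four plus two. *)
Lemma alternating_hexagon (V : finType) (D : {set V}) (a b : V -> V) v0 :
  #|D| = 6 -> v0 \in D ->
  (forall x, x \in D -> [/\ a x \in D, b x \in D, a (a x) = x & b (b x) = x]) ->
  (forall x, x \in D -> [/\ a x != x, b x != x & a x != b x]) ->
  exists f : 'I_6 -> V, [/\ injective f, forall i, f i \in D &
    forall i, f (nx i) = if odd i then a (f i) else b (f i)].
Proof.
move=> cD v0D st ne.
pose v1 := b v0; pose v2 := a v1; pose v3 := b v2; pose v4 := a v3; pose v5 := b v4.
have [_ v1D _ b0] := st _ v0D; rewrite -/v1 in v1D b0.
have [v2D _ a1 _] := st _ v1D; rewrite -/v2 in v2D a1.
have [_ v3D _ b2] := st _ v2D; rewrite -/v3 in v3D b2.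
have [v4D _ a3 _] := st _ v3D; rewrite -/v4 in v4D a3.
have [_ v5D _ b4] := st _ v4D; rewrite -/v5 in v5D b4.
have N0 := ne _ v0D; have N1 := ne _ v1D; have N2 := ne _ v2D.
have N3 := ne _ v3D; have N4 := ne _ v4D; have N5 := ne _ v5D.
have n10 : v1 != v0 by case: N0.
have n21 : v2 != v1 by case: N1.
have n20 : v2 != v0 by case: N1 => _ _; rewrite b0.
have n32 : v3 != v2 by case: N2.
have n31 : v3 != v1 by case: N2 => _ _; rewrite a1 eq_sym.
have n30 : v3 != v0 by apply/eqP => h; move: n21; rewrite -b2 h -/v1 eqxx.
have n43 : v4 != v3 by case: N3.
have n42 : v4 != v2 by case: N3 => _ _; rewrite b2.
have n41 : v4 != v1 by apply/eqP => h; move: n32; rewrite -a3 h -/v2 eqxx.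
(* If the cycle closed after four points, the two remaining points would be exchanged by both [a]
   and [b]. *)
have n40 : v4 != v0.
  apply/eqP => h; have a0 : a v0 = v3 by rewrite -h a3.
  pose F := [set v3; v2; v1; v0].
  have cF : #|F| = 4.
    by rewrite /F -!setUA !cardsU1 !inE cards1
      (negbTE n10) (negbTE n20) (negbTE n30) (negbTE n21) (negbTE n31) (negbTE n32).
  have FD : F \subset D by apply/subsetP => x; rewrite !inE => /orP[/orP[/orP[]|]|] /eqP->.
  have cDF : #|D :\: F| = 2 by rewrite cardsD (setIidPr FD) cD cF.
  have /card_gt0P[p pDF] : 0 < #|D :\: F| by rewrite cDF.
  have aF x : x \in F -> a x \in F /\ b x \in F.
    rewrite !inE => /orP[/orP[/orP[]|]|] /eqP->; rewrite ?a0 ?a1 ?b0 ?b2 -/v1 -/v2 -/v3 -/v4 ?h;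
      by rewrite !eqxx ?orbT.
  have out x : x \in D :\: F -> a x \in D :\: F /\ b x \in D :\: F.
    rewrite in_setD => /andP[xF xD]; have [h1 h2 h3 h4] := st _ xD.
    rewrite !in_setD h1 h2 !andbT; split; apply: contra xF => /aF[]; by rewrite ?h3 ?h4.
  have [apF bpF] := out _ pDF.
  have /cards1P[q hq] : #|(D :\: F) :\ p| == 1.
    by move: cDF; rewrite (cardsD1 p) pDF add1n => -[->].
  have pD : p \in D by move: pDF; rewrite in_setD => /andP[].
  have [m1 m2 m3] := ne _ pD.
  have : a p \in (D :\: F) :\ p by rewrite in_setD1 m1.
  have : b p \in (D :\: F) :\ p by rewrite in_setD1 m2.
  by rewrite hq !inE => /eqP h1 /eqP h2; rewrite h1 h2 eqxx in m3.
have n54 : v5 != v4 by case: N4.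
have n53 : v5 != v3 by case: N4 => _ _; rewrite a3 eq_sym.
have n52 : v5 != v2 by apply/eqP => h; move: n43; rewrite -b4 h -/v3 eqxx.
have n51 : v5 != v1 by apply/eqP => h; move: n40; rewrite -b4 h b0 eqxx.
have n50 : v5 != v0 by apply/eqP => h; move: n41; rewrite -b4 h -/v1 eqxx.
have us : uniq [:: v0; v1; v2; v3; v4; v5].
  by rewrite -rev_uniq /rev /= !inE !negb_or
   n10 n20 n21 n30 n31 n32 n40 n41 n42 n43 n50 n51 n52 n53 n54.
have sD : {subset [:: v0; v1; v2; v3; v4; v5] <= D}.
  by move=> x; rewrite !inE => /orP[|/orP[|/orP[|/orP[|/orP[|]]]]] /eqP->.
have a5 : a v5 = v0.
  have [aD _ aa _] := st _ v5D; have [m1 _ m3] := N5.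
  have : a v5 \in [:: v0; v1; v2; v3; v4; v5].
    have e6 : #|[:: v0; v1; v2; v3; v4; v5]| = #|D| by rewrite cD; apply/card_uniqP.
    have := subset_cardP e6; rewrite (introT subsetP sD) => /(_ isT) ->; exact: aD.
  rewrite !inE (negbTE m1) orbF => /orP[/eqP //|/orP[|/orP[|/orP[|]]]] /eqP h; exfalso.
  - by move: n52; rewrite -aa h -/v2 eqxx.
  - by move: n51; rewrite -aa h a1 eqxx.
  - by move: n54; rewrite -aa h -/v4 eqxx.
  - by move: n53; rewrite -aa h a3 eqxx.
pose f (i : 'I_6) := nth v0 [:: v0; v1; v2; v3; v4; v5] i.
exists f; split.
- by move=> i j /eqP; rewrite nth_uniq // => /eqP/val_inj.
- by move=> i; apply: sD; apply: mem_nth.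
by apply: six_ind; rewrite ?nxE /f /= ?a5.
Qed.

Section Defect.
Variable G : mgraph.
Hypotheses (tG : twoconn G) (cG : cubic G).
Let bG : bridgeless G := proj2 tG.
Implicit Types (e : gE G) (v : gV G) (x : dart G).

Lemma colourable_df0 : colourable3 G -> exists A : array3 G, is_array3 A /\ #|uncovered A| = 0.
Proof.
case=> c hc; pose M k := [set e | c e == k].
have uni v k : #|[set d : dart G | (dend d == v) && (c d.1 == k)]| = 1.
  have tot : \sum_k #|[set d : dart G | (dend d == v) && (c d.1 == k)]| = 3.
    rewrite -[RHS](cG v) /deg -sum1_card (partition_big (fun d : dart G => c d.1) xpredT) //=.
    by apply: eq_bigr => i _; rewrite -sum1_card; apply: eq_bigl => d; rewrite !inE.
  apply/eqP; rewrite eqn_leq hc /= lt0n; apply/negP => /eqP h0.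
  move: tot; rewrite (bigD1 k) //= h0 add0n => tot.
  have : \sum_(i < 3 | i != k) #|[set d : dart G | (dend d == v) && (c d.1 == i)]| <= \sum_(i < 3 | i != k) 1.
    by apply: leq_sum => i _; apply: hc.
  by rewrite tot sum1_card cardC1 card_ord.
have pM k : perfect_matching (M k).
  by move=> v; rewrite -(uni v k); apply: eq_card => d; rewrite !inE.
exists (M (o3 0), M (o3 1), M (o3 2)); split; first by split; apply: (pM _).
apply: eq_card0 => e; rewrite !inE /cover_count !inE /=.
by case: (c e) => [[|[|[|n]]] ltn].
Qed.

Lemma darts3 v x y z : dend x = v -> dend y = v -> dend z = v -> x != y -> x != z -> y != z ->
  forall w, dend w = v -> [\/ w = x, w = y | w = z].
Proof.
move=> hx hy hz xy xz yz w hw.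
have sub : [set x; y; z] \subset [set d : dart G | dend d == v].
  by apply/subsetP => d; rewrite !inE => /orP[/orP[]|] /eqP->; rewrite ?hx ?hy ?hz.
have c3 : #|[set x; y; z]| = 3.
  by rewrite -setUA !cardsU1 !inE cards1 (negbTE xy) (negbTE xz) (negbTE yz).
have /eqP eqS : [set x; y; z] == [set d : dart G | dend d == v].
  by rewrite eqEcard sub c3; have := cG v; rewrite /deg => ->.
have : w \in [set x; y; z] by rewrite eqS inE hw.
by rewrite !inE => /orP[/orP[]|] /eqP; [constructor 1|constructor 2|constructor 3].
Qed.

Lemma same_edge_dart x y : dend x = dend y -> x.1 = y.1 -> x = y.
Proof.
move=> h /dart_eq_edge[-> //|e]; have := no_loop x cG bG.
by rewrite h e dend_flip eqxx.
Qed.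

Lemma three_darts v : exists x y z,
  [/\ dend x = v, dend y = v & dend z = v] /\ [/\ x.1 != y.1, x.1 != z.1 & y.1 != z.1].
Proof.
have := cG v; rewrite /deg => h.
have /card_gt0P[x xv] : 0 < #|[set d : dart G | dend d == v]| by rewrite h.
move: h; rewrite (cardsD1 x) xv add1n => -[h].
have /card_gt0P[y yv] : 0 < #|[set d : dart G | dend d == v] :\ x| by rewrite h.
move: h; rewrite (cardsD1 y) yv add1n => -[h].
have /card_gt0P[z zv] : 0 < #|[set d : dart G | dend d == v] :\ x :\ y| by rewrite h.
move: xv yv zv; rewrite !inE => /eqP hx /andP[yx /eqP hy] /and3P[zy zx /eqP hz].
exists x, y, z; split=> //.
split; [apply: contra yx|apply: contra zx|apply: contra zy] => /eqP eq1.
- by rewrite (@same_edge_dart x y) ?hx ?hy.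
- by rewrite (@same_edge_dart x z) ?hx ?hz.
- by rewrite (@same_edge_dart y z) ?hy ?hz.
Qed.

Definition amem (A : array3 G) (k : 'I_3) : {set gE G} :=
  match val k with 0 => A.1.1 | 1 => A.1.2 | _ => A.2 end.

Lemma cover_countE (A : array3 G) e : cover_count A e = \sum_(k < 3) (e \in amem A k).
Proof. by rewrite /cover_count !big_ord_recl big_ord0 addn0 addnA. Qed.

Lemma is_arrayP (A : array3 G) : is_array3 A <-> forall k, perfect_matching (amem A k).
Proof.
split=> [[h1 h2 h3] [[|[|[|k]]] ltk] // | h].
by split; [exact: (h (o3 0)) | exact: (h (o3 1)) | exact: (h (o3 2))].
Qed.

Lemma pm_dart (M : {set gE G}) v : perfect_matching M ->
  exists2 x, dend x = v /\ x.1 \in M & forall y, dend y = v -> y.1 \in M -> y = x.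
Proof.
move=> /(_ v) /eqP/cards1P[x hx]; exists x.
  by have := set11 x; rewrite -hx inE => /andP[/eqP].
by move=> y yv yM; apply/eqP; rewrite -in_set1 -hx inE yv eqxx.
Qed.

Lemma cover_sum_vertex (A : array3 G) v : is_array3 A ->
  \sum_(x : dart G | dend x == v) cover_count A x.1 = 3.
Proof.
move=> /is_arrayP pA; under eq_bigr => x _ do rewrite cover_countE.
rewrite exchange_big /= (eq_bigr (fun=> 1)) ?sum1_card ?card_ord // => k _.
rewrite -(pA k v) -sum1_card big_mkcond [in RHS]big_mkcond /=; apply: eq_bigr => x _.
by rewrite inE; case: (dend x == v); case: (x.1 \in _).
Qed.

Lemma sum_darts (F : gE G -> nat) : \sum_(x : dart G) F x.1 = 2 * \sum_e F e.
Proof.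
rewrite (partition_big (fun x : dart G => x.1) xpredT) //= big_distrr /=.
apply: eq_bigr => e _; rewrite (eq_bigr (fun=> F e)) => [|x /eqP-> //].
rewrite sum_nat_const; congr (_ * _).
have <- : #|[set (e, b) | b : bool]| = 2 by rewrite card_imset ?card_bool // => b b' [].
by apply: eq_card => -[e' b]; apply/eqP/imsetP => /= [->|[b' _ [->]]] //; exists b.
Qed.

Lemma card_edges : 2 * #|gE G| = 3 * #|gV G|.
Proof.
have := sum_darts (fun=> 1); rewrite !sum1_card => <-.
rewrite -cardsT -(card_darts_cubic [set: gV G] cG); apply: eq_card => x; by rewrite !inE.
Qed.

End Defect.

Section Defect3.
Variable G : mgraph.
Hypotheses (tG : twoconn G) (cG : cubic G).
Let bG : bridgeless G := proj2 tG.
Implicit Types (e : gE G) (v : gV G) (x y z : dart G).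

Lemma pm_intro (M : {set gE G}) :
  (forall v, exists2 x, dend x = v /\ x.1 \in M & forall y, dend y = v -> y.1 \in M -> y = x) ->
  perfect_matching M.
Proof.
move=> h v; have [x [xv xM] ux] := h v; apply/eqP/cards1P; exists x; apply/setP => y.
rewrite !inE; apply/andP/eqP => [[/eqP h1 h2]|->]; first exact: ux.
by rewrite xv eqxx.
Qed.

Lemma darts_others x : exists y z, [/\ dend y = dend x, dend z = dend x,
  [/\ x.1 != y.1, x.1 != z.1 & y.1 != z.1], forall w, dend w = dend x -> [\/ w = x, w = y | w = z] &
  forall A : array3 G, is_array3 A -> cover_count A x.1 + cover_count A y.1 + cover_count A z.1 = 3].
Proof.
have [p [q [r [[hp hq hr] [pq pr qr]]]]] := three_darts tG cG (dend x).
have ned (a b : dart G) : a.1 != b.1 -> a != b by apply: contra => /eqP->.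
have D3 := darts3 cG hp hq hr (ned _ _ pq) (ned _ _ pr) (ned _ _ qr).
have sum A : is_array3 A -> cover_count A p.1 + cover_count A q.1 + cover_count A r.1 = 3.
  move=> hA; apply: etrans (cover_sum_vertex (dend x) hA).
  rewrite (bigD1 p) ?hp //= (bigD1 q) /=; last by rewrite hq eqxx eq_sym ned.
  rewrite (bigD1 r) /=; last by rewrite hr eqxx (eq_sym r p) (eq_sym r q) !ned.
  rewrite big1 ?addn0 ?addnA // => i /andP[/andP[/andP[/eqP iv ip] iq] ir].
  by case: (D3 _ iv) => h; rewrite h eqxx in ip iq ir.
case: (D3 x erefl) => h; subst x.
- exists q, r; split=> //.
- exists p, r; split=> //; first by split=> //; rewrite eq_sym.
    by move=> w /D3[]; [constructor 2|constructor 1|constructor 3].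
  by move=> A /sum; rewrite (addnC (cover_count A q.1)).
- exists p, q; split=> //; first by split=> //; rewrite eq_sym.
    by move=> w /D3[]; [constructor 2|constructor 3|constructor 1].
  by move=> A /sum <-; rewrite -addnA addnC.
Qed.

Lemma cover_count_gt0 (A : array3 G) e : 0 < cover_count A e -> exists k, e \in amem A k.
Proof.
rewrite cover_countE lt0n sum_nat_eq0 negb_forall => /existsP[k]; rewrite eqb0 negbK.
by exists k.
Qed.

Lemma cover_count_mem (A : array3 G) e k : e \in amem A k -> 0 < cover_count A e.
Proof. by move=> h; rewrite cover_countE (bigD1 k) //= h. Qed.

Lemma cover_count_mem2 (A : array3 G) e k k' : k != k' -> e \in amem A k -> e \in amem A k' ->
  1 < cover_count A e.
Proof.
by move=> kk h h'; rewrite cover_countE (bigD1 k) //= h (bigD1 k') 1?eq_sym //= h' addnA.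
Qed.

Variable A : array3 G.
Hypothesis hA : is_array3 A.
Hypothesis unc3 : #|uncovered A| = 3.
Hypothesis minA : forall B : array3 G, is_array3 B -> 3 <= #|uncovered B|.
Notation cc := (cover_count A).

(** In one of the matchings containing the edge of [y], replace it by the parallel uncovered edge of
    [x]. The edge of [y] stays covered by another matching, so fewer edges are uncovered, against
    minimality. *)
Lemma no_parallel x y : dend x = dend y -> dother x = dother y -> cc x.1 = 0 -> 1 < cc y.1 -> False.
Proof.
move=> e1 e2 cx cy; have [k yk] : exists k, y.1 \in amem A k.
  by apply: cover_count_gt0; apply: leq_trans cy.
pose M j := if j == k then x.1 |: (amem A k :\ y.1) else amem A j.
pose B : array3 G := (M (o3 0), M (o3 1), M (o3 2)).
have BM j : amem B j = M j.
  by case: j => [[|[|[|j]]] ltj] //; congr M; apply: val_inj.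
have /is_arrayP pA := hA.
have xA j : x.1 \notin amem A j.
  by apply/negP => /cover_count_mem; rewrite cx.
have xy : x.1 != y.1 by apply: contraNneq (xA k) => ->.
have hB : is_array3 B.
  apply/is_arrayP => j; rewrite BM /M; case: (eqVneq j k) => [_|_]; last exact: pA.
  apply: pm_intro => v; have [z [zv zk] uz] := pm_dart v (pA k).
  case: (eqVneq z.1 y.1) => [ezy|nzy]; last first.
    exists z; first by rewrite !inE nzy zk orbT.
    move=> w wv; rewrite !inE => /orP[/eqP wx|/andP[_]]; last exact: uz.
    have [h|h] := dart_eq_edge (esym wx : x.1 = w.1).
      have zy : y = z by apply: uz; rewrite // -e1 -h.
      by rewrite zy eqxx in nzy.
    have zy : flip y = z by apply: uz; rewrite // dend_flip -e2 -dend_flip -h.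
    by rewrite -zy eqxx in nzy.
  have [x' x'v x'x] : exists2 x', dend x' = v & x'.1 = x.1.
    have [h|h] := dart_eq_edge (esym ezy : y.1 = z.1); first by exists x; rewrite // e1 -h.
    by exists (flip x); rewrite // dend_flip e2 -dend_flip -h.
  exists x'; first by rewrite !inE x'x eqxx.
  move=> w wv; rewrite !inE => /orP[/eqP wx|/andP[wy wk]].
    by apply: (same_edge_dart tG cG); rewrite ?x'v ?x'x.
  by have wz := uz _ wv wk; rewrite wz ezy eqxx in wy.
have := minA hB; rewrite -unc3 leqNgt => /negP; apply.
apply: proper_card; apply/properP; split; last first.
  exists x.1; rewrite !inE ?cx //; rewrite -lt0n.
  by apply: (@cover_count_mem _ _ k); rewrite BM /M eqxx !inE eqxx.
apply/subsetP => e; rewrite !inE -!leqn0 leqNgt => eB; rewrite leqNgt; apply: contra eB => eA.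
case: (eqVneq e y.1) => [->|ey].
  have [j jk yj] : exists2 j, j != k & y.1 \in amem A j.
    move: cy; rewrite cover_countE (bigD1 k) //= yk add1n ltnS lt0n sum_nat_eq0 negb_forall.
    by case/existsP => j; rewrite negb_imply eqb0 negbK => /andP[]; exists j.
  by apply: (@cover_count_mem _ _ j); rewrite BM /M (negbTE jk).
have [j ej] := cover_count_gt0 eA; apply: (@cover_count_mem _ _ j); rewrite BM /M.
by case: eqP => [h|//]; rewrite !inE ey -h ej orbT.
Qed.

(** A triply covered edge leaves the two other edges at each of its ends uncovered. These are four
    distinct edges, since a coincidence would be an edge parallel to it; but only three edges are
    uncovered. *)
Lemma cc_le2 x : cc x.1 <= 2.
Proof.
rewrite leqNgt; apply/negP => c3.
have [y [z [hy hz [xy xz yz] _ /(_ _ hA) s1]]] := darts_others x.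
have [y' [z' [hy' hz' [xy' xz' yz'] _ /(_ _ hA) s2]]] := darts_others (flip x).
have [cy cz] : cc y.1 = 0 /\ cc z.1 = 0 by move: c3 s1; clear; lia.
have [cy' cz'] : cc y'.1 = 0 /\ cc z'.1 = 0 by move: c3 s2; rewrite /=; clear; lia.
have par p q : cc p.1 = 0 -> dend p = dend x -> dend q = dend (flip x) -> p.1 = q.1 -> False.
  move=> cp hp hq epq; have [h|h] := dart_eq_edge epq.
    by have := no_loop x cG bG; rewrite -dend_flip -hq h hp eqxx.
  have e2 : dother p = dother x by rewrite -dend_flip -h.
  by apply: (no_parallel hp e2 cp); apply: leq_trans c3.
have : #|[set y.1; z.1; y'.1; z'.1]| <= #|uncovered A|.
  apply/subset_leq_card/subsetP => e; rewrite !inE -!orbA.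
  by case/or4P => /eqP->; rewrite ?cy ?cz ?cy' ?cz'.
rewrite unc3 -!setUA !cardsU1 !inE cards1 (negbTE yz) (negbTE yz').
have -> : (y.1 == y'.1) = false by apply/eqP; apply: par.
have -> : (y.1 == z'.1) = false by apply/eqP; apply: par.
have -> : (z.1 == y'.1) = false by apply/eqP; apply: par.
by have -> : (z.1 == z'.1) = false by apply/eqP; apply: par.
Qed.

(** The counts at a vertex are at most two and add up to three, so they are 1, 1, 1 or 0, 1, 2. *)
Lemma unc_uniq x y : dend x = dend y -> cc x.1 = 0 -> cc y.1 = 0 -> x = y.
Proof.
move=> h cx cy; have [p [q [hp hq _ al /(_ _ hA) s]]] := darts_others x.
have := cc_le2 p; have := cc_le2 q.
by case: (al y (esym h)) => e //; subst y; move: s; rewrite cx cy; clear; lia.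
Qed.

Lemma dbl_uniq x y : dend x = dend y -> cc x.1 = 2 -> cc y.1 = 2 -> x = y.
Proof.
move=> h cx cy; have [p [q [hp hq _ al /(_ _ hA) s]]] := darts_others x.
by case: (al y (esym h)) => e //; subst y; move: s; rewrite cx cy; clear; lia.
Qed.

Lemma unc_others x : cc x.1 = 0 -> exists y z, [/\ dend y = dend x, dend z = dend x, cc y.1 = 2, cc z.1 = 1 &
   forall w, dend w = dend x -> [\/ w = x, w = y | w = z]].
Proof.
move=> cx; have [p [q [hp hq _ al /(_ _ hA) s]]] := darts_others x.
have lp := cc_le2 p; have lq := cc_le2 q.
have [[cp cq]|[cp cq]] : cc p.1 = 2 /\ cc q.1 = 1 \/ cc p.1 = 1 /\ cc q.1 = 2.
  by move: s lp lq; rewrite cx; clear; lia.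
  by exists p, q.
by exists q, p; split=> // w /al[]; [constructor 1|constructor 3|constructor 2].
Qed.

Lemma dbl_unc x : cc x.1 = 2 -> exists2 y, dend y = dend x & cc y.1 = 0.
Proof.
move=> cx; have [p [q [hp hq _ al /(_ _ hA) s]]] := darts_others x.
have [cp|cq] : cc p.1 = 0 \/ cc q.1 = 0 by move: s; rewrite cx; clear; lia.
  by exists p.
by exists q.
Qed.

(** The three uncovered edges have six distinct ends, and each end meets one uncovered and one
    doubly covered edge. Following these two kinds alternately gives two involutions on six points,
    hence a hexagon; edges of odd index are the uncovered ones. *)
Theorem defect3_hexagon : exists hv he hd c,
  [/\ hexframe hv he hd, proper_off hv c,
     uncovered A = [set he (o6 1); he (o6 3); he (o6 5)] &
     [/\ c (hd (o6 0)).1 = c (hd (o6 1)).1, c (hd (o6 2)).1 = c (hd (o6 3)).1 &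
         c (hd (o6 4)).1 = c (hd (o6 5)).1]].
Proof.
have /card_gt0P[e0] : 0 < #|uncovered A| by rewrite unc3.
rewrite inE => /eqP ce0; pose x0 : dart G := (e0, true).
pose pk v n := odflt x0 [pick x | (dend x == v) && (cc x.1 == n)].
have pkP v n x : dend x = v -> cc x.1 = n -> dend (pk v n) = v /\ cc (pk v n).1 = n.
  move=> xv xn; rewrite /pk; case: pickP => [z /andP[/eqP h1 /eqP h2]|/(_ x)] //=.
  by rewrite xv xn !eqxx.
pose D := [set v | [exists x, (dend x == v) && (cc x.1 == 0)]].
have DP v : reflect (exists2 x, dend x = v & cc x.1 = 0) (v \in D).
  rewrite inE; apply: (iffP existsP) => [[x /andP[/eqP h1 /eqP h2]]|[x h1 h2]]; exists x => //.
  by rewrite h1 h2 !eqxx.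
have inD v : v \in D -> [/\ dend (pk v 0) = v, dend (pk v 1) = v, dend (pk v 2) = v &
   [/\ cc (pk v 0).1 = 0, cc (pk v 1).1 = 1, cc (pk v 2).1 = 2 &
    forall w, dend w = v -> [\/ w = pk v 0, w = pk v 2 | w = pk v 1]]].
  move=> /DP[x xv cx]; have [y [z [hy hz cy cz al]]] := unc_others cx.
  rewrite xv in hy hz al.
  have [p1 q1] := pkP _ _ _ xv cx; have [p2 q2] := pkP _ _ _ hy cy; have [p3 q3] := pkP _ _ _ hz cz.
  split=> //; split=> // w wv; case: (al w wv) => ->.
  - by constructor 1; apply: unc_uniq; rewrite ?p1.
  - by constructor 2; apply: dbl_uniq; rewrite ?p2.
  constructor 3; case: (al _ p3) => // e; by move: q3; rewrite e ?cx ?cy.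
pose a v := dother (pk v 0); pose b v := dother (pk v 2).
have pka v : v \in D -> a v \in D /\ pk (a v) 0 = flip (pk v 0).
  move=> vD; have [p0 p1 p2 [q0 q1 q2 al]] := inD _ vD.
  have [r1 r2] := pkP (a v) 0 (flip (pk v 0)) erefl q0.
  split; last by apply: unc_uniq.
  by apply/DP; exists (flip (pk v 0)).
have pkb v : v \in D -> b v \in D /\ pk (b v) 2 = flip (pk v 2).
  move=> vD; have [p0 p1 p2 [q0 q1 q2 al]] := inD _ vD.
  have [r1 r2] := pkP (b v) 2 (flip (pk v 2)) erefl q2.
  split; last by apply: dbl_uniq.
  by apply/DP; apply: (@dbl_unc (flip (pk v 2))).
have cD : #|D| = 6.
  have -> : D = (fun x : dart G => dend x) @: [set x : dart G | cc x.1 == 0].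
    apply/setP => v; apply/DP/imsetP => [[x xv cx]|[x]]; first by exists x; rewrite ?inE ?cx.
    by rewrite inE => /eqP cx ->; exists x.
  rewrite card_in_imset; last first.
    by move=> x y; rewrite !inE => /eqP cx /eqP cy h; apply: unc_uniq.
  have := sum_darts (fun e => (cc e == 0) : nat).
  have -> : \sum_e (cc e == 0) = 3.
    by rewrite -unc3 -sum1_card [RHS]big_mkcond /=; apply: eq_bigr => e _; rewrite inE; case: eqP.
  move=> h; apply: etrans (_ : \sum_(x : dart G) (cc x.1 == 0) = _); last by rewrite h.
  by rewrite -sum1_card big_mkcond /=; apply: eq_bigr => e _; rewrite inE; case: eqP.
have v0D : dend x0 \in D by apply/DP; exists x0.
have [||hv [hvI hvD hvn]] := @alternating_hexagon _ D a b _ cD v0D.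
- move=> v vD; have [aD pa] := pka _ vD; have [bD pb] := pkb _ vD.
  have [p0 p1 p2 _] := inD _ vD.
  by split=> //; rewrite ?/a ?/b ?pa ?pb dother_flip.
- move=> v vD; have [p0 p1 p2 [q0 q1 q2 _]] := inD _ vD.
  split; rewrite ?/a ?/b; [rewrite -{2}p0|rewrite -{2}p2|].
  + by rewrite eq_sym no_loop.
  + by rewrite eq_sym no_loop.
  apply/eqP => h; apply: (@no_parallel (pk v 0) (pk v 2)) => //; first by rewrite p0 p2.
  by rewrite q2.
have imD v : v \in D -> exists i, v = hv i.
  have : [set hv i | i : 'I_6] = D.
    apply/eqP; rewrite eqEcard card_imset // cD card_ord leqnn andbT.
    by apply/subsetP => w /imsetP[i _ ->].
  by move=> <- /imsetP[i _ ->]; exists i.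
pose he (i : 'I_6) := if odd i then (pk (hv i) 0).1 else (pk (hv i) 2).1.
pose hd i := pk (hv i) 1.
(* The colour is the matching containing the edge. Doubly covered and uncovered edges get an
   arbitrary value, but they all lie on the hexagon. *)
pose c e : 'I_3 := odflt (o3 0) [pick k | e \in amem A k].
have cche i : cc (he i) = if odd i then 0 else 2.
  by have [p0 p1 p2 [q0 q1 q2 _]] := inD _ (hvD i); rewrite /he; case: (odd i).
have heE i : exists b, dend (G := G) (he i, b) = hv i /\ dother (G := G) (he i, b) = hv (nx i).
  have [p0 p1 p2 _] := inD _ (hvD i); rewrite hvn /he.
  by case: (odd i); [exists (pk (hv i) 0).2|exists (pk (hv i) 2).2]; rewrite -surjective_pairing.
have onx i : odd (nx i) = ~~ odd i by move: i; apply: six_ind; rewrite nxE.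
have hF : hexframe hv he hd.
  split=> //.
  - move=> i j e; have [b1 [h1 h2]] := heE i; have [b2 [h3 h4]] := heE j.
    have oij : odd i = odd j.
      by have := cche i; rewrite e cche; case: (odd i); case: (odd j).
    have [h|h] := dart_eq_edge (e : (he i, b1).1 = (he j, b2).1).
      by apply: hvI; rewrite -h1 -h3 h.
    have : hv (nx i) = hv j by rewrite -h2 -h3 h.
    by move/hvI => ij; move: (onx i); rewrite ij oij; case: (odd j).
  - by move=> i; have [] := inD _ (hvD i).
  - move=> i j; have [_ _ _ [_ q1 _ _]] := inD _ (hvD i).
    by apply/eqP => h; have := cche j; rewrite -h q1; case: (odd j).
  move=> x i xv; have [p0 p1 p2 [q0 q1 q2 al]] := inD _ (hvD i).
  have prev : hv i = if odd i then b (hv (pv i)) else a (hv (pv i)).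
    by rewrite -{1 2}(pvK i) onx hvn; case: (odd (pv i)).
  have opv : odd (pv i) = ~~ odd i by rewrite -{2}(pvK i) onx negbK.
  have [aD pa] := pka _ (hvD (pv i)); have [bD pb] := pkb _ (hvD (pv i)).
  case: (al x xv) => ->; last by constructor 1.
  - case: (boolP (odd i)) => oi; [constructor 2|constructor 3]; rewrite /he ?opv oi //.
    by rewrite prev (negbTE oi) pa.
  - case: (boolP (odd i)) => oi; [constructor 3|constructor 2]; rewrite /he ?opv ?oi ?(negbTE oi) //.
    by rewrite prev oi pb.
have /is_arrayP pA := hA.
have cP e k : cc e = 1 -> (c e = k) <-> (e \in amem A k).
  move=> ce; have [j ej] : exists j, e \in amem A j by apply: cover_count_gt0; rewrite ce.
  have cA : e \in amem A (c e).
    by rewrite /c; case: pickP => [//|/(_ j)]; rewrite ej.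
  split=> [<- //|ek]; apply/eqP/negPn/negP => ne.
  by have := cover_count_mem2 ne cA ek; rewrite ce.
exists hv, he, hd, c; split=> //.
- move=> x x' xx' xh; have vD : dend x \notin D.
    by apply/negP => /imD[i h]; have := xh i; rewrite h eqxx.
  have c1 y : dend y = dend x -> cc y.1 = 1.
    move=> yx; have := cc_le2 y; case E: (cc y.1) => [|[|[|n]]] //= _.
      by case/DP: vD; exists y.
    by have [z zy cz] := dbl_unc E; case/DP: vD; exists z; rewrite // zy.
  move=> ec; have [z _ uz] := pm_dart (dend x) (pA (c x.1)).
  have h1 : x.1 \in amem A (c x.1) by apply: (proj1 (cP _ _ _) erefl); apply: c1.
  have h2 : x'.1 \in amem A (c x.1) by apply: (proj1 (cP _ _ _) (esym ec)); apply: c1.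
  by rewrite (uz x erefl h1) (uz x' (esym xx') h2).
- apply/setP => e; rewrite !inE; apply/eqP/idP => [ce|]; last first.
    by move=> /orP[/orP[]|] /eqP->; rewrite cche.
  have vD : dend (G := G) (e, true) \in D by apply/DP; exists (e, true).
  have [i vi] := imD _ vD; have [p0 p1 p2 [q0 q1 q2 al]] := inD _ vD.
  have eu : (e, true) = pk (hv i) 0 by rewrite -vi; apply: unc_uniq; rewrite ?p0.
  have he1 (j : 'I_6) : odd j -> hv i = hv j \/ hv i = hv (nx j) -> e = he j.
    move=> oj h; have [pj _ _ _] := inD _ (hvD j); rewrite /he oj.
    case: h => h; first by rewrite -h -eu.
    move: h; rewrite hvn oj => h; have [_ pa] := pka _ (hvD j).
    by move: (congr1 fst eu); rewrite h pa.
  have : exists2 j : 'I_6, odd j & hv i = hv j \/ hv i = hv (nx j).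
    case: (boolP (odd i)) => oi; first by exists i; [|left].
    by exists (pv i); rewrite ?pvK; [rewrite -(negbK (odd _)) -onx pvK|right].
  case=> j oj /(he1 _ oj) ->; move: j oj {he1}; apply: six_ind => // _; by rewrite eqxx ?orbT.
(* For even [i] the edge [he i] lies in two matchings, so the remaining matching passes through the
   third dart at both of its ends. *)
have pair (i : 'I_6) : ~~ odd i -> c (hd i).1 = c (hd (nx i)).1.
  move=> oi; have [p0 p1 p2 [q0 q1 q2 al]] := inD _ (hvD i).
  have [r0 r1 r2 [s0 s1 s2 al']] := inD _ (hvD (nx i)).
  apply: esym; apply: (proj2 (cP _ _ s1)).
  have hk : (hd i).1 \in amem A (c (hd i).1) by apply: (proj1 (cP _ _ _) erefl).
  have [z [zv zk] uz] := pm_dart (hv (nx i)) (pA (c (hd i).1)).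
  case: (al' _ zv) => e; rewrite e in zk.
  - by have := cover_count_mem zk; rewrite s0.
  - have [z' _ uz'] := pm_dart (hv i) (pA (c (hd i).1)).
    have [bD pb] := pkb _ (hvD i); have hb : hv (nx i) = b (hv i) by rewrite hvn (negbTE oi).
    rewrite hb pb in zk; have e1 := uz' _ p2 zk; have e2 := uz' _ p1 hk.
    by move: q1; rewrite e2 -e1 q2.
  exact: zk.
by rewrite -nx0 -nx2 -nx4; split; apply: pair.
Qed.

End Defect3.

(** * Cutting along the barrier *)

Section CutColours.
Variable G : mgraph.
Hypotheses (tG : twoconn G) (cG : cubic G).
Let bG : bridgeless G := proj2 tG.
Variables (Q : pred (gV G)) (c : gE G -> 'I_3).
Hypothesis pc : forall x x' : dart G, dend x = dend x' -> Q (dend x) -> c x.1 = c x'.1 -> x = x'.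

Lemma vertex_colour v k : Q v -> exists2 x, dend x = v & c x.1 = k.
Proof.
move=> Qv; have [x [y [z [[hx hy hz] [xy xz yz]]]]] := three_darts tG cG v.
pose F := [set x; y; z].
have ned (a b : dart G) : a.1 != b.1 -> a != b by apply: contra => /eqP->.
have cF : #|F| = 3 by rewrite /F -setUA !cardsU1 !inE cards1 !(negbTE (ned _ _ _)).
have Fv w : w \in F -> dend w = v by rewrite !inE => /orP[/orP[]|] /eqP->.
have : k \in (fun w : dart G => c w.1) @: F.
  have -> : (fun w : dart G => c w.1) @: F = setT.
    apply/eqP; rewrite eqEcard subsetT card_in_imset ?cF ?cardsT ?card_ord //.
    by move=> w w' /Fv wv /Fv wv'; apply: pc; rewrite ?wv ?wv'.
  by rewrite inE.
by case/imsetP => w /Fv wv ->; exists w.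
Qed.

(** Parity lemma: a colour class meets each vertex of [X] once. Properness is asked only inside [X],
    so the lemma applies although the colouring is not proper on the hexagon. *)
Lemma odd_colour_cut (X : {set gV G}) k : {in X, forall v, Q v} ->
  odd #|[set d in bd X | c d.1 == k]| = odd #|X|.
Proof.
move=> XQ; rewrite -(odd_darts_bd X (fun e => c e == k)).
rewrite (card_darts_sum X (fun d : dart G => c d.1 == k)) (eq_bigr (fun=> 1)) ?sum1_card //.
move=> v vX; have [x xv xk] := vertex_colour k (XQ _ vX).
apply/eqP/cards1P; exists x; apply/setP => y; rewrite !inE.
apply/andP/eqP => [[/eqP h1 /eqP h2]|->]; last by rewrite xv xk !eqxx.
by apply: pc; rewrite ?h1 ?xv ?h2 ?xk //; apply: XQ.
Qed.

(** Each of the three colours occurs an odd number of times on a cut of three edges, hence once. *)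
Lemma cut3_colours (X : {set gV G}) : {in X, forall v, Q v} -> #|bd X| = 3 ->
  (forall k, exists2 x, x \in bd X & c x.1 = k) /\
  {in bd X &, forall x y, c x.1 = c y.1 -> x = y}.
Proof.
move=> XQ b3; have oX : odd #|X| by rewrite -odd_bd // b3.
have ex k : exists2 x, x \in bd X & c x.1 = k.
  have : odd #|[set d in bd X | c d.1 == k]| by rewrite odd_colour_cut.
  by move=> /odd_gt0/card_gt0P[x]; rewrite in_set => /andP[h /eqP]; exists x.
split=> //; apply/imset_injP.
have -> : (fun w : dart G => c w.1) @: bd X = setT.
  by apply/setP => k; rewrite inE; apply/imsetP; have [x h <-] := ex k; exists x.
by rewrite cardsT card_ord b3.
Qed.

Lemma cut2_colours (X : {set gV G}) x y : {in X, forall v, Q v} -> bd X = [set x; y] ->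
  x != y -> c x.1 = c y.1.
Proof.
move=> XQ bX xy; apply/eqP/negPn/negP => ne.
have := odd_colour_cut (c x.1) XQ; have := odd_bd X cG; rewrite bX cards2 xy /= => <-.
suff -> : [set d in [set x; y] | c d.1 == c x.1] = [set x] by rewrite cards1.
apply/setP => z; rewrite !inE; case: (eqVneq z x) => [->|zx] /=; first by rewrite eqxx.
by case: (eqVneq z y) => //= ->; rewrite eq_sym (negbTE ne).
Qed.
End CutColours.

Section Stage1.
Variable G : mgraph.
Hypotheses (tG : twoconn G) (cG : cubic G).
Let bG : bridgeless G := proj2 tG.
Implicit Types (x y z : dart G) (X Y : {set gV G}).
Variables (Z S : {set gV G}).
Let T := ~: Z :\: S.
Hypothesis SZ : S \subset ~: Z.
Hypothesis ST : forall x, dend x \in S -> dother x \in T.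
Hypothesis comp3 : forall y : gV G, y \in T -> #|bd (component (eadj (G := G)) T y)| = 3.
Hypothesis Z0 : Z != set0.
Notation comp := (component (eadj (G := G)) T).

Lemma T_notS v : v \in T -> v \notin S. Proof. by rewrite inE => /andP[]. Qed.
Lemma T_notZ v : v \in T -> v \notin Z. Proof. by rewrite !inE => /andP[]. Qed.
Lemma S_notZ v : v \in S -> v \notin Z. Proof. by move/(subsetP SZ); rewrite inE. Qed.
Lemma notZ v : v \notin Z -> (v \in S) || (v \in T).
Proof. by move=> h; rewrite !inE h andbT orbN. Qed.

Lemma bd_comp x : dend x \in T -> (x \in bd (comp (dend x))) = (x \in bd T).
Proof.
move=> xT; rewrite !in_bd component_refl xT /=; apply/idP/idP; apply: contra => h.
  by apply: (component_step (component_refl _ _ _) xT h); apply/eadjP; exists x.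
exact: (subsetP (component_sub _ xT) _ h).
Qed.

Lemma comp_eqT u v : u \in T -> v \in comp u -> v \in T /\ comp v = comp u.
Proof.
move=> uT vu; split; first exact: (subsetP (component_sub _ uT) _ vu).
exact: (component_eq (@eadj_sym G)).
Qed.

Lemma bdT_other x : x \in bd T -> (dother x \in S) || (dother x \in Z).
Proof. by rewrite in_bd !inE negb_and !negbK => /andP[_]. Qed.

Lemma S_flip x : dend x \in S -> flip x \in bd T.
Proof. by move=> h; rewrite in_bd dend_flip dother_flip ST //= inE h. Qed.

(** A union of whole components and barrier vertices that contains all neighbours of its barrier
    vertices. The cut of such a set is three times the excess of components over barrier
    vertices. *)
Definition saturated X := [/\ X \subset ~: Z, forall u v, u \in X -> u \in T -> v \in comp u -> v \in X &
  forall x, dend x \in X -> dend x \in S -> dother x \in X].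

Lemma saturated_bd X x : saturated X -> x \in bd X -> x \in bd T.
Proof.
move=> [XZ sT sS]; rewrite in_bd => /andP[xX oX].
have := notZ (v := dend x); rewrite -in_setC (subsetP XZ) // => /(_ isT) /orP[xS|xT].
  by rewrite sS in oX.
rewrite in_bd xT /=; apply: contra oX => oT; apply: (sT _ _ xX xT).
by apply: (component_step (component_refl _ _ _) xT oT); apply/eadjP; exists x.
Qed.

Lemma card_saturated_bd X : saturated X ->
  #|bd X| + 3 * #|S :&: X| = #|[set x in bd T | dend x \in X]|.
Proof.
move=> sX; have [XZ sT sS] := sX; rewrite -(card_darts_cubic (S :&: X) cG).
rewrite -(cardsID (bd X) [set x in bd T | dend x \in X]); congr (_ + _).
  apply: eq_card => x; rewrite in_setI in_set; apply/idP/andP => [h|[]//].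
  by rewrite (saturated_bd sX h) h; move: h; rewrite in_bd => /andP[->].
rewrite -(card_imset _ (@flip_inj G)); apply: eq_card => x; apply/imsetP/idP => [[y]|].
  rewrite !inE => /andP[yS yX] ->; have := S_flip yS; rewrite !inE dend_flip dother_flip => ->.
  by rewrite yX sS.
rewrite in_setD in_bd in_set => /andP[h1 /andP[h2 h3]]; rewrite h3 /= negbK in h1.
exists (flip x); rewrite ?flipK // inE dend_flip in_setI h1 andbT.
case/orP: (bdT_other h2) => // /negPn; have := subsetP XZ _ h1; by rewrite inE => ->.
Qed.

Lemma dvdn_saturated X : saturated X -> 3 %| #|bd X|.
Proof.
move=> sX; have [XZ sT sS] := sX.
rewrite -(@dvdn_addl (3 * #|S :&: X|)) ?dvdn_mulr // card_saturated_bd //.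
rewrite -sum1_card (partition_big (fun x => comp (dend x)) (mem [set comp v | v in X :&: T])) /=.
  apply: dvdn_sum => C /imsetP[v]; rewrite inE => /andP[vX vT] ->.
  rewrite (_ : \sum_(i | _) 1 = 3) //; apply: etrans (comp3 vT); rewrite -sum1_card.
  apply: eq_bigl => x; rewrite in_set; apply/andP/idP => [[/andP[h1 h2] /eqP <-]|h].
    by rewrite bd_comp //; move: h1; rewrite in_bd => /andP[].
  have [xT e1] : dend x \in T /\ comp (dend x) = comp v.
    by apply: comp_eqT => //; move: h; rewrite in_bd => /andP[].
  rewrite -bd_comp // e1 h eqxx (sT v) //; by move: h; rewrite in_bd => /andP[].
move=> x; rewrite inE => /andP[h1 h2]; apply: imset_f; rewrite inE h2 /=.
by move: h1; rewrite in_bd => /andP[].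
Qed.

Lemma saturatedU X Y : saturated X -> saturated Y -> saturated (X :|: Y).
Proof.
move=> [h1 h2 h3] [g1 g2 g3]; split; first by rewrite subUset h1 g1.
  by move=> u v; rewrite !inE => /orP[hu|hu] uT vu; [rewrite (h2 u)|rewrite (g2 u) ?orbT]; rewrite // ?inE.
by move=> x; rewrite !in_setU => /orP[hu|hu] xS; [rewrite h3|rewrite g3 ?orbT].
Qed.

Lemma saturatedI X Y : saturated X -> saturated Y -> saturated (X :&: Y).
Proof.
move=> [h1 h2 h3] [g1 g2 g3]; split.
- exact: subset_trans (subsetIl _ _) h1.
- by move=> u v; rewrite !in_setI => /andP[hu gu] uT vu; rewrite (h2 u) // (g2 u).
by move=> x; rewrite !in_setI => /andP[hu gu] xS; rewrite h3 // g3.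
Qed.

(** On saturated sets the cut size is a difference of two counting measures, so the usual submodular
    inequality becomes an equality. *)
Lemma card_bd_modular X Y : saturated X -> saturated Y ->
  #|bd (X :&: Y)| + #|bd (X :|: Y)| = #|bd X| + #|bd Y|.
Proof.
move=> sX sY.
have e1 := card_saturated_bd sX; have e2 := card_saturated_bd sY.
have e3 := card_saturated_bd (saturatedU sX sY); have e4 := card_saturated_bd (saturatedI sX sY).
have e5 := cardsUI (S :&: X) (S :&: Y).
have e6 := cardsUI [set x in bd T | dend x \in X] [set x in bd T | dend x \in Y].
have e7 : (S :&: X) :|: (S :&: Y) = S :&: (X :|: Y) by rewrite setIUr.
have e8 : (S :&: X) :&: (S :&: Y) = S :&: (X :&: Y).
  by apply/setP => v; rewrite !in_setI; case: (v \in S).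
have e9 : [set x in bd T | dend x \in X] :|: [set x in bd T | dend x \in Y] = [set x in bd T | dend x \in X :|: Y].
  by apply/setP => x; rewrite !inE -andb_orr.
have e10 : [set x in bd T | dend x \in X] :&: [set x in bd T | dend x \in Y] = [set x in bd T | dend x \in X :&: Y].
  apply/setP => x; rewrite !inE.
  by case: (dend x \in X); case: (dend x \in Y); rewrite /= ?andbT ?andbF ?andbb.
rewrite e7 e8 in e5; rewrite e9 e10 in e6.
have aux (a b i u sa sb si su ca cb ci cu : nat) : a + 3 * sa = ca -> b + 3 * sb = cb ->
  u + 3 * su = cu -> i + 3 * si = ci -> su + si = sa + sb -> cu + ci = ca + cb -> i + u = a + b by lia.
exact: aux e1 e2 e3 e4 e5 e6.
Qed.

(** The cut of the union is divisible by three and larger than three, hence at least six. Modularity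
    leaves an empty cut for the intersection, which is impossible in a connected graph unless the
    sets are disjoint. *)
Lemma saturated_disjoint X Y : saturated X -> saturated Y -> #|bd X| = 3 -> #|bd Y| = 3 ->
  3 < #|bd (X :|: Y)| -> [disjoint X & Y].
Proof.
move=> sX sY bX bY bU; rewrite -setI_eq0; apply/negPn/negP => /set0Pn[v vI].
have [z zZ] := set0Pn _ Z0.
have h := card_bd_modular sX sY; rewrite bX bY in h.
have /dvdnP[k hk] := dvdn_saturated (saturatedU sX sY).
have b0 : #|bd (X :&: Y)| = 0 by move: h bU; rewrite hk; clear; lia.
have [h1 _ _] := saturatedI sX sY.
have zI : z \notin X :&: Y by apply/negP => /(subsetP h1); rewrite inE zZ.
by have := bd_connected (proj1 tG) vI zI; rewrite -cards_eq0 b0.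
Qed.

Section Hex.
Variables (hv : 'I_6 -> gV G) (he : 'I_6 -> gE G) (hd : 'I_6 -> dart G) (c : gE G -> 'I_3).
Hypothesis hF : hexframe hv he hd.
Hypothesis ZP : forall v, reflect (exists i, v = hv i) (v \in Z).
Hypothesis hdT : forall i, dother (hd i) \in T.

Lemma hd_bdT i : flip (hd i) \in bd T.
Proof.
rewrite in_bd dend_flip dother_flip hdT /=.
by apply/negP => /T_notZ /ZP; case; exists i; apply: (hd_end hF).
Qed.

Lemma hd_inj : injective hd.
Proof. by move=> i j h; apply: (hv_inj hF); rewrite -!(hd_end hF) h. Qed.

Lemma bdT_hd x i : x \in bd T -> dother x = hv i -> x = flip (hd i).
Proof.
rewrite in_bd => /andP[xT _] xi; apply: (can_inj (@flipK G)); rewrite flipK.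
have := hd_all hF (x := flip x) (i := i); rewrite dend_flip => /(_ xi).
have hx j : (flip x).1 = he j -> False.
  move=> e; have [b [h1 h2]] := he_ends hF j.
  have [h|h] := dart_eq_edge (e : (x.1 = (he j, b).1)).
    by have := T_notZ xT; rewrite -h h1 => /ZP; case; exists j.
  have := T_notZ xT; rewrite -[dend x]dother_flip -h h2 => /ZP; case; by exists (nx j).
by case=> // /hx.
Qed.

Hypothesis pc : proper_off hv c.
Hypothesis ncol : ~ colourable3 G.
Hypothesis c01 : c (hd (o6 0)).1 = c (hd (o6 1)).1.
Hypothesis c0N : forall i : 'I_6, 1 < i -> c (hd i).1 != c (hd (o6 0)).1.

Let pcQ : forall x x' : dart G, dend x = dend x' -> dend x \notin Z -> c x.1 = c x'.1 -> x = x'.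
Proof.
move=> x x' xx xZ; apply: pc => // i; apply: contra xZ => /eqP->; apply/ZP; by exists i.
Qed.

(** This instantiates the abstract incidence structure: its edges are the darts leaving [T], its
    nodes the components of [T] and the vertices of [S], and its pendant edges the six edges at the
    hexagon. *)
Let E : finType := {x : dart G | x \in bd T}.
Let L : finType := {v : gV G | v \in S}.
Let Tt : finType := {C : {set gV G} | C \in [set comp v | v in T]}.
Let EdT (x : E) : dend (val x) \in T.
Proof. by have := valP x; rewrite in_bd => /andP[]. Qed.
Let t (x : E) : Tt := Sub (comp (dend (val x))) (imset_f (fun v => comp v) (EdT x)).
Let s (x : E) : L + 'I_6 :=
  if insub (dother (val x)) is Some l then inl l
  else inr (odflt (o6 0) [pick i | hv i == dother (val x)]).
Let d (i : 'I_6) : E := Sub (flip (hd i)) (hd_bdT i).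

Let sP (x : E) : (exists2 l, s x = inl l & dother (val x) = val l) \/
  exists2 i, s x = inr i & dother (val x) = hv i.
Proof.
rewrite /s; case: insubP => [l _ vl|nS]; first by left; exists l.
right; have := bdT_other (valP x); rewrite (negbTE nS) /= => /ZP[i hi].
case: pickP => [j /eqP hj|/(_ i)]; first by exists j.
by rewrite hi eqxx.
Qed.

Let sd (e : E) i : s e = inr i <-> e = d i.
Proof.
split=> [h|->].
  case: (sP e) => [[l h' _]|[j h' hj]]; rewrite h' // in h.
  by case: h hj => -> hj; apply: val_inj => /=; apply: bdT_hd => //; apply: valP.
have vd : val (d i) = flip (hd i) by [].
case: (sP (d i)) => [[l _]|[j ->]]; rewrite vd dother_flip (hd_end hF) => h.
  by have := S_notZ (valP l); rewrite -h => /ZP; case; exists i.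
by rewrite ((hv_inj hF) _ _ h).
Qed.

Let compQ v : v \in T -> {in comp v, forall w, w \notin Z}.
Proof. by move=> vT w /(comp_eqT vT)[/T_notZ]. Qed.

Let t_bd (x : E) : val x \in bd (val (t x)).
Proof. by rewrite /= bd_comp ?EdT //; apply: valP. Qed.

Let bd_t C y : y \in bd (val C) -> exists2 x : E, t x = C & val x = y.
Proof.
have /imsetP[v vT eC] := valP C; rewrite eC => h.
have [yT e1] : dend y \in T /\ comp (dend y) = comp v.
  by apply: comp_eqT => //; move: h; rewrite in_bd => /andP[].
have yb : y \in bd T by rewrite -bd_comp // e1.
by exists (Sub y yb); [apply: val_inj; rewrite /= e1 eC|].
Qed.

Let pc3 : proper3 t s (fun x : E => c (val x).1).
Proof.
have C3' (C : Tt) := @cut3_colours G tG cG (fun v => v \notin Z) c pcQ (val C).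
have C3 (C : Tt) : (forall k, exists2 x, x \in bd (val C) & c x.1 = k) /\
    {in bd (val C) &, forall x y, c x.1 = c y.1 -> x = y}.
  have /imsetP[v vT eC] := valP C.
  by apply: (C3' C); rewrite eC; [exact: compQ|exact: comp3].
split.
- move=> x y h1 h2; apply: val_inj; apply: (proj2 (C3 (t x))) => //.
  by rewrite h1 t_bd.
- move=> x y; case: (sP x) => [[l -> xl]|[i hi _]]; last first.
    by rewrite hi => /esym/(proj1 (sd _ _)) -> _; apply: (proj1 (sd _ _)).
  case: (sP y) => [[l' -> yl]|[i -> _]] // [ll] h; apply: val_inj; apply: (can_inj (@flipK G)).
  by apply: pcQ; rewrite ?dend_flip ?xl ?yl ?ll //; apply: S_notZ; apply: valP.
split=> [C k|l k].
  have [y yC yk] := proj1 (C3 C) k; have [x tx xy] := bd_t yC.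
  by exists x; rewrite ?xy.
have [y yl yk] := @vertex_colour G tG cG (fun v => v \notin Z) c pcQ _ k (S_notZ (valP l)).
have yS : dend y \in S by rewrite yl; apply: valP.
exists (Sub (flip y) (S_flip yS)) => //.
case: (sP (Sub (flip y) (S_flip yS) : E)) => [[l' -> ]|[i _]]; rewrite SubK dother_flip yl.
  by move=> /val_inj ->.
by move=> h; have := S_notZ (valP l); rewrite h => /ZP; case; exists i.
Qed.

(** The cut edges of a component carry all three colours before and after, so the recolouring
    induces a permutation [pi] of the colours; applying it to the inside of the component keeps the
    colouring proper. *)
Lemma recolour_skeleton (c' : E -> 'I_3) : proper3 t s c' -> exists2 c'', proper_off hv c'' &
  forall i, c'' (hd i).1 = c' (d i).
Proof.
move=> [ct cs [ext exs]].
pose pi (C : {set gV G}) k := odflt (o3 0) (omap c' [pick x : E | (val (t x) == C) && (c (val x).1 == k)]).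
have [pct pcs [pext pexs]] := pc3.
have piP (x : E) : pi (val (t x)) (c (val x).1) = c' x.
  rewrite /pi; case: pickP => [y /andP[/eqP h1 /eqP h2]|/(_ x)] /=; last by rewrite !eqxx.
  by congr c'; apply: pct => //; apply: val_inj.
have pi_inj (C : Tt) : injective (pi (val C)).
  move=> k k'; have [x tx <-] := pext C k; have [y ty <-] := pext C k'.
  rewrite -{1}tx -{1}ty !piP => h; congr (c (val _).1); apply: ct => //; by rewrite tx ty.
pose c'' e := if insub (e, true) is Some x then c' x else
   if insub (e, false) is Some x then c' x else pi (comp (dend (G := G) (e, true))) (c e).
have c''b (x : E) : c'' (val x).1 = c' x.
  rewrite /c''; have nf z : z \in bd T -> flip z \in bd T -> False.
    by rewrite !in_bd dend_flip dother_flip => /andP[-> /negbTE->].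
  case: insubP => [y _ vy|n1].
    congr c'; apply: val_inj; have e1 : (val y).1 = (val x).1 by rewrite vy.
    have [-> //|h] := dart_eq_edge e1.
    by case: (nf _ (valP y)); rewrite -h; apply: valP.
  have e2 : val x = ((val x).1, false).
    move: n1 (valP x); case: (val x) => e [] //= n1 h; by rewrite h in n1.
  by rewrite -e2 valK.
have c''T x : dend x \in T -> c'' x.1 = pi (comp (dend x)) (c x.1).
  move=> xT; case: (boolP (x \in bd T)) => xb.
    pose y : E := Sub x xb; have vy : val y = x by [].
    by rewrite -vy c''b -piP.
  have oT : dother x \in T by move: xb; rewrite in_bd xT negbK.
  have ob : flip x \notin bd T by rewrite in_bd dend_flip dother_flip oT xT.
  have eC : comp (dother x) = comp (dend x).
    apply: (comp_eqT xT _).2; apply: (component_step (component_refl _ _ _) xT oT).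
    by apply/eadjP; exists x.
  rewrite /c''; move: xb ob xT eC; case: x oT => e [] _ xb ob xT eC /=.
    by rewrite insubN // insubN.
  by rewrite insubN // insubN //; congr (pi _ _); exact: eC.
have c''S x : dend x \in S -> exists2 y : E, val y = flip x & c'' x.1 = c' y.
  by move=> xS; exists (Sub (flip x) (S_flip xS)) => //; rewrite -c''b.
exists c''; last by move=> i; rewrite -c''b.
move=> x x' xx xh; have xZ : dend x \notin Z by apply/ZP => -[i /eqP]; apply/negP.
case/orP: (notZ xZ) => xS.
  have [y vy ->] := c''S _ xS; have [y' vy' ->] : exists2 y : E, val y = flip x' & c'' x'.1 = c' y.
    by apply: c''S; rewrite -xx.
  move=> h; apply: (can_inj (@flipK G)); rewrite -vy -vy'; congr val; apply: cs => //.
  have sl (z : E) l : val z = flip l -> dend l \in S -> exists2 k, s z = inl k & val k = dend l.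
    move=> vz lS; case: (sP z) => [[k -> ]|[i _]]; rewrite vz dother_flip; first by exists k.
    by move=> e; have := S_notZ lS; rewrite e => /ZP; case; exists i.
  have [k -> hk] := sl _ _ vy xS; have [k' -> hk'] : exists2 k, s y' = inl k & val k = dend x'.
    by apply: sl; rewrite -?xx.
  by congr inl; apply: val_inj; rewrite hk hk'.
rewrite !c''T -?xx // => /(@pi_inj (Sub (comp (dend x)) (imset_f (fun v => comp v) xS))) h.
exact: pcQ.
Qed.

(** A recolouring would extend over the hexagon by [hexext_opposite] and colour the whole graph. So
    [recolour_or_cut] yields a cut, which is read back as a vertex set. *)
Theorem opposite_cut : exists X, [/\ saturated X, #|bd X| = 3, dother (hd (o6 0)) \in X & dother (hd (o6 3)) \in X].
Proof.
have [||[c' pc' [p0 p1 p2 p3]]|[QT [QL [cl t0 t3 o3]]]] := recolour_or_cut pc3 sd.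
- exact: c01.
- exact: c0N.
- have [c'' pc'' hc''] := recolour_skeleton pc'; case: ncol.
  apply: (colour_hexagon cG bG hF pc''); apply: hexext_opposite; rewrite ?hc'' //.
  by move=> i i0 i3; rewrite !hc''; apply: p1.
pose X := [set v | if insub v is Some l then l \in QL else
  (v \in T) && (if insub (comp v) is Some C then C \in QT else false)].
have XT v C : v \in T -> val C = comp v -> (v \in X) = (C \in QT).
  by move=> vT e; rewrite inE insubN ?T_notS // vT -e valK.
have XS l : (val l \in X) = (l \in QL) by rewrite inE valK.
have tE (x : E) y : dend y = dend (val x) -> (dend y \in X) = (t x \in QT).
  by move=> ->; apply: XT => //; apply: EdT.
have satX : saturated X; first split.
- apply/subsetP => v; rewrite inE in_setC; case: insubP => [l vS _ _|_ /andP[/T_notZ]] //.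
  exact: S_notZ.
- move=> u v uX uT vu; have [vT e1] := comp_eqT uT vu.
  pose C : Tt := Sub (comp u) (imset_f (fun v => comp v) uT).
  by rewrite (XT v C) ?e1 // -(XT u C).
- move=> x xX xS; pose y : E := Sub (flip x) (S_flip xS).
  have -> : dother x = dend (val y) by rewrite SubK dend_flip.
  rewrite (tE y (val y)) //; case: (sP y) => [[l sl hl]|[i _]].
    apply: (cl _ _ sl); rewrite -XS -hl SubK dother_flip; exact: xX.
  by rewrite SubK dother_flip => h; have := S_notZ xS; rewrite h => /ZP; case; exists i.
have dX i : t (d i) \in QT -> dother (hd i) \in X.
  by move=> h; rewrite -dend_flip (tE (d i) (val (d i))).
exists X; split=> //; [|exact: dX|exact: dX].
apply: etrans o3; rewrite -(card_imset _ val_inj); apply: eq_card => x.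
apply/idP/imsetP => [h|[y]].
  have xb := saturated_bd satX h; exists (Sub x xb); last by rewrite SubK.
  pose y : E := Sub x xb; have vy : val y = x by [].
  rewrite inE -(tE y (val y)) ?vy //; move: h; rewrite in_bd => /andP[-> oX].
  case: (sP y) => [[l -> hl]|[i -> _]] //=.
  by rewrite -XS -hl vy.
rewrite inE => /andP[h1 h2] ->; rewrite in_bd (tE y (val y)) // h1 /=.
case: (sP y) h2 => [[l -> ->]|[i -> ->]]; first by rewrite -XS.
move=> _; apply/negP => h; have [XZ _ _] := satX; have := subsetP XZ _ h.
by rewrite inE => /ZP; case; exists i.
Qed.
End Hex.
End Stage1.

(** * The Petersen skeleton *)

Definition md (i : 'I_6) : 'I_3 := inord (i %% 3).
Lemma val_md i : md i = i %% 3 :> nat. Proof. by rewrite inordK // ltn_mod. Qed.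
Lemma md0 : md (o6 0) = o3 0. Proof. by apply: val_inj; rewrite /= val_md. Qed.
Lemma md1 : md (o6 1) = o3 1. Proof. by apply: val_inj; rewrite /= val_md. Qed.
Lemma md2 : md (o6 2) = o3 2. Proof. by apply: val_inj; rewrite /= val_md. Qed.
Lemma md3 : md (o6 3) = o3 0. Proof. by apply: val_inj; rewrite /= val_md. Qed.
Lemma md4 : md (o6 4) = o3 1. Proof. by apply: val_inj; rewrite /= val_md. Qed.
Lemma md5 : md (o6 5) = o3 2. Proof. by apply: val_inj; rewrite /= val_md. Qed.
Definition mdE := (md0, md1, md2, md3, md4, md5).

Lemma three_ind (P : 'I_3 -> Prop) : P (o3 0) -> P (o3 1) -> P (o3 2) -> forall i, P i.
Proof. by move=> p0 p1 p2 [[|[|[|i]]] lti] //; rewrite (bool_irrelevance lti isT). Qed.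

(* The Petersen graph drawn around a 6-cycle: rim vertices, the three leaves joining
   opposite rim vertices, and the centre [inr None]. *)
Definition P6_ends (e : 'I_6 + ('I_6 + 'I_3)) : ('I_6 + option 'I_3) * ('I_6 + option 'I_3) :=
  match e with
  | inl i => (inl i, inl (nx i))
  | inr (inl i) => (inl i, inr (Some (md i)))
  | inr (inr j) => (inr (Some j), inr None)
  end.
Definition P6 : mgraph := @MGraph ('I_6 + option 'I_3)%type ('I_6 + ('I_6 + 'I_3))%type P6_ends.

Section Skeleton.
Variable G : mgraph.
Variables (p : gV G -> gV P6) (io : gE P6 -> dart G).
(** Contracting the fibres of [p] turns [G] into [P6]: [io e] is the edge of [G] representing [e],
    oriented like [e], and the last field says that no other edge joins different fibres. *)
Record skeleton : Prop := Skel {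
  sk_end : forall e, p (dend (io e)) = (gends e).1;
  sk_other : forall e, p (dother (io e)) = (gends e).2;
  sk_all : forall x : dart G, p (dend x) != p (dother x) -> exists e, (io e).1 = x.1 }.
Definition fibre (y : gV P6) : {set gV G} := [set v | p v == y].
(** The third clause puts all exits of the fibre at [U]. When everything outside the fibre is
    contracted to one vertex, that vertex is then adjacent to [U] only, which is what correctness of
    a substitution requires. *)
Definition bipartising_fibre y (U : {set gV G}) :=
  [/\ U \subset fibre y, forall x : dart G, dend x \in U -> dother x \notin U,
      forall x : dart G, p (dend x) = y -> p (dother x) != y -> dend x \in U &
      forall v, p v = y -> v \notin U -> #|bd (component (eadj (G := G)) (fibre y :\: U) v)| = 3].
End Skeleton.

Lemma component_closed (V : finType) (e : rel V) (T A : {set V}) v : A \subset T ->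
  (forall u w, u \in A -> w \in T -> e u w -> w \in A) -> v \in A -> component e A v = component e T v.
Proof.
move=> AT cl vA; apply/setP => w; rewrite !inE; apply/idP/idP.
  apply: (connect_sub (e := within e A) (e' := within e T)).
  move=> a b /and3P[aA bA ab]; apply: connect1.
  by rewrite /within /= ab !(subsetP AT).
case/connectP => q; elim: q v vA => [|b q IH] v vA /=; first by move=> _ ->; apply: connect0.
case/andP => /and3P[vT bT vb] pth lst; have bA := cl _ _ vA bT vb.
by apply: connect_trans (connect1 _) (IH _ bA pth lst); rewrite /within /= vA bA.
Qed.

Section Rotate.
Variables (G : mgraph) (hv : 'I_6 -> gV G) (he : 'I_6 -> gE G) (hd : 'I_6 -> dart G).
(** A rotation by two positions permutes the pairs 01, 23, 45 of equally coloured third edges, so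
    one theorem on opposite cuts serves all three of them. *)
Lemma hexframe_rot : hexframe hv he hd ->
  hexframe (fun i => hv (nx (nx i))) (fun i => he (nx (nx i))) (fun i => hd (nx (nx i))).
Proof.
have nI : injective nx := can_inj nxK.
case=> h1 h2 h3 h4 h5 h6; split=> //.
- by move=> i j /h1/nI/nI.
- by move=> i j /h2/nI/nI.
- by move=> x i /h6; rewrite nxK pvK.
Qed.
End Rotate.

Section Stage1.
Variable G : mgraph.
Hypotheses (tG : twoconn G) (cG : cubic G).
Let bG : bridgeless G := proj2 tG.
Implicit Types (x y : dart G) (X Y : {set gV G}).

Lemma not_colourable_df3 : df_eq G 3 -> ~ colourable3 G.
Proof. by case=> _ h /(colourable_df0 cG)[A [/h h3 e]]; rewrite e in h3. Qed.

Lemma even_vertices : ~~ odd #|gV G|.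
Proof.
by have := congr1 odd (card_edges cG); rewrite !oddM /= => <-.
Qed.

Definition no_4cover := forall M : 'I_4 -> {set gE G}, (forall k, perfect_matching (M k)) ->
  exists e, forall k, e \notin M k.

Lemma pmi5_no_4cover : pmi_eq G 5 -> no_4cover.
Proof.
case=> _ h M pM; case: (pickP (fun e => [forall k, e \notin M k])) => [e /forallP he|ne].
  by exists e.
suff : 5 <= 4 by [].
apply: (h _ _ pM) => e; have /negbT := ne e; rewrite negb_forall => /existsP[k].
by rewrite negbK; exists k.
Qed.

Theorem petersen_skeleton : df_eq G 3 -> no_4cover -> exists p io (c : gE G -> 'I_3) U,
  [/\ @skeleton G p io, forall v v' i, p v = inl i -> p v' = inl i -> v = v',
     forall x x', dend x = dend x' -> (forall i, p (dend x) != inl i) -> c x.1 = c x'.1 -> x = x' :> dart G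
     & bipartising_fibre p (inr None) U].
Proof.
move=> df nocov; have ncol := not_colourable_df3 df.
case: df => [[A [hA unc3]] minA].
have [hv [he [hd [c [hF pc uncE [c01 c23 c45]]]]]] := defect3_hexagon tG cG hA unc3 minA.
have [hvI heI hen hde hdh hda] := hF.
pose Z := [set hv i | i : 'I_6].
have ZP v : reflect (exists i, v = hv i) (v \in Z).
  by apply: (iffP imsetP) => [[i _ ->]|[i ->]]; exists i.
have cZ : #|Z| = 6 by rewrite card_imset // card_ord.
have hvZ i : hv i \in Z by apply/ZP; exists i.
have Z0 : Z != set0 by apply/set0Pn; exists (hv (o6 0)).
have heZ x i : x.1 = he i -> dend x \in Z.
  move=> e; have [b [h1 h2]] := hen i.
  by have [->|->] := dart_eq_edge (esym e : (he i, b).1 = x.1); rewrite ?dend_flip ?h1 ?h2.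
have bdZ : bd Z \subset hd @: setT.
  apply/subsetP => x; rewrite in_bd => /andP[/ZP[i hi] /negP oZ].
  case: (hda _ _ hi) => [->|h|h]; first exact: imset_f.
    by case: oZ; apply: (heZ (flip x) i).
  by case: oZ; apply: (heZ (flip x) (pv i)).
have chd : #|hd @: setT| = 6 by rewrite card_imset ?cardsT ?card_ord //; apply: (hd_inj hF).
(* The three hexagon edges left uncovered by the array complete [M] to a perfect matching [N], and
   the array together with [N] covers the graph. *)
have noM M : ~ pm_on (~: Z) M.
  move=> [M1 M2].
  pose N := M :|: [set he (o6 1); he (o6 3); he (o6 5)].
  have hN : perfect_matching N.
    apply: pm_intro => v; case: (boolP (v \in Z)) => vZ; last first.
      have /cards1P[x hx] : #|[set d : dart G | (dend d == v) && (d.1 \in M)]| == 1 by rewrite M1 ?inE.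
      have : x \in [set x] by rewrite set11. rewrite -hx inE => /andP[/eqP xv xM].
      exists x; first by rewrite inE xM.
      move=> y yv; rewrite in_setU => /orP[yM|]; first by apply/eqP; rewrite -in_set1 -hx inE yv eqxx.
      by rewrite !inE => /orP[/orP[]|] /eqP /heZ; rewrite yv (negbTE vZ).
    have /ZP[i vi] := vZ.
    have nM x : dend x = v -> x.1 \notin M.
      by move=> xv; apply/negP => /M2; rewrite xv inE vZ.
    have [j [x [jO xv xj nj]]] : exists (j : 'I_6) x,
       [/\ odd j, dend x = v, x.1 = he j & forall y k, dend y = v -> y.1 = he k -> odd k -> k = j].
      pose j := if odd i then i else pv i.
      have [b [h1 h2]] := hen j; have oj : odd j.
        rewrite /j; case: ifP => // /negbT; rewrite val_pv; move: i {vi j b h1 h2}; by apply: six_ind.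
      exists j, (if odd i then (he j, b) else flip (he j, b)); split=> //.
      - by rewrite /j in h1 h2 *; case: (odd i) h1 h2 => h1 h2; rewrite ?dend_flip ?h1 ?h2 ?pvK.
      - by case: (odd i).
      move=> y k yv yk ok; rewrite vi in yv.
      case: (hda _ _ yv) => [e|e|e].
      + by have := hdh i k; rewrite -e yk eqxx.
      + have := heI _ _ (etrans (esym yk) e) => ki; by rewrite /j -ki ok.
      have ki := heI _ _ (etrans (esym yk) e); rewrite /j; case: ifP => // oi.
      move: ok; rewrite ki val_pv; move: i oi {vi j h1 h2 oj yv e ki}; by apply: six_ind.
    exists x.
      split=> //; rewrite in_setU xj; apply/orP; right; move: j jO {xj nj}; apply: six_ind => // _;
      by rewrite !inE eqxx ?orbT.
    move=> y yv; rewrite in_setU (negbTE (nM _ yv)) /= => yN.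
    apply: (same_edge_dart tG cG); rewrite ?yv ?xv // xj.
    by move: yN; rewrite !inE => /orP[/orP[]|] /eqP e; rewrite e (nj _ _ yv e).
  have /is_arrayP pA := hA.
  pose F (k : 'I_4) := if val k is 3 then N else amem A (inord k).
  have pF k : perfect_matching (F k) by case: k => [[|[|[|[|k]]]] ltk] //; apply: pA.
  have FE (k : 'I_3) : F (widen_ord (isT : 3 <= 4) k) = amem A k.
    by move: k; apply: three_ind; rewrite /F /=; congr (amem A _); apply: val_inj; rewrite /= inordK.
  have [e he'] := nocov _ pF; have : e \in uncovered A.
    rewrite inE -leqn0 leqNgt; apply/negP => /cover_count_gt0[k].
    by rewrite -FE (negbTE (he' _)).
  by move=> eU; have := he' (@Ordinal 4 3 isT); rewrite /F /= in_setU -uncE eU orbT.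
have evZ : ~~ odd #|~: Z|.
  by have := even_vertices; rewrite -(cardsC Z) cZ oddD.
have b6 : #|bd Z| <= 6 by rewrite -chd subset_leq_card.
have [S [SZ ST comp3 bd6]] := barrier tG cG Z0 evZ b6 noM.
set T := ~: Z :\: S in ST comp3.
(* Six edges leave the hexagon by the equality in the barrier lemma, so every third dart leaves it
   and there is no chord. *)
have bdZE : bd Z = hd @: setT by apply/eqP; rewrite eqEcard bdZ chd bd6.
have hdT i : dother (hd i) \in T.
  have : hd i \in bd Z by rewrite bdZE imset_f.
  rewrite in_bd => /andP[_ oZ]; rewrite !inE oZ andbT; apply/negP => oS.
  by have := ST (flip (hd i)); rewrite dend_flip dother_flip => /(_ oS); rewrite hde !inE hvZ andbF.
have dst : [&& c (hd (o6 0)).1 != c (hd (o6 2)).1, c (hd (o6 0)).1 != c (hd (o6 4)).1 &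
            c (hd (o6 2)).1 != c (hd (o6 4)).1].
  apply/negPn/negP => h; apply: ncol; apply: (colour_hexagon cG bG hF pc).
  exact: hexext_two_equal.
case/and3P: dst => d02 d04 d24.
(* The pair of equal colours 01 yields a cut around the neighbours of the opposite hexagon vertices
   0 and 3. Rotation by four turns the pair 45 into a cut for 4 and 1, and rotation by two turns 23
   into a cut for 2 and 5. *)
have cut3 (j : 'I_3) : exists X, [/\ saturated Z S X, #|bd X| = 3 &
    forall i, md i = j -> dother (hd i) \in X].
  have oc h0 := @opposite_cut G tG cG Z S SZ ST comp3 _ _ _ c h0.
  have ZP2 v : reflect (exists i, v = hv (nx (nx i))) (v \in Z).
    apply: (iffP (ZP v)) => [[i ->]|[i ->]]; last by exists (nx (nx i)).
    by exists (pv (pv i)); rewrite !pvK.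
  have ZP4 v : reflect (exists i, v = hv (nx (nx (nx (nx i))))) (v \in Z).
    apply: (iffP (ZP v)) => [[i ->]|[i ->]]; last by exists (nx (nx (nx (nx i)))).
    by exists (pv (pv (pv (pv i)))); rewrite !pvK.
  have pc2 : proper_off (fun i => hv (nx (nx i))) c.
    by move=> x x' xx h; apply: pc => // i; have := h (pv (pv i)); rewrite !pvK.
  have pc4 : proper_off (fun i => hv (nx (nx (nx (nx i))))) c.
    by move=> x x' xx h; apply: pc => // i; have := h (pv (pv (pv (pv i)))); rewrite !pvK.
  move: j; apply: three_ind.
  - have [||X [h1 h2 h3 h4]] := oc _ _ _ hF ZP hdT pc ncol; first by [].
      by apply: six_ind => // _; rewrite -?c23 -?c45 eq_sym.
    by exists X; split=> //; apply: six_ind => // /eqP; rewrite mdE.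
  - have [||X [h1 h2 h3 h4]] := oc _ _ _ (hexframe_rot (hexframe_rot hF)) ZP4 (fun i => hdT _) pc4 ncol.
    + by rewrite !nxE.
    + by apply: six_ind => // _; rewrite !nxE -?c23 -?c01 // eq_sym.
    by rewrite !nxE in h3 h4; exists X; split=> //; apply: six_ind => // /eqP; rewrite mdE.
  have [||X [h1 h2 h3 h4]] := oc _ _ _ (hexframe_rot hF) ZP2 (fun i => hdT _) pc2 ncol.
  + by rewrite !nxE.
  + by apply: six_ind => // _; rewrite !nxE -?c01 -?c45 // eq_sym.
  by rewrite !nxE in h3 h4; exists X; split=> //; apply: six_ind => // /eqP; rewrite mdE.
have [X XP] := fin_all_exists cut3.
have XS j : saturated Z S (X j) by case: (XP j).
have X3 j : #|bd (X j)| = 3 by case: (XP j).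
have Xd i : dother (hd i) \in X (md i) by case: (XP (md i)) => _ _; apply.
have XZ j v : v \in X j -> v \notin Z.
  by case: (XS j) => h _ _ /(subsetP h); rewrite inE.
have hdI := hd_inj hF.
have fbd i j : md i = j -> flip (hd i) \in bd (X j).
  move=> <-; rewrite in_bd dend_flip dother_flip Xd /= hde; apply/negP => /XZ; by rewrite hvZ.
have twos (j : 'I_3) : exists i i' : 'I_6, [/\ i != i', md i = j, md i' = j & forall k, md k = j -> k = i \/ k = i'].
  move: j; apply: three_ind; [exists (o6 0), (o6 3)|exists (o6 1), (o6 4)|exists (o6 2), (o6 5)];
  by split; rewrite ?mdE //; apply: six_ind => // /eqP; rewrite mdE // => _; [left|right].
(* Two of these sets together send four edges to the hexagon, so the cut of their union exceeds
   three. *)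
have dis j j' : j != j' -> [disjoint X j & X j'].
  move=> jj; apply: (saturated_disjoint tG cG SZ ST comp3 Z0) => //.
  have [i [i' [ii m m' _]]] := twos j; have [k [k' [kk n n' _]]] := twos j'.
  apply: leq_trans (_ : #|[set flip (hd i); flip (hd i'); flip (hd k); flip (hd k')]| <= _).
    have ne a b : md a = j -> md b = j' -> (flip (hd a) == flip (hd b)) = false.
      by move=> ma mb; apply/eqP => /(@flip_inj G)/hdI e; rewrite -ma -mb e eqxx in jj.
    have nii : (flip (hd i) == flip (hd i')) = false by rewrite (inj_eq (@flip_inj G)) (inj_eq hdI) (negbTE ii).
    have nkk : (flip (hd k) == flip (hd k')) = false by rewrite (inj_eq (@flip_inj G)) (inj_eq hdI) (negbTE kk).
    by rewrite -!setUA !cardsU1 !inE cards1 nii nkk !ne.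
  apply/subset_leq_card/subsetP => x; rewrite !inE -!orbA => /or4P[] /eqP->;
  rewrite dend_flip dother_flip hde ?m ?m' ?n ?n'.
  + by have := Xd i; rewrite m => ->; apply/negP => /orP[] /XZ; rewrite hvZ.
  + by have := Xd i'; rewrite m' => ->; apply/negP => /orP[] /XZ; rewrite hvZ.
  + by have := Xd k; rewrite n => ->; rewrite orbT; apply/negP => /orP[] /XZ; rewrite hvZ.
  by have := Xd k'; rewrite n' => ->; rewrite orbT; apply/negP => /orP[] /XZ; rewrite hvZ.
have disj v j j' : v \in X j -> v \in X j' -> j = j'.
  move=> h1 h2; apply/eqP/negPn/negP => /dis/pred0P/(_ v) /=.
  by rewrite h1 h2.
(* Two of the three cut edges of [X j] run to the hexagon. The third ends in a barrier vertex
   outside all three sets: saturation would otherwise put its start into the same set as its end. *)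
have third j : exists r : dart G, [/\ r \in bd (X j), dother r \in S,
    forall j', dother r \notin X j' & forall x, x \in bd (X j) -> x = r \/ dother x \in Z].
  have [i [i' [ii m m' al]]] := twos j.
  have fi := fbd _ _ m; have fi' := fbd _ _ m'.
  have nii : flip (hd i) != flip (hd i') by rewrite (inj_eq (@flip_inj G)) (inj_eq hdI).
  have /cards1P[r hr] : #|bd (X j) :\ flip (hd i) :\ flip (hd i')| == 1.
    have := X3 j; rewrite (cardsD1 (flip (hd i))) fi (cardsD1 (flip (hd i'))) in_setD1 fi' eq_sym nii.
    by rewrite !add1n => -[->].
  have : r \in [set r] by rewrite set11.
  rewrite -hr !in_setD1 => /and3P[r1 r2 rb].
  have oZ : dother r \notin Z.
    apply/negP => /ZP[k hk].
    have e : r = flip (hd k).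
      exact: (bdT_hd (S := S) hF ZP (saturated_bd (XS j) rb) hk).
    have mk : md k = j.
      by apply: (disj (dother (hd k))) => //; move: rb; rewrite in_bd e dend_flip => /andP[].
    by case: (al k mk) => ek; rewrite e ek eqxx in r1 r2.
  have oS : dother r \in S.
    by have := bdT_other (saturated_bd (XS j) rb); rewrite (negbTE oZ) orbF.
  exists r; split=> //.
    move=> j'; apply/negP => oX; have [_ _ sS] := XS j'.
    have := sS (flip r); rewrite dend_flip dother_flip => /(_ oX oS) rX.
    have jj : j = j' by apply: (disj (dend r)) => //; move: rb; rewrite in_bd => /andP[].
    by move: rb; rewrite in_bd jj oX andbF.
  move=> x xb; case: (eqVneq x (flip (hd i))) => [->|x1]; first by right; rewrite dother_flip hde.
  case: (eqVneq x (flip (hd i'))) => [->|x2]; first by right; rewrite dother_flip hde.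
  by left; apply/eqP; rewrite -in_set1 -hr !in_setD1 x1 x2.
have [r rP] := fin_all_exists third.
pose p v : gV P6 := if [pick i | v == hv i] is Some i then inl i else inr [pick j | v \in X j].
have phv i : p (hv i) = inl i.
  by rewrite /p; case: pickP => [j /eqP/hvI ->|/(_ i)] //; rewrite eqxx.
have pZ v : v \notin Z -> p v = inr [pick j | v \in X j].
  move=> vZ; rewrite /p; case: pickP => [j /eqP h|//]; by rewrite h hvZ in vZ.
have pX v j : v \in X j -> p v = inr (Some j).
  move=> vX; rewrite pZ ?(XZ j) //; case: pickP => [j' h|/(_ j)]; last by rewrite vX.
  by rewrite (disj _ _ _ h vX).
have pW v : v \notin Z -> (forall j, v \notin X j) -> p v = inr None.
  by move=> vZ vX; rewrite pZ //; case: pickP => // j h; have := vX j; rewrite h.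
have pP v : [\/ exists2 i, v = hv i & p v = inl i, exists2 j, v \in X j & p v = inr (Some j) |
   [/\ v \notin Z, forall j, v \notin X j & p v = inr None]].
  case: (boolP (v \in Z)) => [/ZP[i ->]|vZ]; first by constructor 1; exists i.
  case: (pickP (fun j => v \in X j)) => [j h|h]; first by constructor 2; exists j; rewrite ?(pX _ j).
  have {}h j : v \notin X j by rewrite h.
  by constructor 3; rewrite pW.
have [hx hxP] : exists hx : 'I_6 -> bool, forall i, dend (G := G) (he i, hx i) = hv i /\ dother (G := G) (he i, hx i) = hv (nx i).
  by apply: (fin_all_exists (P := fun i b => dend (G := G) (he i, b) = hv i /\ dother (G := G) (he i, b) = hv (nx i))).
pose io (e : gE P6) : dart G := match e with
  | inl i => (he i, hx i) | inr (inl i) => hd i | inr (inr j) => r j end.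
have rX j : dend (r j) \in X j by case: (rP j); rewrite in_bd => /andP[].
have ends e : p (dend (io e)) = (gends e).1 /\ p (dother (io e)) = (gends e).2.
  case: e => [i|[i|j]] /=.
  - by have [-> ->] := hxP i; rewrite !phv.
  - by rewrite hde phv (pX _ (md i)).
  have [rb rS rN _] := rP j; rewrite (pX _ j) // pW //.
  exact: (S_notZ SZ rS).
have fromZ x : dend x \in Z -> exists e, (io e).1 = x.1.
  move=> /ZP[i hi]; case: (hda _ _ hi) => h; first by exists (inr (inl i)); rewrite h.
    by exists (inl i); rewrite h.
  by exists (inl (pv i)); rewrite h.
have fromX x j : dend x \in X j -> dother x \notin X j -> exists e, (io e).1 = x.1.
  move=> h1 h2; have [_ _ _ /(_ x)] := rP j; rewrite in_bd h1 h2 => /(_ isT) [->|oZ].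
    by exists (inr (inr j)).
  by apply: (fromZ (flip x)).
have sk : skeleton p io.
  split; [by move=> e; case: (ends e)|by move=> e; case: (ends e)|].
  move=> x; case: (boolP (dend x \in Z)) => [/fromZ //|dZ].
  case: (boolP (dother x \in Z)) => [/(fromZ (flip x)) //|oZ].
  case: (pickP (fun j => dend x \in X j)) => [j dX|dX].
    case: (boolP (dother x \in X j)) => [oX|oX _]; last exact: fromX oX.
    by rewrite !(pX _ j) ?eqxx.
  case: (pickP (fun j => dother x \in X j)) => [j oX _|oX].
    by apply: (fromX (flip x) j); rewrite ?dend_flip ?dother_flip // dX.
  by rewrite !pW ?eqxx // => j; rewrite ?dX ?oX.
have pWE v : p v = inr None -> v \notin Z /\ forall j, v \notin X j.
  by case: (pP v) => [[i _ ->]|[j _ ->]|[]].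
(* The centre of the skeleton stands for everything outside the hexagon and the three sets; the
   barrier vertices there form its bipartising set. *)
exists p, io, c, (S :&: fibre p (inr None)); split=> //.
- move=> v v' i; case: (pP v) => [[k -> ->]|[j _ ->]|[_ _ ->]] // [->].
  by case: (pP v') => [[k' -> ->]|[j _ ->]|[_ _ ->]] // [->].
- move=> x x' xx xh; apply: pc => // i; apply: contraNneq (xh i) => ->; by rewrite phv.
have UT v : v \in fibre p (inr None) :\: (S :&: fibre p (inr None)) -> v \in T.
  rewrite inE [v \in fibre _ _]inE => /andP[vS /eqP h]; have [vZ _] := pWE _ h.
  by move: vS; rewrite !inE h eqxx andbT vZ => ->.
have exitW x : p (dend x) = inr None -> p (dother x) != inr None -> dend x \in S.
  move=> h1 h2; have [|e he1] := sk_all sk (x := x); first by rewrite h1 eq_sym.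
  have [e1 e2] := ends e; have [h|h] := dart_eq_edge he1.
    by move: e1; rewrite -h h1; case: e {he1 e2 h} => [i|[i|j]].
  rewrite h dend_flip in h1 *; move: h1; rewrite e2.
  by case: e {he1 e1 e2 h} => [i|[i|j]] //= _; case: (rP j).
split.
- exact: subsetIr.
- move=> x; rewrite inE => /andP[/ST xT _]; rewrite inE.
  by have := T_notS xT => /negbTE->.
- by move=> x h1 h2; rewrite inE exitW // inE h1 eqxx.
move=> v vW vU; rewrite (@component_closed _ _ T).
- by apply: comp3; apply: UT; rewrite in_setD vU inE vW eqxx.
- by apply/subsetP => w; apply: UT.
- move=> u w uA wT /eadjP[x [xu xw]]; have uT := UT _ uA.
  have wS := T_notS wT; rewrite !inE (negbTE wS) /=; apply/negPn/negP => pw.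
  move: (uA); rewrite in_setD [u \in fibre _ _]inE => /andP[_ /eqP pu].
  have : u \in S by rewrite -xu; apply: exitW; rewrite ?xu ?xw.
  by rewrite (negbTE (T_notS uT)).
by rewrite in_setD vU inE vW eqxx.
Qed.
End Stage1.

Lemma P6_simple (a b : gE P6) : ueq (gends a) (gends b) -> a = b.
Proof.
have nn i : nx (nx i) <> i by move: i; apply: six_ind; rewrite !nxE => /(congr1 val).
case: a => [i|[i|j]]; case: b => [i'|[i'|j']]; move=> /orP[] /eqP[] //.
- by move=> ->.
- by move=> -> /nn.
- by move=> ->.
- by move=> ->.
Qed.

Lemma P6_noloop (d : dart P6) : dend d != dother d.
Proof.
have nn i : inl (nx i) != inl i :> 'I_6 + option 'I_3.
  by apply/eqP => -[]; move: i; apply: six_ind; rewrite nxE => /(congr1 val).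
by case: d => [[i|[i|j]] []]; rewrite /dother /dend //= eq_sym.
Qed.

Lemma P6_rim_darts (d : dart P6) i : dend d = inl i ->
  [\/ d = (inl i, true), d = (inl (pv i), false) | d = (inr (inl i), true)].
Proof.
case: d => [[k|[k|k]] []] //= [] h; rewrite -h ?nxK; by [constructor 1|constructor 2|constructor 3].
Qed.

Lemma P6_leaf_darts (d : dart P6) j : dend d = inr (Some j) ->
  (exists2 i, md i = j & d = (inr (inl i), false)) \/ d = (inr (inr j), true).
Proof. by case: d => [[k|[k|k]] []] //= [] h; [left; exists k|right; rewrite -h]. Qed.

Lemma P6_centre_darts (d : dart P6) : dend d = inr None -> exists j, d = (inr (inr j), false).
Proof. by case: d => [[k|[k|k]] []] //= _; exists k. Qed.

Lemma mdP (i i' : 'I_6) : md i = md i' -> i' = i \/ i' = nx (nx (nx i)).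
Proof.
move: i i'; apply: six_ind; apply: six_ind; rewrite ?mdE ?nxE => // /(congr1 val) // _;
by [left|right].
Qed.
Lemma md_nx3 i : md (nx (nx (nx i))) = md i.
Proof. by move: i; apply: six_ind; rewrite !nxE !mdE. Qed.
Lemma ex_md j : exists i, md i = j.
Proof. by move: j; apply: three_ind; [exists (o6 0)|exists (o6 1)|exists (o6 2)]; rewrite mdE. Qed.
Lemma nx3_neq i : nx (nx (nx i)) != i.
Proof. by move: i; apply: six_ind; rewrite !nxE. Qed.

(** * Lifting matchings of the skeleton to the graph *)

Section SkeletonTheory.
Variables (G : mgraph) (p : gV G -> gV P6) (io : gE P6 -> dart G).
Hypothesis sk : skeleton p io.

Definition iod (d : dart P6) : dart G := if d.2 then io d.1 else flip (io d.1).

Lemma iod_flip d : iod (flip d) = flip (iod d).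
Proof. by case: d => e []; rewrite /iod /= ?flipK. Qed.
Lemma iod_end d : p (dend (iod d)) = dend d.
Proof. by case: d => e []; rewrite /iod /= ?dend_flip ?(sk_end sk) ?(sk_other sk). Qed.
Lemma iod_other d : p (dother (iod d)) = dother d.
Proof. by rewrite -dend_flip -iod_flip iod_end. Qed.
Lemma iod_edge d : (iod d).1 = (io d.1).1.
Proof. by case: d => e []. Qed.

Lemma io_edge_inj a b : (io a).1 = (io b).1 -> a = b.
Proof.
move=> h; apply: P6_simple.
have ga : gends a = (p (dend (io a)), p (dother (io a))).
  by rewrite (sk_end sk) (sk_other sk); case: (gends a).
have gb : gends b = (p (dend (io b)), p (dother (io b))).
  by rewrite (sk_end sk) (sk_other sk); case: (gends b).
rewrite ga gb /ueq; have [->|->] := dart_eq_edge h; first by rewrite eqxx.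
by rewrite dend_flip dother_flip eqxx orbT.
Qed.

Lemma iod_inj : injective iod.
Proof.
move=> d d' h; have e : d.1 = d'.1 by apply: io_edge_inj; rewrite -!iod_edge h.
have [//|h'] := dart_eq_edge e; have := P6_noloop d.
by rewrite -(iod_end d) h h' iod_end dend_flip eqxx.
Qed.

Lemma skel_dart (x : dart G) : p (dend x) != p (dother x) -> exists d, iod d = x.
Proof.
move=> /(sk_all sk)[e he]; have [->|->] := dart_eq_edge he; first by exists (e, true).
by exists (e, false).
Qed.

Lemma bd_fibre y : bd (fibre p y) = iod @: [set d | dend d == y].
Proof.
apply/setP => x; rewrite in_bd !inE; apply/andP/imsetP => [[/eqP h1 h2]|[d]].
  have [|d hd] := @skel_dart x; first by rewrite h1 eq_sym.
  by exists d; rewrite // inE -iod_end hd h1.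
by rewrite inE => /eqP <- ->; rewrite iod_end iod_other eqxx eq_sym P6_noloop.
Qed.

Lemma P6_deg y : #|[set d : dart P6 | dend d == y]| = 3.
Proof.
case: y => [i|[j|]].
- have -> : [set d : dart P6 | dend d == inl i] = [set (inl i, true); (inl (pv i), false); (inr (inl i), true)].
    apply/setP => d; rewrite !inE; apply/eqP/idP => [/P6_rim_darts[] ->|]; rewrite ?eqxx ?orbT //.
    by move=> /orP[/orP[]|] /eqP-> //; rewrite /dend /= pvK.
  by rewrite -setUA !cardsU1 !inE cards1 !xpair_eqE /= !andbF.
- have [i mi] := ex_md j.
  have -> : [set d : dart P6 | dend d == inr (Some j)] =
     [set (inr (inl i), false); (inr (inl (nx (nx (nx i)))), false); (inr (inr j), true)].
    apply/setP => d; rewrite !inE; apply/eqP/idP => [/P6_leaf_darts[[k mk ->]|->]|]; rewrite ?eqxx ?orbT //.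
      by have [->|->] := mdP (etrans mi (esym mk)); rewrite eqxx ?orbT.
    by move=> /orP[/orP[]|] /eqP-> //; rewrite /dend /= ?md_nx3 mi.
  rewrite -setUA !cardsU1 !inE cards1 /=.
  have /negbTE n3 := nx3_neq i.
  by rewrite !xpair_eqE /= andbT (_ : (inr (inl i) == inr (inl (nx (nx (nx i)))) :> 'I_6 + ('I_6 + 'I_3)) = false) //
    -[LHS]/(i == _) eq_sym.
have -> : [set d : dart P6 | dend d == inr None] = (fun j => (inr (inr j), false)) @: [set: 'I_3].
  apply/setP => d; rewrite inE; apply/eqP/imsetP => [/P6_centre_darts[j ->]|[j _ ->]] //.
  by exists j.
by rewrite card_imset ?cardsT ?card_ord // => j j' [].
Qed.

Lemma card_bd_fibre y : #|bd (fibre p y)| = 3.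
Proof. by rewrite bd_fibre card_imset ?P6_deg //; apply: iod_inj. Qed.

Hypotheses (tG : twoconn G) (cG : cubic G).
Variable c : gE G -> 'I_3.
Hypothesis rim1 : forall v v' i, p v = inl i -> p v' = inl i -> v = v'.
Hypothesis pc : forall x x' : dart G, dend x = dend x' -> (forall i, p (dend x) != inl i) ->
  c x.1 = c x'.1 -> x = x'.

Definition nonrim (y : gV P6) := if y is inl _ then false else true.
Lemma pcn (x x' : dart G) : dend x = dend x' -> nonrim (p (dend x)) -> c x.1 = c x'.1 -> x = x'.
Proof. by move=> xx nr; apply: pc => // i; apply: contraTneq nr => ->. Qed.

Lemma fibre_colours y : nonrim y ->
  (forall k, exists2 d, dend d = y & c (iod d).1 = k) /\
  (forall d d', dend d = y -> dend d' = y -> c (iod d).1 = c (iod d').1 -> d = d').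
Proof.
move=> ny.
have [|h1 h2] := @cut3_colours G tG cG (fun v => nonrim (p v)) c pcn (fibre p y) _ (card_bd_fibre y).
  by move=> v; rewrite inE => /eqP->.
have mem d : dend d = y -> iod d \in bd (fibre p y).
  by move=> dy; rewrite bd_fibre imset_f // inE dy.
split=> [k|d d' dy dy' e]; last by apply: iod_inj; apply: h2 => //; apply: mem.
have [x + <-] := h1 k; rewrite bd_fibre => /imsetP[d]; rewrite inE => /eqP dy ->.
by exists d.
Qed.

(* A matching [N] of the skeleton is lifted to [G]; inside the fibre of [y] the edges in [s y] are used. *)
Definition lift (N : pred (gE P6)) (s : gV P6 -> pred (gE G)) : {set gE G} :=
  [set e | [exists a, (e == (io a).1) && N a] ||
     (p (gends e).1 == p (gends e).2) && s (p (gends e).1) e].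

Lemma liftE N s (x : dart G) : (x.1 \in lift N s) =
  if p (dend x) == p (dother x) then s (p (dend x)) x.1
  else [exists d, (iod d == x) && N d.1].
Proof.
have gE : p (gends x.1).1 == p (gends x.1).2 = (p (dend x) == p (dother x)).
  by case: x => e []; rewrite /dother /dend //= eq_sym.
rewrite inE gE; case: ifP => [/eqP xx|nx].
  have -> : p (gends x.1).1 = p (dend x).
    move/eqP: xx; rewrite -gE => /eqP; case: x {gE} => e []; rewrite /dend //=.
  rewrite /= (_ : [exists a, _] = false) //; apply/negbTE/negP => /existsP[a /andP[/eqP h _]].
  have := P6_noloop (a, true); rewrite -iod_end -iod_other /iod /=.
  by have [->|->] := dart_eq_edge h; rewrite ?dend_flip ?dother_flip xx eqxx.
rewrite andFb orbF; apply/existsP/existsP => [[a /andP[/eqP h Na]]|[d /andP[/eqP <- Nd]]].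
  have [d hd] : exists d, iod d = x by apply: skel_dart; rewrite nx.
  exists d; rewrite hd eqxx; suff -> : d.1 = a by [].
  by apply: io_edge_inj; rewrite -iod_edge hd.
by exists d.1; rewrite iod_edge eqxx.
Qed.

Definition single (N : pred (gE P6)) y := exists2 d : dart P6, dend d = y /\ N d.1 &
  forall d', dend d' = y -> N d'.1 -> d' = d.

(** If [N] meets [y] in a single edge, this is the colour class of the corresponding exit. *)
Definition colour_sel (N : pred (gE P6)) (y : gV P6) : pred (gE G) :=
  fun e => [exists d : dart P6, [&& dend d == y, N d.1 & c e == c (iod d).1]].

(** At a vertex of a blown-up fibre exactly one edge has the colour of the exit chosen by [N]. If
    that edge is itself an exit it is the chosen one, as the three exits have distinct colours. Rim
    fibres are single vertices. *)
Lemma lift_single N s v : single N (p v) -> s (p v) =1 colour_sel N (p v) ->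
  exists2 x, dend x = v /\ x.1 \in lift N s &
    forall y, dend y = v -> y.1 \in lift N s -> y = x.
Proof.
move=> [d [dy Nd] ud] hs.
have selE e : s (p v) e = (c e == c (iod d).1).
  rewrite hs /colour_sel; apply/existsP/eqP => [[d' /and3P[/eqP h1 h2 /eqP ->]]|e1].
    by rewrite (ud d').
  by exists d; rewrite dy Nd e1 !eqxx.
have ext x : dend x = v -> p (dend x) != p (dother x) -> (x.1 \in lift N s) = (x == iod d).
  move=> xv nx; rewrite liftE (negbTE nx); apply/existsP/eqP => [[d' /andP[/eqP h1 h2]]|->].
    by rewrite -h1 (ud d') // -iod_end h1 xv.
  by exists d; rewrite eqxx.
case nr: (nonrim (p v)); last first.
  case pv: (p v) nr => [i|o] // _.
  have vd : dend (iod d) = v by apply: (rim1 (i := i)); rewrite ?iod_end ?dy.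
  have nin x : dend x = v -> p (dend x) != p (dother x).
    move=> xv; apply/eqP => h; have := no_loop x cG (proj2 tG).
    by rewrite (rim1 (v := dend x) (v' := dother x) (i := i)) ?eqxx // -?h xv.
  exists (iod d); first by rewrite ext ?nin // eqxx.
  by move=> y yv; rewrite ext ?nin // => /eqP.
have [x xv xk] := @vertex_colour G tG cG (fun v => nonrim (p v)) c pcn v (c (iod d).1) nr.
have inE' z : dend z = v -> (z.1 \in lift N s) = (c z.1 == c (iod d).1).
  move=> zv; case: (boolP (p (dend z) == p (dother z))) => h.
    by rewrite liftE h zv selE.
  rewrite ext //; apply/eqP/eqP => [-> //|e1].
  have [d' hd'] := skel_dart h; rewrite -hd' in e1 *; congr iod.
  apply: (proj2 (fibre_colours nr)) => //.
  by rewrite -iod_end hd' zv.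
exists x; first by rewrite inE' // xk.
by move=> y yv; rewrite inE' // => /eqP yk; apply: pcn; rewrite ?yv ?xv ?xk.
Qed.

End SkeletonTheory.

Lemma pv0 : pv (o6 0) = o6 5. Proof. by rewrite -nx5 nxK. Qed.
Lemma pv1 : pv (o6 1) = o6 0. Proof. by rewrite -nx0 nxK. Qed.
Lemma pv2 : pv (o6 2) = o6 1. Proof. by rewrite -nx1 nxK. Qed.
Lemma pv3 : pv (o6 3) = o6 2. Proof. by rewrite -nx2 nxK. Qed.
Lemma pv4 : pv (o6 4) = o6 3. Proof. by rewrite -nx3 nxK. Qed.
Lemma pv5 : pv (o6 5) = o6 4. Proof. by rewrite -nx4 nxK. Qed.
Definition pvE := (pv0, pv1, pv2, pv3, pv4, pv5).

Lemma single_rim (N : pred (gE P6)) i : N (inl i) + N (inl (pv i)) + N (inr (inl i)) = 1 -> single N (inl i).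
Proof.
case E1: (N (inl i)); case E2: (N (inl (pv i))); case E3: (N (inr (inl i))) => // _.
- exists (inl i, true) => // d /P6_rim_darts[] -> //=; by rewrite ?E2 ?E3.
- exists (inl (pv i), false); first by rewrite /dend /= pvK.
  by move=> d /P6_rim_darts[] -> //=; rewrite ?E1 ?E3.
exists (inr (inl i), true) => // d /P6_rim_darts[] -> //=; by rewrite ?E1 ?E2.
Qed.

Lemma single_leaf (N : pred (gE P6)) i : N (inr (inl i)) + N (inr (inl (nx (nx (nx i))))) + N (inr (inr (md i))) = 1 ->
  single N (inr (Some (md i))).
Proof.
case E1: (N (inr (inl i))); case E2: (N (inr (inl (nx (nx (nx i)))))); case E3: (N (inr (inr (md i)))) => // _.
- exists (inr (inl i), false) => // d /P6_leaf_darts[[k /esym/mdP[] -> ->]| ->] //=; by rewrite ?E2 ?E3.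
- exists (inr (inl (nx (nx (nx i)))), false); first by rewrite /dend /= md_nx3.
  by move=> d /P6_leaf_darts[[k /esym/mdP[] -> ->]| ->] //=; rewrite ?E1 ?E3.
exists (inr (inr (md i)), true) => // d /P6_leaf_darts[[k /esym/mdP[] -> ->]| ->] //=; by rewrite ?E1 ?E2.
Qed.

Lemma single_centre (N : pred (gE P6)) : N (inr (inr (o3 0))) + N (inr (inr (o3 1))) + N (inr (inr (o3 2))) = 1 ->
  single N (inr None).
Proof.
case E1: (N (inr (inr (o3 0)))); case E2: (N (inr (inr (o3 1)))); case E3: (N (inr (inr (o3 2)))) => // _;
[exists (inr (inr (o3 0)), false)|exists (inr (inr (o3 1)), false)|exists (inr (inr (o3 2)), false)] => // d /P6_centre_darts[j ->] /=;
move: j; apply: three_ind => //; by rewrite ?E1 ?E2 ?E3.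
Qed.

Definition edges_of (h s r : seq nat) : pred (gE P6) := fun e =>
  match e with inl i => val i \in h | inr (inl i) => val i \in s | inr (inr j) => val j \in r end.

(* Four edge sets covering the Petersen graph; the first three are perfect matchings, the
   last one meets the leaf [Some 0] three times and every other vertex once. *)
Definition cover4 (k : 'I_4) : pred (gE P6) :=
  match val k with
  | 0 => edges_of [:: 3; 5] [:: 1; 2] [:: 0]
  | 1 => edges_of [:: 0; 4] [:: 3; 2] [:: 1]
  | 2 => edges_of [:: 2; 4] [:: 1; 0] [:: 2]
  | _ => edges_of [:: 1] [:: 0; 3; 5; 4] [:: 0]
  end.
Notation o4 k := (@Ordinal 4 k isT).

Lemma four_ind (P : 'I_4 -> Prop) : P (o4 0) -> P (o4 1) -> P (o4 2) -> P (o4 3) -> forall i, P i.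
Proof. by move=> p0 p1 p2 p3 [[|[|[|[|i]]]] lti] //; rewrite (bool_irrelevance lti isT). Qed.

Lemma cover4_single k y : (k != o4 3) || (y != inr (Some (o3 0))) -> single (cover4 k) y.
Proof.
case: y => [i|[j|]] h.
- by apply: single_rim; move: k i {h}; apply: four_ind; apply: six_ind; rewrite pvE.
- have [i mi] : exists2 i : 'I_6, i < 3 & md i = j.
    by move: j {h}; apply: three_ind; [exists (o6 0)|exists (o6 1)|exists (o6 2)]; rewrite ?mdE.
  move=> mj; rewrite -mj in h *; apply: single_leaf; move: k i h mi {j mj}.
  by apply: four_ind; apply: six_ind; rewrite !nxE !mdE.
by apply: single_centre; move: k {h}; apply: four_ind.
Qed.

Lemma cover4_cover e : exists k, cover4 k e.
Proof.
case: e => [i|[i|j]]; [move: i; apply: six_ind|move: i; apply: six_ind|move: j; apply: three_ind];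
by (exists (o4 0) + exists (o4 1) + exists (o4 2) + exists (o4 3)).
Qed.

(** In the fibre of this leaf the fourth edge set will not be a colour class, so all three colours
    have to be supplied by the first three matchings. *)
Lemma cover4_leaf (d : dart P6) : dend d = inr (Some (o3 0)) -> exists2 k, k != o4 3 & cover4 k d.1.
Proof.
case/P6_leaf_darts => [[i mi ->]| ->]; last by exists (o4 0).
move: i mi; apply: six_ind; rewrite mdE => /(congr1 val) // _; [exists (o4 2)|exists (o4 1)] => //.
Qed.

(** [rotE] is the edge part of a rotation of order three, and [rotV] the inverse of its vertex part.
    In this form [p] followed by [rotV] and [io] preceded by [rotE] are again a skeleton. *)
Definition rotV (y : gV P6) : gV P6 := match y with
  inl i => inl (pv (pv i)) | inr (Some j) => inr (Some (inord ((j + 1) %% 3))) | inr None => inr None end.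
Definition rotE (e : gE P6) : gE P6 := match e with
  inl i => inl (nx (nx i)) | inr (inl i) => inr (inl (nx (nx i))) | inr (inr j) => inr (inr (inord ((j + 2) %% 3))) end.
Definition s1 (j : 'I_3) : 'I_3 := inord ((j + 1) %% 3).
Lemma s1E : (s1 (o3 0) = o3 1) * (s1 (o3 1) = o3 2) * (s1 (o3 2) = o3 0).
Proof. by split; [split|]; apply: val_inj; rewrite /= inordK. Qed.
Lemma s2E : (inord ((o3 0 + 2) %% 3) = o3 2) * (inord ((o3 1 + 2) %% 3) = o3 0) * (inord ((o3 2 + 2) %% 3) = o3 1).
Proof. by split; [split|]; apply: val_inj; rewrite /= inordK. Qed.

Lemma rotVE e : rotV (gends (rotE e)).1 = (gends e).1 /\ rotV (gends (rotE e)).2 = (gends e).2.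
Proof.
case: e => [i|[i|j]] /=; rewrite ?nxK //; split=> //; congr (inr (Some _)).
  by move: i; apply: six_ind; rewrite !nxE !mdE -/(s1 _) s1E.
by move: j; apply: three_ind; rewrite s2E -/(s1 _) s1E.
Qed.

Lemma rotV1 : rotV (inr (Some (o3 1))) = inr (Some (o3 2)).
Proof. by rewrite /rotV -/(s1 _) s1E. Qed.
Lemma rotV2 : rotV (inr (Some (o3 2))) = inr (Some (o3 0)).
Proof. by rewrite /rotV -/(s1 _) s1E. Qed.

Lemma rotV_inj : injective rotV.
Proof.
have s1I : injective s1.
  by apply: three_ind; apply: three_ind => //; rewrite !s1E => /(congr1 val).
case=> [i|[j|]] [i'|[j'|]] //=; first by move=> [/(can_inj pvK)/(can_inj pvK) ->].
by move=> [/s1I ->].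
Qed.

Lemma rotE_surj e : exists e', rotE e' = e.
Proof.
case: e => [i|[i|j]]; [exists (inl (pv (pv i)))|exists (inr (inl (pv (pv i))))|exists (inr (inr (s1 j)))].
- by rewrite /= !pvK.
- by rewrite /= !pvK.
by rewrite /=; congr (inr (inr _)); move: j; apply: three_ind; rewrite s1E s2E.
Qed.

(** * The pieces attached to opposite hexagon vertices *)

Section Leaf.
Variables (G : mgraph) (c : gE G -> 'I_3).
Hypotheses (tG : twoconn G) (cG : cubic G) (nocov : no_4cover G).

Definition coloured_skeleton (p : gV G -> gV P6) (io : gE P6 -> dart G) :=
  [/\ skeleton p io, forall v v' i, p v = inl i -> p v' = inl i -> v = v' &
     forall x x', dend x = dend x' -> (forall i, p (dend x) != inl i) -> c x.1 = c x'.1 -> x = x' :> dart G].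

(** The implication holds for every exit of the fibre, so exits count as chosen: [M] matches the
    vertices of the fibre that carry no exit, and the three exits start at different vertices. *)
Definition meets_once (p : gV G -> gV P6) (y : gV P6) (M : pred (gE G)) :=
  forall v, p v = y -> exists2 x : dart G, dend x = v /\ ((p (dend x) == p (dother x)) ==> M x.1) &
    forall x', dend x' = v -> (p (dend x') == p (dother x')) ==> M x'.1 -> x' = x.

Lemma rot_skeleton p io : coloured_skeleton p io ->
  coloured_skeleton (fun v => rotV (p v)) (fun e => io (rotE e)).
Proof.
move=> [[s1 s2 s3] r1 pc]; split; first split.
- by move=> e; rewrite s1; case: (rotVE e).
- by move=> e; rewrite s2; case: (rotVE e).
- move=> x; rewrite (inj_eq rotV_inj) => /s3[e he]; have [e' ee] := rotE_surj e.
  by exists e'; rewrite ee.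
- move=> v v' i h h'; have [i' e] : exists i', p v = inl i' by case: (p v) h => [i'|[j|]] //; exists i'.
  by apply: (r1 _ _ i') => //; apply: rotV_inj; rewrite h' -e.
move=> x x' xx h; apply: pc => // i; apply: contraNneq (h (pv (pv i))) => ->; exact: eqxx.
Qed.

(** Lift the four sets of [cover4], using [M] for the last one in the fibre of the leaf, where it
    takes all three exits. All four lifts are perfect matchings. They cover the graph, since an
    inner edge of a fibre has the colour of some exit and is taken with it. *)
Lemma no_3matching0 p io M : coloured_skeleton p io -> ~ meets_once p (inr (Some (o3 0))) M.
Proof.
move=> [sk r1 pc] hM; set y0 := inr (Some (o3 0)) in hM.
pose s (k : 'I_4) (y : gV P6) : pred (gE G) :=
  if (k == o4 3) && (y == y0) then M else colour_sel io c (cover4 k) y.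
have pm k : perfect_matching (lift p io (cover4 k) (s k)).
  apply: pm_intro => v; case: (boolP ((k == o4 3) && (p v == y0))) => [/andP[/eqP k3 /eqP pv]|h].
    have mE x : dend x = v -> (x.1 \in lift p io (cover4 k) (s k)) = ((p (dend x) == p (dother x)) ==> M x.1).
      move=> xv; rewrite (liftE sk); case: ifP => [xx|/negbT nx]; first by rewrite /s k3 eqxx xv pv eqxx.
      have [d hd] := skel_dart sk nx; apply/existsP; exists d; rewrite hd eqxx /=.
      have : dend d = y0 by rewrite -(iod_end sk) hd xv.
      rewrite k3; case/P6_leaf_darts => [[i mi ->]| ->] //=.
      by move: i mi; apply: six_ind; rewrite mdE => /(congr1 val).
    have [x [xv xM] ux] := hM v pv; exists x; first by rewrite mE.
    by move=> x' xv'; rewrite mE //; apply: ux.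
  apply: (lift_single sk tG cG r1 pc).
    by apply: cover4_single; rewrite -negb_and.
  by move=> e; rewrite /s (negbTE h).
have [e he] := nocov pm.
pose x : dart G := (e, true).
case: (boolP (p (dend x) == p (dother x))) => [xx|nx].
  have ny : nonrim (p (dend x)).
    case E1: (p (dend x)) => [i|//]; have := no_loop x cG (proj2 tG).
    by rewrite (r1 (dend x) (dother x) i) ?eqxx // -(eqP xx).
  have [d dy dc] := proj1 (fibre_colours sk tG cG pc ny) (c e).
  have [k kd k0] : exists2 k, cover4 k d.1 & ~~ ((k == o4 3) && (p (dend x) == y0)).
    case: (eqVneq (p (dend x)) y0) => h; last by have [k hk] := cover4_cover d.1; exists k; rewrite ?andbF.
    by have [|k k3 hk] := @cover4_leaf d; [rewrite dy | exists k; rewrite // (negbTE k3)].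
  have /negP := he k; apply; have -> : e = x.1 by [].
  rewrite (liftE sk) xx /s (negbTE k0); apply/existsP; exists d.
  by rewrite dy kd dc !eqxx.
have [d hd] := skel_dart sk nx; have [k hk] := cover4_cover d.1.
have /negP := he k; apply; have -> : e = x.1 by [].
by rewrite (liftE sk) (negbTE nx); apply/existsP; exists d; rewrite hd eqxx.
Qed.

Lemma no_3matching p io M j : coloured_skeleton p io -> ~ meets_once p (inr (Some j)) M.
Proof.
move=> cs.
have tr q y : meets_once q y M -> meets_once (fun v => rotV (q v)) (rotV y) M.
  move=> h v /rotV_inj /h[x [xv xM] ux]; exists x; first by rewrite (inj_eq rotV_inj).
  by move=> x' xv'; rewrite (inj_eq rotV_inj); apply: ux.
move: j; apply: three_ind.
- exact: no_3matching0 cs.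
- move/tr/tr; rewrite rotV1 rotV2; apply: no_3matching0.
  exact: rot_skeleton (rot_skeleton cs).
move/tr; rewrite rotV2; apply: no_3matching0.
exact: rot_skeleton cs.
Qed.
End Leaf.

Lemma cards3P (T : finType) (A : {set T}) : #|A| = 3 -> exists x y z,
  A = [set x; y; z] /\ [&& x != y, x != z & y != z].
Proof.
move=> h; have /card_gt0P[x xA] : 0 < #|A| by rewrite h.
move: h; rewrite (cardsD1 x) xA add1n => -[h].
have /card_gt0P[y yA] : 0 < #|A :\ x| by rewrite h.
move: h; rewrite (cardsD1 y) yA add1n => -[/eqP/cards1P[z hz]].
have zA : z \in A :\ x :\ y by rewrite hz set11.
exists x, y, z; split.
  by rewrite -(setD1K xA) -(setD1K yA) hz setUA.
move: yA zA; rewrite !inE => /andP[yx _] /and3P[zy zx _].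
by rewrite eq_sym yx eq_sym zx eq_sym zy.
Qed.

Section LeafCases.
Variables (G : mgraph) (p : gV G -> gV P6) (io : gE P6 -> dart G) (y : gV P6).
Hypotheses (tG : twoconn G) (cG : cubic G) (sk : skeleton p io).
Hypothesis no3 : forall M, ~ meets_once p y M.
Notation X := (fibre p y).
Implicit Types (x : dart G) (v : gV G).

(** The piece is a cubic vertex [a] carrying two of the exits, while on the way to its third exit
    [d0] an edge-deleted graph has been inserted; [d3] is the dart from [a] into it. *)
Definition inserted_fibre (a : gV G) (d0 : dart P6) (d3 : dart G) :=
  [/\ p a = y, dend d0 = y, dend d3 = a,
      p (dother d3) = y /\ dother d3 != a &
      dend (iod io d0) != a /\ forall d, dend d = y -> d != d0 -> dend (iod io d) = a].

(** If the third dart at the common start [a] is the third exit, connectivity leaves no room for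
    other vertices; otherwise it stays in the fibre and an insertion is visible. *)
Lemma two_exits_at e1 e2 e3 : [set d : dart P6 | dend d == y] = [set e1; e2; e3] -> e1 != e2 ->
  e1 != e3 -> e2 != e3 -> dend (iod io e1) = dend (iod io e2) ->
  (exists a, X = [set a]) \/ exists a d0 d3, inserted_fibre a d0 d3.
Proof.
move=> eE n12 n13 n23 a12; set a := dend (iod io e1) in a12.
have ey e : e \in [set e1; e2; e3] -> dend e = y by rewrite -eE inE => /eqP.
have y1 : dend e1 = y by apply: ey; rewrite !inE eqxx.
have y2 : dend e2 = y by apply: ey; rewrite !inE eqxx orbT.
have y3 : dend e3 = y by apply: ey; rewrite !inE eqxx !orbT.
have bdX x : x \in bd X -> [\/ x = iod io e1, x = iod io e2 | x = iod io e3].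
  rewrite (bd_fibre sk) eE => /imsetP[d]; rewrite !inE => /orP[/orP[]|] /eqP-> ->;
  by [constructor 1|constructor 2|constructor 3].
have exX e : dend e = y -> iod io e \in bd X by move=> h; rewrite (bd_fibre sk) imset_f // inE h.
have iI := iod_inj sk.
have pa : p a = y by rewrite (iod_end sk).
have [d3 [d3a n1 n2 al]] : exists d3, [/\ dend d3 = a, d3 != iod io e1, d3 != iod io e2 &
    forall w, dend w = a -> [\/ w = iod io e1, w = iod io e2 | w = d3]].
  have [u [w [ua wa [n1 n2 n3] al _]]] := darts_others tG cG (iod io e1).
  have ned (x x' : dart G) : x.1 != x'.1 -> x != x' by apply: contra => /eqP->.
  case: (al _ (esym a12)) => [/iI e|e|e]; first by rewrite e eqxx in n12.
    exists w; split=> //; first by rewrite eq_sym ned.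
      by rewrite e eq_sym ned.
    by move=> t /al[]; rewrite e; [constructor 1|constructor 2|constructor 3].
  exists u; split=> //; first by rewrite eq_sym ned.
    by rewrite e ned.
  by move=> t /al[]; rewrite e; [constructor 1|constructor 3|constructor 2].
case: (eqVneq (dend (iod io e3)) a) => a3; [left|right]; last first.
  exists a, e3, d3; split=> //; last first.
    split=> // d dy de; have : d \in [set e1; e2; e3] by rewrite -eE inE dy.
    by rewrite !inE (negbTE de) orbF => /orP[] /eqP->.
  split; last by have := no_loop d3 cG (proj2 tG); rewrite d3a eq_sym.
  apply/eqP/negPn/negP => h; have : d3 \in bd X by rewrite in_bd !inE d3a pa eqxx.
  case/bdX => e; [by rewrite e eqxx in n1|by rewrite e eqxx in n2|].
  by rewrite -e d3a eqxx in a3.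
exists a; apply/eqP; rewrite eqEsubset sub1set inE pa eqxx andbT.
apply/subsetP => v vX; rewrite inE; apply/negPn/negP => va.
have atA w : dend w = a -> w \in bd X.
  move=> wa; case: (al _ wa) => ->; [exact: exX|exact: exX|].
  by case: (al _ a3) => [/iI e|/iI e|<-]; [rewrite e eqxx in n13|rewrite e eqxx in n23|exact: exX].
have vX' : v \in X :\ a by rewrite in_setD1 va.
have aX : a \notin X :\ a by rewrite !inE eqxx.
have /set0Pn[w] := bd_connected (proj1 tG) vX' aX.
rewrite in_bd in_setD1 => /andP[/andP[wa wX]]; rewrite in_setD1 negb_and negbK => /orP[/eqP h|h].
  have := atA (flip w); rewrite dend_flip => /(_ h); rewrite in_bd dother_flip => /andP[_].
  by rewrite wX.
have : w \in bd X by rewrite in_bd wX.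
by case/bdX => e; move: wa; rewrite e -?a12 ?a3 eqxx.
Qed.

(** Take the exit vertices [F] out of the fibre. A perfect matching of the rest would contradict
    [no3], and at most six edges lead into it: the nine darts at [F] without the three exits. So the
    barrier lemma applies a second time, and its set together with [F] is bipartising. *)
Lemma distinct_exits e1 e2 e3 : [set d : dart P6 | dend d == y] = [set e1; e2; e3] ->
  dend (iod io e1) != dend (iod io e2) -> dend (iod io e1) != dend (iod io e3) ->
  dend (iod io e2) != dend (iod io e3) ->
  exists2 U, bipartising_fibre p y U & 2 <= #|U|.
Proof.
move=> eE.
set x1 := iod io e1; set x2 := iod io e2; set x3 := iod io e3.
set a1 := dend x1; set a2 := dend x2; set a3 := dend x3 => n12 n13 n23.
have ey e : e \in [set e1; e2; e3] -> dend e = y by rewrite -eE inE => /eqP.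
have y1 : dend e1 = y by apply: ey; rewrite !inE eqxx.
have y2 : dend e2 = y by apply: ey; rewrite !inE eqxx orbT.
have y3 : dend e3 = y by apply: ey; rewrite !inE eqxx !orbT.
have bdX x : x \in bd X -> [\/ x = x1, x = x2 | x = x3].
  rewrite (bd_fibre sk) eE => /imsetP[d]; rewrite !inE => /orP[/orP[]|] /eqP-> ->;
  by [constructor 1|constructor 2|constructor 3].
have exX e : dend e = y -> iod io e \in bd X by move=> h; rewrite (bd_fibre sk) imset_f // inE h.
have b1 : x1 \in bd X by apply: exX.
have b2 : x2 \in bd X by apply: exX.
have b3 : x3 \in bd X by apply: exX.
pose F := [set a1; a2; a3].
have cF : #|F| = 3 by rewrite /F -setUA !cardsU1 !inE cards1 (negbTE n12) (negbTE n13) (negbTE n23).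
have FX : F \subset X.
  by apply/subsetP => v; rewrite !inE => /orP[/orP[]|] /eqP->; rewrite (iod_end sk) ?y1 ?y2 ?y3.
have exF v : v \in F -> exists2 x, x \in bd X & dend x = v.
  by rewrite !inE => /orP[/orP[]|] /eqP->; [exists x1|exists x2|exists x3].
have Fex x : x \in bd X -> dend x \in F.
  by case/bdX => ->; rewrite !inE eqxx ?orbT.
have uqF x x' : x \in bd X -> x' \in bd X -> dend x = dend x' -> x = x'.
  move=> /bdX[] -> /bdX[] -> // /eqP; rewrite 1?eq_sym -/a1 -/a2 -/a3;
  by rewrite ?(negbTE n12) ?(negbTE n13) ?(negbTE n23) // eq_sym ?(negbTE n12) ?(negbTE n13) ?(negbTE n23).
pose Z := ~: X :|: F.
have ZC : ~: Z = X :\: F by apply/setP => v; rewrite !inE negb_or negbK andbC.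
have Z0 : Z != set0 by apply/set0Pn; exists a1; rewrite !inE eqxx ?orbT.
have oX : odd #|X| by rewrite -odd_bd // (card_bd_fibre sk).
have evZ : ~~ odd #|~: Z|.
  rewrite ZC; have := cardsID F X; rewrite (setIidPr FX) cF => h.
  by move: oX; rewrite -h oddD.
pose B := [set d : dart G | dend d \in F] :\: bd X.
have cB : #|B| = 6.
  have := cardsID (bd X) [set d : dart G | dend d \in F].
  rewrite card_darts_cubic // cF (setIidPr _) ?(card_bd_fibre sk).
    by rewrite -/B -[3 * 3]/(3 + 6) => /eqP; rewrite eqn_add2l => /eqP.
  by apply/subsetP => x xb; rewrite inE Fex.
have bZB : bd Z \subset B.
  apply/subsetP => x; rewrite in_bd => /andP[xZ oZ].
  have oXF : dother x \in X :\: F by rewrite -ZC inE.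
  have [oF oX'] : dother x \notin F /\ dother x \in X by move: oXF; rewrite in_setD => /andP[].
  rewrite in_setD in_bd oX' andbF /= inE.
  move: xZ; rewrite in_setU in_setC => /orP[xX|//].
  have : flip x \in bd X by rewrite in_bd dend_flip dother_flip oX'.
  by move/Fex; rewrite dend_flip (negbTE oF).
have b6 : #|bd Z| <= 6 by rewrite -cB subset_leq_card.
have noM M : ~ pm_on (~: Z) M.
  move=> [M1 M2]; apply: (@no3 (fun e => e \in M)) => v pv.
  have inX x : dend x = v -> p (dend x) != p (dother x) -> x \in bd X.
    by move=> xv; rewrite in_bd !inE xv pv eqxx eq_sym.
  case: (boolP (v \in F)) => vF.
    have [x xb xv] := exF _ vF; exists x.
      split=> //; apply/implyP => /eqP h; move: xb; rewrite in_bd !inE -h => /andP[->] //.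
    move=> x' xv' /implyP h; apply: uqF; rewrite ?xv ?xv' //; apply: inX => //.
    by apply/negP => /h /M2; rewrite ZC in_setD xv' vF.
  have vZ : v \in ~: Z by rewrite ZC in_setD vF inE pv eqxx.
  have /cards1P[x hx] : #|[set d : dart G | (dend d == v) && (d.1 \in M)]| == 1 by rewrite M1.
  have : x \in [set x] by rewrite set11.
  rewrite -hx inE => /andP[/eqP xv xM].
  exists x; first by rewrite xM implybT.
  move=> x' xv' /implyP h; apply/eqP; rewrite -in_set1 -hx inE xv' eqxx /= h //.
  by apply/negPn/negP => /(inX _ xv')/Fex; rewrite xv' (negbTE vF).
have [S [SZ ST comp3 bd6]] := barrier tG cG Z0 evZ b6 noM.
(* Equality shows that every other dart at [F] leads into the fibre without [F], so [F] is
   independent. *)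
have bZE : bd Z = B by apply/eqP; rewrite eqEcard bZB cB bd6.
have FS v : v \in F -> v \notin ~: Z :\: S by move=> vF; rewrite ZC !in_setD vF !andbF.
have TE : X :\: (S :|: F) = ~: Z :\: S by rewrite ZC setDDl setUC.
have SX v : v \in S -> v \in X by move/(subsetP SZ); rewrite ZC in_setD => /andP[].
have TU v : v \in ~: Z :\: S -> v \notin S :|: F.
  by rewrite -TE in_setD => /andP[].
exists (S :|: F); last by apply: leq_trans (subset_leq_card (subsetUr S F)); rewrite cF.
split.
- by rewrite subUset FX andbT; apply/subsetP => v /SX.
- move=> x; rewrite in_setU => /orP[/ST/TU //|xF].
  case: (boolP (x \in bd X)) => xb.
    move: xb; rewrite in_bd => /andP[_ oX']; apply: contra oX'.
    by rewrite in_setU => /orP[/SX //|/(subsetP FX)].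
  have : x \in bd Z by rewrite bZE in_setD xb inE.
  rewrite in_bd -in_setC => /andP[_ oZ]; rewrite in_setU negb_or; apply/andP; split.
    apply/negP => oS; have := ST (flip x); rewrite dend_flip dother_flip => /(_ oS).
    by rewrite (negbTE (FS _ xF)).
  by move: oZ; rewrite ZC in_setD => /andP[].
- move=> x xy oy; rewrite in_setU; apply/orP; right; apply: Fex.
  by rewrite in_bd !inE xy eqxx.
by move=> v pv vU; rewrite TE; apply: comp3; rewrite -TE in_setD vU inE pv eqxx.
Qed.

Lemma leaf_cases : [\/ exists a, X = [set a], exists2 U, bipartising_fibre p y U & 2 <= #|U| |
  exists a d0 d3, inserted_fibre a d0 d3].
Proof.
have [e1 [e2 [e3 [eE /and3P[n12 n13 n23]]]]] := cards3P (P6_deg y).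
have two a b c' : [set e1; e2; e3] = [set a; b; c'] -> a != b -> a != c' -> b != c' ->
    dend (iod io a) = dend (iod io b) -> [\/ exists a, X = [set a],
      exists2 U, bipartising_fibre p y U & 2 <= #|U| | exists a d0 d3, inserted_fibre a d0 d3].
  move=> e nab nac nbc h; case: (two_exits_at (etrans eE e) nab nac nbc h) => h'.
    by constructor 1.
  by constructor 3.
case: (eqVneq (dend (iod io e1)) (dend (iod io e2))) => h12; first exact: (two e1 e2 e3).
case: (eqVneq (dend (iod io e1)) (dend (iod io e3))) => h13.
  apply: (two e1 e3 e2) => //; first by rewrite setUAC.
  by rewrite eq_sym.
case: (eqVneq (dend (iod io e2)) (dend (iod io e3))) => h23.
  apply: (two e2 e3 e1) => //; rewrite 1?eq_sym //.
  by rewrite (setUC [set e2; e3]) setUA.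
by constructor 2; apply: (distinct_exits eE).
Qed.

(** If [U] is a single vertex, all three exits start there and use up its degree, so by connectivity
    the fibre contains nothing else. *)
Lemma centre_cases U : bipartising_fibre p y U -> (exists a, X = [set a]) \/ 2 <= #|U|.
Proof.
case=> UX ind ex _.
have ey d : dend d = y -> dend (iod io d) \in U.
  by move=> dy; apply: ex; rewrite ?(iod_end sk) ?(iod_other sk) // -dy eq_sym P6_noloop.
case: (leqP 2 #|U|) => cU; [by right|left].
have U1 : #|U| == 1.
  rewrite eqn_leq -ltnS cU; apply/card_gt0P.
  have [e1 [e2 [e3 [eE _]]]] := cards3P (P6_deg y).
  exists (dend (iod io e1)); apply: ey; apply/eqP.
  have : e1 \in [set d : dart P6 | dend d == y] by rewrite eE !inE eqxx.
  by rewrite inE.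
have /cards1P[a Ua] := U1.
have pa : p a = y by have := subsetP UX a; rewrite Ua set11 inE => /(_ isT)/eqP.
have bdX x : x \in bd X -> dend x = a.
  rewrite in_bd !inE => /andP[/eqP h1 h2]; apply/eqP; rewrite -in_set1 -Ua; exact: ex.
have bda : bd X = [set d : dart G | dend d == a].
  have := cG a; rewrite /deg => da; apply/eqP; rewrite eqEcard (card_bd_fibre sk) da leqnn andbT.
  by apply/subsetP => x /bdX h; rewrite inE h.
exists a; apply/eqP; rewrite eqEsubset sub1set inE pa eqxx andbT.
apply/subsetP => v vX; rewrite inE; apply/negPn/negP => va.
have vX' : v \in X :\ a by rewrite in_setD1 va.
have aX : a \notin X :\ a by rewrite !inE eqxx.
have /set0Pn[w] := bd_connected (proj1 tG) vX' aX.
rewrite in_bd in_setD1 => /andP[/andP[wa wX]]; rewrite in_setD1 negb_and negbK => /orP[/eqP h|h].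
  have : flip w \in bd X by rewrite bda inE dend_flip h.
  by rewrite in_bd dother_flip wX andbF.
have : w \in bd X by rewrite in_bd wX.
by move/bdX => e; rewrite e eqxx in wa.
Qed.
End LeafCases.

(** * Contractions and splices *)

Lemma connect_adj_map (G K : mgraph) (A : {set gE G}) (B : {set gE K}) (f : gV G -> gV K) x y :
  (forall d : dart G, d.1 \notin A -> connect (adj_av B) (f (dend d)) (f (dother d))) ->
  connect (adj_av A) x y -> connect (adj_av B) (f x) (f y).
Proof.
move=> h /connectP[q + ->]; elim: q x => [|z q IH] x /=; first by move=> _; apply: connect0.
case/andP => /adj_avP[d [<- <- dA]] pth; exact: connect_trans (h _ dA) (IH _ pth).
Qed.

Section Contract.
Variables (G : mgraph) (X : {set gV G}).
Implicit Types (x : dart G) (v : gV G).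

Definition cV : finType := option {v : gV G | v \in X}.
Definition cE : finType := {e : gE G | ((gends e).1 \in X) || ((gends e).2 \in X)}.
Definition cproj v : cV := insub v.
(** The outside of [X] becomes the vertex [None], and edges without an end in [X] disappear.
    Deleting [None] gives back the subgraph on [X], which makes this the cubic graph to be
    substituted. *)
Definition contract : mgraph :=
  @MGraph cV cE (fun e => (cproj (gends (val e)).1, cproj (gends (val e)).2)).
Definition cdart (d : dart contract) : dart G := (val d.1, d.2).

Lemma cdart_inj : injective cdart.
Proof. by case=> e b [e' b'] [/val_inj -> ->]. Qed.
Lemma cdart_flip d : cdart (flip d) = flip (cdart d). Proof. by []. Qed.
Lemma dend_cdart (d : dart contract) : dend d = cproj (dend (cdart d)).
Proof. by case: d => e []. Qed.
Lemma dother_cdart (d : dart contract) : dother d = cproj (dother (cdart d)).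
Proof. by rewrite -dend_flip dend_cdart cdart_flip dend_flip. Qed.
Lemma cproj_in v (vX : v \in X) : cproj v = Some (Sub v vX).
Proof. exact: insubT. Qed.
Lemma cproj_out v : v \notin X -> cproj v = None.
Proof. by move=> h; rewrite /cproj insubN. Qed.
Lemma cproj_eq v w : v \in X -> cproj w = cproj v -> w = v.
Proof.
move=> vX; rewrite (cproj_in vX) /cproj; case: insubP => // u _ <- [->].
by rewrite SubK.
Qed.
Lemma cproj_None v : (cproj v == None) = (v \notin X).
Proof. by rewrite /cproj; case: insubP => [u ->|/negbTE->]. Qed.

Lemma touches x : (dend x \in X) || (dother x \in X) = ((gends x.1).1 \in X) || ((gends x.1).2 \in X).
Proof. by case: x => e []; rewrite /dother /dend //= orbC. Qed.

Lemma cdart_touch d : (dend (cdart d) \in X) || (dother (cdart d) \in X).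
Proof. rewrite touches; exact: (valP d.1). Qed.

Lemma ex_cdart x : (dend x \in X) || (dother x \in X) -> exists d, cdart d = x.
Proof.
rewrite touches => h; exists (Sub x.1 h, x.2); rewrite /cdart SubK; by case: x h.
Qed.

Lemma contract_darts_in v : v \in X -> cdart @: [set d : dart contract | dend d == cproj v] = [set x | dend x == v].
Proof.
move=> vX; apply/setP => x; rewrite inE; apply/imsetP/eqP => [[d]|xv].
  by rewrite inE dend_cdart => /eqP /(cproj_eq vX) h ->.
have [|d hd] := @ex_cdart x; first by rewrite xv vX.
by exists d; rewrite // inE dend_cdart hd xv.
Qed.

Lemma contract_darts_out : cdart @: [set d : dart contract | dend d == None] = (@flip G) @: bd X.
Proof.
apply/setP => x; apply/imsetP/imsetP => [[d]|[z]].
  rewrite inE dend_cdart cproj_None => h ->; exists (flip (cdart d)); rewrite ?flipK //.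
  by rewrite in_bd dend_flip dother_flip h andbT; have := cdart_touch d; rewrite (negbTE h).
rewrite in_bd => /andP[h1 h2] ->; have [|d hd] := @ex_cdart (flip z).
  by rewrite dother_flip h1 orbT.
by exists d; rewrite // inE dend_cdart hd dend_flip cproj_None.
Qed.

Hypotheses (tG : twoconn G) (cG : cubic G) (b3 : #|bd X| = 3).

Lemma contract_vertex (k : gV contract) : exists v, k = cproj v.
Proof.
case: k => [[v vX]|]; first by exists v; rewrite (cproj_in vX).
have /card_gt0P[x] : 0 < #|bd X| by rewrite b3.
by rewrite in_bd => /andP[_ h]; exists (dother x); rewrite cproj_out.
Qed.

Lemma contract_connect A v w : connect (adj_av A) v w ->
  connect (adj_av [set e : gE contract | val e \in A]) (cproj v : gV contract) (cproj w).
Proof.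
apply: connect_adj_map => x xA; case: (boolP ((dend x \in X) || (dother x \in X))) => [/ex_cdart[d hd]|].
  apply: connect1; apply/adj_avP; exists d; rewrite dend_cdart dother_cdart hd; split=> //.
  by rewrite inE -[val d.1]/(cdart d).1 hd.
by rewrite negb_or => /andP[h1 h2]; rewrite !cproj_out //; apply: connect0.
Qed.

Lemma contract_twoconn : twoconn contract.
Proof.
split=> [k k'|e k k']; have [v ->] := contract_vertex k; have [w ->] := contract_vertex k'.
  have := contract_connect (proj1 tG v w); rewrite (_ : [set _ | _] = set0) //.
  by apply/setP => e; rewrite !inE.
have := contract_connect (proj2 tG (val e) v w); rewrite (_ : [set _ | _] = [set e]) //.
by apply/setP => e'; rewrite !inE (inj_eq val_inj).
Qed.

Lemma contract_cubic : cubic contract.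
Proof.
move=> k; rewrite /deg -(card_imset _ cdart_inj).
have [v ->] := contract_vertex k; case: (boolP (v \in X)) => vX.
  by rewrite contract_darts_in //; apply: cG.
by rewrite cproj_out // contract_darts_out card_imset //; apply: flip_inj.
Qed.

(** At the new vertex the colours are distinct because the cut has three edges. *)
Lemma contract_colourable (Q : pred (gV G)) (c : gE G -> 'I_3) :
  (forall x x' : dart G, dend x = dend x' -> Q (dend x) -> c x.1 = c x'.1 -> x = x') ->
  {in X, forall v, Q v} -> colourable3 contract.
Proof.
move=> pc XQ; exists (fun e => c (val e)) => k i; rewrite leqNgt; apply/negP => /card_gt1P[d [d' []]].
rewrite !inE => /andP[/eqP dk /eqP di] /andP[/eqP dk' /eqP di'] /negP; apply; apply/eqP/cdart_inj.
have [v kv] := contract_vertex k; case: (boolP (v \in X)) => vX.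
  have ev : dend (cdart d) = v by apply: cproj_eq => //; rewrite -dend_cdart dk.
  have ev' : dend (cdart d') = v by apply: cproj_eq => //; rewrite -dend_cdart dk'.
  by apply: pc; rewrite ?ev ?ev' ?XQ //= di di'.
have [_ inj] := cut3_colours tG cG pc XQ b3.
have out z : dend z = k -> flip (cdart z) \in bd X.
  move=> zk; have : cdart z \in (@flip G) @: bd X.
    by rewrite -contract_darts_out imset_f // inE zk kv cproj_out.
  by case/imsetP => x xb ->; rewrite flipK.
by apply: (can_inj (@flipK G)); apply: inj; rewrite ?out //= di di'.
Qed.

Lemma ndarts_None (d : dart contract) : dend d = None -> dother d != None.
Proof.
rewrite dend_cdart dother_cdart => /eqP; rewrite !cproj_None => h.
by have := cdart_touch d; rewrite (negbTE h) negbK.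
Qed.

Section Bipartising.
Variable U : {set gV G}.
Hypotheses (UX : U \subset X) (Uind : forall x, dend x \in U -> dother x \notin U)
  (Uex : forall x, x \in bd X -> dend x \in U)
  (Ucomp : forall v, v \in X -> v \notin U -> #|bd (component (eadj (G := G)) (X :\: U) v)| = 3)
  (U2 : 2 <= #|U|).
Let cU : {set gV contract} := [set cproj v | v in U].

Lemma in_cU v : (cproj v \in cU) = (v \in U).
Proof.
apply/imsetP/idP => [[u uU e]|]; last by exists v.
by rewrite (cproj_eq (subsetP UX _ uU) e).
Qed.

Lemma edges_of_darts (K : mgraph) (P Q : pred (gV K)) : (forall z : gV K, P z -> ~~ Q z) ->
  #|[set e : gE K | (P (gends e).1 && Q (gends e).2) || (P (gends e).2 && Q (gends e).1)]| =
  #|[set d : dart K | P (dend d) && Q (dother d)]|.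
Proof.
move=> PQ; rewrite -(card_in_imset (f := fun d : dart K => d.1)
   (D := mem [set d : dart K | P (dend d) && Q (dother d)])).
  apply: eq_card => e; rewrite inE; apply/orP/imsetP.
    by case=> h; [exists (e, true)|exists (e, false)]; rewrite ?inE.
  by case=> -[e' []]; rewrite inE /dother /dend /= => h ->; [left|right].
move=> d d'; rewrite !inE => /andP[h1 h2] /andP[h3 h4] /dart_eq_edge[//|e].
by move: h3; rewrite e dend_flip => /PQ; rewrite h2.
Qed.

Lemma contract_adj_out v w : v \in X :\: U -> w \in X :\: U ->
  adj_out cU (cproj v) (cproj w) = eadj v w.
Proof.
rewrite !in_setD => /andP[vU vX] /andP[wU wX]; rewrite /adj_out !in_cU vU wU !andTb.
apply/existsP/eadjP => [[e /ueq_dartP[b [h1 h2]]]|[x [h1 h2]]].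
  exists (cdart (e, b)); split; first by apply: (cproj_eq vX); rewrite -dend_cdart.
  by apply: (cproj_eq wX); rewrite -dother_cdart.
have [|d hd] := @ex_cdart x; first by rewrite h1 vX.
exists d.1; apply/ueq_dartP; exists d.2; rewrite -surjective_pairing.
by rewrite dend_cdart dother_cdart hd h1 h2.
Qed.

Lemma None_adj_out k : adj_out cU None k -> False.
Proof.
rewrite /adj_out => /and3P[_ kU /existsP[e /ueq_dartP[b [h1 h2]]]].
have : cdart (e, b) \in (@flip G) @: bd X by rewrite -contract_darts_out imset_f // inE h1.
case/imsetP => x /Uex xU hx; move: kU; rewrite -h2 dother_cdart hx dother_flip.
by rewrite in_cU xU.
Qed.

Lemma comp_out_None : comp_out cU None = [set None].
Proof.
apply/setP => k; rewrite !inE; apply/idP/eqP => [/connectP[[|k' q] /=]|->]; last exact: connect0.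
  by [].
by case/andP => /None_adj_out.
Qed.

Lemma comp_out_contract v : v \in X :\: U ->
  comp_out cU (cproj v) = [set cproj w | w in component (eadj (G := G)) (X :\: U) v].
Proof.
move=> vXU; apply/setP => k; rewrite inE; apply/idP/imsetP => [/connectP[q]|[w]].
  elim: q v vXU => [|k' q IH] v vXU /=; first by move=> _ ->; exists v; rewrite ?component_refl.
  case/andP => av pth lst; have [w kw] := contract_vertex k'.
  have wXU : w \in X :\: U.
    move: (av); rewrite kw => /and3P[_ wU /existsP[e]]; rewrite in_cU in wU.
    rewrite in_setD wU andTb; apply: contraLR => wX; apply/negP => h.
    case: (@None_adj_out (cproj v)); rewrite /adj_out -(cproj_out wX) !in_cU wU.
    move: vXU; rewrite in_setD => /andP[-> _]; rewrite !andTb; apply/existsP; exists e.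
    by move: h => /ueq_dartP[b [h1 h2]]; apply/ueq_dartP; exists (~~ b);
      rewrite -/(flip (e, b)) dend_flip dother_flip.
  rewrite kw in av pth lst; rewrite contract_adj_out // in av.
  have [u uC ->] := IH _ wXU pth lst; exists u => //.
  rewrite -(component_eq (@eadj_sym G) (x := v) (y := w)) //.
  exact: (component_step (component_refl _ _ _) vXU wXU av).
rewrite inE => /connectP[q]; elim: q v vXU => [|u q IH] v vXU /=.
  by move=> _ -> ->; apply: connect0.
case/andP => /and3P[_ uXU vu] pth lst kw; apply: connect_trans (IH _ uXU pth lst kw).
by apply: connect1; rewrite contract_adj_out.
Qed.

(** All exits start in [U], so the new vertex [None] is a component by itself; the other components
    are those of [X] without [U]. *)
Lemma contract_bipartising : bipartising cU.
Proof.
have loopU (z : gV contract) : z \in cU -> exists2 u, u \in U & z = cproj u by case/imsetP => u; exists u.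
have indK (d : dart contract) : dend d \in cU -> dother d \notin cU.
  by rewrite dend_cdart dother_cdart !in_cU; apply: Uind.
split.
- rewrite card_in_imset // => u w uU wU /esym h; exact/esym/(cproj_eq (subsetP UX _ uU)).
- move=> e; apply/negP => /andP[h1 h2]; have := indK (e, true) h1.
  by rewrite /dother /dend /= h2.
- move=> k /loopU[u uU ->].
  rewrite (@edges_of_darts contract (fun z : gV contract => z == cproj u) (fun z : gV contract => z \notin cU)).
    rewrite -(contract_cubic (cproj u)) /deg; apply: eq_card => d; rewrite !inE.
    by case: eqP => //= h; rewrite indK // h in_cU.
  by move=> v /eqP ->; rewrite in_cU uU.
move=> k kU.
have disj (v : gV contract) : v \in cU -> v \notin comp_out cU k.
  move=> vU; rewrite inE; apply/negP => /connectP[q]; case/lastP: q => [_ /= e|q z].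
    by rewrite -e vU in kU.
  by rewrite rcons_path last_rcons => /andP[_ /and3P[_ zU _]] e; rewrite -e vU in zU.
rewrite (@edges_of_darts contract (mem cU) (mem (comp_out cU k))) //.
have -> : [set d : dart contract | (mem cU) (dend d) && (mem (comp_out cU k)) (dother d)] =
   (@flip contract) @: [set d : dart contract | (dother d \in cU) && (dend d \in comp_out cU k)].
  apply/setP => d; rewrite inE; apply/idP/imsetP => [h|[d']].
    by exists (flip d); rewrite ?flipK // inE dother_flip dend_flip.
  by rewrite inE => h ->; rewrite dother_flip dend_flip.
rewrite card_imset; last exact: flip_inj.
have [v kv] := contract_vertex k; rewrite {}kv in kU disj *.
rewrite in_cU in kU; case: (boolP (v \in X)) => vX; last first.
  rewrite cproj_out // comp_out_None -(contract_cubic None) /deg; apply: eq_card => d; rewrite !inE.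
  case: eqP => [dN|]; rewrite ?andbF ?andbT //.
  have : cdart d \in (@flip G) @: bd X by rewrite -contract_darts_out imset_f // inE dN.
  case/imsetP => x xb hx; rewrite dother_cdart hx dother_flip in_cU; exact: Uex.
have vXU : v \in X :\: U by rewrite in_setD kU.
rewrite comp_out_contract // -(Ucomp vX kU) -(card_imset _ cdart_inj); apply: eq_card => x.
set C := component _ _ _.
have CX w : w \in C -> w \in X :\: U by apply: (subsetP (component_sub _ vXU)).
have inC w : (cproj w \in [set cproj w | w in C]) = (w \in C).
  apply/imsetP/idP => [[u uC e]|]; last by exists w.
  by have := CX _ uC; rewrite in_setD => /andP[_ uX]; rewrite (cproj_eq uX e).
apply/imsetP/idP => [[d]|].
  rewrite inE dother_cdart dend_cdart in_cU inC => /andP[h1 h2] ->.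
  rewrite in_bd h2; apply/negP => /CX; by rewrite in_setD h1.
rewrite in_bd => /andP[xC oC]; have := CX _ xC; rewrite in_setD => /andP[xU xX].
have [|d hd] := @ex_cdart x; first by rewrite xX.
exists d => //; rewrite inE dother_cdart dend_cdart in_cU hd inC xC andbT.
apply: contraR oC => oU; case: (boolP (dother x \in X)) => oX; last first.
  by have := Uex (x := x); rewrite in_bd xX oX => /(_ isT); rewrite (negbTE xU).
apply: (component_step xC); rewrite ?in_setD ?xU ?xX ?oU //.
by apply/eadjP; exists x.
Qed.

Lemma contract_correct : correct_sub (K := contract) None.
Proof.
exists cU; split; first exact: contract_bipartising.
split; last exact: comp_out_None.
apply/negP => /imsetP[u uU /esym/eqP]; by rewrite cproj_None (subsetP UX _ uU).
Qed.
End Bipartising.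
End Contract.

Section Splice.
Variables (G : mgraph) (R : {set gV G}) (x1 x2 : dart G).
Hypotheses (x1R : dend x1 \in R) (x2R : dend x2 \in R).
Implicit Types (x : dart G) (v : gV G).

Definition sV : finType := {v : gV G | v \in R}.
Definition sE : finType := option {e : gE G | ((gends e).1 \in R) && ((gends e).2 \in R)}.
Definition sends (e : sE) : sV * sV :=
  match e with
  | Some g => (Sub (gends (val g)).1 (andb_l (valP g)), Sub (gends (val g)).2 (andb_r (valP g)))
  | None => (Sub (dend x1) x1R, Sub (dend x2) x2R)
  end.
(* The vertex set [R] with the dangling edges at [x1], [x2] closed up into the edge [None]. *)
Definition splice : mgraph := @MGraph sV sE sends.
Definition sdart (d : dart splice) : dart G :=
  match d with (Some g, b) => (val g, b) | (None, b) => if b then x1 else x2 end.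

Definition spv (k : gV splice) : gV G := val (k : sV).
Lemma spv_inj : injective spv. Proof. exact: val_inj. Qed.
Lemma spv_in k : spv k \in R. Proof. exact: (valP (k : sV)). Qed.

Lemma dend_sdart (d : dart splice) : spv (dend d) = dend (sdart d).
Proof. by case: d => [[g|] []]. Qed.
Lemma dother_sdart g b : spv (dother ((Some g, b) : dart splice)) = dother (sdart (Some g, b)).
Proof. by case: b. Qed.

Lemma inner_sdart x : dend x \in R -> dother x \in R -> exists g, sdart (Some g, x.2) = x.
Proof.
move=> h1 h2; have h : ((gends x.1).1 \in R) && ((gends x.1).2 \in R).
  by move: h1 h2; case: x => e []; rewrite /dother /dend /= => -> ->.
by exists (Sub x.1 h); case: x {h1 h2} h.
Qed.

Hypotheses (tG : twoconn G) (cG : cubic G).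
Hypotheses (bR : bd R = [set x1; x2]) (x12 : x1 != x2).

Let x1b : x1 \in bd R. Proof. by rewrite bR !inE eqxx. Qed.
Let x2b : x2 \in bd R. Proof. by rewrite bR !inE eqxx orbT. Qed.

Lemma sdart_inj : injective sdart.
Proof.
have inn (g : {e : gE G | ((gends e).1 \in R) && ((gends e).2 \in R)}) b : dother (val g, b) \in R.
  by have := valP g; case: b => /andP[].
have nin z : z \in bd R -> dother z \notin R by rewrite in_bd => /andP[].
have nn g b b' : sdart (Some g, b) = sdart (None, b') -> False.
  by move=> e; have := inn g b; rewrite -/(sdart (Some g, b)) e /=; case: b' {e}; apply/negP/nin.
move=> [[g|] b] [[g'|] b'].
- by move=> [/val_inj -> ->].
- by move/nn.
- by move/esym/nn.
by rewrite /=; case: b; case: b' => // e; have := x12; rewrite e eqxx.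
Qed.

Lemma splice_darts (k : gV splice) : sdart @: [set d : dart splice | dend d == k] = [set x | dend x == spv k].
Proof.
apply/setP => x; rewrite inE; apply/imsetP/eqP => [[d]|xk].
  by rewrite inE => /eqP <- ->; rewrite dend_sdart.
have xR : dend x \in R by rewrite xk; apply: spv_in.
have fin d : sdart d = x -> exists2 d, d \in [set d : dart splice | dend d == k] & x = sdart d.
  by move=> e; exists d; rewrite // inE; apply/eqP/spv_inj; rewrite dend_sdart e.
case: (boolP (dother x \in R)) => oR; first by have [g] := inner_sdart xR oR; apply: fin.
have : x \in bd R by rewrite in_bd xR.
rewrite bR !inE => /orP[] /eqP e; first by apply: (fin (None, true)).
by apply: (fin (None, false)).
Qed.

Lemma splice_cubic : cubic splice.
Proof. by move=> k; rewrite /deg -(card_imset _ sdart_inj) splice_darts; apply: cG. Qed.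

Lemma splice_colourable (Q : pred (gV G)) (c : gE G -> 'I_3) :
  (forall x x' : dart G, dend x = dend x' -> Q (dend x) -> c x.1 = c x'.1 -> x = x') ->
  {in R, forall v, Q v} -> colourable3 splice.
Proof.
move=> pc RQ; have c12 := cut2_colours tG cG pc RQ bR x12.
pose c' (e : gE splice) := if e is Some g then c (val g) else c x1.1.
have c'E d : c' d.1 = c (sdart d).1 by case: d => [[g|] []].
exists c' => k i; rewrite leqNgt; apply/negP => /card_gt1P[d [d' []]].
rewrite !inE => /andP[/eqP dk /eqP di] /andP[/eqP dk' /eqP di'] /negP; apply; apply/eqP/sdart_inj.
by apply: pc; rewrite -?c'E -?dend_sdart ?dk ?dk' ?di ?di' // RQ //; apply: spv_in.
Qed.

(** The outside of the set is collapsed onto the inner end of [x1]. Then [x1] becomes trivial and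
    [x2] plays the part of the new edge [None], so connectivity with an edge deleted is
    inherited. *)
Let mu v : gV splice := insubd (Sub (dend x1) x1R : sV) v.
Let val_mu v : v \in R -> spv (mu v) = v. Proof. by move=> h; rewrite /spv val_insubd h. Qed.
Let mu_out v : v \notin R -> mu v = Sub (dend x1) x1R.
Proof. by move=> h; apply: spv_inj; rewrite /spv val_insubd (negbTE h). Qed.

Lemma splice_connect (A : {set gE G}) (B : {set gE splice}) v w :
  (forall g, (Some g : gE splice) \in B -> val g \in A) -> ((None : gE splice) \in B -> x2.1 \in A) ->
  connect (adj_av A) v w -> connect (adj_av B) (mu v) (mu w).
Proof.
move=> BA NA; apply: connect_adj_map => x xA.
have bdc z : z \in bd R -> z.1 \notin A -> connect (adj_av B) (mu (dend z)) (mu (dother z)) /\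
    connect (adj_av B) (mu (dother z)) (mu (dend z)).
  move=> zb zA; have := zb; rewrite in_bd => /andP[zR oR]; rewrite (mu_out oR).
  move: zb; rewrite bR !inE => /orP[] /eqP e.
    have -> : mu (dend z) = Sub (dend x1) x1R by apply: spv_inj; rewrite val_mu // e.
    by split; apply: connect0.
  have -> : mu (dend z) = Sub (dend x2) x2R by apply: spv_inj; rewrite val_mu // e.
  have nB : (None : gE splice) \notin B by apply: contra zA => /NA; rewrite e.
  split; apply: connect1; apply/adj_avP.
    by exists (None, false).
  by exists (None, true).
case: (boolP (dend x \in R)) => xR; case: (boolP (dother x \in R)) => oR.
- have [g hg] := inner_sdart xR oR; apply: connect1; apply/adj_avP; exists (Some g, x.2).
  split; [apply: spv_inj|apply: spv_inj|].
  + by rewrite dend_sdart hg val_mu.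
  + by rewrite dother_sdart hg val_mu.
  by apply: contra xA => /BA; have -> : val g = x.1 by exact: (congr1 fst hg).
- have xb : x \in bd R by rewrite in_bd xR.
  exact: (proj1 (bdc x xb xA)).
- have xb : flip x \in bd R by rewrite in_bd dend_flip dother_flip oR.
  by rewrite -(dother_flip x) -(dend_flip x); apply: (proj2 (bdc _ xb xA)).
by rewrite !mu_out //; apply: connect0.
Qed.

Lemma splice_twoconn : twoconn splice.
Proof.
have muK k : mu (spv k) = k by apply: spv_inj; rewrite val_mu //; apply: spv_in.
split=> [k k'|e k k']; rewrite -(muK k) -(muK k').
  by apply: (@splice_connect set0); rewrite ?inE //; [move=> g; rewrite inE|apply: (proj1 tG)].
pose e' := if e is Some g then val g else x2.1.
apply: (@splice_connect [set e']); last exact: (proj2 tG).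
  by move=> g; rewrite inE => /eqP h; rewrite inE /e' -h.
by rewrite inE => /eqP h; rewrite inE /e' -h.
Qed.
End Splice.

(** * Rebuilding the graph from its skeleton *)

Section Expansion.
Variables (G : mgraph) (p : gV G -> gV P6) (io : gE P6 -> dart G).
Hypothesis sk : skeleton p io.
Variables (cv : 'I_6 -> gV Pg) (ce : 'I_6 -> gE Pg).
Variables (fV : gV P6 -> gV Pg) (fE : gE P6 -> gE Pg).
Hypotheses (fVI : injective fV) (fEI : injective fE).
Hypotheses (fcv : forall i, fV (inl i) = cv i) (fce : forall i, fE (inl i) = ce i).
Implicit Types (x : dart G) (v : gV G) (g : gE G) (F : {set gV P6}).

(** The edges that survive when the fibres of the vertices outside [F] are contracted. *)
Definition active F g := (p (gends g).1 != p (gends g).2) || (p (gends g).1 \in F).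

Lemma activeE F x : active F x.1 = (p (dend x) != p (dother x)) || (p (dend x) \in F).
Proof.
case: x => g []; rewrite /active /dother /dend //= eq_sym.
by case: eqVneq => //= ->.
Qed.

(* [G'] is obtained from [G] by contracting the fibres of the vertices outside [F];
   [phiV], [phiE] are the contraction maps, [phiE] being meaningful on active edges only. *)
Record expansion F (G' : mgraph) (tv : gV Pg -> option (gV G')) (te : gE Pg -> option (gE G'))
    (phiV : gV G -> gV G') (phiE : gE G -> gE G') : Prop := Expansion {
  exp_built : @built cv ce G' tv te;
  exp_eqV : forall v w, phiV v = phiV w <-> v = w \/ p v = p w /\ p v \notin F;
  exp_ontoV : forall z, exists v, phiV v = z;
  exp_injE : forall g g', active F g -> active F g' -> phiE g = phiE g' -> g = g';
  exp_ontoE : forall z, exists2 g, active F g & phiE g = z;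
  exp_ends : forall x, active F x.1 -> exists x' : dart G',
     [/\ x'.1 = phiE x.1, dend x' = phiV (dend x) & dother x' = phiV (dother x)];
  exp_tv : forall v, p v \notin F -> tv (fV (p v)) = Some (phiV v);
  exp_te : forall a : gE P6, (forall j b, dend (G := P6) (a, b) = inr (Some j) -> inr (Some j) \notin F) ->
     te (fE a) = Some (phiE (io a).1) }.

Definition expandable F := exists G' tv te phiV phiE, @expansion F G' tv te phiV phiE.

Variable y : gV P6.
Hypothesis ny : nonrim y.
Hypotheses (tG : twoconn G) (cG : cubic G).
Notation X := (fibre p y).
Notation K := (contract X).
Let b3 : #|bd X| = 3 := card_bd_fibre sk y.
Hypotheses (Kcol : colourable3 K) (Kcor : correct_sub (K := K) None).

Let in_X v : (v \in X) = (p v == y). Proof. by rewrite inE. Qed.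

Lemma ex_in_fibre : exists v, p v = y.
Proof.
have /card_gt0P[x] : 0 < #|bd X| by rewrite b3.
by rewrite in_bd in_X => /andP[/eqP h _]; exists (dend x).
Qed.

(** The vertex [u0] of the intermediate graph stands for the contracted fibre. A 3-sum with the
    graph [K], in which the outside of the fibre is contracted instead, restores the fibre and
    leaves the rest as it is. *)
Lemma expand_O2 F : y \notin F -> expandable F -> expandable (y |: F).
Proof.
move=> yF [G' [tv [te [phiV [phiE [hB eqV ontoV injE ontoE ends htv hte]]]]]].
have [v0 pv0] := ex_in_fibre.
pose u0 := phiV v0.
have u0E v : phiV v = u0 <-> p v = y.
  rewrite eqV pv0; split=> [[->|[]]|h] //; right; by rewrite h.
have tu0 : tv (fV y) = Some u0 by rewrite -pv0 htv // pv0.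
have K2 := contract_twoconn tG b3; have K3 := contract_cubic cG b3.
have Kq : quasi_bipartite K.
  by split=> //; split=> //; have [U [hU _]] := Kcor; exists U.
have mono g : active F g -> active (y |: F) g.
  by rewrite /active in_setU => /orP[->|->] //; rewrite !orbT.
have dart0 (d : dart G') : dend d = u0 -> dother d != u0 ->
    exists x, [/\ x \in bd X, active F x.1, phiE x.1 = d.1 & phiV (dother x) = dother d].
  move=> d1 d2; have [g ag hg] := ontoE d.1.
  have [x' [h1 h2 h3]] := ends (g, true) ag.
  have [x [xg x1 x2]] : exists x, [/\ x.1 = g, phiV (dend x) = dend d & phiV (dother x) = dother d].
    have e : x'.1 = d.1 by rewrite h1 hg.
    have [->|->] := dart_eq_edge e; first by exists (g, true).
    by exists (flip (g, true)); rewrite !dend_flip !dother_flip.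
  exists x; split=> //; rewrite ?xg //.
  rewrite d1 in x1; move/u0E: x1 => px; rewrite in_bd !in_X px eqxx /=.
  by apply: contra d2 => /eqP/u0E <-; apply/eqP.
have bdd x : x \in bd X -> exists d : dart G', [/\ d.1 = phiE x.1, dend d = u0 & dother d = phiV (dother x)].
  rewrite in_bd !in_X => /andP[/eqP px ox].
  have [|d [d1 d2 d3]] := ends x; first by rewrite activeE px eq_sym ox.
  by exists d; split=> //; rewrite d2; apply/u0E.
have bda x : x \in bd X -> active F x.1.
  by rewrite in_bd !in_X activeE => /andP[/eqP -> h]; rewrite eq_sym h.
have out0 x : x \in bd X -> phiV (dother x) != u0.
  by rewrite in_bd !in_X => /andP[_ h]; apply: contra h => /eqP/u0E ->.
have nd_inj (H : mgraph) (z : gV H) (d d' : ndarts H z) : (sval d).1 = (sval d').1 -> d = d'.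
  move=> h; apply: val_inj; case: (dart_eq_edge h) => [//|e] /=; have /andP[/eqP h1 h2] := valP d.
  by have /andP[/eqP h3 _] := valP d'; move: h2; rewrite -dend_flip -e h3 eqxx.
(* Darts at [u0] and darts at [None] both represent the three cut edges of the fibre; the bijection
   matches darts coming from the same edge of [G]. *)
have ex_sigma (d : ndarts G' u0) : exists d' : ndarts K None, phiE (val (sval d').1) = (sval d).1.
  have /andP[/eqP d1 d2] := valP d.
  have [x [xb _ xe _]] := dart0 _ d1 d2; move: (xb); rewrite in_bd => /andP[xX oX].
  have [|k hk] := @ex_cdart G X (flip x); first by rewrite dother_flip xX orbT.
  have kN : dend k = None by rewrite dend_cdart hk dend_flip cproj_out.
  have kn : (dend k == None) && (dother k != None) by rewrite kN eqxx ndarts_None.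
  exists (exist _ k kn) => /=; by rewrite -xe -[x.1]/(flip x).1 -hk.
have [sigma sigmaE] := fin_all_exists ex_sigma.
have sigma_inj : injective sigma.
  by move=> d d' h; apply: nd_inj; rewrite -!sigmaE h.
have sigma_bij : bijective sigma.
  have sur (d' : ndarts K None) : exists d, sigma d = d'.
    have /andP[/eqP d1 d2] := valP d'.
    have : cdart (sval d') \in (@flip G) @: bd X.
      by rewrite -contract_darts_out imset_f // inE d1.
    case/imsetP => x xb hx; have [d [e1 e2 e3]] := bdd _ xb.
    have dn : (dend d == u0) && (dother d != u0) by rewrite e2 e3 eqxx out0.
    exists (exist _ d dn); apply: nd_inj; apply: val_inj.
    have /andP[/eqP s1 s2] := valP (sigma (exist _ d dn)).
    have : cdart (sval (sigma (exist _ d dn))) \in (@flip G) @: bd X.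
      by rewrite -contract_darts_out imset_f // inE s1.
    case/imsetP => x' xb' hx'.
    have q1 : val (sval (sigma (exist _ d dn))).1 = x'.1 by rewrite -[x'.1]/(flip x').1 -hx'.
    have q2 : val (sval d').1 = x.1 by rewrite -[x.1]/(flip x).1 -hx.
    rewrite q1 q2; apply: injE; rewrite ?bda // -q1 -e1; exact: sigmaE.
  have [tau tauK] := fin_all_exists sur.
  by exists tau => // d; apply: sigma_inj; rewrite tauK.
pose G2 := threesum sigma.
have hB2 : @built cv ce G2 (sub_tv sigma (fV y) tv) (sub_te sigma te).
  apply: built_O2 => //; first by move=> i; rewrite -fcv (inj_eq fVI); case: (y) ny.
  exact: (proj1 K2).
have exV v : exists z : gV G2, (p v = y /\ exists2 k, z = inr k & val k = cproj X v) \/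
    (p v <> y /\ exists2 k, z = inl k & val k = phiV v).
  case: (eqVneq (p v) y) => pv.
    have vn : cproj X v != None by rewrite cproj_None in_X pv eqxx.
    by exists (inr (exist _ (cproj X v : gV K) vn)); left; split=> //; eexists; [reflexivity|].
  have vn : phiV v != u0 by apply/eqP => /u0E h; rewrite h eqxx in pv.
  by exists (inl (exist _ (phiV v) vn)); right; split; [apply/eqP|eexists; [reflexivity|]].
have [psiV psiVP] := fin_all_exists exV.
have noe0 x : active F x.1 -> p (dend x) != y -> p (dother x) != y ->
    ((gends (phiE x.1)).1 != u0) && ((gends (phiE x.1)).2 != u0).
  move=> ax h1 h2; have [x' [e1 e2 e3]] := ends _ ax.
  have n1 : dend x' != u0 by rewrite e2; apply/eqP => /u0E h; rewrite h eqxx in h1.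
  have n2 : dother x' != u0 by rewrite e3; apply/eqP => /u0E h; rewrite h eqxx in h2.
  by rewrite -e1; move: n1 n2; case: (x') => e []; rewrite /dother /dend /= => -> ->.
(* Three kinds of edges: inside the fibre, away from it, and on its cut. The maps into the new graph
   are chosen from such specifications, because the edge types are nested sums of subtypes. *)
pose specE (g : gE G) (z : gE G2) :=
  [\/ p (gends g).1 = y /\ p (gends g).2 = y /\ exists2 k, z = inl (inr k) & val (val k) = g,
      p (gends g).1 <> y /\ p (gends g).2 <> y /\ (active F g /\ exists2 k, z = inl (inl k) & val k = phiE g) |
      (exists2 x, x \in bd X & x.1 = g) /\ exists2 d, z = inr d & (sval d).1 = phiE g].
have exE0 g : active (y |: F) g -> exists z, specE g z.
  move=> ag; pose x : dart G := (g, true).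
  case: (eqVneq (p (dend x)) y) => h1; case: (eqVneq (p (dother x)) y) => h2.
  - have [|k hk] := @ex_cdart G X x; first by rewrite in_X h1 eqxx.
    have vk : val k.1 = g by rewrite -[val k.1]/(cdart k).1 hk.
    have kn : ((gends k.1).1 != None :> option _) && ((gends k.1).2 != None :> option _).
      by rewrite /= !cproj_None vk !negbK !in_X; apply/andP; split; apply/eqP.
    by exists (inl (inr (exist _ k.1 kn))); constructor 1; split=> //; split=> //; eexists; [reflexivity|].
  - have xb : x \in bd X by rewrite in_bd !in_X h1 eqxx.
    have [d [d1 d2 d3]] := bdd _ xb.
    have dn : (dend d == u0) && (dother d != u0) by rewrite d2 d3 eqxx out0.
    exists (inr (exist _ d dn)); constructor 3; split; first by exists x.
    by eexists; [reflexivity|].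
  - have xb : flip x \in bd X by rewrite in_bd !in_X dend_flip dother_flip h2 eqxx.
    have [d [d1 d2 d3]] := bdd _ xb.
    have dn : (dend d == u0) && (dother d != u0) by rewrite d2 d3 eqxx out0.
    exists (inr (exist _ d dn)); constructor 3; split; first by exists (flip x).
    by eexists; [reflexivity|].
  have ag' : active F x.1.
    by move: ag; rewrite -[g]/x.1 !activeE in_setU in_set1 (negbTE h1).
  exists (inl (inl (exist _ (phiE g) (noe0 x ag' h1 h2)))); constructor 2; split; first exact/eqP.
  by split; [exact/eqP|split=> //; eexists; [reflexivity|]].
have bd_uniq x x' : x \in bd X -> x' \in bd X -> x.1 = x'.1 -> x = x'.
  move=> h h' /dart_eq_edge[//|e]; move: h'; rewrite e in_bd dend_flip dother_flip.
  by move: h; rewrite in_bd => /andP[_ /negbTE ->].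
have exE g : exists z, active (y |: F) g -> specE g z.
  case: (boolP (active (y |: F) g)) => ag; first by have [z hz] := exE0 _ ag; exists z.
  have /card_gt0P[x xb] : 0 < #|bd X| by rewrite b3.
  by have [z _] := exE0 _ (mono _ (bda _ xb)); exists z.
have [psiE psiEP] := fin_all_exists exE.
have bdends x : x \in bd X -> (p (gends x.1).1 == y) != (p (gends x.1).2 == y).
  rewrite in_bd !in_X; case: x => e []; rewrite /dother /dend /=;
  by case: (p _ == y); case: (p _ == y).
have bdN x : x \in bd X -> p (gends x.1).1 = y -> p (gends x.1).2 = y -> False.
  by move=> /bdends h h1 h2; move: h; rewrite h1 h2 eqxx.
have bdN' x : x \in bd X -> p (gends x.1).1 <> y -> p (gends x.1).2 <> y -> False.
  by move=> /bdends h /eqP/negbTE h1 /eqP/negbTE h2; move: h; rewrite h1 h2.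
have nact g : active F g -> p (gends g).1 = y -> p (gends g).2 = y -> False.
  by rewrite /active => + h1 h2; rewrite h1 h2 eqxx (negbTE yF).
have sig_dart x (d : ndarts G' u0) : x \in bd X -> (sval d).1 = phiE x.1 ->
    dother (sval d) = phiV (dother x) /\ dother (sval (sigma d)) = cproj X (dend x).
  move=> xb hd; have /andP[/eqP d1 d2] := valP d; split.
    have [d0 [e1 e2 e3]] := bdd _ xb; rewrite -e3; congr dother; apply: esym.
    have [//|e] := dart_eq_edge (etrans e1 (esym hd)).
    by have := out0 _ xb; rewrite -e3 -dend_flip -e d1 eqxx.
  have /andP[/eqP s1 s2] := valP (sigma d).
  have : cdart (sval (sigma d)) \in (@flip G) @: bd X by rewrite -contract_darts_out imset_f // inE s1.
  case/imsetP => x' xb' hx'; rewrite dother_cdart hx' dother_flip; congr (cproj X (dend _)).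
  apply: bd_uniq => //; apply: injE; rewrite ?bda // -hd -sigmaE.
  by rewrite -[x'.1]/(flip x').1 -hx'.
have psiV_inE v : p v = y -> exists2 k, psiV v = inr k & val k = cproj X v.
  by move=> pv; case: (psiVP v) => [[_]|[]].
have psiV_outE v : p v <> y -> exists2 k, psiV v = inl k & val k = phiV v.
  by move=> pv; case: (psiVP v) => [[]|[_]].
exists G2, (sub_tv sigma (fV y) tv), (sub_te sigma te), psiV, psiE; split=> //.
- move=> v w; case: (eqVneq (p v) y) => [pv|/eqP pv]; case: (eqVneq (p w) y) => [pw|/eqP pw].
  + have [k -> hk] := psiV_inE _ pv; have [k' -> hk'] := psiV_inE _ pw.
    split=> [[e]|[e|[_]]]; last by rewrite pv in_setU in_set1 eqxx.
      by left; apply: (cproj_eq (X := X)); rewrite ?in_X ?pw ?eqxx // -hk -hk' e.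
    by congr inr; apply: val_inj; rewrite hk' hk e.
  + have [k -> hk] := psiV_inE _ pv; have [k' -> hk'] := psiV_outE _ pw.
    by split=> // -[e|[e _]]; case: pw; rewrite -?e.
  + have [k -> hk] := psiV_outE _ pv; have [k' -> hk'] := psiV_inE _ pw.
    by split=> // -[e|[e _]]; case: pv; rewrite ?e.
  have [k -> hk] := psiV_outE _ pv; have [k' -> hk'] := psiV_outE _ pw.
  rewrite in_setU in_set1 (negbTE (introN eqP pv)) /= -eqV -hk -hk'.
  by split=> [[->]|/val_inj ->].
- case=> k.
    have [v hv] := ontoV (val k); exists v; have pv : p v <> y.
      by move/u0E => h; have := valP k; rewrite -hv h eqxx.
    by have [k' -> hk'] := psiV_outE _ pv; congr inl; apply: val_inj; rewrite hk' hv.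
  case: k => [[v|] kn]; last by have := kn; rewrite eqxx.
  have pv : p (val v) = y by apply/eqP; rewrite -in_X; apply: (valP v).
  exists (val v); have [k' -> hk'] := psiV_inE _ pv; congr inr; apply: val_inj; rewrite hk' /=.
  exact: valK.
- move=> g g' ag ag' e; case: (psiEP _ ag); case: (psiEP _ ag'); rewrite e.
  + by move=> [_ [_ [k -> <-]]] [_ [_ [k' [->] <-]]].
  + by move=> [_ [_ [_ [k -> _]]]] [_ [_ [k' //]]].
  + by move=> [_ [d -> _]] [_ [_ [k' //]]].
  + by move=> [_ [_ [k -> _]]] [_ [_ [_ [k' //]]]].
  + by move=> [_ [_ [a' [k -> hk]]]] [_ [_ [a [k' [e'] hk']]]]; apply: injE => //; rewrite -hk -hk' e'.
  + by move=> [_ [d -> _]] [_ [_ [_ [k' //]]]].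
  + by move=> [_ [_ [k -> _]]] [_ [k' //]].
  + by move=> [_ [_ [_ [k -> _]]]] [_ [k' //]].
  move=> [[x xb <-] [d -> hd]] [[x' xb' <-] [d' [e'] hd']].
  by apply: injE; rewrite ?bda // -hd -hd' e'.
- have bdd' (d : ndarts G' u0) : exists2 x, x \in bd X & (sval d).1 = phiE x.1.
    have /andP[/eqP d1 d2] := valP d; have [x [xb _ e _]] := dart0 _ d1 d2.
    by exists x.
  case=> [[k|k]|d].
  + have [g ag hg] := ontoE (val k); exists g; first exact: mono.
    case: (psiEP _ (mono _ ag)) => [[h1 [h2 _]]|[_ [_ [_ [k' -> hk']]]]|[[x xb hx] [d _ hd]]].
    * by case: (nact _ ag h1 h2).
    * by congr (inl (inl _)); apply: val_inj; rewrite hk' hg.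
    have /andP[/eqP d1 _] := valP d; have kk := valP k; exfalso; move: kk; rewrite -hg -hd.
    by move: d1; rewrite /=; case: (sval d) => e [] /= <-; rewrite /dend /= eqxx ?andbF.
  + have := valP k; rewrite /= !cproj_None !negbK !in_X => /andP[/eqP h1 /eqP h2].
    exists (val (val k)); first by rewrite /active h1 in_setU in_set1 eqxx orbT.
    have ag : active (y |: F) (val (val k)) by rewrite /active h1 in_setU in_set1 eqxx orbT.
    case: (psiEP _ ag) => [[_ [_ [k' -> hk']]]|[]|[[x xb hx] _]] //.
      by congr (inl (inr _)); do 2 apply: val_inj.
    by case: (bdN _ xb); rewrite hx.
  have [x xb hx] := bdd' d; exists x.1; first exact: mono (bda _ xb).
  case: (psiEP _ (mono _ (bda _ xb))) => [[h1 [h2 _]]|[h1 [h2 _]]|[_ [d' -> hd']]].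
  * by case: (bdN _ xb).
  * by case: (bdN' _ xb).
  by congr inr; apply: nd_inj; rewrite hd' hx.
- move=> x ax; case: (psiEP _ ax) => [[h1 [h2 [k -> hk]]]|[h1 [h2 [ag [k -> hk]]]]|[[x0 xb hx] [d -> hd]]].
  + have [px ox] : p (dend x) = y /\ p (dother x) = y.
      by move: h1 h2; case: (x) => e []; rewrite /dother /dend.
    have [k1 e1 hk1] := psiV_inE _ px; have [k2 e2 hk2] := psiV_inE _ ox.
    have kx : cdart (val k, x.2) = x by rewrite /cdart /= hk; case: (x).
    exists (inl (inr k), x.2); rewrite e1 e2; split=> //.
      rewrite /dend /=; case E1: x.2; congr inr; apply: val_inj; rewrite hk1 /= hk;
      by move: E1; case: (x) => e [].
    rewrite /dother /dend /=; case E1: x.2; congr inr; apply: val_inj; rewrite hk2 /= hk;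
    by move: E1; case: (x) => e [].
  + have [px ox] : p (dend x) <> y /\ p (dother x) <> y.
      by move: h1 h2; case: (x) => e []; rewrite /dother /dend.
    have [k1 e1 hk1] := psiV_outE _ px; have [k2 e2 hk2] := psiV_outE _ ox.
    have [x' [f1 f2 f3]] := ends _ ag.
    exists (inl (inl k), x'.2); rewrite e1 e2; split=> //.
      rewrite /dend /=; case E1: x'.2; congr inl; apply: val_inj; rewrite hk1 /= hk -f1 -f2;
      by move: E1; case: (x') => e [].
    rewrite /dother /dend /=; case E1: x'.2; congr inl; apply: val_inj; rewrite hk2 /= hk -f1 -f3;
    by move: E1; case: (x') => e [].
  have [s1 s2] := sig_dart _ _ xb (etrans hd (congr1 phiE (esym hx))).
  have px : p (dend x0) = y by move: xb; rewrite in_bd in_X => /andP[/eqP].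
  have ox : p (dother x0) <> y by move: xb; rewrite in_bd !in_X => /andP[_ /eqP].
  have [k1 e1 hk1] := psiV_inE _ px; have [k2 e2 hk2] := psiV_outE _ ox.
  have q1 : dend (G := G2) (inr d, false) = psiV (dend x0).
    by rewrite e1 /dend /=; congr inr; apply: val_inj; rewrite hk1.
  have q2 : dend (G := G2) (inr d, true) = psiV (dother x0).
    by rewrite e2 /dend /=; congr inl; apply: val_inj; rewrite hk2.
  have [->|->] := dart_eq_edge hx; [exists (inr d, false)|exists (inr d, true)];
  by rewrite ?dend_flip ?dother_flip.
- move=> v; rewrite in_setU in_set1 negb_or => /andP[pv vF].
  have [k -> hk] := psiV_outE _ (elimN eqP pv).
  rewrite /sub_tv (inj_eq fVI) (negbTE pv) htv //= -hk.
  by case: insubP => [k' _ hk'|]; [congr (Some (inl _)); apply: val_inj|rewrite (valP k)].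
move=> a ha; rewrite /sub_te hte /=; last first.
  by move=> j b /ha; rewrite in_setU negb_or => /andP[].
have aa : active F (io a).1.
  rewrite activeE (_ : _ != _) // (sk_end sk) (sk_other sk); exact: (P6_noloop (a, true)).
rewrite /sub_edge; case: (psiEP _ (mono _ aa)) => [[h1 [h2 _]]|[h1 [h2 [_ [k -> hk]]]]|[[x xb hx] [d -> hd]]].
- by case: (nact _ aa h1 h2).
- rewrite -hk; case: insubP => [k' _ hk'|]; last by rewrite (valP k).
  by congr (Some (inl (inl _))); apply: val_inj.
have [d1 d2] : dend (sval d) = u0 /\ dother (sval d) != u0.
  by have /andP[/eqP h1 h2] := valP d.
rewrite insubN; last first.
  rewrite -hd negb_and !negbK; move: d1; case: (sval d) => e []; rewrite /dend /= => ->;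
  by rewrite eqxx ?orbT.
case: insubP => [d' _ hd'|nt]; first by congr (Some (inr _)); apply: nd_inj; rewrite hd -[sval d']/(val d') hd'.
case: insubP => [d' _ hd'|nf] /=; first by congr (Some (inr _)); apply: nd_inj; rewrite hd -[sval d']/(val d') hd'.
exfalso; move: d1 d2 nt nf; rewrite -hd; case: (sval d) => e [] /= -> h; rewrite ?eqxx ?h //.
Qed.
End Expansion.

(** Only insertions destroy the identity of an edge, and they occur at leaves. As no edge meets two
    leaves, the edge into which a leaf needs an insertion is still available when that leaf is
    treated. *)
Lemma P6_one_leaf (e : gE P6) b b' j j' : dend (G := P6) (e, b) = inr (Some j) ->
  dend (G := P6) (e, b') = inr (Some j') -> j = j'.
Proof. by case: e => [i|[i|i]]; case: b; case: b' => //= -[<-] [<-]. Qed.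

Section InsertedFibre.
Variables (G : mgraph) (p : gV G -> gV P6) (io : gE P6 -> dart G) (y : gV P6).
Hypotheses (sk : skeleton p io) (cG : cubic G).
Variables (a : gV G) (d0 : dart P6) (d3 : dart G).
Hypothesis ins : inserted_fibre p io y a d0 d3.
Notation X := (fibre p y).
Notation R := (fibre p y :\ a).

Lemma inserted_R1 : dend (iod io d0) \in R.
Proof. by case: ins => _ h _ _ [h' _]; rewrite in_setD1 h' inE (iod_end sk) h eqxx. Qed.
Lemma inserted_R2 : dend (flip d3) \in R.
Proof. by case: ins => _ _ _ [h1 h2] _; rewrite dend_flip in_setD1 h2 inE h1 eqxx. Qed.

(** Two of the three darts at [a] are exits, so only [d3] stays in the fibre. *)
Lemma inserted_darts_at x : dend x = a -> p (dother x) = y -> x = d3.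
Proof.
case: ins => pa yd0 d3a [h1 h2] [h3 h4] xa px.
have [e1 [e2 [e3 [eE /and3P[n12 n13 n23]]]]] := cards3P (P6_deg y).
have [f1 [f2 [f12 [f1y f2y] [f10 f20]]]] : exists f1 f2, [/\ f1 != f2, dend f1 = y /\ dend f2 = y & f1 != d0 /\ f2 != d0].
  have ey e : e \in [set e1; e2; e3] -> dend e = y by rewrite -eE inE => /eqP.
  have y1 : dend e1 = y by apply: ey; rewrite !inE eqxx.
  have y2 : dend e2 = y by apply: ey; rewrite !inE eqxx orbT.
  have y3 : dend e3 = y by apply: ey; rewrite !inE eqxx !orbT.
  have : d0 \in [set e1; e2; e3] by rewrite -eE inE yd0.
  rewrite !inE => /orP[/orP[]|] /eqP ->; [exists e2, e3|exists e1, e3|exists e1, e2];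
  by split=> //; split=> //; rewrite eq_sym.
have ned (w : dart P6) z : dend w = y -> p (dother z) = y -> iod io w != z.
  move=> wy pz; apply/eqP => e; have := P6_noloop w; rewrite -(iod_other sk) e pz wy eqxx //.
have iI := iod_inj sk.
have [] := @darts3 _ cG a (iod io f1) (iod io f2) d3 (h4 _ f1y f10) (h4 _ f2y f20) d3a _ _ _ x xa.
- by rewrite (inj_eq iI).
- exact: ned.
- exact: ned.
- by move=> e; have := ned _ _ f1y px; rewrite e eqxx.
- by move=> e; have := ned _ _ f2y px; rewrite e eqxx.
by [].
Qed.

Lemma inserted_bd : bd R = [set iod io d0; flip d3].
Proof.
case: (ins) => pa yd0 d3a [h1 h2] [h3 h4].
apply/setP => x; rewrite in_bd in_setD1 !inE negb_and negbK; apply/idP/orP.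
  case/andP => /andP[xa /eqP px] /orP[/eqP ox|ox].
    right; apply/eqP/(can_inj (@flipK G)); rewrite flipK; apply: inserted_darts_at.
      by rewrite dend_flip.
    by rewrite dother_flip.
  left; have [|d hd] := @skel_dart _ _ _ sk x; first by rewrite px eq_sym.
  case: (eqVneq d d0) => [<-|dd]; first by rewrite hd.
  have dy : dend d = y by rewrite -(iod_end sk) hd.
  by have := h4 _ dy dd; rewrite hd => e; rewrite e eqxx in xa.
case=> /eqP ->.
  have := inserted_R1; rewrite in_setD1 inE => ->.
  by rewrite (iod_other sk) -yd0 (eq_sym (dother d0)) P6_noloop orbT.
have := inserted_R2; rewrite in_setD1 inE => ->.
by rewrite dother_flip d3a eqxx.
Qed.

Lemma inserted_neq : iod io d0 != flip d3.
Proof.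
case: (ins) => pa yd0 d3a [h1 h2] [h3 h4]; apply/eqP => e.
by have := P6_noloop d0; rewrite -(iod_other sk) e dother_flip d3a pa yd0 eqxx.
Qed.
End InsertedFibre.

Section Insertion.
Variables (G : mgraph) (p : gV G -> gV P6) (io : gE P6 -> dart G).
Hypothesis sk : skeleton p io.
Variables (cv : 'I_6 -> gV Pg) (ce : 'I_6 -> gE Pg).
Variables (fV : gV P6 -> gV Pg) (fE : gE P6 -> gE Pg).
Hypotheses (fVI : injective fV) (fEI : injective fE).
Hypotheses (fcv : forall i, fV (inl i) = cv i) (fce : forall i, fE (inl i) = ce i).
Hypotheses (tG : twoconn G) (cG : cubic G).
Variables (j : 'I_3) (a : gV G) (d0 : dart P6) (d3 : dart G).
Notation y := (inr (Some j) : gV P6).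
Hypothesis ins : inserted_fibre p io y a d0 d3.
Notation X := (fibre p y).
Notation R := (fibre p y :\ a).
Notation K := (splice (inserted_R1 sk ins) (inserted_R2 ins)).
Hypothesis Kcol : colourable3 K.
Implicit Types (x : dart G) (v : gV G) (g : gE G) (F : {set gV P6}).

(** The contracted fibre becomes its vertex [a], and the remaining vertices of the fibre, which have
    a 2-cut, are inserted into the edge of the exit [d0]. Of the two new edges, one represents [d3]
    and the other the old exit. *)
Lemma expand_O1 F : y \notin F -> expandable p io cv ce fV fE F -> expandable p io cv ce fV fE (y |: F).
Proof.
move=> yF [G' [tv [te [phiV [phiE [hB eqV ontoV injE ontoE ends htv hte]]]]]].
have [pa yd0 d3a [h1 h2] [h3 h4]] := ins.
set x1 := iod io d0 in h3 h4.
have bR := inserted_bd sk cG ins; have ne12 := inserted_neq sk ins; rewrite -/x1 in bR ne12.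
have K2 : twoconn K by apply: splice_twoconn tG bR.
have K3 : cubic K by apply: splice_cubic cG bR ne12.
have x1e : (io d0.1).1 = x1.1 by rewrite /x1 iod_edge.
have px1 : p (dend x1) = y by rewrite (iod_end sk).
have ox1 : p (dother x1) != y by rewrite (iod_other sk) -yd0 eq_sym P6_noloop.
have x1R : dend x1 \in R by exact: (inserted_R1 sk ins).
have a_out : a \notin R by rewrite !inE eqxx.
have inR v : (v \in R) = (v != a) && (p v == y) by rewrite in_setD1 inE.
have ax1 : active p F x1.1 by rewrite activeE px1 eq_sym ox1.
have [x1' [q1 q2 q3]] := ends _ ax1.
pose u0 := phiV a; pose e0 := phiE x1.1.
have q2' : dend x1' = u0 by rewrite q2; apply/eqV; right; rewrite px1 pa.
have te0 : te (fE d0.1) = Some e0.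
  rewrite hte ?x1e // => j' b h; rewrite (_ : j' = j) //; apply: (P6_one_leaf h (b' := d0.2)).
  by rewrite -surjective_pairing.
(* This choice joins the end [u0] of [e0] to the inner end of [d3] and the other end to the start of
   the exit, whichever way [e0] is stored. *)
pose b := ~~ x1'.2.
pose f : gE K := None.
pose G2 := twosum e0 f b.
have hB2 : @built cv ce G2 (ins_tv e0 f b tv) (ins_te e0 f b (fE d0.1) te).
  apply: built_O1 => //; last exact: (proj1 K2).
  move=> i; rewrite -fce (inj_eq fEI); apply/eqP => e.
  by have := yd0; rewrite [d0]surjective_pairing -e; case: d0.2.
have mono g : active p F g -> active p (y |: F) g.
  by rewrite /active in_setU => /orP[->|->] //; rewrite !orbT.
have nact x : active p F x.1 -> p (dend x) = y -> p (dother x) = y -> False.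
  by rewrite activeE => + g1 g2; rewrite g1 g2 eqxx (negbTE yF).
have ad3 : ~ active p F d3.1 by move/nact; rewrite d3a pa h1; apply.
have Rin x : dend x \in R -> dother x \in R -> active p F x.1 -> False.
  by rewrite !inR => /andP[_ /eqP g1] /andP[_ /eqP g2] /nact; apply.
have d31 : d3.1 != x1.1 by apply/eqP => e; apply: ad3; rewrite e.
have exV v : exists z : gV G2, (v \in R /\ exists2 k, z = inr k & spv k = v) \/
    (v \notin R /\ z = inl (phiV v)).
  case: (boolP (v \in R)) => vR; last by exists (inl (phiV v)); right.
  by exists (inr (Sub v vR : sV R)); left; split=> //; eexists; [reflexivity|rewrite /spv SubK].
have [psiV psiVP] := fin_all_exists exV.
have psiV_in v : v \in R -> exists2 k, psiV v = inr k & spv k = v.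
  by move=> vR; case: (psiVP v) => [[_]|[]] //; rewrite vR.
have psiV_out v : v \notin R -> psiV v = inl (phiV v).
  by move=> vR; case: (psiVP v) => [[]|[_]] //; rewrite (negbTE vR).
pose specE (g : gE G) (z : gE G2) :=
  [\/ exists x, [/\ x.1 = g, dend x \in R, dother x \in R &
        exists k h, [/\ z = inl (inr k), val k = Some h & val h = g]],
      g = d3.1 /\ z = inr x1'.2, g = x1.1 /\ z = inr (~~ x1'.2) |
      [/\ active p F g, g <> x1.1 & exists2 k, z = inl (inl k) & val k = phiE g]].
have exE0 g : active p (y |: F) g -> exists z, specE g z.
  move=> ag; pose x : dart G := (g, true).
  case: (boolP (active p F g)) => aF.
    case: (eqVneq g x1.1) => gx; first by exists (inr (~~ x1'.2)); constructor 3.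
    have kn : phiE g != e0 by apply: contra gx => /eqP/injE ->.
    exists (inl (inl (exist _ (phiE g) kn))); constructor 4; split=> //; first exact/eqP.
    by eexists; [reflexivity|].
  have [px ox] : p (dend x) = y /\ p (dother x) = y.
    move: ag aF; rewrite -[g]/x.1 !activeE in_setU in_set1.
    case: (eqVneq (p (dend x)) (p (dother x))) => //= <-.
    by case: (eqVneq (p (dend x)) y) => [-> //|_ /= ->].
  case: (eqVneq (dend x) a) => xa.
    by exists (inr x1'.2); constructor 2; split=> //; rewrite -(inserted_darts_at sk cG ins xa ox).
  case: (eqVneq (dother x) a) => oa.
    exists (inr x1'.2); constructor 2; split=> //.
    have <- : flip x = d3 by apply: (inserted_darts_at sk cG ins); rewrite ?dend_flip ?dother_flip.
    by [].
  have xR : dend x \in R by rewrite inR xa px eqxx.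
  have oR : dother x \in R by rewrite inR oa ox eqxx.
  have gR : ((gends g).1 \in R) && ((gends g).2 \in R) by apply/andP.
  have kn : (Some (exist _ g gR) : gE K) != f by [].
  exists (inl (inr (exist (fun k : gE K => is_true (k != f)) (Some (exist _ g gR)) kn))); constructor 1; exists x; split=> //.
  by eexists; eexists; split; [reflexivity|reflexivity|].
have exE g : exists z, active p (y |: F) g -> specE g z.
  case: (boolP (active p (y |: F) g)) => ag; first by have [z hz] := exE0 _ ag; exists z.
  by exists (inr true).
have [psiE psiEP] := fin_all_exists exE.
have a'd3 : active p (y |: F) d3.1 by rewrite activeE d3a pa in_setU in_set1 eqxx orbT.
have Rd3 x : x.1 = d3.1 -> dend x \in R -> dother x \in R -> False.
  move=> e g1 g2; have [hx|hx] := dart_eq_edge e.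
    by move: g1; rewrite -hx d3a (negbTE a_out).
  by move: g2; rewrite -dend_flip -hx d3a (negbTE a_out).
have Rx1 x : x.1 = x1.1 -> dend x \in R -> dother x \in R -> False.
  by move=> e g1 g2; apply: (Rin x) => //; rewrite e.
have psi_d3 : psiE d3.1 = inr x1'.2.
  case: (psiEP _ a'd3) => [[x [e g1 g2 _]]|[_ ->]|[e _]|[]] //; first by case: (Rd3 x).
  by rewrite e eqxx in d31.
have psi_x1 : psiE x1.1 = inr (~~ x1'.2).
  case: (psiEP _ (mono _ ax1)) => [[x [e g1 g2 _]]|[e _]|[_ ->]|[]] //; first by case: (Rx1 x).
  by rewrite e eqxx in d31.
have psi_out g : active p F g -> g <> x1.1 -> exists2 k, psiE g = inl (inl k) & val k = phiE g.
  move=> ag gx; case: (psiEP _ (mono _ ag)) => [[x [e g1 g2 _]]|[e _]|[e _]|[]] //.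
    by case: (Rin x); rewrite ?e.
  by case: ad3; rewrite -e.
exists G2, (ins_tv e0 f b tv), (ins_te e0 f b (fE d0.1) te), psiV, psiE; split=> //.
- move=> v w; case: (boolP (v \in R)) => vR; case: (boolP (w \in R)) => wR.
  + have [k -> hk] := psiV_in _ vR; have [k' -> hk'] := psiV_in _ wR.
    split=> [[e]|[e|[_]]]; first by left; rewrite -hk -hk' e.
      by congr inr; apply: spv_inj; rewrite hk hk' e.
    by move: vR; rewrite inR in_setU in_set1 => /andP[_ ->].
  + have [k -> hk] := psiV_in _ vR; rewrite (psiV_out _ wR); split=> // -[e|[e n]].
      by rewrite -e vR in wR.
    by move: vR n; rewrite inR in_setU in_set1 => /andP[_ ->].
  + have [k -> hk] := psiV_in _ wR; rewrite (psiV_out _ vR); split=> // -[e|[e n]].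
      by rewrite e wR in vR.
    by move: wR n; rewrite inR in_setU in_set1 e => /andP[_ ->].
  rewrite !psiV_out // in_setU in_set1 negb_or.
  have ay z : z \notin R -> p z = y -> z = a.
    by rewrite inR => + e; rewrite e eqxx andbT negbK => /eqP.
  split=> [[/eqV[->|[e n]]]|[->|[e /andP[_ n]]]] //; [by left| |].
    case: (eqVneq (p v) y) => pv; last by right.
    by left; rewrite (ay v) // (ay w) // -e.
  by congr inl; apply/eqV; right.
- case=> [z|k].
    have [v hv] := ontoV z; case: (boolP (v \in R)) => vR; last by exists v; rewrite psiV_out // hv.
    exists a; rewrite psiV_out //; congr inl; rewrite -hv; apply/eqV; right.
    by move: vR; rewrite inR pa => /andP[_ /eqP ->].
  by exists (spv k); have [k' -> hk'] := psiV_in _ (spv_in k); congr inr; apply: spv_inj.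
- move=> g g' ag ag' e; case: (psiEP _ ag); case: (psiEP _ ag'); rewrite e.
  + by move=> [x [_ _ _ [k [h [-> e1 e2]]]]] [x' [_ _ _ [k' [h' [[<-] e3 e4]]]]];
      rewrite -e2 -e4; congr val; move: e3; rewrite e1 => -[].
  + by move=> [_ ->] [x' [_ _ _ [k' [h' []]]]].
  + by move=> [_ ->] [x' [_ _ _ [k' [h' []]]]].
  + by move=> [_ _ [k -> _]] [x' [_ _ _ [k' [h' []]]]].
  + by move=> [x' [_ _ _ [k' [h' [->]]]]] _ _ [].
  + by move=> [-> _] [-> _].
  + by move=> [_ ->] [_ []]; case: (x1'.2).
  + by move=> [_ _ [k -> _]] [].
  + by move=> [x' [_ _ _ [k' [h' [->]]]]] _ _ [].
  + by move=> [_ ->] [_ []]; case: (x1'.2).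
  + by move=> [-> _] [-> _].
  + by move=> [_ _ [k -> _]] [].
  + by move=> [x' [_ _ _ [k' [h' [->]]]]] _ _ [_ _ []].
  + by move=> [_ ->] [_ _ []].
  + by move=> [_ ->] [_ _ []].
  by move=> [a1 _ [k -> hk]] [a2 _ [k' [ek] hk']]; apply: injE => //; rewrite -hk -hk' ek.
- case=> [[k|k]|b'].
  + have [g ag hg] := ontoE (val k); exists g; first exact: mono.
    have [|k' -> hk'] := psi_out _ ag; last by congr (inl (inl _)); apply: val_inj; rewrite hk' hg.
    by move=> e; have := valP k; rewrite -hg e eqxx.
  + case: k => [[h|] kn]; last by have := kn; rewrite eqxx.
    have [g1 g2] := andP (valP h).
    have ag : active p (y |: F) (val h).
      by rewrite /active in_setU in_set1; move: g1; rewrite inR => /andP[_ ->]; rewrite orbT.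
    exists (val h) => //; case: (psiEP _ ag) => [[x [_ _ _ [k' [h' [-> e1 e2]]]]]|[e _]|[e _]|[aF _ _]].
    * by congr (inl (inr _)); apply: val_inj; rewrite e1 /=; congr Some; apply: val_inj.
    * by case: (Rd3 (val h, true)).
    * by case: (Rx1 (val h, true)).
    by case: (Rin (val h, true)).
  case: (eqVneq b' x1'.2) => e; first by exists d3.1; rewrite // psi_d3 e.
  exists x1.1; first exact: mono.
  by rewrite psi_x1; congr inr; move: e; case: b'; case: (x1'.2).
- have endE0 : dend (G := G') (e0, x1'.2) = u0 /\ dother (G := G') (e0, x1'.2) = phiV (dother x1).
    by rewrite -q2' -q3 /e0 -q1 -surjective_pairing.
  have x1o : dother x1 \notin R by rewrite inR (negbTE ox1) andbF.
  have d3o : dother d3 \in R by rewrite inR h2 h1 eqxx.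
  have [k1 kE1 hk1] := psiV_in _ x1R; have [k3 kE3 hk3] := psiV_in _ d3o.
  have new3 : exists z : dart G2, [/\ z.1 = inr x1'.2, dend z = psiV (dend d3) & dother z = psiV (dother d3)].
    exists (inr x1'.2, true); rewrite kE3 d3a psiV_out // -/u0; split=> //.
      by case: endE0 => <- _; rewrite /dend /=; case: (x1'.2).
    rewrite /dother /dend /= /b; case: (x1'.2) => /=; congr inr; apply: spv_inj; rewrite hk3;
    by rewrite /spv /= dend_flip.
  have new1 : exists z : dart G2, [/\ z.1 = inr (~~ x1'.2), dend z = psiV (dend x1) & dother z = psiV (dother x1)].
    exists (inr (~~ x1'.2), false); rewrite kE1 psiV_out //; split=> //.
      by rewrite /dend /= /b; case: (x1'.2) => /=; congr inr; apply: spv_inj; rewrite hk1.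
    by case: endE0 => _ <-; rewrite /dother /dend /=; case: (x1'.2).
  have fl x g (z : gE G2) : x.1 = g -> (exists z' : dart G2, [/\ z'.1 = z, dend z' = psiV (dend x) & dother z' = psiV (dother x)]) ->
     forall x', x'.1 = g -> exists z' : dart G2, [/\ z'.1 = z, dend z' = psiV (dend x') & dother z' = psiV (dother x')].
    move=> xg [z' [f1 f2 f3]] x' xg'; have [->|->] := dart_eq_edge (etrans xg (esym xg')).
      by exists z'.
    by exists (flip z'); rewrite !dend_flip !dother_flip.
  move=> x ax; case: (psiEP _ ax) => [[x0 [e g1 g2 [k [h [-> e1 e2]]]]]|[e ->]|[e ->]|[aF ne [k -> hk]]].
  + apply: (fl x0 x.1 _ e) => //.
    have [k1' -> hk1'] := psiV_in _ g1; have [k2' -> hk2'] := psiV_in _ g2.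
    have hx : (val h, x0.2) = x0 by rewrite e2 -e -surjective_pairing.
    exists (inl (inr k), x0.2); split=> //.
      rewrite /dend /= e1 /=; case E: x0.2; congr inr; apply: spv_inj; rewrite hk1' -hx /spv /= E //.
    rewrite /dother /dend /= e1 /=; case E: x0.2; congr inr; apply: spv_inj; rewrite hk2' -hx /spv /= E //.
  + exact: (fl d3 d3.1 _ erefl new3).
  + exact: (fl x1 x1.1 _ erefl new1).
  have [x' [f1 f2 f3]] := ends _ aF.
  have nR v w : phiV v = phiV w -> v \in R -> phiV w = phiV a.
    by rewrite inR => <- /andP[_ /eqP pv]; apply/eqV; right; rewrite pv pa.
  have out v : (exists2 z : dart G, z.1 = x.1 & dend z = v) -> v \notin R.
    move=> [z ez <-]; apply/negP => zR; case: (boolP (dother z \in R)) => oR.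
      by case: (Rin z) => //; rewrite ez.
    have : z \in bd R by rewrite in_bd zR.
    rewrite bR !inE => /orP[] /eqP hz; first by apply: ne; rewrite -ez hz.
    by apply: ad3; move: aF; rewrite -ez hz.
  rewrite !psiV_out; [|by apply: out; exists (flip x)|by apply: out; exists x].
  exists (inl (inl k), x'.2); split=> //.
    by rewrite /dend /= hk -f1 -f2; case: (x') => e [].
  by rewrite /dother /dend /= hk -f1 -f3; case: (x') => e [].
- move=> v; rewrite in_setU in_set1 negb_or => /andP[pv vF].
  by rewrite psiV_out ?inR ?(negbTE pv) ?andbF // /ins_tv htv.
move=> e he; rewrite /ins_te (inj_eq fEI).
have ed0 : e != d0.1.
  apply/eqP => ee; have := he j d0.2; rewrite ee -surjective_pairing yd0 => /(_ erefl).
  by rewrite in_setU in_set1 eqxx.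
rewrite (negbTE ed0) hte /=; last by move=> j' b' /he; rewrite in_setU negb_or => /andP[].
have ae : active p F (io e).1.
  rewrite activeE (_ : _ != _) // (sk_end sk) (sk_other sk); exact: (P6_noloop (e, true)).
have ne : (io e).1 <> x1.1 by rewrite -x1e => /(io_edge_inj sk) ee; rewrite ee eqxx in ed0.
have [k -> hk] := psi_out _ ae ne; rewrite -hk.
by case: insubP => [k' _ hk'|]; [congr (Some (inl (inl _))); apply: val_inj|rewrite (valP k)].
Qed.
End Insertion.

Section Assembly.
Variables (cv : 'I_6 -> gV Pg) (ce : 'I_6 -> gE Pg).
Variables (fV : gV P6 -> gV Pg) (fE : gE P6 -> gE Pg).
Hypotheses (fVI : injective fV) (fEI : injective fE).
Hypotheses (fVs : forall z, exists y, fV y = z) (fEs : forall z, exists e, fE e = z).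
Hypotheses (fcv : forall i, fV (inl i) = cv i) (fce : forall i, fE (inl i) = ce i).
Hypothesis fends : forall e, ueq (gends (fE e)) (fV (gends e).1, fV (gends e).2).
Variable G : mgraph.
Hypotheses (tG : twoconn G) (cG : cubic G).

Section Base.
Variables (p : gV G -> gV P6) (io : gE P6 -> dart G).
Hypothesis sk : skeleton p io.
Implicit Types (F : {set gV P6}).

(** Skeleton vertices with a singleton fibre need no operation. Starting the induction from them
    makes the initial intermediate graph [Pg] itself. *)
Definition trivial_fibres := [set y | #|fibre p y| == 1].

Lemma trivial_fibresP v w : p v = p w -> p v \in trivial_fibres -> v = w.
Proof.
rewrite inE => e /cards1P[u hu].
have : v \in fibre p (p v) by rewrite inE.
have : w \in fibre p (p v) by rewrite inE e.
by rewrite hu !inE => /eqP -> /eqP ->.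
Qed.

Lemma active_trivial x : active p trivial_fibres x.1 -> exists d, iod io d = x.
Proof.
rewrite activeE => /orP[h|h]; first exact: (skel_dart sk).
apply: (skel_dart sk); apply/eqP => e; have := no_loop x cG (proj2 tG).
by rewrite (trivial_fibresP e h) eqxx.
Qed.

Lemma expandable_base : expandable p io cv ce fV fE trivial_fibres.
Proof.
pose phiE g := fE (odflt (inl (o6 0)) [pick a | (io a).1 == g]).
have phiEP a : phiE (io a).1 = fE a.
  rewrite /phiE; case: pickP => [b /eqP /(io_edge_inj sk) -> //|/(_ a)]; by rewrite eqxx.
exists Pg, (@Some _), (@Some _), (fun v => fV (p v)), phiE; split=> //.
- exact: built_Pg.
- move=> v w; split=> [/fVI e|[->|[-> _]]] //.
  case: (boolP (p v \in trivial_fibres)) => h; last by right.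
  by left; apply: trivial_fibresP.
- by move=> z; have [y <-] := fVs z; have [v <-] := ex_in_fibre sk y; exists v.
- move=> g g' ag ag'; have [d hd] := active_trivial (x := (g, true)) ag.
  have [d' hd'] := active_trivial (x := (g', true)) ag'.
  have -> : g = (io d.1).1 by rewrite -iod_edge hd.
  have -> : g' = (io d'.1).1 by rewrite -iod_edge hd'.
  by rewrite !phiEP => /fEI ->.
- move=> z; have [e <-] := fEs z; exists (io e).1; last exact: phiEP.
  rewrite activeE (_ : _ != _) // (sk_end sk) (sk_other sk); exact: (P6_noloop (e, true)).
- move=> x /active_trivial[d <-]; rewrite iod_edge phiEP (iod_end sk) (iod_other sk).
  have /ueq_dartP[b [h1 h2]] := fends d.1.
  case: d h1 h2 => e [] h1 h2; first by exists (fE e, b).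
  by exists (flip (fE e, b)); rewrite dend_flip dother_flip.
by move=> a _; rewrite phiEP.
Qed.

Lemma expandable_iso : expandable p io cv ce fV fE setT ->
  exists G' tv te, @built cv ce G' tv te /\ iso G G'.
Proof.
case=> G' [tv [te [phiV [phiE [hB eqV ontoV injE ontoE ends _ _]]]]].
exists G', tv, te; split=> //; exists phiV, phiE.
have act g : active p setT g by rewrite /active inE orbT.
split.
- have [f fK] := fin_all_exists ontoV; exists f => // v.
  by have /eqV[|[_]] := fK (phiV v); rewrite ?inE.
- have ontoE' z : exists g, phiE g = z by have [g _ <-] := ontoE z; exists g.
  have [f fK] := fin_all_exists ontoE'; exists f => // v; exact: injE.
move=> e; have [x' [h1 h2 h3]] := ends (e, true) (act e).
by apply/ueq_dartP; exists x'.2; rewrite -h1 -surjective_pairing.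
Qed.
End Base.

(** The centre is expanded by a substitution and each leaf by a substitution or an insertion, unless
    trivial; rim fibres are always trivial. Once every skeleton vertex is expanded, the contraction
    maps are isomorphisms. *)
Theorem built_of_skeleton p io c U : no_4cover G -> @coloured_skeleton G c p io ->
  bipartising_fibre p (inr None) U -> exists G' tv te, @built cv ce G' tv te /\ iso G G'.
Proof.
move=> nocov cs hU; have [sk r1 pc] := cs; apply: (expandable_iso (p := p) (io := io)).
have O2 y V (F : {set gV P6}) : nonrim y -> y \notin F -> bipartising_fibre p y V -> 2 <= #|V| ->
    expandable p io cv ce fV fE F -> expandable p io cv ce fV fE (y |: F).
  move=> ny yF [VX Vind Vex Vcomp] V2; have b3 := card_bd_fibre sk y.
  apply: (expand_O2 sk fVI fcv ny tG cG) => //.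
    apply: (@contract_colourable G (fibre p y) tG cG b3 (fun v => nonrim (p v)) c (pcn pc)) => v.
    by rewrite inE => /eqP->.
  apply: (contract_correct cG b3 (U := V)) => //.
    by move=> x; rewrite in_bd !inE => /andP[/eqP h1 h2]; apply: Vex.
  by move=> v; rewrite inE => /eqP; apply: Vcomp.
have triv y (F : {set gV P6}) : trivial_fibres p \subset F -> y \notin F -> ~ exists a, fibre p y = [set a].
  move=> /subsetP tF yF [a ha]; move/negP: yF; apply; apply: tF.
  by rewrite inE ha cards1.
have step y (F : {set gV P6}) : nonrim y -> trivial_fibres p \subset F -> expandable p io cv ce fV fE F ->
    expandable p io cv ce fV fE (y |: F).
  move=> ny tF eF; case: (boolP (y \in F)) => yF; first by rewrite (setUidPr _) // sub1set.
  case: y ny yF => [//|[j|]] ny yF.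
    have [/(triv (inr (Some j)) F tF yF) []|[V hV V2]|[a [d0 [d3 hi]]]] :=
      @leaf_cases G p io (inr (Some j)) tG cG sk (fun M => no_3matching tG cG nocov (M := M) cs).
      exact: (O2 _ V).
    have Kc : colourable3 (splice (inserted_R1 sk hi) (inserted_R2 hi)).
      apply: (@splice_colourable G _ _ _ _ _ tG cG (inserted_bd sk cG hi) (inserted_neq sk hi)
        (fun v => nonrim (p v)) c (pcn pc)).
      by have [_ yd0 _ _ _] := hi; move=> v; rewrite in_setD1 inE => /andP[_ /eqP->].
    exact: (expand_O1 fEI fce tG cG Kc).
  by have [/(triv (inr None) F tF yF) []|U2] := centre_cases tG cG sk hU; apply: (O2 _ U).
have e0 := expandable_base sk; have t0 := subxx (trivial_fibres p).
have grow y (F : {set gV P6}) : trivial_fibres p \subset F -> trivial_fibres p \subset y |: F.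
  by move=> h; apply: subset_trans h (subsetUr _ _).
have e1 := step (inr None) _ isT t0 e0; have {}t0 := grow (inr None) _ t0.
have {}e0 := step (inr (Some (o3 0))) _ isT t0 e1; have {}t0 := grow (inr (Some (o3 0))) _ t0.
have {}e1 := step (inr (Some (o3 1))) _ isT t0 e0; have {}t0 := grow (inr (Some (o3 1))) _ t0.
have {}e0 := step (inr (Some (o3 2))) _ isT t0 e1.
rewrite (_ : setT = (inr (Some (o3 2)) : gV P6) |: (inr (Some (o3 1)) |: (inr (Some (o3 0)) |:
   (inr None |: trivial_fibres p)))) //.
apply/setP => y; rewrite !inE; case: y => [i|[j|]] //=; last first.
  by move: j; apply: three_ind.
apply/esym; have [v hv] := ex_in_fibre sk (inl i).
apply/cards1P; exists v; apply/setP => w; rewrite !inE; apply/eqP/eqP => [h|-> //].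
exact: (r1 _ _ i).
Qed.
End Assembly.

(** * 6-cycles of the Petersen graph *)

Definition enc (v : gV Pg) : nat := match v with inl i => val i | inr i => 5 + val i end.
Definition dec (n : nat) : gV Pg := if n < 5 then inl (inord n) else inr (inord (n - 5)).
Lemma encK : cancel enc dec.
Proof.
case=> i; rewrite /dec /enc; first by rewrite ltn_ord inord_val.
by rewrite ltnNge leq_addr /= addKn inord_val.
Qed.
Lemma decK n : n < 10 -> enc (dec n) = n.
Proof.
move=> n10; rewrite /dec; case: ltnP => n5 /=; first by rewrite inordK.
by rewrite inordK; lia.
Qed.
Lemma enc_lt v : enc v < 10.
Proof. by case: v => i /=; have := ltn_ord i; lia. Qed.

Definition adjn (a b : nat) : bool :=
  if a < 5 then (if b < 5 then (b == (a + 1) %% 5) || (a == (b + 1) %% 5) else b == 5 + a)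
  else (if b < 5 then a == 5 + b else (b - 5 == (a - 5 + 2) %% 5) || (a - 5 == (b - 5 + 2) %% 5)).

Lemma eadj_Pg (u v : gV Pg) : eadj u v = adjn (enc u) (enc v).
Proof.
have io5 (i : 'I_5) k : val (inord ((i + k) %% 5) : 'I_5) = (i + k) %% 5 by rewrite /= inordK // ltn_mod.
apply/eadjP/idP => [[[[k i] b] [<- <-]]|].
  rewrite /adjn; case: k => [[|[|[|k]]] ltk] //; case: b; rewrite /dother /dend /= ?io5 ?ltn_ord ?ltn_mod //=
   ?eqxx ?orbT // ?addKn ?(ltnNge _ 5) ?leq_addr ?ltn_ord /= ?io5 ?eqxx ?orbT //.
case: u => i; case: v => k; rewrite /adjn /= ?ltn_ord ?(ltnNge _ 5) ?leq_addr /= ?ltn_ord ?(ltnNge _ 5) ?leq_addr /= ?addKn.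
- case/orP => /eqP e; [exists (o3 0, i, true)|exists (o3 0, k, false)]; rewrite /dother /dend /=;
  by split=> //; congr inl; apply: val_inj; rewrite /= inordK ?ltn_mod.
- move=> /eqP/addnI e; exists (o3 1, i, true); rewrite /dother /dend /=; split=> //.
  by congr inr; apply: val_inj.
- move=> /eqP/addnI e; exists (o3 1, k, false); rewrite /dother /dend /=; split=> //.
  by congr inr; apply: val_inj.
case/orP => /eqP e; [exists (o3 2, i, true)|exists (o3 2, k, false)]; rewrite /dother /dend /=;
by split=> //; congr inr; apply: val_inj; rewrite /= inordK ?ltn_mod.
Qed.

Lemma Pg_simple (e e' : gE Pg) : ueq (gends e) (gends e') -> e = e'.
Proof.
have ne1 (i : 'I_5) : (i + 1 + 1) %% 5 <> i by case: i => [[|[|[|[|[|i]]]]] lti].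
have ne2 (i : 'I_5) : (i + 2 + 2) %% 5 <> i by case: i => [[|[|[|[|[|i]]]]] lti].
have io5 (i : 'I_5) k : val (inord ((i + k) %% 5) : 'I_5) = (i + k) %% 5 by rewrite /= inordK // ltn_mod.
case: e => [[[|[|[|k]]] ltk] i] //; case: e' => [[[|[|[|k']]] ltk'] i'] //;
move=> /orP[] /eqP[] //.
- by move=> -> _; congr (_, _); apply: val_inj.
- move=> -> /(congr1 val); rewrite io5 /= inordK ?ltn_mod // modnDml => /ne1 //.
- by move=> -> _; congr (_, _); apply: val_inj.
- by move=> -> _; congr (_, _); apply: val_inj.
- move=> -> /(congr1 val); rewrite io5 /= inordK ?ltn_mod // modnDml => /ne2 //.
Qed.

(** Conditionals replace boolean connectives, whose second argument [vm_compute] would evaluate in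
    every branch. *)
Fixpoint all10 (n : nat) (P : nat -> bool) : bool :=
  if n is n'.+1 then (if P n' then all10 n' P else false) else true.
Lemma all10P n P : all10 n P -> forall a, a < n -> P a.
Proof.
elim: n => //= n IH; case E: (P n) => // /IH h a; rewrite ltnS leq_eqVlt => /orP[/eqP -> //|]; exact: h.
Qed.
Fixpoint has10 (n : nat) (P : nat -> bool) : bool :=
  if n is n'.+1 then (if P n' then true else has10 n' P) else false.
Lemma has10P n P : has10 n P -> exists2 a, a < n & P a.
Proof.
elim: n => //= n IH; case: ifP => [h _|_ /IH[a h1 h2]]; first by exists n.
by exists a => //; apply: leqW.
Qed.

Definition next_all (a : nat) (P : nat -> bool) := all10 10 (fun b => if adjn a b then P b else true).
Definition next_has (a : nat) (P : nat -> bool) := has10 10 (fun b => if adjn a b then P b else false).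

(** Around every 6-cycle of the Petersen graph, opposite vertices have common neighbours [x0], [x1],
    [x2], these have a common neighbour [w], and all ten vertices are distinct. This is the drawing
    [P6]. *)
Definition frame_check : bool :=
  all10 10 (fun a0 => next_all a0 (fun a1 => next_all a1 (fun a2 => next_all a2 (fun a3 =>
  next_all a3 (fun a4 => next_all a4 (fun a5 =>
   if ~~ (adjn a5 a0 && uniq [:: a0; a1; a2; a3; a4; a5]) then true else
   next_has a0 (fun x0 => if ~~ adjn a3 x0 then false else
   next_has a1 (fun x1 => if ~~ adjn a4 x1 then false else
   next_has a2 (fun x2 => if ~~ adjn a5 x2 then false else
   next_has x0 (fun w => [&& adjn x1 w, adjn x2 w &
      uniq [:: a0; a1; a2; a3; a4; a5; x0; x1; x2; w]])))))))))).

Lemma frame_checkP : frame_check. Proof. by vm_compute. Qed.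

Definition idx (y : gV P6) : nat :=
  match y with inl i => val i | inr (Some j) => 6 + val j | inr None => 9 end.
Lemma idx_lt10 y : idx y < 10.
Proof.
by case: y => [i|[j|]] //=; [have := ltn_ord i | have := ltn_ord j]; lia.
Qed.
Lemma idxI : injective idx.
Proof.
case=> [i|[j|]] [i'|[j'|]] //=.
- by move=> /val_inj ->.
- by move=> h; have := ltn_ord i; rewrite h; lia.
- by move=> h; have := ltn_ord i; rewrite h.
- by move=> h; have := ltn_ord i'; rewrite -h; lia.
- by move=> /(@addnI 6)/val_inj ->.
- by move=> h; have := ltn_ord j; lia.
- by move=> h; have := ltn_ord i'; rewrite -h.
- by move=> h; have := ltn_ord j'; lia.
Qed.

Lemma ueq_join (T : eqType) (g h q : T * T) : ueq g q -> ueq h q -> ueq g h.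
Proof.
rewrite /ueq; case: q => q1 q2 /=.
by move=> /orP[/eqP->|/eqP->] /orP[/eqP->|/eqP->]; rewrite /= eqxx ?orbT.
Qed.

(** This reduces an arbitrary fixed 6-cycle to the rim of [P6]. Edge maps come for free, since both
    graphs are simple. *)
Lemma petersen_frame cv ce : @is_6cycle Pg cv ce -> exists (fV : gV P6 -> gV Pg) (fE : gE P6 -> gE Pg),
  [/\ injective fV, injective fE, forall i, fV (inl i) = cv i, forall i, fE (inl i) = ce i &
    forall e, ueq (gends (fE e)) (fV (gends e).1, fV (gends e).2)].
Proof.
move=> [cvI ceI cends].
have cends' i : ueq (gends (ce i)) (cv i, cv (nx i)) := cends i.
pose a i := enc (cv i).
have adj i : adjn (a i) (a (nx i)) by rewrite -eadj_Pg; apply/existsP; exists (ce i).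
have nall i P : next_all (a i) P -> P (a (nx i)).
  by move=> /all10P /(_ _ (enc_lt (cv (nx i)))); rewrite -/(a (nx i)) adj.
have nhas i P : next_has (a i) P -> exists2 b, b < 10 & adjn (a i) b /\ P b.
  by move=> /has10P[b b10]; case: ifP => // ab Pb; exists b.
have := all10P frame_checkP (enc_lt (cv (o6 0))).
rewrite -/(a (o6 0)) => /nall /nall /nall /nall /nall; rewrite !nxE.
have := adj (o6 5); rewrite nxE => ->.
have -> : uniq [:: a (o6 0); a (o6 1); a (o6 2); a (o6 3); a (o6 4); a (o6 5)].
  have aI : injective a by move=> i k /(can_inj encK)/cvI.
  have -> : [:: a (o6 0); a (o6 1); a (o6 2); a (o6 3); a (o6 4); a (o6 5)] =
     map a [:: o6 0; o6 1; o6 2; o6 3; o6 4; o6 5] by [].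
  by rewrite map_inj_uniq.
rewrite [~~ _]/= => /nhas[x0 l0 [b0]]; case: ifP => // /negbFE c0.
move=> /nhas[x1 l1 [b1]]; case: ifP => // /negbFE c1.
move=> /nhas[x2 l2 [b2]]; case: ifP => // /negbFE c2.
move=> /has10P[w lw]; case: ifP => // d0 /and3P[d1 d2 us].
pose l := [:: a (o6 0); a (o6 1); a (o6 2); a (o6 3); a (o6 4); a (o6 5); x0; x1; x2; w].
have idx_lt y : idx y < size l := idx_lt10 y.
have l10 n : n < size l -> nth 0 l n < 10.
  move=> h; have : nth 0 l n \in l by apply: mem_nth.
  have : all (fun n => n < 10) l by rewrite /= !enc_lt l0 l1 l2 lw.
  by move=> /allP; apply.
pose fV y := dec (nth 0 l (idx y)).
have encf y : enc (fV y) = nth 0 l (idx y) by rewrite decK // l10.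
have fVI : injective fV.
  move=> y y' /(congr1 enc); rewrite !encf => /eqP; rewrite nth_uniq // => /eqP; exact: idxI.
have fcv i : fV (inl i) = cv i.
  apply: (can_inj encK); rewrite encf; move: i; by apply: six_ind.
have ex e : exists e', ueq (gends e') (fV (gends e).1, fV (gends e).2).
  suff : eadj (fV (gends e).1) (fV (gends e).2) by case/existsP => e' he'; exists e'.
  rewrite eadj_Pg !encf; case: e => [i|[i|j]].
  - rewrite -[gends _]/(inl i, inl (nx i)) -!encf !fcv; exact: adj.
  - by move: i; apply: six_ind; rewrite -[gends _]/(inl _, inr (Some (md _))) mdE.
  by move: j; apply: three_ind.
have [fE fEP] := fin_all_exists ex.
have fEI : injective fE.
  move=> e e' h; apply: P6_simple; have h1 := fEP e; have h2 := fEP e'; rewrite h in h1.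
  have mono2 (q r : gV P6 * gV P6) (g : gV Pg * gV Pg) : ueq g (fV q.1, fV q.2) -> ueq g (fV r.1, fV r.2) -> ueq q r.
    case: q => q1 q2; case: r => r1 r2; rewrite /ueq /= => /orP[/eqP->|/eqP->] /orP[/eqP[]|/eqP[]] /fVI -> /fVI ->;
    by rewrite eqxx ?orbT.
  exact: mono2 h1 h2.
exists fV, fE; split=> // i; apply: Pg_simple.
have h1 := fEP (inl i); rewrite -[gends (inl i : gE P6)]/(inl i, inl (nx i)) in h1.
rewrite !fcv in h1; exact: ueq_join h1 (cends' i).
Qed.

(** * Perfect matchings of sums *)

Section QuasiBipartite.
Variables (K : mgraph) (U : {set gV K}) (v : gV K) (M : {set gE K}).
Hypotheses (cK : cubic K) (bU : bipartising U) (vU : v \notin U) (vC : comp_out U v = [set v]).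
Notation once y := (#|[set d : dart K | (dend d == y) && (d.1 \in M)]| = 1).
Hypothesis M1 : forall y, y != v -> once y.
Implicit Types (d : dart K) (x y : gV K).

Lemma adj_outP x y : reflect [/\ x \notin U, y \notin U & exists d, dend d = x /\ dother d = y] (adj_out U x y).
Proof.
apply: (iffP and3P) => [[h1 h2 /existsP[e /ueq_dartP[b h]]]|[h1 h2 [[e b] h]]]; split=> //.
  by exists (e, b).
by apply/existsP; exists e; apply/ueq_dartP; exists b.
Qed.

Lemma adj_out_sym : symmetric (adj_out U).
Proof.
by move=> x y; apply/adj_outP/adj_outP => -[h1 h2 [d [h3 h4]]]; split=> //; exists (flip d);
  rewrite dend_flip dother_flip.
Qed.

Lemma comp_out_eq x y : y \in comp_out U x -> comp_out U y = comp_out U x.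
Proof.
rewrite inE => xy; apply/setP=> z; rewrite !inE.
by apply/esym/same_connect => //; apply: sym_connect_sym adj_out_sym.
Qed.

Lemma comp_out_refl x : x \in comp_out U x. Proof. by rewrite inE connect0. Qed.

Lemma comp_out_notin x y : x \notin U -> y \in comp_out U x -> y \notin U.
Proof.
move=> xU; rewrite inE => /connectP[q]; case/lastP: q => [_ /= -> //|q z].
by rewrite rcons_path last_rcons => /andP[_ /adj_outP[_ zU _]] ->.
Qed.

Lemma U_indep d : dend d \in U -> dother d \notin U.
Proof.
case: bU => _ ind _ _; have := ind d.1; case: d => e []; rewrite /dother /dend /= negb_and.
  by case/orP => // /negbTE->.
by case/orP => // /negbTE h h'; rewrite h in h' *.
Qed.

Lemma comp_bd x : x \notin U ->
  bd (comp_out U x) = (@flip K) @: [set d | (dend d \in U) && (dother d \in comp_out U x)].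
Proof.
move=> xU; apply/setP => d; rewrite in_bd; apply/andP/imsetP => [[h1 h2]|[d' + ->]].
  exists (flip d); rewrite ?flipK // inE dend_flip dother_flip h1 andbT.
  apply: contraR h2 => oU; rewrite -(comp_out_eq h1) inE; apply: connect1; apply/adj_outP.
  by split=> //; [exact: comp_out_notin h1 | exists d].
rewrite inE dend_flip dother_flip => /andP[h1 ->]; split=> //.
by apply/negP => /(comp_out_notin xU); rewrite h1.
Qed.

Let comps := [set comp_out U x | x in ~: U].

Lemma comp3_darts x : x \notin U -> #|[set d | (dend d \in U) && (dother d \in comp_out U x)]| = 3.
Proof.
move=> xU; case: bU => _ _ _ /(_ _ xU) <-.
rewrite (@edges_of_darts K (fun z => z \in U) (fun z => z \in comp_out U x)) // => z zU.
by apply/negP => /(comp_out_notin xU); rewrite zU.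
Qed.

Lemma sum_comps (P : pred (dart K)) : #|[set d | (dend d \in U) && P d]| =
  \sum_(C in comps) #|[set d | [&& dend d \in U, dother d \in C & P d]]|.
Proof.
rewrite -sum1_card (partition_big (fun d => comp_out U (dother d)) (mem comps)) /=.
  apply: eq_bigr => C /imsetP[x]; rewrite inE => xU ->; rewrite -sum1_card; apply: eq_bigl => d.
  rewrite !inE; apply/andP/and3P => [[/andP[h1 h2] /eqP h3]|[h1 h2 h3]]; split=> //.
  - by have := comp_out_refl (dother d); rewrite h3 inE.
  - by rewrite h1.
  by apply/eqP/comp_out_eq; rewrite inE.
move=> d; rewrite inE => /andP[dU _]; apply: imset_f; rewrite inE; exact: U_indep.
Qed.

Lemma card_comps : #|comps| = #|U|.
Proof.
have := sum_comps predT.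
have -> : [set d | (dend d \in U) && predT d] = [set d | dend d \in U].
  by apply/setP => d; rewrite !inE andbT.
rewrite card_darts_cubic // (eq_bigr (fun=> 3)); last first.
  move=> C /imsetP[x]; rewrite inE => /comp3_darts <- ->.
  by apply: eq_card => d; rewrite !inE andbT.
by rewrite sum_nat_const mulnC => /eqP; rewrite eqn_pmul2r // => /eqP.
Qed.

(** Counting edges shows that there are as many components outside [U] as vertices in [U]. The
    [#|U|] matching edges at [U] reach every component other than the one of [v], its cut being odd,
    so at most one is left for [v]; parity of the order excludes none. *)
Theorem correct_sub_once : once v.
Proof.
have cU : #|[set d | (dend d \in U) && (d.1 \in M)]| = #|U|.
  rewrite (card_darts_sum U (fun d => d.1 \in M)) (eq_bigr (fun=> 1)) ?sum1_card // => u uU.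
  by apply: M1; apply: contraNneq vU => <-.
have vcomps : [set v] \in comps by rewrite -vC imset_f // inE.
set q := #|_|.
(* All three darts at [v] lead into [U], because [v] is a component by itself with three edges to
   [U]. *)
have qv : #|[set d | [&& dend d \in U, dother d \in [set v] & d.1 \in M]]| = q.
  rewrite /q -(card_imset _ (@flip_inj K)); apply: eq_card => d; rewrite !inE.
  apply/imsetP/andP => [[d']|[/eqP dv dM]].
    by rewrite !inE => /and3P[_ /eqP h1 h2] ->; rewrite dend_flip h1 eqxx.
  exists (flip d); rewrite ?flipK // !inE dend_flip dother_flip dv eqxx dM !andbT.
  apply/negPn/negP => oU; have : dother d \in comp_out U v.
    rewrite inE; apply: connect1; apply/adj_outP; split; [exact: vU|exact: oU|by exists d].
  rewrite vC inE => /eqP ov; have nb : d \notin bd [set v] by rewrite in_bd ov set11 andbF.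
  have b3 : #|bd [set v]| = 3.
    by rewrite -vC comp_bd // card_imset ?comp3_darts //; apply: flip_inj.
  have e : bd [set v] = [set d : dart K | dend d == v].
    apply/eqP; rewrite eqEcard b3; have := cK v; rewrite /deg => ->; rewrite leqnn andbT.
    by apply/subsetP => z; rewrite in_bd !inE => /andP[].
  by rewrite e inE dv eqxx in nb.
have odd_n C : C \in comps -> C != [set v] -> 0 < #|[set d | [&& dend d \in U, dother d \in C & d.1 \in M]]|.
  case/imsetP => x; rewrite inE => xU -> Cv; set C' := comp_out U x in Cv *.
  have vC' : v \notin C' by apply: contra Cv => h; apply/eqP; rewrite -vC; exact/esym/comp_out_eq.
  apply: odd_gt0.
  have -> : #|[set d | [&& dend d \in U, dother d \in C' & d.1 \in M]]| = #|[set d in bd C' | d.1 \in M]|.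
    rewrite comp_bd // -(card_imset _ (@flip_inj K)); apply: eq_card => d.
    apply/imsetP/idP => [[d']|].
      rewrite inE => /and3P[h1 h2 h3] ->; rewrite inE; apply/andP; split; last exact: h3.
      by apply: imset_f; rewrite inE h1.
    by rewrite inE => /andP[/imsetP[d']]; rewrite inE => /andP[h1 h2] -> h3; exists d' => //; rewrite inE h1 h2.
  rewrite -(odd_darts_bd C' (fun e => e \in M)).
  rewrite (card_darts_sum C' (fun d => d.1 \in M)) (eq_bigr (fun=> 1)); last first.
    by move=> y yC; apply: M1; apply: contraNneq vC' => <-.
  rewrite sum1_card -odd_bd // comp_bd // card_imset ?comp3_darts //; exact: flip_inj.
have le1 : q <= 1.
  have := sum_comps (fun d => d.1 \in M); rewrite cU -card_comps (bigD1 _ vcomps) /= qv.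
  have : #|comps :\ [set v]| <= \sum_(C in comps | C != [set v]) #|[set d | [&& dend d \in U, dother d \in C & d.1 \in M]]|.
    rewrite -sum1_card; apply: leq_trans (_ : \sum_(C in comps | C != [set v]) 1 <= _).
      by apply: eq_leq; apply: eq_bigl => C; rewrite !inE andbC.
    by apply: leq_sum => C /andP[h1 h2]; apply: odd_n.
  rewrite (cardsD1 [set v] comps) vcomps.
  have aux (a s t : nat) : a <= s -> true + a = t + s -> t <= 1 by lia.
  exact: aux.
(* The darts in [M] are even in number, while the vertices other than [v] contribute one each and
   are odd in number. *)
have evV : ~~ odd #|gV K| by apply: even_vertices.
have : ~~ odd #|[set d : dart K | d.1 \in M]|.
  by apply: (@even_card_involution _ _ (@flip K)) => d; rewrite ?inE ?flipK ?flip_neq.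
have -> : [set d : dart K | d.1 \in M] = [set d | (dend d \in [set: gV K]) && (d.1 \in M)].
  by apply/setP => d; rewrite !inE.
rewrite (card_darts_sum [set: gV K] (fun d => d.1 \in M)) (bigD1 v) ?inE //= -/q.
rewrite (eq_bigr (fun=> 1)); last by move=> y /andP[_ /M1].
rewrite sum1_card.
have -> : #|[pred i | (i \in [set: gV K]) & i != v]| = #|gV K|.-1.
  by rewrite -(cardC1 v); apply: eq_card => y; rewrite !inE.
have V0 : 0 < #|gV K| by apply/card_gt0P; exists v.
have aux (n r : nat) : ~~ odd n -> r <= 1 -> 0 < n -> ~~ odd (r + n.-1) -> r = 1 by lia.
exact: aux evV le1 V0.
Qed.
End QuasiBipartite.

(** * Transfer of arrays and coverings between a graph and its sums *)

Section Transfer.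
Variables (G H : mgraph).
Implicit Types (A : array3 G) (B : array3 H).

Lemma count_transport (r : dart H -> option (dart G)) (x : gV G) (y : gV H) (P : pred (dart G)) (Q : pred (dart H)) :
  (forall d', dend d' = y -> exists2 d, dend d = x & r d' = Some d) ->
  (forall d, dend d = x -> exists2 d', dend d' = y & r d' = Some d) ->
  (forall d d1 d2, dend d1 = y -> dend d2 = y -> r d1 = Some d -> r d2 = Some d -> d1 = d2) ->
  (forall d' d, r d' = Some d -> Q d' = P d) ->
  #|[set d' | (dend d' == y) && Q d']| = #|[set d | (dend d == x) && P d]|.
Proof.
move=> r1 r2 rI PQ; rewrite -(card_imset (mem [set d | (dend d == x) && P d]) (@Some_inj _)).
rewrite -(@card_in_imset _ _ r (mem [set d' | (dend d' == y) && Q d'])); last first.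
  move=> d1 d2; rewrite !inE => /andP[/eqP y1 _] /andP[/eqP y2 _] e; have [d _ rd] := r1 _ y1.
  by apply: (rI d) => //; rewrite -e.
apply: eq_card => o; apply/imsetP/imsetP => [[d']|[d]]; rewrite inE => /andP[/eqP h1 h2] ->.
  have [d dx rd] := r1 _ h1; exists d => //; rewrite inE dx eqxx /=; by rewrite -(PQ _ _ rd).
have [d' dy rd] := r2 _ h1; exists d' => //; rewrite inE dy eqxx /=; by rewrite (PQ _ _ rd).
Qed.

Lemma pm_no_loop (M : {set gE G}) d : perfect_matching M -> d.1 \in M -> dend d != dother d.
Proof.
move=> pM dM; apply/eqP => h; have := pM (dend d); apply/eqP; rewrite neq_ltn; apply/orP; right.
rewrite (cardD1 d) (cardD1 (flip d)) !inE flip_neq dend_flip -h eqxx /= dM.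
by [].
Qed.

Variable ep : gE G -> gE H.
Hypothesis epI : injective ep.

(** [N] extends [M] along the edge embedding [ep]. On the added edges, [N k] acts as the colour
    class [col k] of a 3-edge-colouring; surjectivity of [col] ensures that all of them are
    covered. *)
Definition lift_of m (M : 'I_m -> {set gE G}) (N : 'I_m -> {set gE H}) (col : 'I_m -> 'I_3) :=
  [/\ forall k, perfect_matching (N k), forall c, exists k, col k = c,
      forall e k, (ep e \in N k) = (e \in M k) &
      forall z, (exists e, z = ep e) \/ exists c, forall k, (z \in N k) = (col k == c)].

Lemma lift_cover m (M : 'I_m -> {set gE G}) N col : lift_of M N col ->
  (forall e, exists k, e \in M k) -> forall z, exists k, z \in N k.
Proof.
move=> [_ cs NE Nz] cov z; case: (Nz z) => [[e ->]|[c h]].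
  by have [k hk] := cov e; exists k; rewrite NE.
by have [k hk] := cs c; exists k; rewrite h hk.
Qed.

(** With three matchings the surjection [col] is a bijection onto the colours, so each added edge is
    covered exactly once and the core does not grow. *)
Lemma lift_array A N col : #|uncovered A| = 3 -> lift_of (amem A) N col ->
  exists B, [/\ is_array3 B, #|uncovered B| = 3 & core B = ep @: core A].
Proof.
move=> u3 [pN cs NE Nz]; pose B : array3 H := (N (o3 0), N (o3 1), N (o3 2)).
have BN k : amem B k = N k by move: k; apply: three_ind.
have cE e : cover_count B (ep e) = cover_count A e.
  by rewrite !cover_countE; apply: eq_bigr => k _; rewrite BN NE.
have [g gK] := fin_all_exists cs.
have cK : cancel col g by apply: canF_sym gK.
have cz z : (exists e, z = ep e) \/ cover_count B z = 1.
  case: (Nz z) => [|[c h]]; [by left | right].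
  rewrite cover_countE (bigD1 (g c)) //= BN h gK eqxx big1 // => k.
  rewrite BN h => kc; suff /negbTE-> : col k != c by [].
  by apply: contra kc => /eqP<-; rewrite cK.
exists B; split; first by apply/is_arrayP => k; rewrite BN.
  rewrite -u3 -(card_imset _ epI); apply: eq_card => z; rewrite inE; apply/eqP/imsetP.
    by case: (cz z) => [[e ->]|-> //]; rewrite cE => h; exists e => //; rewrite inE h.
  by case=> e; rewrite inE => /eqP h ->; rewrite cE.
apply/setP => z; rewrite inE; apply/idP/imsetP.
  by case: (cz z) => [[e ->]|->//]; rewrite cE => h; exists e => //; rewrite inE h.
by case=> e; rewrite inE => h ->; rewrite cE.
Qed.

Hypothesis down : forall N : {set gE H}, perfect_matching N -> perfect_matching (ep @^-1: N).

Lemma pull_array : (forall A, is_array3 A -> 3 <= #|uncovered A|) ->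
  forall B, is_array3 B -> 3 <= #|uncovered B|.
Proof.
move=> hA [[B1 B2] B3] [/down p1 /down p2 /down p3].
pose A : array3 G := (ep @^-1: B1, ep @^-1: B2, ep @^-1: B3).
have /hA h : is_array3 A by split.
apply: leq_trans h _; rewrite -(card_imset _ epI); apply: subset_leq_card.
by apply/subsetP => z /imsetP[e]; rewrite !inE => /eqP; rewrite /cover_count /= !inE => h ->; apply/eqP.
Qed.

Lemma pull_cover n : (forall m (M : 'I_m -> {set gE G}), (forall k, perfect_matching (M k)) ->
    (forall e, exists k, e \in M k) -> n <= m) ->
  forall m (N : 'I_m -> {set gE H}), (forall k, perfect_matching (N k)) ->
    (forall e, exists k, e \in N k) -> n <= m.
Proof.
move=> h m N pN cN; apply: (h m (fun k => ep @^-1: N k)) => [k|e]; first exact: down.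
by have [k hk] := cN (ep e); exists k; rewrite inE.
Qed.
End Transfer.

Lemma colour_class_pm (K : mgraph) (c : gE K -> 'I_3) : cubic K ->
  (forall (v : gV K) i, #|[set d : dart K | (dend d == v) && (c d.1 == i)]| <= 1) ->
  forall i, perfect_matching [set e | c e == i].
Proof.
move=> cK pc i v; rewrite (eq_card (B := [set d : dart K | (dend d == v) && (c d.1 == i)])); last first.
  by move=> d; rewrite !inE.
have s3 : 3 = \sum_(k < 3) #|[set d : dart K | (dend d == v) && (c d.1 == k)]|.
  rewrite -{1}(cK v) /deg -sum1_card (partition_big (fun d : dart K => c d.1) predT) //=.
  by apply: eq_bigr => k _; rewrite -sum1_card; apply: eq_bigl => d; rewrite !inE.
move: s3; rewrite (bigD1 i) //=.
have : \sum_(k < 3 | k != i) #|[set d : dart K | (dend d == v) && (c d.1 == k)]| <= 2.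
  apply: leq_trans (_ : \sum_(k < 3 | k != i) 1 <= _); first by apply: leq_sum.
  by rewrite sum1_card (cardC1 i) card_ord.
have aux (a s : nat) : a <= 1 -> s <= 2 -> 3 = a + s -> a = 1 by lia.
exact: aux (pc v i).
Qed.

Section TwoSum.
Variables (G K : mgraph) (e0 : gE G) (f : gE K) (b : bool).
Hypotheses (cG : cubic G) (cK : cubic K).
Notation H := (twosum e0 f b).

Definition ts2_edge (e : gE G) : gE H :=
  match (insub e : option {x : gE G | x != e0}) with Some z => inl (inl z) | None => inr true end.
(** Each new edge of the sum counts as a dart of [e0] at one end and a dart of [f] at the other. The
    two partial maps make degrees and matchings of the sum comparable with those of the summands. *)
Definition ts2_left (d : dart H) : option (dart G) :=
  match d with
  | (inl (inl e), s) => Some (val e, s)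
  | (inr c, true) => Some (e0, c)
  | _ => None
  end.
Definition ts2_right (d : dart H) : option (dart K) :=
  match d with
  | (inl (inr y), s) => Some (val y, s)
  | (inr c, false) => Some (f, c == b)
  | _ => None
  end.

Lemma ts2_edge_inj : injective ts2_edge.
Proof.
move=> e e'; rewrite /ts2_edge; case: insubP => [z _ ze|/negPn/eqP ee0]; case: insubP => [z' _ ze'|/negPn/eqP ee0'] //.
  by move=> [zz]; rewrite -ze -ze' zz.
by rewrite ee0 ee0'.
Qed.

Lemma ts2_left_spec (x : gV G) (P : pred (dart G)) (Q : pred (dart H)) :
  (forall d' d, ts2_left d' = Some d -> Q d' = P d) ->
  #|[set d' : dart H | (dend d' == inl x) && Q d']| = #|[set d | (dend d == x) && P d]|.
Proof.
move=> PQ; apply: count_transport PQ.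
- move=> [[[z|z]|c] []]; rewrite /dend //=.
  + by move=> [h]; exists (val z, true).
  + by move=> [h]; exists (val z, false).
  + by move=> h; exists (e0, c) => //; case: c h => /= -[].
  by case: c.
- move=> [e s] h; case: (altP (e =P e0)) => [ee|ee].
    subst e; exists (inr s, true) => //; move: h; rewrite /dend /=; by case: s => <-.
  by exists (inl (inl (exist _ e ee)), s) => //; move: h; rewrite /dend /=; case: s => <-.
move=> d d1 d2 _ _ h1; rewrite -h1; move: h1.
case: d1 => [[[z|z]|c] s]; case: d2 => [[[z'|z']|c'] s'] //= h1 h2; move: h2 h1; try by (case: s; case: s').
- by move=> [/val_inj-> ->].
- by case: s' => // -[h] _; case: z h => z /= pz h; case/negP: (pz); rewrite h.
- by case: s => // -[h] _; case: z' h => z' /= pz h; case/negP: (pz); rewrite -h.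
- by case: s; case: s' => // -[->].
Qed.

Lemma ts2_right_spec (x : gV K) (P : pred (dart K)) (Q : pred (dart H)) :
  (forall d' d, ts2_right d' = Some d -> Q d' = P d) ->
  #|[set d' : dart H | (dend d' == inr x) && Q d']| = #|[set d | (dend d == x) && P d]|.
Proof.
move=> PQ; apply: count_transport PQ.
- move=> [[[z|z]|c] []]; rewrite /dend //=.
  + by move=> [h]; exists (val z, true).
  + by move=> [h]; exists (val z, false).
  + by case: c.
  + move=> h; exists (f, c == b) => //; by move: h; case: (c); case: (b) => -[<-].
- move=> [e s] h; case: (altP (e =P f)) => [ee|ee].
    subst e; exists (inr (s == b), false); last by rewrite /=; case: (s); case: (b).
    by move: h; rewrite /dend /=; case: s; case: (b) => /= <-.
  by exists (inl (inr (exist _ e ee)), s) => //; move: h; rewrite /dend /=; case: s => <-.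
move=> d d1 d2 _ _ h1; rewrite -h1; move: h1.
case: d1 => [[[z|z]|c] s]; case: d2 => [[[z'|z']|c'] s'] //= h1 h2; move: h2 h1; try by (case: s; case: s').
- by move=> [/val_inj-> ->].
- by case: s' => // -[h] _; case: z h => z /= pz h; case/negP: (pz); rewrite h.
- by case: s => // -[h] _; case: z' h => z' /= pz h; case/negP: (pz); rewrite -h.
- by case: s; case: s' => // -[]; case: c; case: c'; case: (b).
Qed.

Lemma twosum_cubic : cubic H.
Proof.
have dT (J : mgraph) (z : gV J) : deg z = #|[set d : dart J | (dend d == z) && predT d]|.
  by apply: eq_card => d; rewrite !inE andbT.
by case=> x; rewrite dT; [rewrite (@ts2_left_spec x predT) | rewrite (@ts2_right_spec x predT)]; rewrite -?dT.
Qed.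

Lemma ts2_edge_self : ts2_edge e0 = inr true.
Proof. by rewrite /ts2_edge; case: insubP => // z; rewrite eqxx. Qed.
Lemma ts2_edge_other (z : {x : gE G | x != e0}) : ts2_edge (val z) = inl (inl z).
Proof. by rewrite /ts2_edge valK. Qed.

(* The darts of [K] whose edges of the sum lie in [N] are even in number, so [N] contains
   both or none of the two new edges. *)
Lemma ts2_new_edges (N : {set gE H}) : perfect_matching N -> (inr true \in N) = (inr false \in N).
Proof.
move=> pN.
pose P (d : dart K) := (match (insub d.1 : option {y : gE K | y != f}) with
  Some z => inl (inr z) : gE H | None => inr (d.2 == b) end) \in N.
have once y : #|[set d | (dend d == y) && P d]| = 1.
  rewrite -(pN (inr y)); apply/esym/(@ts2_right_spec y P (fun d => d.1 \in N)) => -[[[z|z]|c] s] d //=.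
    by case: s => -[<-]; rewrite /P /= valK.
  by case: s => // -[<-]; rewrite /P /= insubF ?eqxx //; case: c; case: (b).
have ev : ~~ odd #|[set d | P d]|.
  have -> : [set d | P d] = [set d | (dend d \in [set: gV K]) && P d] by apply/setP => d; rewrite !inE.
  by rewrite card_darts_sum (eq_bigr (fun=> 1)) // sum1_card cardsT even_vertices.
have ev1 : ~~ odd #|[set d | P d] :\ (f, true) :\ (f, false)|.
  apply: (@even_card_involution _ _ (@flip K)) => d; rewrite ?flipK ?flip_neq // !inE /P /=.
  by case: d => e s; rewrite /flip /= !xpair_eqE; case: insubP => [z /negbTE-> //|/negPn/eqP->]; rewrite eqxx; case: s.
have Pf s : P (f, s) = (inr (s == b) \in N) by rewrite /P /= insubF ?eqxx.
move: ev; rewrite (cardsD1 (f, true)) (cardsD1 (f, false)) !inE !Pf xpair_eqE /= andbF /= !oddD (negbTE ev1).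
by case: (b); case: (_ \in N); case: (_ \in N).
Qed.

Lemma ts2_pull (N : {set gE H}) : perfect_matching N -> perfect_matching (ts2_edge @^-1: N).
Proof.
move=> pN x; rewrite -(pN (inl x)); apply/esym.
apply: (@ts2_left_spec x (fun d => d.1 \in _ @^-1: N) (fun d => d.1 \in N)) => -[[[z|z]|c] s] d //=.
  by case: s => -[<-]; rewrite inE ts2_edge_other.
by case: s => // -[<-]; rewrite inE /= ts2_edge_self; case: c; rewrite ?(ts2_new_edges pN).
Qed.

Variable c : gE K -> 'I_3.
Hypothesis pc : forall (v : gV K) i, #|[set d : dart K | (dend d == v) && (c d.1 == i)]| <= 1.

(** Both new edges follow [e0]. The last hypothesis makes the colour class on the other side use [f]
    exactly when [e0] is used, so the two halves fit. *)
Lemma ts2_lift m (M : 'I_m -> {set gE G}) (col : 'I_m -> 'I_3) : (forall k, perfect_matching (M k)) ->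
  (forall i, exists k, col k = i) -> (forall k, (e0 \in M k) = (col k == c f)) ->
  exists N, lift_of ts2_edge M N col.
Proof.
move=> pM cs ce0.
pose N k : {set gE H} := [set z : gE H | match z with inl (inl e) => val e \in M k | inl (inr y) => c (val y) == col k
   | inr _ => e0 \in M k end].
exists N; split=> //.
- move=> k [] x.
    rewrite -(pM k x); apply: (@ts2_left_spec x (fun d => d.1 \in M k) (fun d => d.1 \in N k)).
    by move=> [[[z|z]|cc] s] d //=; case: s => // -[<-]; rewrite inE.
  rewrite -(colour_class_pm cK pc (col k) x).
  apply: (@ts2_right_spec x (fun d => d.1 \in [set e | c e == col k]) (fun d => d.1 \in N k)).
  by move=> [[[z|z]|cc] s] d //=; case: s => // -[<-]; rewrite !inE //= ce0 eq_sym.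
- by move=> e k; rewrite inE /ts2_edge; case: insubP => [z _ -> //|/negPn/eqP->].
case=> [[z|z]|[]].
- by left; exists (val z); rewrite ts2_edge_other.
- by right; exists (c (val z)) => k; rewrite inE eq_sym.
- by left; exists e0; rewrite ts2_edge_self.
by right; exists (c f) => k; rewrite inE ce0.
Qed.
End TwoSum.

Section ThreeSum.
Variables (G K : mgraph) (u0 : gV G) (v : gV K) (sigma : ndarts G u0 -> ndarts K v).
Hypotheses (cG : cubic G) (nlG : forall d : dart G, dend d != dother d).
Hypotheses (cK : cubic K) (tK : twoconn K) (sB : bijective sigma).
Notation H := (threesum sigma).

Let nlK (d : dart K) : dend d != dother d := no_loop d cK (proj2 tK).
Let sI : injective sigma := bij_inj sB.

Lemma nd_end (J : mgraph) (x : gV J) (d : ndarts J x) : dend (sval d) = x.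
Proof. by case: d => d /= /andP[/eqP]. Qed.
Lemma nd_other (J : mgraph) (x : gV J) (d : ndarts J x) : dother (sval d) != x.
Proof. by case: d => d /= /andP[]. Qed.
Lemma nd_edge_inj (J : mgraph) (x : gV J) (d d' : ndarts J x) : (sval d).1 = (sval d').1 -> d = d'.
Proof.
move=> /dart_eq_edge[] h; apply: val_inj => //.
by have := nd_end d'; have := nd_other d; rewrite h dend_flip => /eqP.
Qed.
Lemma nd_both (J : mgraph) (x : gV J) (d : dart J) :
  ((gends d.1).1 != x) && ((gends d.1).2 != x) = (dend d != x) && (dother d != x).
Proof. by case: d => e []; rewrite /dother /dend //= andbC. Qed.

Lemma nd_out (J : mgraph) (x : gV J) (d : ndarts J x)
  (z : {e : gE J | ((gends e).1 != x) && ((gends e).2 != x)}) : sval z <> (sval d).1.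
Proof. by move=> h; have := proj2_sig z; rewrite h nd_both nd_end eqxx. Qed.

Definition ts3_left (d : dart H) : option (dart G) :=
  match d with
  | (inl (inl e), s) => Some (sval e, s)
  | (inr d, true) => Some (flip (sval d))
  | _ => None
  end.
Definition ts3_right (d : dart H) : option (dart K) :=
  match d with
  | (inl (inr e), s) => Some (sval e, s)
  | (inr d, false) => Some (flip (sval (sigma d)))
  | _ => None
  end.

Lemma ts3_left_spec (x : {x : gV G | x != u0}) (P : pred (dart G)) (Q : pred (dart H)) :
  (forall d' d, ts3_left d' = Some d -> Q d' = P d) ->
  #|[set d' : dart H | (dend d' == inl x) && Q d']| = #|[set d | (dend d == val x) && P d]|.
Proof.
move=> PQ; apply: count_transport PQ.
- move=> [[[z|z]|d] []]; rewrite /dend //=.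
  + by move=> -[<-]; exists (sval z, true).
  + by move=> -[<-]; exists (sval z, false).
  by move=> -[<-]; exists (flip (sval d)).
- move=> d dx; case: (eqVneq (dother d) u0) => od.
    have pd : (dend (flip d) == u0) && (dother (flip d) != u0).
      by rewrite dend_flip dother_flip od eqxx dx; exact: (valP x).
    exists (inr (exist _ (flip d) pd), true); last by rewrite /= flipK.
    by congr inl; apply: val_inj; rewrite /= dother_flip.
  have pd : ((gends d.1).1 != u0) && ((gends d.1).2 != u0).
    by rewrite nd_both od andbT dx; exact: (valP x).
  exists (inl (inl (exist _ d.1 pd)), d.2); last by rewrite /= -surjective_pairing.
  by move: dx; rewrite /dend /=; case: (d.2) => dx; congr inl; apply: val_inj.
move=> d d1 d2 _ _ h1; rewrite -h1; move: h1.
case: d1 => [[[z|z]|c] s]; case: d2 => [[[z'|z']|c'] s'] //= h1 h2; move: h2 h1; try by (case: s; case: s').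
- by move=> [/val_inj-> ->].
- by case: s' => // -[h _] _; case: (nd_out (esym h)).
- by case: s => // -[h _] _; case: (nd_out h).
- by case: s; case: s' => // -[h _] _; rewrite (nd_edge_inj h).
Qed.

Lemma ts3_right_spec (x : {x : gV K | x != v}) (P : pred (dart K)) (Q : pred (dart H)) :
  (forall d' d, ts3_right d' = Some d -> Q d' = P d) ->
  #|[set d' : dart H | (dend d' == inr x) && Q d']| = #|[set d | (dend d == val x) && P d]|.
Proof.
move=> PQ; have [si sK siK] := sB; apply: count_transport PQ.
- move=> [[[z|z]|d] []]; rewrite /dend //=.
  + by move=> -[<-]; exists (sval z, true).
  + by move=> -[<-]; exists (sval z, false).
  by move=> -[<-]; exists (flip (sval (sigma d))).
- move=> d dx; case: (eqVneq (dother d) v) => od.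
    have pd : (dend (flip d) == v) && (dother (flip d) != v).
      by rewrite dend_flip dother_flip od eqxx dx; exact: (valP x).
    exists (inr (si (exist _ (flip d) pd)), false); last by rewrite /= siK /= flipK.
    by congr inr; apply: val_inj; rewrite /= siK /= dother_flip.
  have pd : ((gends d.1).1 != v) && ((gends d.1).2 != v).
    by rewrite nd_both od andbT dx; exact: (valP x).
  exists (inl (inr (exist _ d.1 pd)), d.2); last by rewrite /= -surjective_pairing.
  by move: dx; rewrite /dend /=; case: (d.2) => dx; congr inr; apply: val_inj.
move=> d d1 d2 _ _ h1; rewrite -h1; move: h1.
case: d1 => [[[z|z]|c] s]; case: d2 => [[[z'|z']|c'] s'] //= h1 h2; move: h2 h1; try by (case: s; case: s').
- by move=> [/val_inj-> ->].
- by case: s' => // -[h _] _; case: (nd_out (esym h)).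
- by case: s => // -[h _] _; case: (nd_out h).
- by case: s; case: s' => // -[h _] _; rewrite (sI (nd_edge_inj h)).
Qed.

Lemma threesum_cubic : cubic H.
Proof.
have dT (J : mgraph) (z : gV J) : deg z = #|[set d : dart J | (dend d == z) && predT d]|.
  by apply: eq_card => d; rewrite !inE andbT.
by case=> x; rewrite dT; [rewrite (@ts3_left_spec x predT) | rewrite (@ts3_right_spec x predT)]; rewrite -?dT.
Qed.

Lemma sub_edge_out (z : {e : gE G | ((gends e).1 != u0) && ((gends e).2 != u0)}) :
  sub_edge sigma (val z) = Some (inl (inl z)).
Proof. by rewrite /sub_edge valK. Qed.

Lemma sub_edge_at (d : ndarts G u0) : sub_edge sigma (sval d).1 = Some (inr d).
Proof.
have h := nd_both u0 (sval d); rewrite nd_end eqxx /= in h.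
rewrite /sub_edge insubF //; case: d h => [[e []] pd] h.
  by rewrite insubT; congr (Some (inr _)); apply: val_inj.
rewrite insubF /=; first by rewrite insubT; congr (Some (inr _)); apply: val_inj.
by have /andP[/eqP h1 /negP h2] := pd; apply/negP => /andP[].
Qed.

Lemma sub_edge_cases e : (exists z, e = val z /\ sub_edge sigma e = Some (inl (inl z))) \/
  (exists d : ndarts G u0, e = (sval d).1 /\ sub_edge sigma e = Some (inr d)).
Proof.
case: (boolP (((gends e).1 != u0) && ((gends e).2 != u0))) => h.
  by left; exists (exist _ e h); split=> //; apply: (sub_edge_out (exist _ e h)).
right; have [s es] : exists s, dend (e, s) = u0.
  by move: h; rewrite negb_and !negbK => /orP[]/eqP; [exists true | exists false].
have pd : (dend (e, s) == u0) && (dother (e, s) != u0) by rewrite es eqxx /= -es eq_sym nlG.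
by exists (exist _ (e, s) pd); split=> //; apply: (sub_edge_at (exist _ (e, s) pd)).
Qed.

Variable ep : gE G -> gE H.
Hypothesis epE : forall e, sub_edge sigma e = Some (ep e).

Lemma ts3_ep_out z : ep (val z) = inl (inl z).
Proof. by have := epE (val z); rewrite sub_edge_out => -[]. Qed.
Lemma ts3_ep_at (d : ndarts G u0) : ep (sval d).1 = inr d.
Proof. by have := epE (sval d).1; rewrite sub_edge_at => -[]. Qed.

Lemma ts3_ep_inj : injective ep.
Proof.
move=> e e' h; have := epE e; have := epE e'; rewrite -h.
case: (sub_edge_cases e) => -[z [-> ->]]; case: (sub_edge_cases e') => -[z' [-> ->]];
by move=> [<-] [] // ->.
Qed.

Lemma darts_at (J : mgraph) (x : gV J) (nlJ : forall d : dart J, dend d != dother d) (P : pred (dart J)) :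
  #|[set d | (dend d == x) && P d]| = #|[set d : ndarts J x | P (sval d)]|.
Proof.
rewrite -(card_imset _ val_inj); apply: eq_card => d; rewrite inE.
apply/andP/imsetP => [[dx Pd]|[d' + ->]]; last by rewrite inE nd_end eqxx.
have pd : (dend d == x) && (dother d != x) by rewrite dx -(eqP dx) eq_sym nlJ.
by exists (exist _ d pd); rewrite ?inE.
Qed.

Hypothesis cv : correct_sub v.
(** Only [u0] is critical: exactly one of the three new edges must lie in [N]. This is
    [correct_sub_once] for the trace [MK] of [N] on [K]. *)
Lemma ts3_pull (N : {set gE H}) : perfect_matching N -> perfect_matching (ep @^-1: N).
Proof.
move=> pN; have [U [bU [vU vC]]] := cv.
pose MK := [set y : gE K | match (insub y : option {e : gE K | ((gends e).1 != v) && ((gends e).2 != v)}) with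
  | Some z => inl (inr z) \in N
  | None => [exists d : ndarts G u0, (inr d \in N) && ((sval (sigma d)).1 == y)] end].
have MKat d : ((sval (sigma d)).1 \in MK) = (inr d \in N).
  rewrite inE insubF; last by rewrite nd_both nd_end eqxx.
  apply/existsP/idP => [[d' /andP[h /eqP/nd_edge_inj/sI <-]] //|h]; by exists d; rewrite h eqxx.
have once1 y : y != v -> #|[set d : dart K | (dend d == y) && (d.1 \in MK)]| = 1.
  move=> yv; rewrite -(pN (inr (exist _ y yv))); apply/esym.
  apply: (@ts3_right_spec (exist _ y yv) (fun d => d.1 \in MK) (fun d => d.1 \in N)).
  move=> [[[z|z]|d'] s] d //=; first by case: s => -[<-]; rewrite inE /= valK.
  by case: s => // -[<-]; rewrite /= MKat.
move=> x; case: (eqVneq x u0) => [->|xu]; last first.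
  rewrite -(pN (inl (exist _ x xu))); apply/esym.
  apply: (@ts3_left_spec (exist _ x xu) (fun d => d.1 \in _ @^-1: N) (fun d => d.1 \in N)).
  move=> [[[z|z]|d'] s] d //=; first by case: s => -[<-]; rewrite inE /= ts3_ep_out.
  by case: s => // -[<-]; rewrite inE /= ts3_ep_at.
rewrite -(correct_sub_once cK bU vU vC once1).
rewrite (darts_at u0 nlG (fun d => d.1 \in _)) (darts_at v nlK (fun d => d.1 \in _)).
rewrite -(card_imset _ sI); apply: eq_card => d; rewrite inE.
have [si sK siK] := sB; rewrite -{2}(siK d) MKat -(ts3_ep_at (si d)).
apply/imsetP/idP => [[d']|h]; first by rewrite !inE => h ->; rewrite sK.
by exists (si d); rewrite ?siK // !inE.
Qed.

Variable c : gE K -> 'I_3.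
Hypothesis pc : forall (v : gV K) i, #|[set d : dart K | (dend d == v) && (c d.1 == i)]| <= 1.

(** The colour [col k] is forced: it is the colour of the dart at [v] that [sigma] assigns to the
    edge of [M k] at [u0]. All colours occur because the family covers the three edges at [u0]. *)
Lemma ts3_lift m (M : 'I_m -> {set gE G}) : (forall k, perfect_matching (M k)) ->
  (forall d, dend d = u0 -> exists k, d.1 \in M k) -> exists N col, lift_of ep M N col.
Proof.
move=> pM cov; have [si sK siK] := sB.
have cI (d d' : ndarts K v) : c (sval d).1 = c (sval d').1 -> d = d'.
  move=> h; apply/eqP; have := pc v (c (sval d).1); apply: contraTT => dd'.
  rewrite (darts_at v nlK (fun d0 => c d0.1 == _)) -ltnNge (cardD1 d) (cardD1 d') !inE h eqxx.
  by rewrite eq_sym dd'.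
have ex k : exists d : ndarts G u0, (sval d).1 \in M k.
  have := pM k u0; rewrite (darts_at u0 nlG (fun d => d.1 \in M k)) => /eqP/cards1P[d /setP/(_ d)].
  by rewrite !inE eqxx; exists d.
have [dk dkP] := fin_all_exists ex.
have uniq k d : (sval d).1 \in M k -> d = dk k.
  move=> h; have := pM k u0; rewrite (darts_at u0 nlG (fun d => d.1 \in M k)) => /eqP/cards1P[d' e].
  by have /set1P-> : d \in [set d']; rewrite -?e ?inE //; have /set1P-> : dk k \in [set d']; rewrite -?e ?inE.
pose col k := c (sval (sigma (dk k))).1.
have colE k d : ((sval d).1 \in M k) = (col k == c (sval (sigma d)).1).
  by apply/idP/eqP => [/uniq-> //|/cI/sI <-].
pose N k : {set gE H} := [set z : gE H | match z with inl (inl e) => sval e \in M k | inl (inr y) => c (sval y) == col k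
   | inr d => (sval d).1 \in M k end].
exists N, col; split.
- move=> k [] x.
    rewrite -(pM k (val x)); apply: (@ts3_left_spec x (fun d => d.1 \in M k) (fun d => d.1 \in N k)).
    by move=> [[[z|z]|d'] s] d //=; case: s => // -[<-]; rewrite inE.
  rewrite -(colour_class_pm cK pc (col k) (val x)).
  apply: (@ts3_right_spec x (fun d => d.1 \in [set e | c e == col k]) (fun d => d.1 \in N k)).
  by move=> [[[z|z]|d'] s] d //=; case: s => // -[<-]; rewrite !inE //= colE eq_sym.
- move=> i; have := colour_class_pm cK pc i v.
  rewrite (darts_at v nlK (fun d => d.1 \in _)) => /eqP/cards1P[d /setP/(_ d)].
  rewrite !inE eqxx => /eqP <-; have [k] := cov (sval (si d)) (nd_end _).
  by rewrite colE siK => /eqP; exists k.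
- move=> e k; case: (sub_edge_cases e) => -[z [-> _]]; first by rewrite ts3_ep_out inE.
  by rewrite ts3_ep_at inE.
case=> [[z|z]|d].
- by left; exists (val z); rewrite ts3_ep_out.
- by right; exists (c (val z)) => k; rewrite inE eq_sym.
by left; exists (sval d).1; rewrite ts3_ep_at.
Qed.
End ThreeSum.

(** * Perfect matchings of the Petersen graph *)

(* The six perfect matchings of the Petersen graph; every edge lies in exactly two of them
   and every two of them share exactly one edge. *)
Definition petersen_pm (k : 'I_6) : {set gE P6} := [set e : gE P6 | match e with
  | inl i => (k == nx (nx i)) || (k == nx (nx (nx (nx i))))
  | inr (inl i) => (k == i) || (k == pv i)
  | inr (inr j) => md k == inord ((j + 1) %% 3)
  end].

Lemma petersen_pmP k : perfect_matching (petersen_pm k).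
Proof.
suff h y : single (fun e => e \in petersen_pm k) y by apply: pm_intro => y; have [d h1 h2] := h y; exists d.
have vj (j : 'I_3) : val (inord ((j + 1) %% 3) : 'I_3) = (j + 1) %% 3 by rewrite /= inordK ?ltn_mod.
case: y => [i|[j|]].
- apply: single_rim; rewrite !inE; move: k i; by apply: six_ind; apply: six_ind; rewrite ?pvE !nxE.
- have [i mi] : exists2 i : 'I_6, i < 3 & md i = j.
    by move: j; apply: three_ind; [exists (o6 0)|exists (o6 1)|exists (o6 2)]; rewrite ?mdE.
  move=> <-; apply: single_leaf; rewrite !inE -!val_eqE vj; move: k i mi {j}.
  by apply: six_ind; apply: six_ind; rewrite !nxE !mdE ?pvE.
by apply: single_centre; rewrite !inE -!val_eqE !vj; move: k; apply: six_ind; rewrite mdE.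
Qed.

Lemma nx_orbit (k k' : 'I_6) : k' \in [:: k; nx k; nx (nx k); nx (nx (nx k)); pv (pv k); pv k].
Proof. by move: k k'; apply: six_ind; rewrite !nxE !pvE; apply: six_ind. Qed.

(** Only the offset between the indices matters: offset one is shared on an edge from rim to leaf,
    offset two on a rim edge, offset three on an edge at the centre. *)
Lemma petersen_pm_share k k' : k != k' ->
  exists e, forall l, (e \in petersen_pm l) = (l == k) || (l == k').
Proof.
pose share k k' := exists e, forall l, (e \in petersen_pm l) = (l == k) || (l == k').
have sym k1 k2 : share k1 k2 -> share k2 k1 by case=> e h; exists e => l; rewrite h orbC.
have sp i : share i (pv i) by exists (inr (inl i)) => l; rewrite inE.
have hx i : share (nx (nx i)) (nx (nx (nx (nx i)))) by exists (inl i) => l; rewrite inE.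
have ce i : share i (nx (nx (nx i))).
  have ii : exists j : 'I_3, md i = inord ((j + 1) %% 3).
    exists (md (nx (nx i))); apply: val_inj; rewrite /= inordK ?ltn_mod //; move: i; by apply: six_ind; rewrite !nxE !mdE.
  have [j hj] := ii; exists (inr (inr j)) => l; rewrite inE -hj; apply/eqP/orP.
    by move=> /esym/mdP[] ->; [left|right].
  by case=> /eqP->; rewrite ?md_nx3.
have h2 i : share i (nx (nx i)) by have := hx (pv (pv i)); rewrite !pvK.
move=> kk; rewrite -/(share k k'); have := nx_orbit k k'.
rewrite !inE eq_sym (negbTE kk) /= => /or4P[| | |/orP[]] /eqP->.
- by apply: sym; have := sp (nx k); rewrite nxK.
- exact: h2.
- exact: ce.
- by apply: sym; have := h2 (pv (pv k)); rewrite !pvK.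
- exact: sp.
Qed.

Lemma petersen_pm_two e : exists k k', [/\ k != k', e \in petersen_pm k & e \in petersen_pm k'].
Proof.
have nn (i : 'I_6) : i != nx (nx i) by move: i; apply: six_ind; rewrite !nxE.
case: e => [i|[i|j]].
- by exists (nx (nx i)), (nx (nx (nx (nx i)))); rewrite nn !inE !eqxx orbT.
- exists i, (pv i); rewrite !inE !eqxx orbT; split=> //; by move: i; apply: six_ind; rewrite pvE.
have [i ij] := ex_md (inord ((j + 1) %% 3)).
exists i, (nx (nx (nx i))); rewrite !inE md_nx3 ij eqxx; split=> //.
by move: i {ij}; apply: six_ind; rewrite !nxE.
Qed.

Definition words_all : nat -> (seq bool -> bool) -> bool :=
  fix loop n P := if n is n'.+1 then
    if loop n' (fun w => P (true :: w)) then loop n' (fun w => P (false :: w)) else false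
  else P [::].
Lemma words_allP n P w : words_all n P -> size w = n -> P w.
Proof.
elim: n P w => [|n IH] P [|b w] //=; case: ifP => // h1 h2 [sw].
by case: b; [apply: (IH _ _ h1) | apply: (IH _ _ h2)].
Qed.

(** Positions 0 to 5 are the rim edges, 6 to 11 the edges from rim to leaves, 12 to 14 those at the
    centre; the three conditions concern rim vertices, leaves and centre. *)
Definition pm_word (w : seq bool) : bool :=
  let f i : nat := nth false w i in
  [&& all (fun i => f i + f ((i + 5) %% 6) + f (6 + i) == 1) (iota 0 6),
      all (fun j => f (6 + j) + f (9 + j) + f (12 + j) == 1) (iota 0 3) &
      f 12 + f 13 + f 14 == 1].
Definition petersen_word (k : nat) : seq bool :=
  [seq (k == (i + 2) %% 6) || (k == (i + 4) %% 6) | i <- iota 0 6] ++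
  [seq (k == i) || (k == (i + 5) %% 6) | i <- iota 0 6] ++
  [seq k %% 3 == (j + 1) %% 3 | j <- iota 0 3].

Lemma pm_word_petersen : words_all 15 (fun w => if pm_word w then has (fun k => w == petersen_word k) (iota 0 6) else true).
Proof. by vm_compute. Qed.

Lemma single3 (a b c : bool) : (a || b || c) -> ~~ (a && b) -> ~~ (a && c) -> ~~ (b && c) -> a + b + c = 1.
Proof. by case: a; case: b; case: c. Qed.

Lemma petersen_pm_complete M : @perfect_matching P6 M -> exists k, M = petersen_pm k.
Proof.
move=> pM.
have ex v : exists2 x : dart P6, dend x = v & x.1 \in M by have [x []] := pm_dart v pM; exists x.
have uq (x y : dart P6) : dend x = dend y -> x != y -> ~~ ((x.1 \in M) && (y.1 \in M)).
  move=> xy ne; apply/andP => -[xM yM]; have := pM (dend x) => /eqP/cards1P[z hz].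
  have : x \in [set z] by rewrite -hz !inE eqxx.
  have : y \in [set z] by rewrite -hz !inE xy eqxx.
  by rewrite !inE => /eqP h /eqP h'; rewrite h h' eqxx in ne.
have rim i : (inl i \in M) + (inl (pv i) \in M) + (inr (inl i) \in M) = 1.
  apply: single3.
  - by have [d /P6_rim_darts[] -> /= ->] := ex (inl i); rewrite ?orbT.
  - by apply: (uq (inl i, true) (inl (pv i), false)); rewrite ?xpair_eqE ?andbF //; rewrite /dend /= pvK.
  - by apply: (uq (inl i, true) (inr (inl i), true)).
  by apply: (uq (inl (pv i), false) (inr (inl i), true)); rewrite // /dend /= pvK.
have leaf i : (inr (inl i) \in M) + (inr (inl (nx (nx (nx i)))) \in M) + (inr (inr (md i)) \in M) = 1.
  apply: single3.
  - have [d /P6_leaf_darts[[k /esym/mdP[] -> ->]| ->] /= ->] := ex (inr (Some (md i))); by rewrite ?orbT.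
  - apply: (uq (inr (inl i), false) (inr (inl (nx (nx (nx i)))), false)); first by rewrite /dend /= md_nx3.
    by apply/eqP => -[]; apply/eqP; rewrite eq_sym nx3_neq.
  - by apply: (uq (inr (inl i), false) (inr (inr (md i)), true)).
  by apply: (uq (inr (inl (nx (nx (nx i)))), false) (inr (inr (md i)), true)); rewrite // /dend /= md_nx3.
have cen : (inr (inr (o3 0)) \in M) + (inr (inr (o3 1)) \in M) + (inr (inr (o3 2)) \in M) = 1.
  apply: single3; [|apply: (uq (inr (inr _), false) (inr (inr _), false)) => // ..].
  by have [d /P6_centre_darts[j ->] /=] := ex (inr None); move: j; apply: three_ind => ->; rewrite ?orbT.
pose es : seq (gE P6) := [seq inl i | i <- [:: o6 0; o6 1; o6 2; o6 3; o6 4; o6 5]] ++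
  [seq inr (inl i) | i <- [:: o6 0; o6 1; o6 2; o6 3; o6 4; o6 5]] ++ [seq inr (inr j) | j <- [:: o3 0; o3 1; o3 2]].
pose w := [seq e \in M | e <- es].
have wok : pm_word w.
  have [r0 r1] := (rim (o6 0), rim (o6 1)).
  have [r2 r3] := (rim (o6 2), rim (o6 3)).
  have [r4 r5] := (rim (o6 4), rim (o6 5)).
  have [l0 l1] := (leaf (o6 0), leaf (o6 1)); have l2 := leaf (o6 2).
  rewrite !pvE in r0 r1 r2 r3 r4 r5; rewrite !nxE !mdE in l0 l1 l2.
  by rewrite /pm_word /= r0 r1 r2 r3 r4 r5 l0 l1 l2 cen.
have := words_allP pm_word_petersen (erefl : size w = 15); rewrite wok => /hasP[k].
rewrite mem_iota add0n => /andP[_ k6] /eqP ew; exists (Ordinal k6); apply/setP => e.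
have nth_w n : n < 15 -> (nth (inl (o6 0)) es n \in M) = nth false (petersen_word k) n.
  by move=> n15; rewrite -ew (nth_map (inl (o6 0))).
have vj (j : 'I_3) : val (inord ((j + 1) %% 3) : 'I_3) = (j + 1) %% 3 by rewrite /= inordK ?ltn_mod.
rewrite inE; case: e => [i|[i|j]].
- have := nth_w i; rewrite -!val_eqE /= !val_nx; move: i; by apply: six_ind => /(_ isT).
- have := nth_w (6 + i); rewrite -!val_eqE /= val_pv; move: i; by apply: six_ind => /(_ isT).
have := nth_w (12 + j); rewrite -!val_eqE vj /= val_md /=; move: j; by apply: three_ind => /(_ isT).
Qed.

(** Three of the six matchings are not in the array. Each two of these share an edge that lies in no
    other matching, which gives three distinct uncovered edges. *)
Lemma P6_array_uncovered (A : array3 P6) : is_array3 A -> 3 <= #|uncovered A|.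
Proof.
case: A => [[A1 A2] A3] [/petersen_pm_complete[a /= ->] /petersen_pm_complete[b /= ->] /petersen_pm_complete[c /= ->]].
set A : array3 P6 := (_, _, _).
have : 2 < #|~: [set a; b; c]|.
  have := cardsC [set a; b; c]; rewrite card_ord.
  have : #|[set a; b; c]| <= 3 by rewrite -setUA !cardsU1 cards1; do 2 case: (_ \in _).
  have aux (x y : nat) : x <= 3 -> x + y = 6 -> 2 < y by lia.
  exact: aux.
move=> /card_gt2P[x [y [z [[+ + +] [xy yz zx]]]]]; rewrite !inE !negb_or -!andbA.
move=> /and3P[xa xb xc] /and3P[ya yb yc] /and3P[za zb zc].
have [e1 h1] := petersen_pm_share xy; have [e2 h2] := petersen_pm_share yz.
have [e3 h3] := petersen_pm_share zx.
have u k k' e : (forall l, (e \in petersen_pm l) = (l == k) || (l == k')) ->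
   [&& k != a, k != b, k != c, k' != a, k' != b & k' != c] -> e \in uncovered A.
  move=> h /and5P[n1 n2 n3 n4 /andP[n5 n6]]; rewrite inE /cover_count /= !h.
  by rewrite !(eq_sym _ k) !(eq_sym _ k') (negbTE n1) (negbTE n2) (negbTE n3) (negbTE n4) (negbTE n5) (negbTE n6).
have s : [set e1; e2; e3] \subset uncovered A.
  apply/subsetP => e; rewrite !inE -!orbA => /or3P[] /eqP->.
  - by have := u _ _ _ h1; rewrite inE xa xb xc ya yb yc => ->.
  - by have := u _ _ _ h2; rewrite inE ya yb yc za zb zc => ->.
  by have := u _ _ _ h3; rewrite inE xa xb xc za zb zc => ->.
apply: leq_trans (subset_leq_card s).
have n12 : e1 != e2.
  by apply/eqP => e; have := h1 x; rewrite e h2 eqxx ?orbT ?(negbTE xy) ?(negbTE yz) ?(negbTE zx) 1?eq_sym ?(negbTE xy) ?(negbTE yz) ?(negbTE zx) //.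
have n13 : e1 != e3.
  by apply/eqP => e; have := h1 y; rewrite e h3 eqxx ?orbT ?(negbTE xy) ?(negbTE yz) ?(negbTE zx) 1?eq_sym ?(negbTE xy) ?(negbTE yz) ?(negbTE zx) //.
have n23 : e2 != e3.
  by apply/eqP => e; have := h2 y; rewrite e h3 eqxx ?orbT ?(negbTE xy) ?(negbTE yz) ?(negbTE zx) 1?eq_sym ?(negbTE xy) ?(negbTE yz) ?(negbTE zx) //.
by rewrite -setUA !cardsU1 !inE cards1 (negbTE n12) (negbTE n13) (negbTE n23).
Qed.

(** Four matchings leave out two of the six, and the edge shared by those two is not covered. *)
Lemma P6_cover_ge5 m (M : 'I_m -> {set gE P6}) : (forall k, perfect_matching (M k)) ->
  (forall e, exists k, e \in M k) -> 5 <= m.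
Proof.
move=> pM cov; have [f fM] := fin_all_exists (fun k => petersen_pm_complete (pM k)).
rewrite leqNgt; apply/negP => m5.
have : 1 < #|~: [set f k | k : 'I_m]|.
  have := cardsC [set f k | k : 'I_m]; rewrite card_ord.
  have := leq_imset_card f 'I_m; rewrite card_ord.
  have aux (x y : nat) : x <= m -> x + y = 6 -> 1 < y by lia.
  exact: aux.
move=> /card_gt1P[x [y [+ + xy]]]; rewrite !inE => xn yn.
have [e h] := petersen_pm_share xy; have [k] := cov e; rewrite fM h => /orP[/eqP fx|/eqP fy].
  by rewrite -fx imset_f in xn.
by rewrite -fy imset_f in yn.
Qed.

Lemma P6_cover5 (e : gE P6) : exists k : 'I_5, e \in petersen_pm (widen_ord (leqnSn 5) k).
Proof.
have [k [k' [kk ek ek']]] := petersen_pm_two e.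
have lt (l : 'I_6) : l != o6 5 -> l < 5 by move: l; apply: six_ind.
case: (eqVneq k (o6 5)) => [k5|/lt k5].
  have k'5 : k' < 5 by apply: lt; rewrite -k5 eq_sym.
  by exists (Ordinal k'5); rewrite (_ : widen_ord _ _ = k') //; apply: val_inj.
by exists (Ordinal k5); rewrite (_ : widen_ord _ _ = k) //; apply: val_inj.
Qed.

(** Matchings whose indices differ by two share a rim edge. So the chosen ones cover three rim edges
    twice, and the omitted ones 0, 2, 4 account for the three uncovered rim edges. *)
Definition P6_array : array3 P6 := (petersen_pm (o6 1), petersen_pm (o6 3), petersen_pm (o6 5)).

Lemma P6_array_count (e : gE P6) : cover_count P6_array e =
  match e with inl i => if odd i then 2 else 0 | _ => 1 end.
Proof.
have vj (j : 'I_3) : val (inord ((j + 1) %% 3) : 'I_3) = (j + 1) %% 3 by rewrite /= inordK ?ltn_mod.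
rewrite /cover_count !inE; case: e => [i|[i|j]].
- by move: i; apply: six_ind; rewrite !nxE.
- by move: i; apply: six_ind; rewrite !pvE.
by rewrite -!val_eqE !vj !mdE; move: j; apply: three_ind.
Qed.

Lemma P6_arrayP : [/\ is_array3 P6_array, #|uncovered P6_array| = 3 & core P6_array = [set inl i | i : 'I_6]].
Proof.
split; first by split; apply: petersen_pmP.
  have -> : uncovered P6_array = [set inl (o6 0); inl (o6 2); inl (o6 4)].
    apply/setP => e; rewrite inE P6_array_count !inE; case: e => [i|[i|j]] //=.
    by move: i; apply: six_ind.
  by rewrite -setUA !cardsU1 !inE cards1.
apply/setP => e; rewrite inE P6_array_count; apply/idP/imsetP; first by case: e => [i|[i|j]] // _; exists i.
by case=> i _ ->; case: (odd i).
Qed.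

(** The invariant of the converse. Besides the two bounds with their witnesses, it keeps the hexagon
    and its incidences alive and the identities injective, so that the site of an operation is known
    to lie off the hexagon. *)
Record hexagonal (cv : 'I_6 -> gV Pg) (ce : 'I_6 -> gE Pg) (G : mgraph)
  (tv : gV Pg -> option (gV G)) (te : gE Pg -> option (gE G)) : Prop := Hexagonal {
  hx_cubic : cubic G;
  hx_tv : forall x x' y, tv x = Some y -> tv x' = Some y -> x = x';
  hx_te : forall x x' y, te x = Some y -> te x' = Some y -> x = x';
  hx_ends : forall i, exists u u' e,
    [/\ tv (cv i) = Some u, tv (cv (nx i)) = Some u', te (ce i) = Some e & ueq (gends e) (u, u')];
  hx_array : exists A : array3 G, [/\ is_array3 A, #|uncovered A| = 3 &
    forall e, e \in core A <-> exists i, te (ce i) = Some e];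
  hx_uncovered : forall A : array3 G, is_array3 A -> 3 <= #|uncovered A|;
  hx_cover_ge : forall m (M : 'I_m -> {set gE G}), (forall k, perfect_matching (M k)) ->
    (forall e, exists k, e \in M k) -> 5 <= m;
  hx_cover : exists M : 'I_5 -> {set gE G}, (forall k, perfect_matching (M k)) /\
    (forall e, exists k, e \in M k) }.

(** * The converse *)

Section Frame.
Variables (fV : gV P6 -> gV Pg) (fE : gE P6 -> gE Pg).
Hypotheses (fVI : injective fV) (fEI : injective fE).
Hypothesis fends : forall e, ueq (gends (fE e)) (fV (gends e).1, fV (gends e).2).

Lemma frame_onto : (forall y, exists x, fV x = y) /\ (forall y, exists x, fE x = y).
Proof.
have cV : #|gV Pg| <= #|gV P6| by rewrite !card_sum !card_option !card_ord.
have cE : #|gE Pg| <= #|gE P6| by rewrite card_prod !card_sum !card_ord.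
split=> y.
  by have /codomP[x ->] := inj_card_onto fVI cV y; exists x.
by have /codomP[x ->] := inj_card_onto fEI cE y; exists x.
Qed.

Lemma Pg_no_loop (d : dart Pg) : dend d != dother d.
Proof.
have [_ /(_ d.1)[e he]] := frame_onto.
have /ueq_dartP[b [h1 h2]] := fends e; rewrite he in h1 h2.
suff h : dend (d.1, b) != dother (d.1, b).
  by have [-> //|->] := @dart_eq_edge Pg (d.1, b) d erefl; rewrite dend_flip dother_flip eq_sym.
by rewrite h1 h2 (inj_eq fVI); exact: (P6_noloop (e, true)).
Qed.

Lemma frame_count (x : gV P6) (P : pred (gE P6)) (Q : pred (gE Pg)) : (forall e, Q (fE e) = P e) ->
  #|[set d : dart Pg | (dend d == fV x) && Q d.1]| = #|[set d : dart P6 | (dend d == x) && P d.1]|.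
Proof.
move=> QP; pose r (d' : dart Pg) := [pick d : dart P6 | (fE d.1 == d'.1) && (fV (dend d) == dend d')].
have ex (d : dart P6) : exists2 d' : dart Pg, d'.1 = fE d.1 & dend d' = fV (dend d).
  have /ueq_dartP[b [h1 h2]] := fends d.1.
  by case: d h1 h2 => e [] h1 h2; [exists (fE e, b) | exists (fE e, ~~ b)].
have rS d d' : fE d.1 = d'.1 -> fV (dend d) = dend d' -> r d' = Some d.
  rewrite /r => h1 h2; case: pickP => [d1 /andP[/eqP h3 /eqP h4]|/(_ d)]; last by rewrite h1 h2 !eqxx.
  have /dart_eq_edge[->//|e] : d.1 = d1.1 by apply: fEI; rewrite h3.
  have := P6_noloop d; rewrite -dend_flip -e; have -> : dend d = dend d1 by apply: fVI; rewrite h2 h4.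
  by rewrite eqxx.
have rP d d' : r d' = Some d -> fE d.1 = d'.1 /\ fV (dend d) = dend d'.
  by rewrite /r; case: pickP => // d1 /andP[/eqP h3 /eqP h4] [<-].
apply: (count_transport (r := r)).
- move=> d' dx; have [_ /(_ d'.1)[e he]] := frame_onto.
  have [d1 h1 h2] := ex (e, true); have [d2 h3 h4] := ex (e, false).
  have [h|h] : d' = d1 \/ d' = d2.
    have /dart_eq_edge[->|->] : d1.1 = d'.1 by rewrite h1 he.
      by left.
    have /dart_eq_edge[h|h] : d2.1 = d1.1 by rewrite h1 h3.
      have := P6_noloop (e, true); have := h2; rewrite h h4 => /fVI; rewrite /dother => ->.
      by rewrite eqxx.
    by right; rewrite h flipK.
  - exists (e, true); last by apply: rS; rewrite h.
    by apply: fVI; rewrite -h2 -h.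
  exists (e, false); last by apply: rS; rewrite h.
  by apply: fVI; rewrite -h4 -h.
- move=> d dx; have [d' h1 h2] := ex d; exists d'; first by rewrite h2 dx.
  exact: rS.
- move=> d d1 d2 e1 e2 /rP[h1 _] /rP[h2 _].
  have /dart_eq_edge[->//|e] : d2.1 = d1.1 by rewrite -h1 -h2.
  by have := Pg_no_loop d2; rewrite -dend_flip -e e1 e2 eqxx.
by move=> d' d /rP[<- _]; apply: QP.
Qed.

Lemma frame_pull (N : {set gE Pg}) : perfect_matching N -> perfect_matching (fE @^-1: N).
Proof.
by move=> pN x; rewrite -(pN (fV x)); apply/esym; apply: (@frame_count x (fun e => e \in fE @^-1: N) (fun e => e \in N)) => e; rewrite [RHS]inE.
Qed.

Lemma frame_push (M : {set gE P6}) : perfect_matching M -> perfect_matching (fE @: M).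
Proof.
move=> pM y; have [/(_ y)[x <-] _] := frame_onto.
by rewrite -(pM x); apply: (@frame_count x (fun e => e \in M) (fun e => e \in fE @: M)) => e; rewrite mem_imset.
Qed.

Lemma Pg_cubic : cubic Pg.
Proof.
move=> y; have [/(_ y)[x <-] _] := frame_onto.
have dT (J : mgraph) (z : gV J) : deg z = #|[set d : dart J | (dend d == z) && predT d.1]|.
  by apply: eq_card => d; rewrite !inE andbT.
by rewrite dT (@frame_count x predT) // -dT; apply: P6_deg.
Qed.

Lemma frame_lift m (M : 'I_m -> {set gE P6}) (col : 'I_m -> 'I_3) : (forall k, perfect_matching (M k)) ->
  (forall c, exists k, col k = c) -> lift_of fE M (fun k => fE @: M k) col.
Proof.
move=> pM cs; split=> // [k|e k|z]; first exact: frame_push.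
  by rewrite mem_imset.
by left; have [_ /(_ z)[e <-]] := frame_onto; exists e.
Qed.
End Frame.

Section Converse.
Variables (cv : 'I_6 -> gV Pg) (ce : 'I_6 -> gE Pg).
Hypothesis C6 : is_6cycle cv ce.

Lemma hexagonal_Pg : @hexagonal cv ce Pg (@Some _) (@Some _).
Proof.
have [fV [fE [fVI fEI fcv fce fends]]] := petersen_frame C6.
split.
- exact: (Pg_cubic fVI fEI fends).
- by move=> x x' y [->] [->].
- by move=> x x' y [->] [->].
- move=> i; exists (cv i), (cv (nx i)), (ce i); split=> //; case: C6 => _ _; exact.
- have [pA uA cA] := P6_arrayP.
  have /is_arrayP pA' := pA.
  have [B [pB uB cB]] := lift_array fEI uA (frame_lift fVI fEI fends pA' (fun c => ex_intro _ c erefl)).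
  exists B; split=> // e; rewrite cB cA; split=> [/imsetP[e' /imsetP[i _ ->] ->]|[i [<-]]].
    by exists i; rewrite fce.
  by rewrite -fce; apply/imset_f/imset_f.
- exact: (pull_array fEI (frame_pull fVI fEI fends) P6_array_uncovered).
- exact: (pull_cover (frame_pull fVI fEI fends) P6_cover_ge5).
exists (fun k => fE @: petersen_pm (widen_ord (leqnSn 5) k)); split.
  by move=> k; apply: (frame_push fVI fEI fends); apply: petersen_pmP.
move=> e; have [_ /(_ e)[e' <-]] := frame_onto fVI fEI; have [k hk] := P6_cover5 e'.
by exists k; rewrite mem_imset.
Qed.

Variables (G : mgraph) (tv : gV Pg -> option (gV G)) (te : gE Pg -> option (gE G)).
Hypothesis hG : hexagonal cv ce tv te.

Lemma hexagonal_no_loop (d : dart G) : dend d != dother d.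
Proof. by have [M [pM /(_ d.1)[k]]] := hx_cover hG; apply: pm_no_loop. Qed.

Lemma array_core_complement (A : array3 G) e : (forall e, e \in core A <-> exists i, te (ce i) = Some e) ->
  (forall i, te (ce i) <> Some e) -> cover_count A e = 1.
Proof.
move=> cA ne; apply/eqP/negPn/negP => h; have /cA[i /ne //] : e \in core A by rewrite inE.
Qed.

Section Step.
Variables (H : mgraph) (ep : gE G -> gE H) (tv' : gV Pg -> option (gV H)) (te' : gE Pg -> option (gE H)).
(** The condition under which a family of matchings lifts. For an insertion it asks for a compatible
    surjective colouring of the indices, for a substitution that every edge at the substituted
    vertex is covered. *)
Variable adm : forall m, ('I_m -> {set gE G}) -> Prop.
Hypotheses (epI : injective ep) (cH : cubic H).
Hypothesis pull : forall N : {set gE H}, perfect_matching N -> perfect_matching (ep @^-1: N).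
Hypothesis lift : forall m (M : 'I_m -> {set gE G}), (forall k, perfect_matching (M k)) -> adm M ->
  exists N col, lift_of ep M N col.
Hypothesis adm_cover : forall m (M : 'I_m -> {set gE G}), (forall k, perfect_matching (M k)) ->
  (forall e, exists k, e \in M k) -> adm M.
Hypothesis adm_array : forall A : array3 G, is_array3 A ->
  (forall e, e \in core A <-> exists i, te (ce i) = Some e) -> adm (amem A).
Hypothesis tvI : forall x x' y, tv' x = Some y -> tv' x' = Some y -> x = x'.
Hypothesis teI : forall x x' y, te' x = Some y -> te' x' = Some y -> x = x'.
Hypothesis tE : forall i e, te (ce i) = Some e -> te' (ce i) = Some (ep e).
Hypothesis tends : forall i u u' e, tv (cv i) = Some u -> tv (cv (nx i)) = Some u' ->
  te (ce i) = Some e -> ueq (gends e) (u, u') ->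
  exists w w', [/\ tv' (cv i) = Some w, tv' (cv (nx i)) = Some w' & ueq (gends (ep e)) (w, w')].

Lemma hexagonal_step : hexagonal cv ce tv' te'.
Proof.
split=> //.
- move=> i; have [u [u' [e [h1 h2 h3 h4]]]] := hx_ends hG i.
  have [w [w' [k1 k2 k3]]] := tends h1 h2 h3 h4.
  by exists w, w', (ep e); split=> //; apply: tE.
- have [A [pA uA cA]] := hx_array hG; have /is_arrayP pA' := pA.
  have [N [col hN]] := lift pA' (adm_array pA cA).
  have [B [pB uB cB]] := lift_array epI uA hN; exists B; split=> // z; rewrite cB; split.
    by case/imsetP => e /cA[i hi] ->; exists i; apply: tE.
  case=> i hi; have [u [u' [e [h1 h2 h3 h4]]]] := hx_ends hG i.
  by move: hi; rewrite (tE h3) => -[<-]; apply/imset_f/cA; exists i.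
- exact: (pull_array epI pull (hx_uncovered hG)).
- exact: (pull_cover pull (hx_cover_ge hG)).
have [M [pM cM]] := hx_cover hG; have [N [col hN]] := lift pM (adm_cover pM cM).
by exists N; split; [case: hN | apply: lift_cover hN cM].
Qed.
End Step.

Lemma surjective_colouring m (B : 'I_m -> bool) (c : 'I_3) k0 k1 k2 : B k0 -> ~~ B k1 -> ~~ B k2 -> k1 != k2 ->
  exists col : 'I_m -> 'I_3, (forall i, exists k, col k = i) /\ forall k, B k = (col k == c).
Proof.
move=> B0 B1 B2 n12.
have [a [b [ac bc ab i3]]] : exists a b : 'I_3, [/\ a != c, b != c, a != b & forall i, [\/ i = a, i = b | i = c]].
  move: c; apply: three_ind; [exists (o3 1), (o3 2)|exists (o3 0), (o3 2)|exists (o3 0), (o3 1)]; split=> //;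
  by apply: three_ind; first [by constructor 1|by constructor 2|by constructor 3].
exists (fun k => if B k then c else if k == k1 then a else b); split=> [i|k].
  case: (i3 i) => ->; [exists k1|exists k2|exists k0]; rewrite ?B0 ?(negbTE B1) ?(negbTE B2) ?eqxx //.
  by rewrite eq_sym (negbTE n12).
by case: (B k); rewrite ?eqxx //; case: ifP => _; rewrite ?(negbTE ac) ?(negbTE bc).
Qed.
End Converse.

Section Induction.
Variables (cv : 'I_6 -> gV Pg) (ce : 'I_6 -> gE Pg).

Lemma hexagonal_O1 (G : mgraph) tv te (e : gE Pg) (e0 : gE G) (K : mgraph) (f : gE K) (b : bool) :
  hexagonal cv ce tv te -> te e = Some e0 -> (forall i, ce i != e) -> cubic K -> colourable3 K ->
  hexagonal cv ce (ins_tv e0 f b tv) (ins_te e0 f b e te).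
Proof.
move=> hG te0 cee cK [c pc]; have cG := hx_cubic hG; have nl := hexagonal_no_loop hG.
pose adm m (M : 'I_m -> {set gE G}) := exists col : 'I_m -> 'I_3,
  (forall i, exists k, col k = i) /\ forall k, (e0 \in M k) = (col k == c f).
have teP x y : ins_te e0 f b e te x = Some y -> exists2 y1, te x = Some y1 & y = ts2_edge e0 f b y1.
  rewrite /ins_te; case: ifP => // _; case: (te x) => //= y1; case: insubP => //= z _ zy [<-].
  by exists y1; rewrite // -zy ts2_edge_other.
have ne i e1 : te (ce i) = Some e1 -> e1 != e0.
  move=> h; apply/eqP => h'; have := cee i; rewrite (hx_te hG h (x' := e)) ?eqxx //.
  by rewrite h'.
apply: (@hexagonal_step cv ce G tv te hG _ (ts2_edge e0 f b) _ _ adm).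
- exact: ts2_edge_inj.
- exact: twosum_cubic.
- exact: ts2_pull.
- by move=> m M pM [col [h1 h2]]; have [N hN] := ts2_lift b cK pc pM h1 h2; exists N, col.
(* Two further edges meet [e0] at its end [x]. In a covering they lie in two different matchings
   avoiding [e0], which leaves an index for each of the other two colours. *)
- move=> m M pM cov; pose x := dend (e0, true).
  have : 1 < #|[set d : dart G | dend d == x] :\ (e0, true)|.
    by have := cG x; rewrite /deg (cardsD1 (e0, true)) inE eqxx add1n => -[->].
  move=> /card_gt1P[d1 [d2 [+ + d12]]]; rewrite !inE => /andP[n1 /eqP x1] /andP[n2 /eqP x2].
  have uq k d d' : dend d = x -> dend d' = x -> d.1 \in M k -> d'.1 \in M k -> d = d'.
    move=> dx dx' dM dM'; have := pM k x => /eqP/cards1P[z /setP hz].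
    have := hz d; have := hz d'; rewrite !inE dx dx' dM dM' eqxx /= => /esym/eqP-> /esym/eqP->.
    by [].
  have [[[k0 M0] [k1 M1]] [k2 M2]] := (cov e0, cov d1.1, cov d2.1).
  have N1 : e0 \notin M k1 by apply/negP => h; rewrite (uq k1 d1 (e0, true)) ?eqxx in n1.
  have N2 : e0 \notin M k2 by apply/negP => h; rewrite (uq k2 d2 (e0, true)) ?eqxx in n2.
  apply: (surjective_colouring (B := fun k => e0 \in M k) (c f) M0 N1 N2).
  by apply/eqP => k12; rewrite (uq k1 d1 d2) ?eqxx // k12 in d12.
- move=> A pA cA.
  (* The edge lies off the hexagon, hence off the core; the single matching containing it gets the
     colour of [f], the others the remaining two colours. *)
  have : cover_count A e0 = 1.
    by apply: (array_core_complement cA) => i /ne; rewrite eqxx.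
  rewrite /cover_count; case E1: (_ \in _); case E2: (_ \in _); case E3: (_ \in _) => // _.
  + by apply: (surjective_colouring (B := fun k => e0 \in amem A k) (c f) (k0 := o3 0) (k1 := o3 1) (k2 := o3 2)); rewrite /amem /= ?E1 ?E2 ?E3.
  + by apply: (surjective_colouring (B := fun k => e0 \in amem A k) (c f) (k0 := o3 1) (k1 := o3 0) (k2 := o3 2)); rewrite /amem /= ?E1 ?E2 ?E3.
  by apply: (surjective_colouring (B := fun k => e0 \in amem A k) (c f) (k0 := o3 2) (k1 := o3 0) (k2 := o3 1)); rewrite /amem /= ?E1 ?E2 ?E3.
- move=> x x' y; rewrite /ins_tv; case E1: (tv x) => [z|] //=; case E2: (tv x') => [z'|] //= [<-] [zz].
  by rewrite zz in E2; apply: (hx_tv hG E1 E2).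
- move=> x x' y /teP[y1 h1 ->] /teP[y2 h2 /ts2_edge_inj e12].
  by rewrite -e12 in h2; apply: (hx_te hG h1 h2).
- move=> i e1 h; rewrite /ins_te (negbTE (cee i)) h /= insubT; first exact: ne h.
  by move=> p1; rewrite /= -(ts2_edge_other f b (exist _ e1 p1)).
move=> i u u' e1 h1 h2 h3 h4; exists (inl u), (inl u'); rewrite /ins_tv h1 h2; split=> //.
have ne1 := ne _ _ h3; rewrite (ts2_edge_other f b (exist _ e1 ne1)) /=.
by case/orP: h4 => /eqP[] e2; rewrite /ueq /= e2 eqxx ?orbT.
Qed.

Lemma hexagonal_O2 (G : mgraph) tv te (u : gV Pg) (u0 : gV G) (K : mgraph) (v : gV K)
    (sigma : ndarts G u0 -> ndarts K v) :
  hexagonal cv ce tv te -> tv u = Some u0 -> (forall i, cv i != u) -> twoconn K -> cubic K ->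
  colourable3 K -> correct_sub v -> bijective sigma ->
  hexagonal cv ce (sub_tv sigma u tv) (sub_te sigma te).
Proof.
move=> hG tu cvu tK cK [c pc] cs sB; have cG := hx_cubic hG; have nl := hexagonal_no_loop hG.
have total e : exists z, sub_edge sigma e = Some z.
  by case: (sub_edge_cases sigma nl e) => -[z [_ ->]]; [exists (inl (inl z)) | exists (inr z)].
have [ep epE] := fin_all_exists total.
have tvP x y : sub_tv sigma u tv x = Some y -> exists2 z : {z | z != u0}, tv x = Some (val z) & y = inl z.
  rewrite /sub_tv; case: ifP => // _; case: (tv x) => //= y1; case: insubP => //= z _ zy [<-].
  by exists z; rewrite ?zy.
have teE x : sub_te sigma te x = omap ep (te x) by rewrite /sub_te; case: (te x) => //= y; rewrite epE.
have ne i w : tv (cv i) = Some w -> w != u0.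
  move=> h; apply/eqP => h'; have := cvu i; rewrite (hx_tv hG h (x' := u)) ?eqxx //.
  by rewrite h'.
apply: (@hexagonal_step cv ce G tv te hG _ ep _ _ (fun m M => forall d : dart G, dend d = u0 -> exists k, d.1 \in M k)).
- exact: (ts3_ep_inj nl epE).
- exact: (threesum_cubic cG cK sB).
- exact: (ts3_pull nl cK tK sB epE cs).
- by move=> m M pM h; apply: (ts3_lift nl cK tK sB epE pc).
- by move=> m M pM h d _.
(* Hexagon edges do not meet [u0], so every edge at [u0] is off the core and therefore covered
   once. *)
- move=> A pA cA d du; apply: cover_count_gt0; rewrite (array_core_complement cA) // => i hi.
  have [w [w' [e1 [h1 h2 + h4]]]] := hx_ends hG i; rewrite hi => -[e1d]; rewrite -e1d in h4.
  have [h|h] : dend d = w \/ dend d = w'.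
    by case/orP: h4 => /eqP; rewrite /dend; case: d {du hi e1d} => g [] /= ->; auto.
    by have := ne _ _ h1; rewrite -h du eqxx.
  by have := ne _ _ h2; rewrite -h du eqxx.
- move=> x x' y /tvP[z h1 ->] /tvP[z' h2 [zz]].
  by rewrite -zz in h2; apply: (hx_tv hG h1 h2).
- move=> x x' y; rewrite !teE; case E1: (te x) => [z|] //=; case E2: (te x') => [z'|] //= [<-] [/(ts3_ep_inj nl epE) zz].
  by rewrite zz in E2; apply: (hx_te hG E1 E2).
- by move=> i e1 h; rewrite teE h.
move=> i w w' e1 h1 h2 h3 h4; have [n1 n2] := (ne _ _ h1, ne _ _ h2).
exists (inl (exist _ w n1)), (inl (exist _ w' n2)); split.
- by rewrite /sub_tv (negbTE (cvu i)) h1 /= insubT.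
- by rewrite /sub_tv (negbTE (cvu (nx i))) h2 /= insubT.
have pe : ((gends e1).1 != u0) && ((gends e1).2 != u0).
  by case/orP: h4 => /eqP-> /=; rewrite n1 n2.
rewrite (ts3_ep_out epE (exist _ e1 pe)) /=.
by case/orP: h4 => /eqP e2; apply/orP; [left|right]; apply/eqP; congr (_, _); congr inl; apply: val_inj; rewrite /= e2.
Qed.
End Induction.

Lemma built_hexagonal (cv : 'I_6 -> gV Pg) (ce : 'I_6 -> gE Pg) : is_6cycle cv ce ->
  forall G tv te, @built cv ce G tv te -> hexagonal cv ce tv te.
Proof.
move=> C6 G tv te; elim=> {G tv te}; first exact: hexagonal_Pg.
  by move=> G tv te e e0 K f b _ IH h1 h2 _ cK _ col; apply: (hexagonal_O1 _ _ IH h1).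
by move=> G tv te u u0 K v sigma _ IH h1 h2 tK cK _ col _ cs sB; apply: (hexagonal_O2 IH h1).
Qed.

Theorem theorem6p10 :
  (forall G : mgraph, twoconn G -> cubic G -> df_eq G 3 -> pmi_eq G 5 ->
     forall (cv : 'I_6 -> gV Pg) (ce : 'I_6 -> gE Pg), is_6cycle cv ce ->
       iso G Pg \/
       exists (G' : mgraph) (tv : gV Pg -> option (gV G')) (te : gE Pg -> option (gE G')),
         @built cv ce G' tv te /\ iso G G')
  /\
  (forall (cv : 'I_6 -> gV Pg) (ce : 'I_6 -> gE Pg), is_6cycle cv ce ->
     forall (G : mgraph) (tv : gV Pg -> option (gV G)) (te : gE Pg -> option (gE G)),
       @built cv ce G tv te ->
       [/\ df_eq G 3, pmi_eq G 5 &
           exists A : array3 G, optimal A /\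
             forall e : gE G, e \in core A <-> exists i : 'I_6, te (ce i) = Some e]).
Proof.
split.
  (* The second alternative always holds, since [built] also contains [Pg] with no operation
     applied. *)
  move=> G tG cG df pmi cv ce C6; right.
  have nocov := pmi5_no_4cover pmi.
  have [p [io [c [U [sk rI pr bU]]]]] := petersen_skeleton tG cG df nocov.
  have [fV [fE [fVI fEI fcv fce fends]]] := petersen_frame C6.
  have [fVs fEs] := frame_onto fVI fEI.
  have cs : coloured_skeleton c p io by split.
  exact: (built_of_skeleton fVI fEI fVs fEs fcv fce fends tG cG nocov cs bU).
move=> cv ce C6 G tv te /(built_hexagonal C6) hG.
have [A [pA uA cA]] := hx_array hG; have u3 := hx_uncovered hG.
split.
- by split=> //; exists A.
- by split; [exact: hx_cover hG | exact: hx_cover_ge hG].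
by exists A; split=> //; split=> // B /u3; rewrite uA.
Qed.
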